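(* Let $\epsilon>0$, let $u_L\in\mathcal I_0$ with $u_L>0$, and let $u_R\in\mathcal I_0$ be such that $(u_L,u_R)$ verifies the Oleinik condition. Then there exist $0<a^*<1$ and $C>0$ such that the following holds. Let $a_1,a_2>0$ with $\frac{a_2}{a_1}<a^*$. For any $u\in\mathcal S_{\text{weak},u_L,\epsilon}$ there exists a Lipschitz path $h(t)$, with $h(0)=0$, such that for any $t>0$ the pseudo-norm $$E_t(u)=a_1\int_{-\infty}^0\eta(u(t,x+h(t))|u_L)\,dx+a_2\int_0^\infty\eta(u(t,x+h(t))|u_R)\,dx$$ is non-increasing in time. In particular, for every $t>0$, $$\|u(t,\cdot+h(t))-S\|_{L^2(\mathbb R)}\le C\|u_0-S\|_{L^2(\mathbb R)},$$ where $u_0=u(t=0)$ and $S(x)=u_L$ for $x<0$, $S(x)=u_R$ for $x>0$.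
   Context: Setting. Fix $M>0$ and the state space $\mathcal I_0=[-M,M]$. The flux $f:\mathbb R\to\mathbb R$ is of class $C^4$ and concave-convex: $uf''(u)>0$ for $u\ne0$, $f'''(0)\neq0$, and $f'(u)\to+\infty$ as $|u|\to+\infty$. Consider the scalar conservation law $u_t+(f(u))_x=0$, $t>0$, $x\in\mathbb R$, with $u$ valued in $\mathcal I_0$. Fix a strictly convex entropy $\eta\in C^3$ ($\eta''>0$) with entropy flux $q$, $q'=\eta'f'$. For $k\in\mathbb R$ the Kruzkov entropy is $\eta_k(u)=|u-k|$ with flux $q_k(u)=\mathrm{sgn}(u-k)(f(u)-f(k))$. A weak solution $u\in L^\infty(\mathbb R^+\times\mathbb R;\mathcal I_0)$ is $\eta$-entropic (resp. $\eta_k$-entropic) if $(\eta(u))_t+(q(u))_x\le0$ (resp. with $\eta_k,q_k$) in the sense of distributions on $(0,\infty)\times\mathbb R$. The initial value of a weak solution is denoted $u_0=u(0,\cdot)$. Relative entropy: $\eta(a|b)=\eta(a)-\eta(b)-\eta'(b)(a-b)$. Strong Trace property: $u\in L^\infty(\mathbb R^+\times\mathbb R)$ has it if for every Lipschitz curve $t\mapsto h(t)$ there are bounded functions $u_-,u_+$ of $t$ such that for every $T>0$, $\lim_{n\to\infty}\int_0^T\sup_{y\in(0,1/n)}|u(t,h(t)+y)-u_+(t)|\,dt=\lim_{n\to\infty}\int_0^T\sup_{y\in(-1/n,0)}|u(t,h(t)+y)-u_-(t)|\,dt=0$. Oleinik condition for $(u_L,u_R)$, $u_L\ne u_R$: $\frac{f(v)-f(u_L)}{v-u_L}\ge\frac{f(u_R)-f(u_L)}{u_R-u_L}$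 for all $v$ strictly between $u_L$ and $u_R$. Auxiliary functions: for $u\neq0$, $\phi^\natural(u)$ is the unique $v\ne u$ with $f'(v)=\frac{f(u)-f(v)}{u-v}$; $\phi^\natural(0)=0$. With $E_\eta(u_-,u_+)=-\sigma(\eta(u_+)-\eta(u_-))+q(u_+)-q(u_-)$, $\sigma=\frac{f(u_-)-f(u_+)}{u_--u_+}$, for $u\ne0$, $\phi_0^\flat(u)$ is the unique $v\neq u$ with $E_\eta(u,v)=0$; $\phi_0^\flat(0)=0$. Class of solutions: $\mathcal S_{\text{weak},u_L,\epsilon}$ is the set of $u\in L^\infty(\mathbb R^+\times\mathbb R;\mathcal I_0)$ that are weak solutions of $u_t+(f(u))_x=0$, are $\eta$-entropic and $\eta_{\phi^\natural(u_L)}$-entropic, have the Strong Trace property, and such that for every Lipschitz curve $h$, $(u_-(t),u_+(t))\notin B(\phi_0^\flat(u_L),\epsilon)\times B(u_L,\epsilon)$ for almost every $t>0$. $B(c,r)$ is the ball (interval) of center $c$ and radius $r$. *)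

(* Defs.v *)
From HB Require Import structures.
From mathcomp Require Import all_boot all_order all_algebra.
From mathcomp Require Import all_classical all_reals all_analysis.
From mathcomp Require Import ess_sup_inf hoelder.

Set Implicit Arguments.
Unset Strict Implicit.
Unset Printing Implicit Defensive.

Import Order.TTheory GRing.Theory Num.Theory.
Import numFieldNormedType.Exports.

Local Open Scope classical_set_scope.
Local Open Scope ring_scope.

Section Flux.
Context {R : realType}.
Implicit Types (f eta q : R -> R) (M u v k x : R).

Definition class_C (n : nat) f : Prop :=
  (forall k : nat, (k < n)%N -> forall x, derivable (derive1n k f) x 1) /\
  continuous (derive1n n f).

Definition concave_convex_flux f : Prop :=
  [/\ class_C 4 f,
      (forall u, u != 0 -> 0 < u * derive1n 2 f u),
      derive1n 3 f 0 != 0,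
      derive1 f x @[x --> +oo] --> +oo
    & derive1 f x @[x --> -oo] --> +oo].

Definition strictly_convex_entropy eta : Prop :=
  class_C 3 eta /\ (forall u, 0 < derive1n 2 eta u).

Definition entropy_flux f eta q : Prop :=
  forall u, is_derive u 1 q (derive1 eta u * derive1 f u).

Definition kruzkov_entropy k : R -> R := fun u => `|u - k|.

Definition kruzkov_flux f k : R -> R := fun u => Num.sg (u - k) * (f u - f k).

Definition relative_entropy eta (a b : R) : R :=
  eta a - eta b - derive1 eta b * (a - b).

Definition oleinik f (uL uR : R) : Prop :=
  uL != uR /\
  (forall v, Num.min uL uR < v < Num.max uL uR ->
     (f uR - f uL) / (uR - uL) <= (f v - f uL) / (v - uL)).

(* For the fluxes considered here the set has exactly one element when u != 0;
   the default value of xget is then irrelevant. *)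
Definition phi_nat f u : R :=
  if u == 0 then 0
  else xget 0 [set v | v != u /\ derive1 f v = (f u - f v) / (u - v)].

Definition shock_speed f (um up : R) : R := (f um - f up) / (um - up).

Definition entropy_dissipation f eta q (um up : R) : R :=
  - shock_speed f um up * (eta up - eta um) + q up - q um.

(* Same remark as for phi_nat. *)
Definition phi_flat0 f eta q u : R :=
  if u == 0 then 0
  else xget 0 [set v | v != u /\ entropy_dissipation f eta q u v = 0].

End Flux.

Section Solutions.
Context {R : realType}.
Implicit Types (f eta q e Q h : R -> R) (u : R -> R -> R) (phi : R * R -> R).

Local Notation leb := (@lebesgue_measure R).

Fixpoint class_C2 (n : nat) phi : Prop :=
  continuous phi /\
  (if n is m.+1 then
     [/\ (forall z, derivable phi z (1, 0)),
         (forall z, derivable phi z (0, 1)),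
         class_C2 m (fun z => 'D_(1, 0) phi z)
       & class_C2 m (fun z => 'D_(0, 1) phi z)]
   else True).

(* C^oo functions with compact support in ]0, +oo[ * R; the first coordinate
   is time. *)
Definition test_function phi : Prop :=
  (forall n, class_C2 n phi) /\
  (exists K : set (R * R),
     [/\ compact K, K `<=` [set z | 0 < z.1] & forall z, ~ K z -> phi z = 0]).

(* < e(u)_t + Q(u)_x , phi > as a distribution on ]0, +oo[ * R, up to sign. *)
Definition weak_pairing e Q u phi : R :=
  \int[(leb \x leb)%E]_(z in `]0, +oo[ `*` setT)
     (e (u z.1 z.2) * 'D_(1, 0) phi z + Q (u z.1 z.2) * 'D_(0, 1) phi z).

Definition entropic e Q u : Prop :=
  forall phi, test_function phi -> (forall z, 0 <= phi z) ->
    0 <= weak_pairing e Q u phi.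

Definition right_lebesgue_time u (s : R) : Prop :=
  forall K : R, 0 < K ->
    ((d^-1)%:E * \int[leb]_(t in `]s, (s + d)%R[)
                   \int[leb]_(x in `](- K)%R, K[) `|u t x - u s x|%:E)%E
      @[d --> 0^'+] --> 0%E.

(* An element of L^oo(R^+ * R; [-M, M]) which solves u_t + f(u)_x = 0 on
   ]0, +oo[ * R agrees almost everywhere with a map t |-> u(t, .) that is
   continuous on [0, +oo[ for the weak-* topology of L^oo(R), and this map is
   unique.  It is the representative used here, so that u(t, .) makes sense for
   every t >= 0.  The initial value is u(0, .); that it is attained (the last
   clause) is required in L^1_loc, in the averaged sense of
   right_lebesgue_time, because nonlinear functionals of u(0, .) are not
   controlled by weak-* limits. *)
Definition weak_solution f (M : R) u : Prop :=
  [/\ measurable_fun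
        (`[0, +oo[ `*` setT : set (measurableTypeR R * measurableTypeR R))
        (fun z => u z.1 z.2),
      (forall t, 0 <= t -> {ae leb, forall x, - M <= u t x <= M}),
      (forall g : R -> R, leb.-integrable setT (EFin \o g) ->
         {within `[0, +oo[, continuous (fun t => \int[leb]_x (g x * u t x))}),
      (forall phi, test_function phi -> weak_pairing id f u phi = 0)
    & right_lebesgue_time u 0].

Definition lipschitz_curve h : Prop := [lipschitz h t | t in `[0, +oo[].

(* The supremum of |u(t, h(t) + y) - c| over y in A; u(t, .) being defined up to
   null sets, it is an essential supremum. *)
Definition sup_dist u h (A : set R) (c t : R) : \bar R :=
  ess_sup leb ((fun y => `|u t (h t + y) - c|%:E) \_ A).

Definition right_side (n : nat) : set R := `]0, n.+1%:R^-1[.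
Definition left_side (n : nat) : set R := `]- n.+1%:R^-1, 0[.

Definition bounded_trace (w : R -> R) : Prop :=
  measurable_fun (`]0, +oo[ : set (measurableTypeR R)) w /\
  exists B : R, forall t, 0 < t -> `|w t| <= B.

Definition traces u h (um up : R -> R) : Prop :=
  [/\ bounded_trace um, bounded_trace up &
   forall T : R, 0 < T ->
    (\int[leb]_(t in `]0%R, T[) sup_dist u h (right_side n) (up t) t)%E
      @[n --> \oo] --> 0%E /\
    (\int[leb]_(t in `]0%R, T[) sup_dist u h (left_side n) (um t) t)%E
      @[n --> \oo] --> 0%E].

Definition strong_trace u : Prop :=
  forall h, lipschitz_curve h -> exists um up, traces u h um up.

Definition S_weak f eta q (M uL eps : R) u : Prop :=
  [/\ weak_solution f M u,
      entropic eta q u,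
      (let k := phi_nat f uL in entropic (kruzkov_entropy k) (kruzkov_flux f k) u),
      strong_trace u
    & forall h um up, lipschitz_curve h -> traces u h um up ->
        {ae leb, forall t, 0 < t ->
           ~ (ball (phi_flat0 f eta q uL) eps (um t) /\ ball uL eps (up t))}].

Definition shock (uL uR x : R) : R := if x < 0 then uL else uR.

Definition pseudo_norm eta (a1 a2 uL uR : R) h u (t : R) : \bar R :=
  (a1%:E * \int[leb]_(x in `]-oo, 0%R[) (relative_entropy eta (u t (x + h t)) uL)%:E
   + a2%:E * \int[leb]_(x in `]0%R, +oo[) (relative_entropy eta (u t (x + h t)) uR)%:E)%E.

(* Monotonicity of a functional E of u(t, .).  At a time s where u(t, .) jumps
   only weakly, E s is not determined by E at nearby times; such times form a
   null set.  The inequality E t <= E s is asked for every t >= s as soon as s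
   is a right Lebesgue time, in particular for s = 0, and for every s when u is
   continuous with values in L^1_loc. *)
Definition nonincreasing_in_time u (E : R -> \bar R) : Prop :=
  exists N : set R,
    [/\ leb.-negligible N,
        (forall s, N s -> ~ right_lebesgue_time u s)
      & forall s t, 0 <= s -> ~ N s -> s <= t -> (E t <= E s)%E].

End Solutions.

(* Main.v *)
(** Proof idea.  Choose a Lipschitz velocity V which is slightly slower than
    f'(u_L) near u_L and slower than every characteristic away from u_L, and
    let h be a generalized characteristic of V: almost everywhere h' lies between
    V(u_-) and V(u_+), where u_-, u_+ are the traces of u along h.  Transporting
    the relative entropies of both sides to h, the dissipation at h is
      D = h' eta(u_-|u_L) - q(u_-;u_L) + a (q(u_+;u_R) - h' eta(u_+|u_R)).
    If u_- = u_+, the choice of V makes D negative.  At a jump, h' is the shock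
    speed, so one trace is near u_L and the other one is not.  If u_- is near
    u_L, the left part of D is at most - c (u_- - u_L)^2, and the entropy
    inequality for eta_k, k = phi_nat(u_L), bounds the right part by
    C (u_- - u_L)^2.  If u_+ is near u_L, the left part is the entropy
    dissipation of the jump up to a nonpositive term, and it is bounded away
    from 0 since u_- stays away from phi_flat0(u_L).  In all cases D <= 0
    for small a, with h independent of a; taking a = astar / 2 gives the L^2
    bound with a constant which depends on neither a_1 nor a_2.

    The curve h is a limit of curves solving a delayed equation.  The weak
    formulation is tested on smoothed indicators of regions bounded by moving
    curves, and decay between s and t follows from s being a Lebesgue point and
    from lower semicontinuity at t. *)

Require Import Defs.
From HB Require Import structures.
From mathcomp Require Import all_boot all_order all_algebra.
From mathcomp Require Import all_classical all_reals all_analysis.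
From mathcomp Require Import ess_sup_inf hoelder measurable_realfun.
From mathcomp Require Import ring lra.
Import Order.TTheory GRing.Theory Num.Theory.
Import numFieldNormedType.Exports.
Local Open Scope classical_set_scope.
Local Open Scope ring_scope.
Set Implicit Arguments.
Unset Strict Implicit.
Unset Printing Implicit Defensive.

(** * Integrals on segments *)

Section integral_on_segments.
Context {R : realType}.
Local Notation leb := (@lebesgue_measure R).
Implicit Types (a b c : R).

(** Slowing the velocity below f'(u_L) is affordable because the right part at u_+ = u_L is strictly
    negative at speed f'(u_L): it is the integral over ]u_R, u_L[ of (eta'(x) - eta'(u_R)) (f'(x) -
    f'(u_L)), and f' < f'(u_L) there since u_R >= k. Half of this margin is spent on the left part.
    The delicate jump has a left trace b close to u_L: the left part then gains only a multiple of
    (b - u_L)^2, so the right part may grow at most quadratically in b - u_L. The tangency at k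
    endangers this, since k is the tangency point for chords issued from u_L, not from b. Replacing
    u_L by b perturbs the tangency condition by O(|b - u_L|), but the tangent gap of u_L vanishes
    transversally at k, so this matters only within O(|b - u_L|) of k, and the chord slopes lose
    monotonicity by O((b - u_L)^2) only. For the curve, U is merely measurable and no theory of
    differential equations applies: with a delay the approximate equations are solved by plain
    integration, and an ultrafilter gives their limit at all times at once. *)

Definition bounded_measurable d (T : measurableType d) (f : T -> R) : Prop :=
  measurable_fun setT f /\ exists B : R, forall x, `|f x| <= B.

(** The integral is not oriented: it is 0 when b < a, hence the order hypotheses in
    [integ_chasles]. *)
Definition integ a b (f : R -> R) : R := \int[leb]_(x in `[a, b]) f x.

Lemma bm_integrable d (T : measurableType d) (mu : {measure set T -> \bar R})
    (A : set T) (f : T -> R) :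
  measurable A -> (mu A < +oo)%E -> bounded_measurable f ->
  mu.-integrable A (EFin \o f).
Proof.
move=> mA muA [mf [B fB]]; apply: measurable_bounded_integrable => //.
  exact: measurable_funTS.
exists B; split; first exact: num_real.
by move=> M BM x _; exact: le_trans (fB x) (ltW BM).
Qed.

Lemma leb_itv_lty a b : (leb `[a, b] < +oo)%E.
Proof. by rewrite lebesgue_measure_itv; case: ifP => //= _; rewrite ltry. Qed.

Lemma bm_integ a b (f : R -> R) : bounded_measurable f ->
  leb.-integrable `[a, b] (EFin \o f).
Proof. by move=> bf; apply: bm_integrable => //; exact: leb_itv_lty. Qed.

Lemma ae_imp (P Q : R -> Prop) : {ae leb, forall x, P x} ->
  (forall x, P x -> Q x) -> {ae leb, forall x, Q x}.
Proof.
by move=> aP PQ; apply: (@filterS _ _ (ae_filter_ringOfSetsType leb) _ _ _ aP).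
Qed.

Lemma ae_imp2 (P Q S : R -> Prop) : {ae leb, forall x, P x} ->
  {ae leb, forall x, Q x} -> (forall x, P x -> Q x -> S x) ->
  {ae leb, forall x, S x}.
Proof.
by move=> aP aQ PQ; apply: (@filterS2 _ _ (ae_filter_ringOfSetsType leb) _ _ _ _ aP aQ).
Qed.

Section closure.
Context d (T : measurableType d).

Lemma bm_cst (k : R) : bounded_measurable (fun _ : T => k).
Proof. by split; [exact: measurable_cst|exists `|k|]. Qed.

Lemma bmD (f g : T -> R) : bounded_measurable f -> bounded_measurable g ->
  bounded_measurable (fun x => f x + g x).
Proof.
move=> [mf [B fB]] [mg [C gC]]; split; first exact: measurable_funD.
by exists (B + C) => x; apply: le_trans (ler_normD _ _) _; exact: lerD.
Qed.

Lemma bmN (f : T -> R) : bounded_measurable f -> bounded_measurable (fun x => - f x).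
Proof.
move=> [mf [B fB]]; split; first exact: measurableT_comp.
by exists B => x; rewrite normrN.
Qed.

Lemma bmB (f g : T -> R) : bounded_measurable f -> bounded_measurable g ->
  bounded_measurable (fun x => f x - g x).
Proof. by move=> bf bg; apply: bmD => //; exact: bmN. Qed.

Lemma bmM (f g : T -> R) : bounded_measurable f -> bounded_measurable g ->
  bounded_measurable (fun x => f x * g x).
Proof.
move=> [mf [B fB]] [mg [C gC]]; split; first exact: measurable_funM.
by exists (B * C) => x; rewrite normrM; exact: ler_pM.
Qed.

Lemma bm_norm (f : T -> R) : bounded_measurable f -> bounded_measurable (fun x => `|f x|).
Proof.
move=> [mf [B fB]]; split; first exact: measurableT_comp.
by exists B => x; rewrite normr_id.
Qed.

Lemma bm_max (f g : T -> R) : bounded_measurable f -> bounded_measurable g ->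
  bounded_measurable (fun x => Num.max (f x) (g x)).
Proof.
move=> [mf [B fB]] [mg [C gC]]; split; first exact: measurable_maxr.
exists (Num.max B C) => x; have := fB x; have := gC x.
by rewrite /Num.max; case: ifPn; case: ifPn => //; lra.
Qed.

Lemma bm_comp d' (T' : measurableType d') (k : T -> T') (F : T' -> R) :
  measurable_fun setT k -> bounded_measurable F ->
  bounded_measurable (fun x => F (k x)).
Proof.
by move=> mk [mF [B FB]]; split; [exact: measurableT_comp|exists B].
Qed.

Lemma bm_continuous_comp (M : R) (f : T -> R) (e : R -> R) : continuous e ->
  measurable_fun setT f -> (forall x, `|f x| <= M) ->
  bounded_measurable (fun x => e (f x)).
Proof.
move=> ce mf fM; split.
  by apply: measurableT_comp => //; exact: continuous_measurable_fun.
have [B [_ eB]] := @compact_bounded _ _ _ (@continuous_compact _ _ e `[- M, M]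
  (continuous_subspaceT ce) (segment_compact (a := - M) (b := M))).
exists (B + 1) => x; apply: (eB (B + 1)); first by rewrite ltrDl.
by exists (f x) => //=; rewrite in_itv /= -ler_norml.
Qed.

End closure.

Implicit Types f g : R -> R.

Lemma integD a b f g : bounded_measurable f -> bounded_measurable g ->
  integ a b (fun x => f x + g x) = integ a b f + integ a b g.
Proof. by move=> bf bg; rewrite /integ RintegralD//; exact: bm_integ. Qed.

Lemma integB a b f g : bounded_measurable f -> bounded_measurable g ->
  integ a b (fun x => f x - g x) = integ a b f - integ a b g.
Proof. by move=> bf bg; rewrite /integ RintegralB//; exact: bm_integ. Qed.

Lemma integZ a b f (k : R) : bounded_measurable f ->
  integ a b (fun x => k * f x) = k * integ a b f.
Proof. by move=> bf; rewrite /integ RintegralZl//; exact: bm_integ. Qed.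

Lemma integN a b f : bounded_measurable f ->
  integ a b (fun x => - f x) = - integ a b f.
Proof.
move=> bf; rewrite -mulN1r -integZ//.
by congr (integ a b _); apply/funext => x; rewrite mulN1r.
Qed.

Lemma integ_cst a b (k : R) : a <= b -> integ a b (fun=> k) = k * (b - a).
Proof.
move=> ab; rewrite /integ Rintegral_cst//.
have := lebesgue_measure_itv `[a, b]; rewrite /= lte_fin => ->.
by case: ltgtP ab => //= -> _; rewrite subrr.
Qed.

Lemma integ_le a b f g : bounded_measurable f -> bounded_measurable g ->
  (forall x, a <= x <= b -> f x <= g x) -> integ a b f <= integ a b g.
Proof.
move=> bf bg fg; apply: (@le_Rintegral _ _ _ leb _ _ _ (measurable_itv _) (bm_integ _ _ bf) (bm_integ _ _ bg)).
by move=> x /=; rewrite in_itv; exact: fg.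
Qed.

Lemma eq_integ a b f g : (forall x, a <= x <= b -> f x = g x) ->
  integ a b f = integ a b g.
Proof.
move=> fg; apply: eq_Rintegral => x; rewrite inE /= in_itv; exact: fg.
Qed.

Lemma integ_ge0 a b f : (forall x, a <= x <= b -> 0 <= f x) -> 0 <= integ a b f.
Proof. by move=> f0; apply: Rintegral_ge0 => x /=; rewrite in_itv; exact: f0. Qed.

Lemma integ_norm_le a b f (B : R) : bounded_measurable f -> a <= b ->
  (forall x, a <= x <= b -> `|f x| <= B) -> `|integ a b f| <= B * (b - a).
Proof.
move=> bf ab fB; rewrite ler_norml -mulNr -!integ_cst//.
apply/andP; split; apply: integ_le => //; try exact: bm_cst.
- by move=> x /fB; rewrite ler_norml => /andP[].
- by move=> x /fB; rewrite ler_norml => /andP[].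
Qed.

Lemma integ_norm a b f : bounded_measurable f ->
  `|integ a b f| <= integ a b (fun x => `|f x|).
Proof. by move=> bf; apply: le_normr_Rintegral => //; exact: bm_integ. Qed.

Lemma integ_chasles a b c f : bounded_measurable f -> a <= b -> b <= c ->
  integ a c f = integ a b f + integ b c f.
Proof.
move=> bf ab bc; rewrite /integ.
have := @Rintegral_itvB _ f (BLeft a) (BRight c) b.
rewrite bnd_simp => /(_ (bm_integ _ _ bf) ab); rewrite bnd_simp => /(_ bc) E.
rewrite -(@Rintegral_itv_obnd_cbnd _ b); first by rewrite -E addrC subrK.
by apply: bm_integrable => //; have := lebesgue_measure_itv `]b, c] => /= ->; case: ifP => //= _; rewrite ltry.
Qed.

Lemma integaa a f : integ a a f = 0.
Proof. by rewrite /integ set_itv1 Rintegral_set1. Qed.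

Lemma integ_ltNge a b f : b < a -> integ a b f = 0.
Proof.
by move=> ba; rewrite /integ set_itv_ge ?bnd_simp -?ltNge// Rintegral_set0.
Qed.

Lemma ae_eq_integ a b f g : bounded_measurable f -> bounded_measurable g ->
  {ae leb, forall x, a <= x <= b -> f x = g x} -> integ a b f = integ a b g.
Proof.
move=> bf bg fg; rewrite /integ /Rintegral; congr fine.
apply: ae_eq_integral => //.
- by apply/measurable_EFinP; apply: measurable_funTS; case: bf.
- by apply/measurable_EFinP; apply: measurable_funTS; case: bg.
by apply: (ae_imp fg) => x E /=; rewrite in_itv => /E ->.
Qed.

Lemma ae_integ_le a b f g : bounded_measurable f -> bounded_measurable g ->
  {ae leb, forall x, a <= x <= b -> f x <= g x} -> integ a b f <= integ a b g.
Proof.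
move=> bf bg fg.
have bm : bounded_measurable (fun x => Num.max (f x) (g x)) by exact: bm_max.
apply: (@le_trans _ _ (integ a b (fun x => Num.max (f x) (g x)))).
  by apply: integ_le => // x _; rewrite le_max lexx.
rewrite (@ae_eq_integ _ _ _ g)//.
by apply: (ae_imp fg) => x E xab; apply/max_idPr; exact: E.
Qed.

Lemma integ_dominated a b (f_ : nat -> R -> R) f (B : R) :
  (forall n, measurable_fun setT (f_ n)) -> bounded_measurable f ->
  (forall n x, `|f_ n x| <= B) ->
  {ae leb, forall x, a <= x <= b -> f_ n x @[n --> \oo] --> f x} ->
  integ a b (f_ n) @[n --> \oo] --> integ a b f.
Proof.
move=> mf bf fB cf.
have [||||_ _ h] := @dominated_convergence _ _ _ leb `[a, b] (measurable_itv _)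
  (fun n x => (f_ n x)%:E) (EFin \o f) (fun=> B%:E) _ _ _ (bm_integ _ _ (bm_cst _ B)).
- by move=> n; apply/measurable_EFinP; apply: measurable_funTS; exact: mf.
- by apply/measurable_EFinP; apply: measurable_funTS; case: bf.
- by apply: (ae_imp cf) => x h /=; rewrite in_itv => /h {}h; exact: cvg_comp h _.
- by apply: aeW => x n _ /=; rewrite lee_fin.
rewrite /integ /Rintegral; apply: fine_cvg.
rewrite fineK; first exact: h.
by apply: integrable_fin_num => //; exact: bm_integ.
Qed.

Lemma leb_shift (z : R) (A : set (measurableTypeR R)) : measurable A ->
  leb ((fun x => x + z) @^-1` A) = leb A.
Proof.
pose phi := (fun x => x + z) : measurableTypeR R -> measurableTypeR R.
have mphi : measurable_fun setT phi by exact: measurable_funD.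
move=> mA; apply/esym.
rewrite (@lebesgue_measure_unique _ (pushforward leb phi))//.
move=> _ [[u v] _ <-] /=; rewrite /pushforward.
have -> : phi @^-1` `]u, v] = `]u - z, v - z]%classic.
  by apply/seteqP; split => x /=; rewrite !in_itv /= /phi ltrBlDr lerBrDr.
rewrite !lebesgue_measure_itv /= !lte_fin ltrD2r.
by case: ifP => // _; rewrite -!EFinB; congr EFin; ring.
Qed.

Lemma ae_shift (z : R) (P : R -> Prop) : {ae leb, forall x, P x} ->
  {ae leb, forall x, P (x + z)}.
Proof.
move=> [A [mA A0 PA]]; exists ((fun x => x + z) @^-1` A); split.
- rewrite -[X in measurable X]setTI.
  by have /(_ measurableT _ mA) := (measurable_funD (@measurable_id _ R setT) (measurable_cst z)).
- by rewrite leb_shift.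
- by move=> x /= nP; exact: (PA (x + z)).
Qed.

Lemma integral_shift (z : R) (D : set R) (f : R -> \bar R) : measurable D ->
  measurable_fun D f -> (forall x, (0 <= f x)%E) ->
  (\int[leb]_(x in (fun x => x + z)%R @^-1` D) f (x + z)%R = \int[leb]_(x in D) f x)%E.
Proof.
move=> mD mf f0.
pose phi := (fun x => x + z) : measurableTypeR R -> measurableTypeR R.
have mphi : measurable_fun setT phi by exact: measurable_funD.
rewrite -(@ge0_integral_pushforward _ _ _ _ _ phi mphi leb D f)//.
apply: eq_measure_integral => A mA _. exact: (leb_shift z mA).
Qed.

Lemma bm_section1 d (T : measurableType d) (F : T * R -> R) x :
  bounded_measurable F -> bounded_measurable (fun y => F (x, y)).
Proof. by apply: bm_comp; exact: pair1_measurable. Qed.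

Lemma bm_section2 (F : R * R -> R) y : bounded_measurable F ->
  bounded_measurable (fun x => F (x, y)).
Proof. by apply: bm_comp; exact: pair2_measurable. Qed.

Lemma integE a b f : bounded_measurable f ->
  (integ a b f)%:E = (\int[leb]_(x in `[a, b]) (f x)%:E)%E.
Proof.
by move=> bf; rewrite /integ /Rintegral fineK//; apply: integrable_fin_num => //;
  exact: bm_integ.
Qed.

Lemma integ_indicE a b f : bounded_measurable f ->
  (integ a b f)%:E = (\int[leb]_x (f x * \1_(`[a, b]%classic : set R) x)%:E)%E.
Proof.
move=> bf; rewrite integE// integral_mkcond; apply: eq_integral => x _.
by rewrite patchE indicE; case: ifPn => _; rewrite ?mulr1 ?mulr0.
Qed.

(** Adding the bound B makes the integrand nonnegative, so Tonelli applies on the whole plane; the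
    indicators restrict it to a rectangle. *)
Definition boxed (F : R * R -> R) (B a b u v : R) (z : R * R) : \bar R :=
  ((F z + B) * \1_(`[u, v]%classic : set R) z.2
    * \1_(`[a, b]%classic : set R) z.1)%:E.

Lemma boxed_tonelli (F : R * R -> R) (B a b u v : R) : bounded_measurable F ->
  (forall z, `|F z| <= B) ->
  measurable_fun setT (boxed F B a b u v) /\ (forall z, (0 <= boxed F B a b u v z)%E).
Proof.
move=> [mF _] FB; split => [|z].
- apply/measurable_EFinP; apply: measurable_funM; first apply: measurable_funM.
  + exact: measurable_funD.
  + by apply: measurableT_comp => //; exact: measurable_snd.
  + by apply: measurableT_comp => //; exact: measurable_fst.
- rewrite lee_fin !mulr_ge0//; have := FB z; rewrite ler_norml => /andP[]; lra.
Qed.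

Lemma integ_indicM u v f (k : R) : bounded_measurable f ->
  (\int[leb]_x (f x * \1_(`[u, v]%classic : set R) x * k)%:E = (integ u v f * k)%:E)%E.
Proof.
move=> bf; rewrite mulrC -integZ// integ_indicE; last by apply: bmM => //; exact: bm_cst.
by apply: eq_integral => x _; congr EFin; ring.
Qed.

Lemma bm_parameter d (T : measurableType d) (F : T * R -> R) a b :
  bounded_measurable F -> bounded_measurable (fun x => integ a b (fun y => F (x, y))).
Proof.
move=> bF; have [mF [B FB]] := bF; split; last first.
  have [ab|ba] := leP a b; last first.
    by exists 0 => x; rewrite integ_ltNge// normr0.
  by exists (B * (b - a)) => x; apply: integ_norm_le => //; exact: bm_section1.
have [ab|ba] := leP a b; last first.
  rewrite (_ : (fun _ => _) = (fun=> 0)); first exact: measurable_cst.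
  by apply/funext => x; rewrite integ_ltNge.
have bF1 x : bounded_measurable (fun y => F (x, y) + B).
  by apply: bmD; [exact: bm_section1|exact: bm_cst].
have mI : measurable_fun setT (fun x => integ a b (fun y => F (x, y) + B)).
  apply/measurable_EFinP.
  rewrite (_ : EFin \o _ = fubini_F leb
    (fun z : T * R => ((F z + B) * \1_(`[a, b]%classic : set R) z.2)%:E)).
  apply: measurable_fun_fubini_tonelli_F.
  + apply/measurable_EFinP; apply: measurable_funM; first exact: measurable_funD.
    by apply: measurableT_comp => //; exact: measurable_snd.
  + move=> z; rewrite lee_fin mulr_ge0//; have := FB z.
    by rewrite ler_norml => /andP[]; lra.
  + by apply/funext => x; rewrite /fubini_F /= integ_indicE.
rewrite (_ : (fun _ => _) = (fun x => integ a b (fun y => F (x, y) + B) - B * (b - a))).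
  exact: measurable_funB.
apply/funext => x; rewrite integD; [|exact: bm_section1|exact: bm_cst].
by rewrite integ_cst// addrK.
Qed.

Lemma bm_parameter' (F : R * R -> R) a b : bounded_measurable F ->
  bounded_measurable (fun y => integ a b (fun x => F (x, y))).
Proof.
move=> bF; apply: (bm_parameter (F := fun z => F (z.2, z.1))).
apply: (bm_comp (k := fun z : R * R => (z.2, z.1))) => //.
exact: measurable_fun_pair.
Qed.

Lemma integ_Fubini a b u v (F : R * R -> R) : bounded_measurable F ->
  integ a b (fun x => integ u v (fun y => F (x, y))) =
  integ u v (fun y => integ a b (fun x => F (x, y))).
Proof.
move=> bF; have [mF [B FB]] := bF.
have bF' : bounded_measurable (fun z : R * R => F z + B) by apply: bmD => //; exact: bm_cst.
have [mG G0] := @boxed_tonelli F B a b u v bF FB.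
have [uv|vu] := leP u v; last first.
  rewrite [RHS]integ_ltNge//.
  rewrite (_ : (fun _ => _) = (fun=> 0)); last by apply/funext => x; rewrite integ_ltNge.
  by have [ab|ba] := leP a b; [rewrite integ_cst// mul0r|rewrite integ_ltNge].
have [ab|ba] := leP a b; last first.
  rewrite [LHS]integ_ltNge//.
  rewrite (_ : (fun _ => _) = (fun=> 0)); last by apply/funext => x; rewrite integ_ltNge.
  by rewrite integ_cst// mul0r.
have : integ a b (fun x => integ u v (fun y => F (x, y) + B)) =
  integ u v (fun y => integ a b (fun x => F (x, y) + B)).
  apply: EFin_inj; rewrite !integ_indicE; first last.
  - exact: bm_parameter bF'.
  - exact: bm_parameter' bF'.
  have := @fubini_tonelli _ _ _ _ _ leb leb _ mG G0.
  set X := (X in X = _ -> _); set Y := (X in _ = X -> _) => E.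
  transitivity X.
    apply: eq_integral => x _; rewrite -(integ_indicM u v _ (bm_section1 x bF')).
    by [].
  rewrite E; apply: eq_integral => y _.
  rewrite -(integ_indicM a b _ (bm_section2 y bF')).
  by apply: eq_integral => x _; rewrite /boxed /= mulrAC.
have -> : (fun x => integ u v (fun y => F (x, y) + B)) =
  (fun x => integ u v (fun y => F (x, y)) + B * (v - u)).
  apply/funext => x; rewrite integD ?integ_cst//; [exact: bm_section1|exact: bm_cst].
have -> : (fun y => integ a b (fun x => F (x, y) + B)) =
  (fun y => integ a b (fun x => F (x, y)) + B * (b - a)).
  apply/funext => x; rewrite integD ?integ_cst//; [exact: bm_section2|exact: bm_cst].
rewrite !integD ?integ_cst//; try exact: bm_cst; [|exact: bm_parameter'|exact: bm_parameter].
rewrite (_ : B * (v - u) * (b - a) = B * (b - a) * (v - u)); last by ring.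
exact: addIr.
Qed.

End integral_on_segments.

(** * Geometry of the flux and dissipation of shocks *)

Section calculus.
Context {R : realType}.
Implicit Types (f g df dg : R -> R) (x a b d : R).

Definition der_at x f d : Prop := is_derive x (1 : R) f d.

Lemma der_atP x f d : der_at x f d <-> derivable f x 1 /\ derive1 f x = d.
Proof.
split=> [[h <-]|[h <-]]; first by rewrite derive1E.
by rewrite /der_at derive1E; exact: DeriveDef.
Qed.

Lemma der_eq x f d d' : der_at x f d -> d = d' -> der_at x f d'.
Proof. by move=> h <-. Qed.

Lemma derD x f g d d' : der_at x f d -> der_at x g d' ->
  der_at x (fun y => f y + g y) (d + d').
Proof. by rewrite /der_at => hf hg; exact: is_deriveD. Qed.

Lemma derB x f g d d' : der_at x f d -> der_at x g d' ->
  der_at x (fun y => f y - g y) (d - d').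
Proof. by rewrite /der_at => hf hg; exact: is_deriveB. Qed.

Lemma derM x f g d d' : der_at x f d -> der_at x g d' ->
  der_at x (fun y => f y * g y) (d * g x + f x * d').
Proof.
rewrite /der_at => hf hg; apply: (der_eq (is_deriveM hf hg)).
by rewrite /GRing.scale /=; ring.
Qed.

Lemma der_cst x (k : R) : der_at x (fun _ : R => k) 0.
Proof. exact: is_derive_cst. Qed.

Lemma der_id x : der_at x (fun y : R => y) 1.
Proof. exact: is_derive_id. Qed.

Lemma derN x f d : der_at x f d -> der_at x (fun y => - f y) (- d).
Proof. by rewrite /der_at => hf; exact: is_deriveN. Qed.

Lemma der_scale x f d (k : R) : der_at x f d ->
  der_at x (fun y => k * f y) (k * d).
Proof.
move=> hf; apply: (der_eq (derM (der_cst x k) hf)).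
by rewrite mul0r add0r.
Qed.

Lemma derV x f d : f x != 0 -> der_at x f d ->
  der_at x (fun y => (f y)^-1) (- d / f x ^+ 2).
Proof.
move=> f0 hf; apply: (der_eq (is_deriveV f0 hf)).
by rewrite /GRing.scale /=; ring.
Qed.

Lemma der_comp x f g d d' : der_at (g x) f d -> der_at x g d' ->
  der_at x (fun y => f (g y)) (d * d').
Proof. by rewrite /der_at => hf hg; exact: is_derive1_comp. Qed.

Lemma der_continuous x f d : der_at x f d -> {for x, continuous f}.
Proof.
by move=> [h _]; apply: differentiable_continuous; apply/derivable1_diffP.
Qed.

Lemma mean_value f df a b : a < b ->
  (forall x, a <= x <= b -> der_at x f (df x)) ->
  exists c : R, a < c < b /\ f b - f a = df c * (b - a).
Proof.
move=> ab Df; have [||c] := @MVT _ f df a b ab.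
- by move=> x; rewrite in_itv /= => /andP[/ltW ax /ltW xb]; apply: Df; rewrite ax.
- apply: continuous_in_subspaceT => x; rewrite inE /= in_itv /= => xab.
  exact: der_continuous (Df x xab).
- by rewrite in_itv; exists c.
Qed.

Lemma nondecr_der f df a b : a <= b ->
  (forall x, a <= x <= b -> der_at x f (df x)) ->
  (forall x, a < x < b -> 0 <= df x) -> f a <= f b.
Proof.
rewrite le_eqVlt => /predU1P[->//|ab] Df df0.
have [c [cab E]] := mean_value ab Df.
by rewrite -subr_ge0 E mulr_ge0 ?df0// subr_ge0 ltW.
Qed.

Lemma incr_der f df a b : a < b ->
  (forall x, a <= x <= b -> der_at x f (df x)) ->
  (forall x, a < x < b -> 0 < df x) -> f a < f b.
Proof.
move=> ab Df df0; have [c [cab E]] := mean_value ab Df.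
by rewrite -subr_gt0 E mulr_gt0 ?df0// subr_gt0.
Qed.

Lemma nonincr_der f df a b : a <= b ->
  (forall x, a <= x <= b -> der_at x f (df x)) ->
  (forall x, a < x < b -> df x <= 0) -> f b <= f a.
Proof.
move=> ab Df df0; rewrite -lerN2.
apply: (@nondecr_der (fun x => - f x) (fun x => - df x)) => // [x /Df h|x /df0].
  exact: derN.
by rewrite oppr_ge0.
Qed.

Lemma decr_der f df a b : a < b ->
  (forall x, a <= x <= b -> der_at x f (df x)) ->
  (forall x, a < x < b -> df x < 0) -> f b < f a.
Proof.
move=> ab Df df0; rewrite -ltrN2.
apply: (@incr_der (fun x => - f x) (fun x => - df x)) => // [x /Df h|x /df0].
  exact: derN.
by rewrite oppr_gt0.
Qed.

Lemma continuous_seg_bounded g a b : (forall x, {for x, continuous g}) ->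
  exists B : R, 0 < B /\ forall x, a <= x <= b -> `|g x| <= B.
Proof.
move=> cg; have [ab|ba] := leP a b; last first.
  by exists 1; split=> // x /andP[ax xb]; have := le_trans ax xb; rewrite leNgt ba.
have [c _ gc] := @EVT_max _ (fun x => `|g x|) a b ab
  (continuous_subspaceT (fun x => continuous_comp (cg x) (@norm_continuous _ _ _))).
exists (`|g c| + 1); split; first by rewrite ltr_wpDl.
by move=> x xab; have := gc x; rewrite in_itv /= => /(_ xab); lra.
Qed.

Lemma continuous_seg_pos g a b : (forall x, a <= x <= b -> {for x, continuous g}) ->
  (forall x, a <= x <= b -> 0 < g x) ->
  exists B : R, 0 < B /\ forall x, a <= x <= b -> B <= g x.
Proof.
move=> cg g0; have [ab|ba] := leP a b; last first.
  by exists 1; split=> // x /andP[ax xb]; have := le_trans ax xb; rewrite leNgt ba.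
have [|c cab gc] := @EVT_min _ g a b ab.
  apply: continuous_in_subspaceT => x; rewrite inE /= in_itv /=; exact: cg.
exists (g c); split; first by apply: g0; move: cab; rewrite in_itv.
by move=> x xab; apply: gc; rewrite in_itv.
Qed.

Lemma lipschitz_seg f df a b : (forall x, der_at x f (df x)) ->
  (forall x, {for x, continuous df}) ->
  exists B : R, 0 < B /\ (forall x, a <= x <= b -> `|df x| <= B) /\
  forall x y, a <= x <= b -> a <= y <= b -> `|f x - f y| <= B * `|x - y|.
Proof.
move=> Df cdf; have [B [B0 dfB]] := continuous_seg_bounded a b cdf.
exists B; split => //; split => // x y.
wlog xy : x y / x <= y.
  move=> W hx hy; have [xy|/ltW yx] := leP x y; first exact: W.
  by rewrite distrC (distrC x); exact: W.
move=> /andP[ax xb] /andP[ay yb]; move: xy; rewrite le_eqVlt => /predU1P[->|xy].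
  by rewrite !subrr normr0 mulr0.
have [c [/andP[xc cy] E]] := @mean_value f df x y xy (fun z _ => Df z).
rewrite distrC E normrM distrC; apply: ler_wpM2r => //; apply: dfB.
by rewrite (le_trans ax (ltW xc)) (le_trans (ltW cy) yb).
Qed.

Lemma between_itv a b x y z : a <= x <= b -> a <= y <= b ->
  Num.min x y <= z <= Num.max x y -> a <= z <= b.
Proof.
by case: (leP x y) => _ /andP[ax xb] /andP[ay yb] /andP[h1 h2]; apply/andP; split;
  [exact: le_trans h1|exact: le_trans h2 _|exact: le_trans h1|exact: le_trans h2 _].
Qed.

Lemma between_ball (c r x y z : R) : `|x - c| <= r -> `|y - c| <= r ->
  Num.min x y <= z <= Num.max x y -> `|z - c| <= r.
Proof.
by rewrite !ler_distl; exact: between_itv.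
Qed.

Lemma ltW_between x y z : Num.min x y < z < Num.max x y ->
  Num.min x y <= z <= Num.max x y.
Proof. by move=> /andP[/ltW-> /ltW->]. Qed.

Lemma dist_max (k x y : R) : `|Num.max k x - Num.max k y| <= `|x - y|.
Proof.
have h := ler_norm (x - y); have h' := ler_norm (- (x - y)); rewrite normrN in h'.
by have [?|?] := leP k x; have [?|?] := leP k y; rewrite ler_norml; apply/andP; split; lra.
Qed.

Lemma dist_min (k x y : R) : `|Num.min k x - Num.min k y| <= `|x - y|.
Proof.
have h := ler_norm (x - y); have h' := ler_norm (- (x - y)); rewrite normrN in h'.
by have [?|?] := leP k x; have [?|?] := leP k y; rewrite ler_norml; apply/andP; split; lra.
Qed.

(** Meant for a dissipation x of known sign that is close to a dissipation y known to be away from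
    0. *)
Lemma nonpos_gap (c d x y : R) : 0 < c -> c <= `|y| -> `|x - y| <= d -> d <= c / 2 ->
  x <= 0 -> x <= - (c / 2).
Proof.
move=> c0 cy; rewrite ler_norml => /andP[h1 h2] dc x0.
by move: cy; rewrite ler_normr => /orP[]; lra.
Qed.

End calculus.

Ltac der_tac := repeat first
  [ apply: der_cst | apply: der_id | apply: derD | apply: derB | apply: derN
  | apply: der_scale | apply: derM | solve [eauto 2] ].

(** * Tangents and chords of a concave-convex flux *)

Section flux_geometry.
Context {R : realType} (f f1 f2 : R -> R) (u : R).
Hypotheses (Df : forall x, der_at x f (f1 x))
  (Df1 : forall x, der_at x f1 (f2 x))
  (f2_sign : forall x, x != 0 -> 0 < x * f2 x)
  (f1_Ny : f1 x @[x --> -oo] --> +oo)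
  (u_gt0 : 0 < u).
Implicit Types v w x : R.

Let f2_pos x : 0 < x -> 0 < f2 x.
Proof. by move=> x0; have := f2_sign (lt0r_neq0 x0); rewrite pmulr_rgt0. Qed.

Let f2_neg x : x < 0 -> f2 x < 0.
Proof. by move=> x0; have := f2_sign (ltr0_neq0 x0); rewrite nmulr_rgt0. Qed.

Lemma f1_incr v w : 0 <= v -> v < w -> f1 v < f1 w.
Proof.
move=> v0 vw; apply: (incr_der (df := f2)) => // x /andP[vx _].
by apply: f2_pos; exact: le_lt_trans vx.
Qed.

Lemma f1_decr v w : w <= 0 -> v < w -> f1 w < f1 v.
Proof.
move=> w0 vw; apply: (decr_der (df := f2)) => // x /andP[_ xw].
by apply: f2_neg; exact: lt_le_trans xw _.
Qed.

(** Height of the graph above its tangent at v, measured at abscissa b. It vanishes when that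
    tangent passes through (b, f b), and its sign is the sign of the derivative of v |->
    [slope b v]. *)
Definition tangent_gap b v : R := f b - f v - f1 v * (b - v).

Definition slope b v : R := (f b - f v) / (b - v).

Lemma der_tangent_gap b v :
  der_at v (tangent_gap b) (- f2 v * (b - v)).
Proof.
rewrite /tangent_gap; apply: der_eq.
  apply: derB; first by apply: derB; [exact: der_cst|exact: Df].
  by apply: derM; [exact: Df1|apply: derB; [exact: der_cst|exact: der_id]].
by rewrite /=; ring.
Qed.

Lemma der_slope b v : v != b ->
  der_at v (slope b) (tangent_gap b v / (b - v) ^+ 2).
Proof.
move=> vb; have bv0 : b - v != 0 by rewrite subr_eq0 eq_sym.
rewrite /slope; apply: der_eq.
  apply: derM; first by apply: derB; [exact: der_cst|exact: Df].
  apply: (@derV _ v (fun y => b - y) (0 - 1)) => //.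
  by apply: derB; [exact: der_cst|exact: der_id].
by rewrite /= /tangent_gap; field.
Qed.

Lemma slopeC b v : slope b v = slope v b.
Proof. by rewrite /slope -opprB -(opprB v b) invrN mulrNN. Qed.

Lemma slope_f1 a b : a < b -> exists c : R, a < c < b /\ slope a b = f1 c.
Proof.
move=> ab; have [c [cab E]] := mean_value ab (fun x _ => Df x).
exists c; split => //; rewrite slopeC /slope E mulfK// subr_eq0.
by rewrite gt_eqF.
Qed.

Lemma tangent_gapuu : tangent_gap u u = 0.
Proof. by rewrite /tangent_gap !subrr mulr0 subrr. Qed.

(** In v, the gap has derivative - f''(v) (u - v): it increases on the negative half-line, decreases
    on [0, u], where it ends at 0, and increases again beyond u. It is negative far to the left
    because f' tends to +oo there, so besides u it has exactly one zero, and that zero is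
    negative. *)
Lemma tangent_point : exists k : R, [/\ k < 0, tangent_gap u k = 0,
  (forall v, v < k -> tangent_gap u v < 0) &
  (forall v, k < v -> v != u -> 0 < tangent_gap u v)].
Proof.
have N0u v : 0 <= v -> v < u -> 0 < tangent_gap u v.
  move=> v0 vu; rewrite -tangent_gapuu.
  apply: (decr_der vu (fun x _ => der_tangent_gap u x)) => x /andP[vx xu].
  by rewrite mulNr oppr_lt0 mulr_gt0 ?subr_gt0// f2_pos// (le_lt_trans v0).
have Nu v : u < v -> 0 < tangent_gap u v.
  move=> uv; rewrite -tangent_gapuu.
  apply: (incr_der uv (fun x _ => der_tangent_gap u x)) => x /andP[ux xv].
  by rewrite mulNr -mulrN opprB mulr_gt0 ?subr_gt0// f2_pos// (lt_trans u_gt0).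
have Ninc v w : w <= 0 -> v < w -> tangent_gap u v < tangent_gap u w.
  move=> w0 vw; apply: (incr_der vw (fun x _ => der_tangent_gap u x)) => x /andP[vx xw].
  have x0 : x < 0 by exact: lt_le_trans xw _.
  by rewrite mulr_gt0 ?oppr_gt0 ?f2_neg// subr_gt0 (lt_trans x0).
have N00 := N0u 0 (lexx 0) u_gt0.
have [v0 [v00 Nv0]] : exists v0, v0 < 0 /\ tangent_gap u v0 < 0.
  have /cvgryPgt /(_ (f1 0 + tangent_gap u 0 / u)) := f1_Ny.
  move=> [A [_ hA]].
  exists (Num.min (A - 1) (- 1)); set v := Num.min _ _.
  have v0 : v < 0 by rewrite gt_min; apply/orP; right; rewrite oppr_lt0.
  have vA : v < A by rewrite gt_min; apply/orP; left; rewrite ltrBlDr ltrDl.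
  split => //; have {hA}f1v := hA v vA.
  (* The added term leaves the derivative x f''(x) >= 0. Hence the gap at v < 0 is at most its value
     at 0 minus u (f'(v) - f'(0)), which is negative once f'(v) is large. *)
  have : tangent_gap u v + u * (f1 v - f1 0) <= tangent_gap u 0 + u * (f1 0 - f1 0).
    apply: (nondecr_der (f := fun v => tangent_gap u v + u * (f1 v - f1 0))
      (df := fun x => x * f2 x) (ltW v0)) => [x _|x /andP[_ x0]].
      apply: der_eq.
        apply: derD; first exact: der_tangent_gap.
        apply: der_scale; apply: derB; [exact: Df1|exact: der_cst].
      by rewrite /=; ring.
    by apply: ltW; apply: f2_sign; rewrite lt_eqF.
  rewrite subrr mulr0 addr0.
  have : tangent_gap u 0 < u * (f1 v - f1 0).
    by rewrite -ltr_pdivrMl// mulrC ltrBrDl.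
  lra.
have [|k] := @IVT _ (tangent_gap u) v0 0 0 (ltW v00)
  (continuous_subspaceT (fun x => der_continuous (der_tangent_gap u x))).
  by rewrite ge_min le_max (ltW Nv0) (ltW N00) orbT.
rewrite in_itv /= => /andP[_ k0] Nk.
have {}k0 : k < 0.
  by rewrite lt_neqAle k0 andbT; apply/eqP => k00; move: N00; rewrite -{2}k00 Nk ltxx.
exists k; split => // [v vk|v kv vu]; first by rewrite -Nk Ninc// ltW.
have [v0'|v0'] := leP v 0; first by rewrite -Nk Ninc.
by case: (ltgtP v u) vu => // [vu|uv] _; [apply: N0u => //; exact: ltW|exact: Nu].
Qed.

Section tangent_point_properties.
Variable k : R.
Hypotheses (k_lt0 : k < 0) (Nk : tangent_gap u k = 0)
  (Nlt : forall v, v < k -> tangent_gap u v < 0)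
  (Ngt : forall v, k < v -> v != u -> 0 < tangent_gap u v).

(** The signs of the gap on both sides of k leave k as the only element of the set, so [xget] picks
    it. *)
Lemma phi_natE : derive1 f = f1 -> phi_nat f u = k.
Proof.
move=> f1E; rewrite /phi_nat (gt_eqF u_gt0) f1E; case: xgetP => [v _ [vu Ev]|/(_ k) []].
  have Nv : tangent_gap u v = 0.
    by rewrite /tangent_gap Ev divfK ?subrr// subr_eq0 eq_sym.
  case: (ltgtP v k) => // [/Nlt|/Ngt/(_ vu)]; by rewrite Nv ltxx.
have ku : u - k != 0 by rewrite subr_eq0 gt_eqF// (lt_trans k_lt0).
split; first by rewrite lt_eqF// (lt_trans k_lt0).
by apply: (mulIf ku); rewrite divfK//; apply/eqP; rewrite eq_sym -subr_eq0; apply/eqP.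
Qed.

(** Otherwise f' would be below f'(k) on ]k, 0[, where it decreases, and on ]0, u[, where it stays
    below f'(u) <= f'(k); the chord from k to u would then be less steep than the tangent at k,
    which contains it. *)
Lemma f1k_lt : f1 k < f1 u.
Proof.
have [//|ge] := ltP (f1 k) (f1 u).
have [c [/andP[c0 cu] E1]] := mean_value u_gt0 (fun x _ => Df x).
have [d [/andP[kd d0] E2]] := mean_value k_lt0 (fun x _ => Df x).
have h1 := f1_incr (ltW c0) cu; have h2 := f1_decr (ltW d0) kd.
have := Nk; rewrite /tangent_gap.
have -> : f u - f k = f1 c * (u - 0) + f1 d * (0 - k) by rewrite -E1 -E2; ring.
have : f1 c * u < f1 k * u by rewrite ltr_pM2r//; exact: lt_le_trans ge.
have : f1 d * (- k) < f1 k * (- k) by rewrite ltr_pM2r// oppr_gt0.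
lra.
Qed.

Lemma f1_lt_u v : k <= v -> v < u -> f1 v < f1 u.
Proof.
move=> kv vu; have [v0|v0] := leP 0 v; first exact: f1_incr.
move: kv; rewrite le_eqVlt => /predU1P[<-|kv]; first exact: f1k_lt.
exact: lt_trans (f1_decr (ltW v0) kv) f1k_lt.
Qed.

Lemma slope_incr_right v w : u < v -> v < w -> slope u v < slope u w.
Proof.
move=> uv vw; apply: (incr_der vw (df := fun x => tangent_gap u x / (u - x) ^+ 2)).
  by move=> x /andP[vx _]; apply: der_slope; rewrite gt_eqF// (lt_le_trans uv).
move=> x /andP[vx xw]; have xu : u < x by exact: lt_trans vx.
rewrite divr_gt0//; first by apply: Ngt; [exact: lt_trans (lt_trans k_lt0 u_gt0) xu|rewrite gt_eqF].
by rewrite exprn_even_gt0//= subr_eq0 lt_eqF.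
Qed.

Lemma slope_decr v w : v < w -> w <= k -> slope u w < slope u v.
Proof.
move=> vw wk; have ku : k < u by exact: lt_trans k_lt0 _.
apply: (decr_der vw (df := fun x => tangent_gap u x / (u - x) ^+ 2)).
  move=> x /andP[_ xw]; apply: der_slope.
  by rewrite lt_eqF// (le_lt_trans xw)// (le_lt_trans wk).
move=> x /andP[vx xw]; have xk : x < k by exact: lt_le_trans xw _.
rewrite ltr_pdivrMr ?mul0r ?Nlt// exprn_gt0// subr_gt0.
exact: lt_trans xk ku.
Qed.

(** If u_R < k, the chord from u to k is less steep than the one to u_R and the condition fails at v
    = k. If u_R > u, slopes increase to the right of u and it fails at the midpoint. *)
Lemma oleinik_bounds uR : oleinik f u uR -> k <= uR < u.
Proof.
move=> [uuR ole]; have ku : k < u by exact: lt_trans k_lt0 _.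
have E v : (f v - f u) / (v - u) = slope u v.
  by rewrite slopeC.
apply/andP; split.
  rewrite leNgt; apply/negP => uRk.
  have := ole k; rewrite !E min_r ?max_l ?uRk ?ku; try exact: ltW (lt_trans uRk ku).
  by move=> /(_ isT); rewrite leNgt slope_decr.
rewrite ltNge; apply/negP => uuR'; have {uuR'}uR' : u < uR by rewrite lt_neqAle uuR.
have := ole ((u + uR) / 2); rewrite !E min_l ?max_r; try exact: ltW.
have /andP[h1 h2] : u < (u + uR) / 2 < uR by apply/andP; split; lra.
by rewrite h1 h2 => /(_ isT); rewrite leNgt slope_incr_right.
Qed.

End tangent_point_properties.
End flux_geometry.

(** * Relative entropies and their fluxes *)

Section relative_entropies.
Context {R : realType} (f f1 f2 eta e1 e2 q : R -> R).
Hypotheses (Df : forall x, der_at x f (f1 x))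
  (De : forall x, der_at x eta (e1 x)) (De1 : forall x, der_at x e1 (e2 x))
  (Dq : forall x, der_at x q (e1 x * f1 x)) (e2_gt0 : forall x, 0 < e2 x).
Implicit Types b v w x s : R.

Definition rel_eta v b : R := eta v - eta b - e1 b * (v - b).

Definition rel_flux v b : R := q v - q b - e1 b * (f v - f b).

Lemma convex_tangent (h h1 h2 : R -> R) (A B : R) :
  (forall x, der_at x h (h1 x)) -> (forall x, der_at x h1 (h2 x)) ->
  (forall x, A <= x <= B -> 0 <= h2 x) ->
  forall v b, A <= v <= B -> A <= b <= B -> h1 b * (v - b) <= h v - h b.
Proof.
move=> Dh Dh1 h20 v b /andP[Av vB] /andP[Ab bB].
have mono x y : A <= x -> x <= y -> y <= B -> h1 x <= h1 y.
  move=> Ax xy yB; apply: (nondecr_der xy (fun z _ => Dh1 z)) => z /andP[xz zy].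
  by apply: h20; rewrite (le_trans Ax (ltW xz)) (le_trans (ltW zy) yB).
case: (ltgtP v b) => [vb|bv|->]; last by rewrite !subrr mulr0.
- have [c [/andP[vc cb] E]] := mean_value vb (fun z _ => Dh z).
  rewrite -lerN2 opprB E -mulrN opprB ler_pM2r ?subr_gt0//.
  by apply: mono; [exact: le_trans (ltW vc)|exact: ltW|].
- have [c [/andP[vc cb] E]] := mean_value bv (fun z _ => Dh z).
  rewrite E ler_pM2r ?subr_gt0//.
  by apply: mono; [|exact: ltW|exact: le_trans (ltW cb) _].
Qed.

(** Both bounds are instances of [convex_tangent], for eta - (c / 2) x^2 and for (C / 2) x^2 -
    eta. *)
Lemma rel_eta_bounds (A B c C : R) :
  (forall x, A <= x <= B -> c <= e2 x <= C) ->
  forall v b, A <= v <= B -> A <= b <= B ->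
  c / 2 * (v - b) ^+ 2 <= rel_eta v b <= C / 2 * (v - b) ^+ 2.
Proof.
move=> e2B v b vAB bAB.
have h2 (z : R) : z = z / 2 + z / 2 by rewrite -mulrDl -mulr2n -[z *+ 2]mulr_natr mulfK.
(* From here on c and C denote the halves of the original constants. *)
move: e2B; rewrite (h2 c) (h2 C); move: (c / 2) (C / 2) => {h2}{}c {}C e2B.
have E (z : R) : (z + z) / 2 = z by rewrite -mulr2n -[z *+ 2]mulr_natr mulfK.
have H1 := @convex_tangent (fun x => eta x - c * (x * x)) (fun x => e1 x - (c + c) * x)
  (fun x => e2 x - (c + c)) A B.
have H2 := @convex_tangent (fun x => C * (x * x) - eta x) (fun x => (C + C) * x - e1 x)
  (fun x => (C + C) - e2 x) A B.
rewrite !E /rel_eta; apply/andP; split; rewrite -subr_ge0.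
- rewrite (_ : _ - _ = eta v - c * (v * v) - (eta b - c * (b * b)) - (e1 b - (c + c) * b) * (v - b)); last by ring.
  rewrite subr_ge0; apply: H1; [move=> x|move=> x|move=> x xAB|by []|by []].
  + by apply: der_eq; [der_tac|rewrite /=; ring].
  + by apply: der_eq; [der_tac|rewrite /=; ring].
  + by rewrite subr_ge0; case/andP: (e2B _ xAB).
- rewrite (_ : _ - _ = C * (v * v) - eta v - (C * (b * b) - eta b) - ((C + C) * b - e1 b) * (v - b)); last by ring.
  rewrite subr_ge0; apply: H2; [move=> x|move=> x|move=> x xAB|by []|by []].
  + by apply: der_eq; [der_tac|rewrite /=; ring].
  + by apply: der_eq; [der_tac|rewrite /=; ring].
  + by rewrite subr_ge0; case/andP: (e2B _ xAB).
Qed.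

Lemma e1_incr v w : v < w -> e1 v < e1 w.
Proof. by move=> vw; apply: (incr_der vw (fun x _ => De1 x)) => x _. Qed.

Lemma e1_mono v w : v <= w -> e1 v <= e1 w.
Proof. by rewrite le_eqVlt => /predU1P[->//|/e1_incr/ltW]. Qed.

Lemma rel_eta_gt0 v b : v != b -> 0 < rel_eta v b.
Proof.
rewrite /rel_eta; case: (ltgtP v b) => // [vb|bv] _.
- have [c [/andP[vc cb] E]] := mean_value vb (fun z _ => De z).
  have -> : eta v - eta b = e1 c * (v - b) by rewrite -[LHS]opprB E; ring.
  by rewrite -mulrBl nmulr_rgt0 ?subr_lt0// e1_incr.
- have [c [/andP[vc cb] E]] := mean_value bv (fun z _ => De z).
  by rewrite E -mulrBl mulr_gt0 ?subr_gt0// e1_incr.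
Qed.

Lemma rel_eta_ge0 v b : 0 <= rel_eta v b.
Proof.
have [->|/rel_eta_gt0/ltW//] := eqVneq v b.
by rewrite /rel_eta !subrr mulr0 subrr.
Qed.

Lemma der_rel b c x :
  der_at x (fun w => rel_flux w b - c * rel_eta w b) ((e1 x - e1 b) * (f1 x - c)).
Proof. by rewrite /rel_flux /rel_eta; apply: der_eq; [der_tac|rewrite /=; ring]. Qed.

(** In its first argument, [rel_flux] - c [rel_eta] vanishes at b and has derivative (e1 x - e1 b)
    (f1 x - c), whose sign is that of x - b when f1 >= c. *)
Lemma rel_flux_ge c v b :
  (forall w, Num.min v b <= w <= Num.max v b -> c <= f1 w) ->
  c * rel_eta v b <= rel_flux v b.
Proof.
move=> cf1; rewrite -subr_ge0.
have E0 : 0 = rel_flux b b - c * rel_eta b b.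
  by rewrite /rel_flux /rel_eta; ring.
rewrite [leLHS]E0; have [vb|bv] := leP v b.
- apply: (@nonincr_der _ (fun w => rel_flux w b - c * rel_eta w b) _ v b vb
    (fun x _ => der_rel b c x)) => x /andP[vx xb].
  apply: mulr_le0_ge0; first by rewrite subr_le0 e1_mono// ltW.
  by rewrite subr_ge0 cf1// min_l// max_r// !ltW.
- apply: (@nondecr_der _ (fun w => rel_flux w b - c * rel_eta w b) _ b v (ltW bv)
    (fun x _ => der_rel b c x)) => x /andP[vx xb].
  apply: mulr_ge0; first by rewrite subr_ge0 e1_mono// ltW.
  by rewrite subr_ge0 cf1// min_r ?max_l ?ltW.
Qed.

Lemma rel_flux_le c v b :
  (forall w, Num.min v b <= w <= Num.max v b -> f1 w <= c) ->
  rel_flux v b <= c * rel_eta v b.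
Proof.
move=> cf1; rewrite -subr_le0.
have E0 : 0 = rel_flux b b - c * rel_eta b b.
  by rewrite /rel_flux /rel_eta; ring.
rewrite [leRHS]E0; have [vb|bv] := leP v b.
- apply: (@nondecr_der _ (fun w => rel_flux w b - c * rel_eta w b) _ v b vb
    (fun x _ => der_rel b c x)) => x /andP[vx xb].
  apply: mulr_le0; first by rewrite subr_le0 e1_mono// ltW.
  by rewrite subr_le0 cf1// min_l// max_r// !ltW.
- apply: (@nonincr_der _ (fun w => rel_flux w b - c * rel_eta w b) _ b v (ltW bv)
    (fun x _ => der_rel b c x)) => x /andP[vx xb].
  apply: mulr_ge0_le0; first by rewrite subr_ge0 e1_mono// ltW.
  by rewrite subr_le0 cf1// min_r ?max_l ?ltW.
Qed.

(* Integrating by parts, [rel_flux x b - s * rel_eta x b] is the integral of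
   [e2 * (l - f)] from [b] to [x], [l] being the line of slope [s] through
   [(x, f x)]. *)
Lemma rel_chord_right s x b (B : R) : b <= x ->
  (forall v, b <= v <= x -> f x + s * (v - x) - f v <= B) ->
  rel_flux x b - s * rel_eta x b <= B * (e1 x - e1 b).
Proof.
move=> bx H.
pose J w := q w - s * eta w - e1 w * (f w - (f x + s * (w - x))) - B * e1 w.
have : J x <= J b.
  apply: (@nonincr_der _ J (fun w => e2 w * (f x + s * (w - x) - f w - B)) b x bx).
    by move=> w _; rewrite /J; apply: der_eq; [der_tac|rewrite /=; ring].
  move=> w /andP[bw wx]; rewrite pmulr_rle0// subr_le0 H//.
  by rewrite !ltW.
rewrite /J /rel_flux /rel_eta -subr_ge0 -[in X in _ -> X]subr_ge0.
by congr (0 <= _); ring.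
Qed.

Lemma rel_chord_left s x b (B : R) : x <= b ->
  (forall v, x <= v <= b -> f v - (f x + s * (v - x)) <= B) ->
  rel_flux x b - s * rel_eta x b <= B * (e1 b - e1 x).
Proof.
move=> bx H.
pose J w := q w - s * eta w - e1 w * (f w - (f x + s * (w - x))) + B * e1 w.
have : J x <= J b.
  apply: (@nondecr_der _ J (fun w => e2 w * (B - (f w - (f x + s * (w - x))))) x b bx).
    by move=> w _; rewrite /J; apply: der_eq; [der_tac|rewrite /=; ring].
  move=> w /andP[bw wx]; rewrite pmulr_rge0// subr_ge0 H//.
  by rewrite !ltW.
rewrite /J /rel_flux /rel_eta -subr_ge0 -[in X in _ -> X]subr_ge0.
by congr (0 <= _); ring.
Qed.

Definition shock_entropy v w : R := q w - q v - slope f v w * (eta w - eta v).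

(** Across a discontinuity that satisfies the Rankine-Hugoniot relation, the relative flux in the
    moving frame changes by the plain entropy dissipation, whatever the reference state b: the
    affine part of the relative entropy is conserved. It moves the left part of D from u_- to
    u_+. *)
Lemma rel_jump v w b s : f v - f w = s * (v - w) ->
  rel_flux w b - s * rel_eta w b =
  rel_flux v b - s * rel_eta v b + (q w - q v - s * (eta w - eta v)).
Proof.
move=> RH; rewrite /rel_flux /rel_eta.
rewrite (_ : f v = f w + s * (v - w)); last by rewrite -RH; ring.
ring.
Qed.

End relative_entropies.

(** * Sign of the dissipation of a shock with right state u *)

Section shock_dissipation.
Context {R : realType} (f f1 f2 eta e1 e2 q : R -> R) (u k : R).
Hypotheses (Df : forall x, der_at x f (f1 x)) (Df1 : forall x, der_at x f1 (f2 x))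
  (cf2 : forall x, {for x, continuous f2})
  (De : forall x, der_at x eta (e1 x)) (De1 : forall x, der_at x e1 (e2 x))
  (ce2 : forall x, {for x, continuous e2})
  (Dq : forall x, der_at x q (e1 x * f1 x)) (e2_gt0 : forall x, 0 < e2 x)
  (f2_sign : forall x, x != 0 -> 0 < x * f2 x)
  (u_gt0 : 0 < u) (k_lt0 : k < 0) (Nk : tangent_gap f f1 u k = 0)
  (Nlt : forall v, v < k -> tangent_gap f f1 u v < 0)
  (Ngt : forall v, k < v -> v != u -> 0 < tangent_gap f f1 u v).
Implicit Types b v w x s rho : R.
Local Notation N := (tangent_gap f f1).
Local Notation S := (slope f).
Local Notation E := (shock_entropy f eta q).
Local Notation rele := (rel_eta eta e1).
Local Notation relq := (rel_flux f e1 q).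

Let f1c x : {for x, continuous f1} := der_continuous (Df1 x).
Let e1c x : {for x, continuous e1} := der_continuous (De1 x).

(** As the relative entropy is positive, the sign of this derivative is opposite to that of the
    tangent gap, which [tangent_point] provides. *)
Lemma der_shock_entropy v : v != u ->
  der_at v (fun x => E x u) (- (N u v * rele u v / (u - v) ^+ 2)).
Proof.
move=> vu; have uv0 : u - v != 0 by rewrite subr_eq0 eq_sym.
have -> : (fun x => E x u) = (fun x => q u - q x - S u x * (eta u - eta x)).
  by apply/funext => x; rewrite /shock_entropy slopeC.
apply: der_eq.
  apply: derB; first by der_tac.
  apply: derM; first exact: (@der_slope _ f f1 Df u v vu).
  by der_tac.
by rewrite /= /slope /tangent_gap /rel_eta; field.
Qed.

(** At v = u the slope is a division by zero, so continuity of the dissipation there cannot be read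
    off its formula; this bound takes its place. *)
Lemma shock_entropy_small : exists C : R, 0 < C /\
  forall v, 0 <= v <= u + 1 -> `|E v u| <= C * `|u - v|.
Proof.
have [A [A0 [_ HA]]] := @lipschitz_seg _ f f1 0 (u + 1) Df f1c.
have [B [B0 [_ HB]]] := @lipschitz_seg _ eta e1 0 (u + 1) De e1c.
have cdq (x : R) : {for x, continuous (fun x => e1 x * f1 x)}.
  exact: der_continuous (derM (De1 x) (Df1 x)).
have [C [C0 [_ HC]]] := @lipschitz_seg _ q _ 0 (u + 1) Dq cdq.
exists (C + A * B); split; first by rewrite addr_gt0// mulr_gt0.
move=> v v01; have u01 : 0 <= u <= u + 1 by rewrite ltW//= lerDl.
have [->|vu] := eqVneq v u; first by rewrite /shock_entropy !subrr mulr0 subr0 normr0 mulr0.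
rewrite /shock_entropy (le_trans (ler_normB _ _))// mulrDl lerD// ?HC//.
have uv0 : 0 < `|u - v| by rewrite normr_gt0 subr_eq0 eq_sym.
rewrite normrM -mulrA ler_pM//; last exact: HB.
by rewrite slopeC /slope normrM normfV ler_pdivrMr// HA.
Qed.

(** The dissipation strictly decreases on [k, u[ and tends to 0 at u. A nonpositive value at v would
    keep it below a fixed negative number from some v1 < u on. *)
Lemma shock_entropy_gt0 v : k <= v -> v < u -> 0 < E v u.
Proof.
move=> kv vu; rewrite ltNge; apply/negP => Ev.
have mono x y : k <= x -> x < y -> y < u -> E y u < E x u.
  move=> kx xy yu; apply: (decr_der (f := fun x => E x u) xy (df := fun v => - (N u v * rele u v / (u - v) ^+ 2))) => z.
    by move=> /andP[_ zy]; apply: der_shock_entropy; rewrite lt_eqF// (le_lt_trans zy).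
  move=> /andP[xz zy]; have zu : z < u by exact: lt_trans zy _.
  rewrite oppr_lt0 !mulr_gt0//.
  - by apply: Ngt; [exact: le_lt_trans xz|rewrite lt_eqF].
  - by apply: (rel_eta_gt0 De De1) => //; rewrite gt_eqF.
  - by rewrite invr_gt0 exprn_gt0// subr_gt0.
have [C [C0 HC]] := shock_entropy_small.
pose v1 := Num.max ((v + u) / 2) (u / 2).
have vv1 : v < v1 by rewrite lt_max; apply/orP; left; lra.
have u2u : u / 2 < u by rewrite ltr_pdivrMr// ltr_pMr ?ltr1n.
have v1u : v1 < u by rewrite gt_max u2u andbT; lra.
have v10 : 0 < v1 by rewrite lt_max; apply/orP; right; exact: divr_gt0.
have E1 : E v1 u < 0 by apply: lt_le_trans Ev; exact: mono.
(* So close to u that C (u - y) is at most half of |E v1 u|, while E y u < E v1 u. *)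
pose y := Num.max ((v1 + u) / 2) (u + E v1 u / (2 * C)).
have v1y : v1 < y by rewrite lt_max; apply/orP; left; lra.
have d0 : E v1 u / (2 * C) < 0 by rewrite pmulr_llt0// invr_gt0 mulr_gt0.
have yu : y < u by rewrite gt_max; apply/andP; split; lra.
have Ey := mono _ _ (le_trans kv (ltW vv1)) v1y yu.
have := HC y; rewrite (ltW (lt_trans v10 v1y)) /= => /(_ _)/wrap[]; first lra.
rewrite (gtr0_norm (_ : 0 < u - y)) ?subr_gt0//.
have : u - y <= - (E v1 u / (2 * C)).
  by have : u + E v1 u / (2 * C) <= y; [rewrite le_max lexx orbT|lra].
rewrite -(ler_pM2l C0) => h1 h2.
have h3 : C * - (E v1 u / (2 * C)) = - E v1 u / 2 by field; rewrite gt_eqF.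
have := le_trans h2 h1; rewrite h3 ler_norml => /andP[]; lra.
Qed.

Lemma shock_entropy_lt0 v : u < v -> E v u < 0.
Proof.
move=> uv; rewrite ltNge; apply/negP => Ev.
have mono x y : u < x -> x < y -> E y u < E x u.
  move=> ux xy; apply: (decr_der (f := fun x => E x u) xy (df := fun v => - (N u v * rele u v / (u - v) ^+ 2))) => z.
    by move=> /andP[xz _]; apply: der_shock_entropy; rewrite gt_eqF// (lt_le_trans ux).
  move=> /andP[xz zy]; have uz : u < z by exact: lt_trans xz.
  rewrite oppr_lt0 !mulr_gt0//.
  - by apply: Ngt; [exact: lt_trans (lt_trans k_lt0 u_gt0) uz|rewrite gt_eqF].
  - by apply: (rel_eta_gt0 De De1) => //; rewrite lt_eqF.
  - by rewrite invr_gt0 exprn_even_gt0//= subr_eq0 lt_eqF.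
have [C [C0 HC]] := shock_entropy_small.
pose v1 := Num.min ((v + u) / 2) (u + 1).
have vv1 : v1 < v by rewrite gt_min; apply/orP; left; lra.
have v1u : u < v1 by rewrite lt_min; apply/andP; split; lra.
have v10 : v1 <= u + 1 by rewrite ge_min lexx orbT.
have E1 : 0 < E v1 u by apply: le_lt_trans Ev _; exact: mono.
pose y := Num.min ((v1 + u) / 2) (u + E v1 u / (2 * C)).
have v1y : y < v1 by rewrite gt_min; apply/orP; left; lra.
have d0 : 0 < E v1 u / (2 * C) by rewrite divr_gt0// mulr_gt0.
have yu : u < y by rewrite lt_min; apply/andP; split; lra.
have Ey := mono _ _ yu v1y.
have := HC y; rewrite (ltW (lt_trans u_gt0 yu)) /= => /(_ _)/wrap[].
  by apply: ltW; exact: lt_le_trans v1y _.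
rewrite (ltr0_norm (_ : u - y < 0)) ?subr_lt0// opprB.
have : y - u <= E v1 u / (2 * C).
  by have : y <= u + E v1 u / (2 * C); [rewrite ge_min lexx orbT|lra].
rewrite -(ler_pM2l C0) => h1 h2.
have h3 : C * (E v1 u / (2 * C)) = E v1 u / 2 by field; rewrite gt_eqF.
have := le_trans h2 h1; rewrite h3 ler_norml => /andP[]; lra.
Qed.

Lemma shock_entropy_incr v w : v < w -> w <= k -> E v u < E w u.
Proof.
move=> vw wk; have ku : k < u by exact: lt_trans u_gt0.
apply: (incr_der (f := fun x => E x u) vw (df := fun v => - (N u v * rele u v / (u - v) ^+ 2))) => z.
  move=> /andP[_ zw]; apply: der_shock_entropy.
  by rewrite lt_eqF// (le_lt_trans zw)// (le_lt_trans wk).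
move=> /andP[vz zw]; have zk : z < k by exact: lt_le_trans zw _.
have zu : z < u by exact: lt_trans ku.
rewrite oppr_gt0 nmulr_rlt0; last by rewrite nmulr_rlt0 ?Nlt//;
  apply: (rel_eta_gt0 De De1) => //; rewrite gt_eqF.
by rewrite invr_gt0 exprn_gt0// subr_gt0.
Qed.

(** The signs on [k, u[ and on ]u, +oo[ push every zero other than u to the left of k, where the
    dissipation is strictly increasing. So v is the only element of the set given to [xget]. *)
Lemma phi_flat0E v : v != u -> E v u = 0 -> phi_flat0 f eta q u = v.
Proof.
have Eu w : entropy_dissipation f eta q u w = - E w u.
  by rewrite /entropy_dissipation /shock_entropy slopeC /shock_speed -/(S u w); ring.
have Ek w : w != u -> E w u = 0 -> w < k.
  move=> wu Ew; rewrite ltNge; apply/negP => kw.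
  by case: (ltgtP w u) wu => // [/(shock_entropy_gt0 kw)|/shock_entropy_lt0]; rewrite Ew ltxx.
move=> vu Ev; rewrite /phi_flat0 gt_eqF//.
case: xgetP => [w _ [wu]|/(_ v) []]; last by split => //; rewrite Eu Ev oppr0.
rewrite Eu => /eqP; rewrite oppr_eq0 => /eqP Ew.
have wk := Ek _ wu Ew; have vk := Ek _ vu Ev.
case: (ltgtP w v) => // [wv|vw].
- by have := shock_entropy_incr wv (ltW vk); rewrite Ev Ew ltxx.
- by have := shock_entropy_incr vw (ltW wk); rewrite Ev Ew ltxx.
Qed.

(** Compactness for w = u: |E v u| + max(0, eps - |v - phi|) is continuous and positive on
    [- M, u - rho], since E v u = 0 forces v = phi. Where v is eps-far from phi the second term is
    0, so |E v u| has a positive lower bound. Moving the right state from u to w costs O(|w - u|),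
    and the sign assumption on E v w selects the negative side. *)
Lemma shock_entropy_away (M rho eps : R) : 0 < rho -> 0 < eps ->
  exists c r : R, [/\ 0 < c, 0 < r & forall v w, - M <= v <= u - rho ->
    eps <= `|v - phi_flat0 f eta q u| -> `|w - u| <= r ->
    E v w <= 0 -> E v w <= - c].
Proof.
move=> rho0 eps0; set phi := phi_flat0 f eta q u.
have cE x : - M <= x <= u - rho -> {for x, continuous (fun v => `|E v u| + Num.max 0 (eps - `|v - phi|))}.
  move=> /andP[_ xu]; have xu' : x != u by rewrite lt_eqF// (le_lt_trans xu)// gtrDl oppr_lt0.
  have h := der_continuous (der_shock_entropy xu').
  apply: continuousD; first by apply: (continuous_comp h); exact: norm_continuous.
  apply: continuous_max; first exact: cst_continuous.
  apply: continuousB; first exact: cst_continuous.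
  apply: (@continuous_comp _ _ _ (fun y => y - phi) (fun y => `|y|)).
    by apply: continuousB; [exact: cvg_id|exact: cst_continuous].
  exact: norm_continuous.
have [|c [c0 Hc]] := continuous_seg_pos cE.
  move=> x /andP[_ xu]; have xu' : x != u by rewrite lt_eqF// (le_lt_trans xu)// gtrDl oppr_lt0.
  have [Ex|Ex] := eqVneq (E x u) 0.
    by rewrite /phi (phi_flat0E xu' Ex) subrr normr0 subr0 Ex normr0 add0r lt_max eps0 orbT.
  by rewrite ltr_pwDl ?normr_gt0// le_max lexx.
pose a : R := - `|M| - `|u| - rho - 1; pose b : R := `|u| + rho + 1.
have [A [A0 [HA1 HA]]] := @lipschitz_seg _ f f1 a b Df f1c.
have [B [B0 [_ HB]]] := @lipschitz_seg _ eta e1 a b De e1c.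
have cdq (x : R) : {for x, continuous (fun x => e1 x * f1 x)}.
  exact: der_continuous (derM (De1 x) (Df1 x)).
have [C [C0 [_ HC]]] := @lipschitz_seg _ q _ a b Dq cdq.
have hM := ler_norm M; have hM' := ler_norm (- M); rewrite normrN in hM'.
have hu := ler_norm u; have hu' := ler_norm (- u); rewrite normrN in hu'; have n0 := normr_ge0 M; have n1 := normr_ge0 u.
have aM : a <= - M by rewrite /a; lra.
have ub : u - rho <= b by rewrite /b; lra.
have arho : a <= u - rho / 2 by rewrite /a; lra.
have rhob : u + rho / 2 <= b by rewrite /b; lra.
have rho2 : 0 < rho / 2 by rewrite divr_gt0.
have ua : a <= u <= b.
  by rewrite (le_trans arho) ?gerBl ?(ltW rho2)//= (le_trans _ rhob)// lerDl ltW.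
have Sb v w : a <= v <= b -> a <= w <= b -> v != w -> `|S v w| <= A.
  move=> va wa vw; rewrite /slope normrM normfV ler_pdivrMr ?HA//.
  by rewrite normr_gt0 subr_eq0.
pose K := C + A * B + (A + A) * B * (b - a) / (rho / 2).
have ab : 0 < b - a by rewrite subr_gt0 (le_lt_trans arho)// (lt_le_trans _ rhob)// ltrD2l gt0_cp.
have K0 : 0 < K.
  apply: addr_gt0; first by apply: addr_gt0 => //; exact: mulr_gt0.
  apply: divr_gt0 => //.
  by apply: mulr_gt0 => //; apply: mulr_gt0 => //; exact: addr_gt0.
exists (c / 2), (Num.min (rho / 2) (c / 2 / K)); split.
- by rewrite divr_gt0.
- by rewrite lt_min !divr_gt0.
move=> v w vM veps; rewrite le_min => /andP[wrho wc] Evw.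
have Pc : c <= `|E v u|.
  have := Hc _ vM; rewrite (max_idPl _) ?addr0//.
  by rewrite subr_le0.
have va : a <= v <= b by case/andP: (vM) => h1 h2; rewrite (le_trans aM h1) (le_trans h2 ub).
have wrho' := wrho; rewrite ler_distl in wrho'.
have wa : a <= w <= b by case/andP: wrho' => h1 h2; rewrite (le_trans arho h1) (le_trans h2 rhob).
have vu : v != u by case/andP: vM => _ h; rewrite lt_eqF// (le_lt_trans h)// gtrBl.
have wv : rho / 2 <= w - v.
  case/andP: wrho' => h1 _; case/andP: vM => _ h2; rewrite lerBrDl (le_trans _ h1)//.
  by rewrite -lerBrDr (le_trans h2)// le_eqVlt; apply/orP; left; apply/eqP; field.
have wv0 : 0 < w - v by exact: lt_le_trans wv.
have wv' : w != v by rewrite gt_eqF// -subr_gt0.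
have diff : `|E v w - E v u| <= K * `|w - u|.
  (* The last term comes from S v w - S v u = (f w - f u - S v u (w - u)) / (w - v). *)
  have -> : E v w - E v u = (q w - q u) - S v w * (eta w - eta u)
     - (f w - f u - S v u * (w - u)) * (eta u - eta v) / (w - v).
    rewrite /shock_entropy /slope; field; rewrite !subr_eq0 wv'/=.
    by rewrite [v == w]eq_sym wv' [v == u]eq_sym eq_sym vu.
  rewrite (_ : K * `|w - u| = C * `|w - u| + A * B * `|w - u| + (A + A) * B * (b - a) / (rho / 2) * `|w - u|); last by rewrite /K; ring.
  apply: le_trans (ler_normB _ _) _; apply: lerD.
    apply: le_trans (ler_normB _ _) _; apply: lerD; first exact: HC.
    by rewrite normrM -mulrA ler_pM ?HB ?Sb// eq_sym.
  rewrite normrM normfV (gtr0_norm wv0) ler_pdivrMr//.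
  have h1 : `|f w - f u - S v u * (w - u)| <= (A + A) * `|w - u|.
    rewrite mulrDl (le_trans (ler_normB _ _))// lerD ?HA// normrM ler_wpM2r ?Sb//.
  have h2 : `|eta u - eta v| <= B * (b - a).
    apply: le_trans (HB _ _ ua va) _; rewrite ler_pM2l// ler_norml.
    case/andP: ua => a1 b1; case/andP: va => a2 b2.
    by rewrite opprB; apply/andP; split; exact: lerB.
  rewrite normrM; apply: le_trans (ler_pM _ _ h1 h2) _ => //.
  rewrite -[leLHS]mulr1.
  have : 1 <= (rho / 2)^-1 * (w - v) by rewrite ler_pdivlMl// mulr1.
  move=> h; apply: le_trans (ler_wpM2l _ h) _.
    by rewrite !mulr_ge0// ?(ltW B0) ?(ltW ab) ?(ltW (addr_gt0 A0 A0)).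
  by rewrite le_eqVlt; apply/orP; left; apply/eqP; ring.
have : K * `|w - u| <= c / 2 by rewrite mulrC -ler_pdivlMr.
by move=> d3; exact: nonpos_gap c0 Pc diff d3 Evw.
Qed.

End shock_dissipation.

(** * Choice of the velocity and of the admissible weights *)

Section admissible_velocity.
Context {R : realType} (f f1 f2 eta e1 e2 q : R -> R) (u k uR M eps : R).
Hypotheses (Df : forall x, der_at x f (f1 x)) (Df1 : forall x, der_at x f1 (f2 x))
  (cf2 : forall x, {for x, continuous f2})
  (De : forall x, der_at x eta (e1 x)) (De1 : forall x, der_at x e1 (e2 x))
  (ce2 : forall x, {for x, continuous e2})
  (Dq : forall x, der_at x q (e1 x * f1 x)) (e2_gt0 : forall x, 0 < e2 x)
  (f2_sign : forall x, x != 0 -> 0 < x * f2 x)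
  (u_gt0 : 0 < u) (k_lt0 : k < 0) (Nk : tangent_gap f f1 u k = 0)
  (Nlt : forall v, v < k -> tangent_gap f f1 u v < 0)
  (Ngt : forall v, k < v -> v != u -> 0 < tangent_gap f f1 u v)
  (kuR : k <= uR) (uRu : uR < u) (M_gt0 : 0 < M) (uM : - M <= u <= M)
  (uRM : - M <= uR <= M) (eps_gt0 : 0 < eps).
Implicit Types b v w x s rho : R.
Local Notation N := (tangent_gap f f1).
Local Notation S := (slope f).
Local Notation E := (shock_entropy f eta q).
Local Notation rele := (rel_eta eta e1).
Local Notation relq := (rel_flux f e1 q).

Let f1c x : {for x, continuous f1} := der_continuous (Df1 x).
Let e1c x : {for x, continuous e1} := der_continuous (De1 x).

Lemma continuous_lt_ball (g : R -> R) (c x : R) : {for x, continuous g} -> g x < c ->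
  exists rho : R, 0 < rho /\ forall y, `|y - x| <= rho -> g y < c.
Proof.
move=> cg gc; have /(_ (nbhs_filter x))/nbhs_ballP[d /= d0 H] := cvgr_lt (g x) cg c gc.
 exists (d / 2); split; first by rewrite divr_gt0.
move=> y yx; apply: H; rewrite /ball /= distrC (le_lt_trans yx)//.
by rewrite ltr_pdivrMr// ltr_pMr ?ltr1n.
Qed.

(** The derivative in the first argument, (e1 x - e1 uR) (f1 x - f1 u), is negative on ]uR, u[
    because uR >= k. The strict sign is the margin that allows a velocity slower than f1 u. *)
Lemma dissipation_at_u : relq u uR - f1 u * rele u uR < 0.
Proof.
have E0 : 0 = relq uR uR - f1 u * rele uR uR by rewrite /rel_flux /rel_eta; ring.
rewrite [ltRHS]E0.
apply: (decr_der (f := fun w => relq w uR - f1 u * rele w uR) uRu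
  (fun x _ => der_rel Df De Dq uR (f1 u) x)) => x /andP[ux xu].
rewrite pmulr_rlt0 ?subr_gt0; last exact: (e1_incr De1 e2_gt0).
rewrite subr_lt0; apply: (f1_lt_u Df Df1 f2_sign u_gt0 k_lt0 Nk) => //.
exact: ltW (le_lt_trans kuR ux).
Qed.

Lemma slow_speed : exists V0 mu rho : R, [/\ 0 < mu /\ V0 = f1 u - mu, 0 < rho,
  rho <= u / 2 /\ rho <= u - uR,
  (forall x, `|x - u| <= rho -> f1 u - mu / 2 <= f1 x) &
  (forall x, `|x - u| <= rho -> relq x uR - V0 * rele x uR <= 0)].
Proof.
have d0 := dissipation_at_u; set d := _ - _ in d0.
have H0 : 0 < rele u uR by apply: (rel_eta_gt0 De De1) => //; rewrite gt_eqF.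
(* With this choice exactly half of the margin remains: the dissipation at u for the speed V0 is d /
   2. *)
pose mu : R := - d / 2 / rele u uR.
have mu0 : 0 < mu by rewrite !divr_gt0// oppr_gt0.
pose V0 : R := f1 u - mu.
have V0d : relq u uR - V0 * rele u uR < 0.
  rewrite (_ : _ - _ = d + mu * rele u uR); last by rewrite /d /V0; ring.
  by rewrite /mu divfK ?gt_eqF//; lra.
have h1 : - f1 u < - (f1 u - mu / 2) by lra.
have [r1 [r10 H1]] := @continuous_lt_ball (fun x => - f1 x) (- (f1 u - mu / 2)) u
  (der_continuous (derN (Df1 u))) h1.
have [r2 [r20 H2]] := continuous_lt_ball (der_continuous (der_rel Df De Dq uR V0 u)) V0d.
exists V0, mu, (Num.min (Num.min r1 r2) (Num.min (u / 2) (u - uR))); split => //.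
- by rewrite !lt_min r10 r20 divr_gt0//= subr_gt0.
- by rewrite !ge_min !lexx !orbT.
- by move=> x; rewrite !le_min => /andP[/andP[xr _] _]; rewrite -lerN2; apply: ltW; exact: H1.
- by move=> x; rewrite !le_min => /andP[/andP[_ xr] _]; apply: ltW; exact: H2.
Qed.

Section rho_fixed.
Variable rho : R.
Hypotheses (rho_gt0 : 0 < rho) (rho_u : rho <= u / 2) (rho_uR : rho <= u - uR).

(** The working interval [a, c_u] contains - M, k and the states within rho of u, on whichever side
    of - M the point k lies. *)
Let a : R := k - M.
Let c_u : R := u + rho.
Let L0 : R := c_u - a.
Let aM : a <= - M. Proof. by rewrite /a; move: k_lt0; lra. Qed.
Let ak : a < k. Proof. by rewrite /a; move: M_gt0; lra. Qed.
Let au : a < u. Proof. by rewrite (lt_trans ak)// (lt_trans k_lt0). Qed.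
Let acu : a <= u <= c_u. Proof. by rewrite ltW//= lerDl ltW. Qed.

(** At its zero k the gap has the positive derivative - f''(k) (u - k). That derivative is bounded
    below on [a, k / 2]; on [k / 2, u - rho] the gap itself is bounded below, which is linear growth
    after division by u - k. *)
Lemma tangent_gap_linear : exists c : R, [/\ 0 < c,
  (forall w, a <= w <= k -> N u w <= - (c * (k - w))) &
  (forall w, k <= w <= u - rho -> c * (w - k) <= N u w)].
Proof.
have cN2 x : {for x, continuous (fun w => - f2 w * (u - w))}.
  apply: continuousM; first exact: continuousN.
  by apply: continuousB; [exact: cst_continuous|exact: cvg_id].
have [|c0 [c00 H0]] := @continuous_seg_pos _ (fun w => - f2 w * (u - w)) a (k / 2) (fun x _ => cN2 x).
  move=> x /andP[_ xk]; have x0 : x < 0 by rewrite (le_lt_trans xk)//; move: k_lt0; lra.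
  by rewrite mulr_gt0 ?subr_gt0 ?(lt_trans x0)// oppr_gt0; have := f2_sign (ltr0_neq0 x0);
    rewrite nmulr_rgt0.
have [|n0 [n00 H1]] := @continuous_seg_pos _ (N u) (k / 2) (u - rho)
   (fun x _ => der_continuous (der_tangent_gap Df Df1 u x)).
  move=> x /andP[kx xu]; apply: Ngt; first by move: k_lt0; lra.
  by rewrite lt_eqF//; move: rho_gt0; lra.
have uk : 0 < u - k by move: u_gt0 k_lt0; lra.
have Dg w : der_at w (fun w => N u w - c0 * w) (- f2 w * (u - w) - c0).
  apply: der_eq; first by apply: derB; [exact: der_tangent_gap|der_tac].
  by rewrite mulr1.
exists (Num.min c0 (n0 / (u - k))); split.
- by rewrite lt_min c00 divr_gt0.
- move=> w /andP[aw wk].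
  have : N u w - c0 * w <= N u k - c0 * k.
    apply: (nondecr_der wk (fun x _ => Dg x)) => x /andP[wx xk].
    by rewrite subr_ge0 H0//; apply/andP; split; move: k_lt0; lra.
  rewrite Nk => h; have : Num.min c0 (n0 / (u - k)) * (k - w) <= c0 * (k - w).
    by rewrite ler_wpM2r ?subr_ge0// ge_min lexx.
  lra.
- move=> w /andP[kw wu]; have [wk2|wk2] := leP w (k / 2).
    have : N u k - c0 * k <= N u w - c0 * w.
      apply: (nondecr_der kw (fun x _ => Dg x)) => x /andP[kx xw].
      by rewrite subr_ge0 H0//; apply/andP; split; [move: ak|]; lra.
    rewrite Nk => h; have : Num.min c0 (n0 / (u - k)) * (w - k) <= c0 * (w - k).
      by rewrite ler_wpM2r ?subr_ge0// ge_min lexx.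
    lra.
  apply: (@le_trans _ _ n0); last by apply: H1; rewrite ltW.
  apply: (@le_trans _ _ (n0 / (u - k) * (w - k))).
    by rewrite ler_wpM2r ?subr_ge0// ge_min lexx orbT.
  by rewrite mulrAC ler_pdivrMr// ler_wpM2l ?ltW//; move: rho_gt0; lra.
Qed.

(** Moving the base point from u to b, at distance d, changes the tangent gap by O(d). On
    [k, u - rho] the derivative of the slope is thus at least c' (x - k) - C' d: it can be negative
    only at distance O(d) from k, and the total loss is O(d^2). To the left of k the argument is the
    same with the signs reversed. *)
Lemma slope_almost_monotone : exists C : R, 0 < C /\ forall b, `|b - u| <= rho / 2 ->
  (forall v w, k <= v -> v <= w -> w <= u - rho -> S b v <= S b w + C * (b - u) ^+ 2) /\
  (forall w, a <= w -> w <= k -> S b k <= S b w + C * (b - u) ^+ 2).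
Proof.
have [c [c0 HN1 HN2]] := tangent_gap_linear.
have [A [A0 [HA1 HA]]] := @lipschitz_seg _ f f1 a c_u Df f1c.
have L00 : 0 < L0 by rewrite /L0 /c_u; move: au rho_gt0; lra.
pose c' : R := c / L0 ^+ 2.
pose C' : R := (A + A) / (rho / 2) ^+ 2.
have c'0 : 0 < c' by rewrite divr_gt0// exprn_gt0.
have rho2 : 0 < rho / 2 by rewrite divr_gt0.
have C'0 : 0 < C' by rewrite divr_gt0 ?exprn_gt0 ?addr_gt0.
exists (C' ^+ 2 / (2 * c')); split.
  by apply: divr_gt0; [exact: exprn_gt0|exact: mulr_gt0].
move=> b bu; set d := `|b - u|.
have d0 : 0 <= d by exact: normr_ge0.
have -> : (b - u) ^+ 2 = d ^+ 2 by rewrite /d real_normK ?num_real.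
have bcu : a <= b <= c_u.
  move: bu; rewrite ler_norml => /andP[h1 h2]; rewrite /c_u; apply/andP; split; last first.
    by move: rho_gt0; lra.
  by apply: ltW; apply: (lt_trans ak); move: k_lt0 u_gt0 rho_u rho_gt0; lra.
have dN w : a <= w <= c_u -> `|N b w - N u w| <= (A + A) * d.
  move=> wa; rewrite /tangent_gap.
  have -> : f b - f w - f1 w * (b - w) - (f u - f w - f1 w * (u - w)) =
     (f b - f u) - f1 w * (b - u) by ring.
  rewrite (le_trans (ler_normB _ _))// mulrDl lerD ?HA// normrM ler_wpM2r//.
  exact: HA1.
have bw w : a <= w -> w <= u - rho -> rho / 2 <= b - w /\ b - w <= L0.
  move=> aw wu; move: bu bcu; rewrite ler_norml /L0 => /andP[? ?] /andP[? ?]; split; lra.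
have wb w : w <= u - rho -> w != b.
  by move=> wu; rewrite lt_eqF//; move: bu rho_gt0; rewrite ler_norml => /andP[? ?]; lra.
(* Completing the square: the constant C'^2 / (2 c') is the price for absorbing C' d y into (c' / 2)
   y^2. *)
have quad y : 0 <= c' / 2 * y ^+ 2 - C' * d * y + C' ^+ 2 / (2 * c') * d ^+ 2.
  have -> : c' / 2 * y ^+ 2 - C' * d * y + C' ^+ 2 / (2 * c') * d ^+ 2 =
    (c' * y - C' * d) ^+ 2 / (2 * c') by field; rewrite gt_eqF.
  by rewrite divr_ge0 ?sqr_ge0// mulr_ge0// ltW.
have sq_ge x y : 0 <= x -> x <= y -> x ^+ 2 <= y ^+ 2.
  by move=> x0 xy; rewrite ler_pXn2r ?nnegrE// (le_trans x0).
split.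
- move=> v w kv vw wu.
  pose g (x : R) := S b x - c' / 2 * (x - k) ^+ 2 + C' * d * x.
  have : g v <= g w.
    apply: (nondecr_der (df := fun x => N b x / (b - x) ^+ 2 - c' * (x - k) + C' * d) vw).
      move=> x /andP[vx xw]; rewrite /g.
      under eq_fun do rewrite expr2.
      apply: der_eq.
        apply: derD; last by der_tac.
        apply: derB; first by apply: (der_slope Df); rewrite wb// (le_trans xw).
        by der_tac.
      by rewrite /=; field; rewrite subr_eq0 eq_sym wb// (le_trans xw).
    move=> x /andP[vx xw].
    have kx : k <= x by exact: le_trans (ltW vx).
    have xu : x <= u - rho by exact: le_trans (ltW xw) _.
    have xa : a <= x by exact: le_trans (ltW ak) _.
    have [bw1 bw2] := bw _ xa xu.
    have bx0 : 0 < b - x by exact: lt_le_trans bw1.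
    have Nb : c * (x - k) - (A + A) * d <= N b x.
      have := HN2 x; rewrite kx xu => /(_ isT) h1.
      have := dN x; rewrite xa /= => /(_ _)/wrap[]; first by rewrite /c_u; move: rho_gt0; lra.
      rewrite ler_norml => /andP[h2 _]; lra.
    have h1 : c' * (x - k) <= c * (x - k) / (b - x) ^+ 2.
      rewrite /c' mulrAC ler_wpM2l ?mulr_ge0 ?subr_ge0 ?(ltW c0)//.
      by rewrite lef_pV2 ?posrE ?exprn_gt0// sq_ge// ltW.
    have h2 : (A + A) * d / (b - x) ^+ 2 <= C' * d.
      rewrite /C' [leRHS]mulrAC ler_wpM2l ?mulr_ge0 ?addr_ge0 ?(ltW A0)//.
      by rewrite lef_pV2 ?posrE ?exprn_gt0// sq_ge// ltW.
    have h3 : (c * (x - k) - (A + A) * d) / (b - x) ^+ 2 <= N b x / (b - x) ^+ 2.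
      by rewrite ler_pM2r// invr_gt0 exprn_gt0.
    by rewrite mulrBl in h3; lra.
  rewrite /g => gvw; have := quad (w - v).
  have : (w - v) ^+ 2 <= (w - k) ^+ 2 - (v - k) ^+ 2.
    rewrite -subr_ge0 (_ : _ - _ = 2 * ((w - v) * (v - k))); last by ring.
    by rewrite !mulr_ge0 ?subr_ge0.
  move=> h4 h5; have := ler_wpM2l (ltW (divr_gt0 c'0 (ltr0Sn R 1))) h4.
  by rewrite mulrBr; lra.
- move=> w aw wk.
  pose g (x : R) := S b x - c' / 2 * (x - k) ^+ 2 - C' * d * x.
  have ku : k <= u - rho by move: rho_u k_lt0 u_gt0; lra.
  have : g k <= g w.
    apply: (nonincr_der (df := fun x => N b x / (b - x) ^+ 2 - c' * (x - k) - C' * d) wk).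
      move=> x /andP[vx xw]; rewrite /g.
      under eq_fun do rewrite expr2.
      apply: der_eq.
        apply: derB; last by der_tac.
        apply: derB; first by apply: (der_slope Df); rewrite wb// (le_trans xw).
        by der_tac.
      by rewrite /=; field; rewrite subr_eq0 eq_sym wb// (le_trans xw).
    move=> x /andP[wx xk].
    have xu : x <= u - rho by exact: le_trans (ltW xk) _.
    have xa : a <= x by exact: le_trans (ltW wx).
    have [bw1 bw2] := bw _ xa xu.
    have bx0 : 0 < b - x by exact: lt_le_trans bw1.
    have Nb : N b x <= - (c * (k - x)) + (A + A) * d.
      have := HN1 x; rewrite xa (ltW xk) => /(_ isT) h1.
      have := dN x; rewrite xa /= => /(_ _)/wrap[]; first by rewrite /c_u; move: rho_gt0; lra.
      rewrite ler_norml => /andP[_ h2]; lra.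
    have h1 : c' * (k - x) <= c * (k - x) / (b - x) ^+ 2.
      rewrite /c' mulrAC ler_wpM2l ?mulr_ge0 ?subr_ge0 ?(ltW c0) ?(ltW xk)//.
      by rewrite lef_pV2 ?posrE ?exprn_gt0// sq_ge// ltW.
    have h2 : (A + A) * d / (b - x) ^+ 2 <= C' * d.
      rewrite /C' [leRHS]mulrAC ler_wpM2l ?mulr_ge0 ?addr_ge0 ?(ltW A0)//.
      by rewrite lef_pV2 ?posrE ?exprn_gt0// sq_ge// ltW.
    have h3 : N b x / (b - x) ^+ 2 <= (- (c * (k - x)) + (A + A) * d) / (b - x) ^+ 2.
      by rewrite ler_pM2r// invr_gt0 exprn_gt0.
    by move: h3; rewrite [leRHS]mulrDl mulNr => h3; lra.
  rewrite /g subrr expr0n mulr0 subr0 => gvw; have := quad (k - w).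
  by rewrite -(sqrrN (k - w)) opprB; lra.
Qed.

(** The line through (b, f b) and (x, f x) stays, up to O((b - u)^2), below the graph on [uR, x], or
    above it on [x, uR], because slopes from b are almost monotone; [rel_chord_right] and
    [rel_chord_left] integrate this. For x < k monotonicity is reversed, and the extra assumption,
    which the Kruzkov inequality at k supplies, bridges the gap through S b k. *)
Lemma rel_dissipation_quadratic : exists C : R, 0 < C /\
  forall b x, `|b - u| <= rho / 2 -> - M <= x <= u - rho ->
  (x < k -> S b x <= S b k) ->
  relq x uR - S b x * rele x uR <= C * (b - u) ^+ 2.
Proof.
have [C2 [C20 HS]] := slope_almost_monotone.
have [B [B0 HB]] := continuous_seg_bounded a c_u e1c.
have L00 : 0 < L0 by rewrite /L0 /c_u; move: au rho_gt0; lra.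
exists (L0 * C2 * (B + B)); split; first by rewrite !mulr_gt0// addr_gt0.
move=> b x bu /andP[Mx xu] xk; have [S1 S2] := HS b bu.
have ax : a <= x by exact: le_trans Mx.
set Q := (b - u) ^+ 2; have Q0 : 0 <= Q by exact: sqr_ge0.
have CQ0 : 0 <= C2 * Q by rewrite mulr_ge0// ltW.
have uRu' : uR <= u - rho by move: rho_uR; lra.
have eB v w : a <= v <= c_u -> a <= w <= c_u -> e1 v - e1 w <= B + B.
  move=> /HB + /HB; rewrite !ler_norml => /andP[? ?] /andP[? ?]; lra.
have xcu : a <= x <= c_u by rewrite ax /= /c_u; move: rho_gt0; lra.
have uRcu : a <= uR <= c_u.
  by rewrite (le_trans (ltW ak) kuR) /= /c_u; move: rho_gt0 uRu; lra.
have bw w : a <= w -> w <= u - rho -> 0 < b - w /\ b - w <= L0.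
  move=> aw wu; move: bu; rewrite ler_norml /L0 /c_u => /andP[? ?].
  by split; move: rho_gt0; lra.
have [bx0 _] := bw _ ax xu.
(* The vertical distance between the line and the graph at v is a difference of two slopes issued
   from b. *)
have chord v : a <= v -> v <= u - rho ->
  f x + S b x * (v - x) - f v = (b - v) * (S b v - S b x).
  move=> av vu; have [bv0 _] := bw _ av vu.
  by rewrite /slope; field; rewrite !gt_eqF.
have bound v t : a <= v -> v <= u - rho -> t <= C2 * Q -> (b - v) * t <= L0 * (C2 * Q).
  move=> av vu tC; have [bv0 bvL] := bw _ av vu.
  apply: (@le_trans _ _ ((b - v) * (C2 * Q))); first by rewrite ler_wpM2l// ltW.
  by rewrite ler_wpM2r.
have LQ0 : 0 <= L0 * (C2 * Q) by rewrite mulr_ge0// ltW.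
have -> : L0 * C2 * (B + B) * Q = L0 * (C2 * Q) * (B + B) by ring.
have [uRx|xuR] := leP uR x.
  apply: (le_trans (rel_chord_right Df De De1 Dq e2_gt0 (s := S b x) (B := L0 * (C2 * Q)) uRx _)).
    move=> v /andP[uv vx]; have kv : k <= v by exact: le_trans kuR _.
    have av : a <= v by exact: le_trans (ltW ak) kv.
    rewrite chord//; last exact: le_trans xu.
    apply: bound => //; first exact: le_trans xu.
    by have := S1 v x kv vx xu; rewrite -/Q; lra.
  by rewrite ler_wpM2l// eB.
have {xuR}xuR := ltW xuR.
apply: (le_trans (rel_chord_left Df De De1 Dq e2_gt0 (s := S b x) (B := L0 * (C2 * Q)) xuR _)).
  move=> v /andP[xv vuR].
  have av : a <= v by exact: le_trans ax xv.
  have vu : v <= u - rho by exact: le_trans uRu'.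
  rewrite -[leLHS]opprB chord// -mulrN opprB; apply: bound => //.
  have [kx|{}/xk Sxk] := leP k x; first by have := S1 x v kx xv vu; rewrite -/Q; lra.
  have [kv|/ltW vk] := leP k v; first by have := S1 k v (lexx k) kv vu; rewrite -/Q; lra.
  by have := S2 v av vk; rewrite -/Q; lra.
by rewrite ler_wpM2l// eB.
Qed.

End rho_fixed.

(** When k separates the two states, the inequality for eta_k says that (k, f k) lies on or below
    the chord of the jump: it is the Oleinik condition at the single intermediate value k. *)
Lemma kruzkov_slope um up s : up < k -> k < um -> f um - f up = s * (um - up) ->
  kruzkov_flux f k up - kruzkov_flux f k um
    - s * (kruzkov_entropy k up - kruzkov_entropy k um) <= 0 ->
  s <= S um k.
Proof.
move=> upk kum RH; rewrite /kruzkov_flux /kruzkov_entropy.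
rewrite (ltr0_sg (_ : up - k < 0)) ?(gtr0_sg (_ : 0 < um - k)) ?subr_gt0 ?subr_lt0//.
rewrite (ltr0_norm (_ : up - k < 0)) ?(gtr0_norm (_ : 0 < um - k)) ?subr_gt0 ?subr_lt0//.
have -> : f up = f um - s * (um - up) by rewrite -RH; ring.
move=> H; rewrite /slope ler_pdivlMr ?subr_gt0//; lra.
Qed.

(** A Lipschitz profile: V0 within distance r of u, - L beyond 2 r, affine in |x - u| in between. *)
Definition velocity (V0 L r x : R) : R :=
  V0 - (L + V0) * Num.max 0 (Num.min 1 ((`|x - u| - r) / r)).

Lemma velocity_lipschitz (V0 L r : R) : 0 <= L + V0 -> 0 < r ->
  forall x y, `|velocity V0 L r x - velocity V0 L r y| <= (L + V0) / r * `|x - y|.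
Proof.
move=> LV r0 x y; rewrite /velocity.
have clamp s t : `|Num.max 0 (Num.min 1 s) - Num.max 0 (Num.min 1 t)| <= `|s - t| :> R.
  exact: le_trans (dist_max _ _ _) (dist_min _ _ _).
set A := Num.max _ _; set B := Num.max _ _.
have -> : V0 - (L + V0) * A - (V0 - (L + V0) * B) = (L + V0) * (B - A) by ring.
rewrite normrM ger0_norm// -mulrA ler_wpM2l// distrC.
apply: le_trans (clamp _ _) _.
have -> : (`|x - u| - r) / r - (`|y - u| - r) / r = r^-1 * (`|x - u| - `|y - u|) by ring.
rewrite normrM gtr0_norm ?invr_gt0// ler_pM2l ?invr_gt0//.
apply: le_trans (ler_dist_dist _ _) _.
by rewrite (_ : x - u - (y - u) = x - y)//; ring.
Qed.

Lemma velocity_near (V0 L r x : R) : 0 < r -> `|x - u| <= r -> velocity V0 L r x = V0.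
Proof.
move=> r0 xr; rewrite /velocity (max_idPl _) ?mulr0 ?subr0// ge_min.
by rewrite ler_pdivrMr// mul0r subr_le0 xr orbT.
Qed.

Lemma velocity_far (V0 L r x : R) : 0 < r -> 2 * r <= `|x - u| -> velocity V0 L r x = - L.
Proof.
move=> r0 xr; rewrite /velocity min_l; last by rewrite ler_pdivlMr//; lra.
by rewrite max_r//; ring.
Qed.

Lemma velocity_range (V0 L r x : R) : 0 <= L + V0 -> 0 < r ->
  - L <= velocity V0 L r x <= V0.
Proof.
move=> LV r0; rewrite /velocity; set m := Num.max _ _.
have m0 : 0 <= m by rewrite le_max lexx.
have m1 : m <= 1 by rewrite ge_max ler01 ge_min lexx.
have h1 : 0 <= (L + V0) * m by rewrite mulr_ge0.
have h2 : (L + V0) * m <= L + V0 by rewrite ler_piMr.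
by apply/andP; split; lra.
Qed.

(* One velocity serves every small weight [a]: near [u] it is slower than
   [f1 u], which makes the left part dissipative, and faster than the speed at
   which the right part would grow at [u]; far from [u] it is slower than every
   characteristic. *)
Lemma contracting_velocity : exists (V : R -> R) (K L astar : R),
  [/\ forall x y, `|V x - V y| <= K * `|x - y|,
      (forall x, `|V x| <= L) /\ 0 < L,
      (forall x, - M <= x <= M -> `|f1 x| <= L),
      0 < astar < 1 &
  forall um up s a : R, - M <= um <= M -> - M <= up <= M ->
    Num.min (V um) (V up) <= s <= Num.max (V um) (V up) ->
    f um - f up = s * (um - up) ->
    q up - q um - s * (eta up - eta um) <= 0 ->
    kruzkov_flux f k up - kruzkov_flux f k um
      - s * (kruzkov_entropy k up - kruzkov_entropy k um) <= 0 ->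
    ~ (`|phi_flat0 f eta q u - um| < eps /\ `|u - up| < eps) ->
    0 < a < astar ->
    s * rele um u - relq um u + a * (relq up uR - s * rele up uR) <= 0].
Proof.
have [V0 [mu [rho [[mu0 V0E] rho0 [rhou rhouR] Hf1 HDp]]]] := slow_speed.
have [C1 [C10 HB1]] := rel_dissipation_quadratic rho0 rhou rhouR.
have [cE [rE [cE0 rE0 HE]]] := shock_entropy_away Df Df1 De De1 Dq e2_gt0
  u_gt0 k_lt0 Nlt Ngt M rho0 eps_gt0.
have [A [A0 [HA1 HA]]] := @lipschitz_seg _ f f1 (- M) M Df f1c.
have [cz [cz0 Hcz]] : exists B : R, 0 < B /\ forall x, - M <= x <= M -> B <= e2 x.
  by apply: continuous_seg_pos => x _; [exact: ce2|exact: e2_gt0].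
(* A bounds |f1| on [- M, M], so the speed - L is strictly slower than every characteristic and
   every chord with ends in [- M, M]. *)
pose L : R := A + 1 + `|V0|.
have nV := normr_ge0 V0; have nV1 := ler_norm V0.
have nV2 : - V0 <= `|V0| by rewrite -normrN ler_norm.
have L0 : 0 < L by rewrite /L; lra.
have LV0 : 0 <= L + V0 by rewrite /L; lra.
(* The velocity leaves the value - L only within 2 r of u. This radius is kept below rho / 2 for the
   quadratic bound, below eps for the excluded pairs, and below rE for the dissipation gap. *)
pose r : R := Num.min (rho / 4) (Num.min (eps / 4) (rE / 2)).
have r0 : 0 < r by rewrite !lt_min !divr_gt0.
have r_rho : 2 * r <= rho / 2 by have : r <= rho / 4; [rewrite ge_min lexx|lra].
have r_eps : 2 * r < eps.
  by have : r <= eps / 4; [rewrite /r !ge_min lexx orbT|move: eps_gt0; lra].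
have r_E : 2 * r <= rE by have : r <= rE / 2; [rewrite /r !ge_min lexx !orbT|lra].
have r2rho : 2 * r <= rho by lra.
have rrho : r <= rho by lra.
have AL : A < L by rewrite /L; lra.
have V0mu : V0 < f1 u - mu / 2 by rewrite V0E; lra.
have near_pos v : `|v - u| <= rho -> [/\ 0 <= v, k < v & v <= u + rho].
  have u_rho : 0 < u - rho.
    by rewrite subr_gt0 (le_lt_trans rhou)// ltr_pdivrMr// ltr_pMr// ltr1n.
  rewrite ler_distl => /andP[h1 h2]; split => //; first exact: le_trans (ltW u_rho) h1.
  exact: lt_le_trans (lt_trans k_lt0 u_rho) h1.
have away v : rho < `|v - u| -> v <= u - rho \/ u + rho < v.
  by rewrite lter_normr => /orP[?|?]; [right|left]; lra.
have crele x : {for x, continuous (fun w => rele w uR)}.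
  apply: der_continuous; rewrite /rel_eta.
  by apply: derB; [by der_tac|by der_tac].
have crelq x : {for x, continuous (fun w => relq w uR)}.
  apply: der_continuous; rewrite /rel_flux.
  by apply: derB; [by der_tac|by der_tac].
have [B1 [B10 HB1']] := continuous_seg_bounded (- M) M crele.
have [B2 [B20 HB2']] := continuous_seg_bounded (- M) M crelq.
pose Cp : R := B2 + L * B1.
have Cp0 : 0 < Cp by rewrite addr_gt0// mulr_gt0.
have HCp s w : - M <= w <= M -> `|s| <= L -> relq w uR - s * rele w uR <= Cp.
  move=> wM sL; rewrite (le_trans (ler_norm _))// (le_trans (ler_normB _ _))// lerD ?HB2'//.
  by rewrite normrM ler_pM ?HB1'.
have quad v : - M <= v <= M -> cz / 2 * (v - u) ^+ 2 <= rele v u.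
  move=> vM; have [e2M [_ He2M]] := continuous_seg_bounded (- M) M ce2.
  have hb x : - M <= x <= M -> cz <= e2 x <= e2M.
    by move=> xM; rewrite Hcz//= (le_trans (ler_norm _))// He2M.
  by have /andP[] := rel_eta_bounds De De1 hb vM uM.
have rele0 v : 0 <= rele v u by exact: (rel_eta_ge0 De De1).
have near_u s v : - M <= v <= M -> `|v - u| <= rho -> s <= V0 ->
    s * rele v u - relq v u <= - (mu / 2 * (cz / 2 * (v - u) ^+ 2)).
  move=> vM vu sV0.
  have h : (f1 u - mu / 2) * rele v u <= relq v u.
    apply: (rel_flux_ge Df De De1 Dq e2_gt0) => w wvu; apply: Hf1.
    by apply: (between_ball vu _ wvu); rewrite subrr normr0 ltW.
  have h2 : s * rele v u <= V0 * rele v u by rewrite ler_wpM2r.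
  have h3 := ler_wpM2l (ltW (divr_gt0 mu0 (ltr0Sn R 1))) (quad v vM).
  by move: h2; rewrite V0E; lra.
have quad0 v : 0 <= mu / 2 * (cz / 2 * (v - u) ^+ 2).
  apply: mulr_ge0; first exact/ltW/divr_gt0.
  by apply: mulr_ge0; [exact/ltW/divr_gt0|exact: sqr_ge0].
have far_u v : - M <= v <= M -> - L * rele v u - relq v u <= - (cz / 2 * (v - u) ^+ 2).
  move=> vM.
  have h : - A * rele v u <= relq v u.
    apply: (rel_flux_ge Df De De1 Dq e2_gt0) => w wvu.
    have := between_itv vM uM wvu.
    by move=> /HA1; rewrite ler_norml => /andP[].
  have h2 := quad v vM; have h3 := rele0 v.
  have h4 : 0 <= `|V0| * rele v u by rewrite mulr_ge0.
  rewrite /L; lra.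
pose V := velocity V0 L r.
have Vle x : V x <= V0 by have /andP[] := velocity_range x LV0 r0.
have Vge x : - L <= V x by have /andP[] := velocity_range x LV0 r0.
have V0L : V0 <= L by rewrite /L; lra.
have VL x : `|V x| <= L by rewrite ler_norml Vge (le_trans (Vle x)).
pose cz2 : R := cz / 2.
have cz20 : 0 < cz2 by rewrite divr_gt0.
pose c1 : R := Num.min (mu / 2) 1 * (cz2 * r ^+ 2).
have m1 : 0 < Num.min (mu / 2) 1 by rewrite lt_min divr_gt0 ?ltr01.
have c10 : 0 < c1 by rewrite mulr_gt0// mulr_gt0// exprn_gt0.
(* One bound per case: c1 / Cp when there is no jump and the common trace is outside the ball of
   radius r, the third when u_- is near u, cE / Cp when u_+ is near u. The bound 1 / 2 ensures that
   [astar] < 1. *)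
pose astar : R := Num.min (1 / 2) (Num.min (c1 / Cp) (Num.min (mu / 2 * cz2 / C1) (cE / Cp))).
have as0 : 0 < astar.
  by rewrite !lt_min !divr_gt0// ?mulr_gt0// divr_gt0.
exists V, ((L + V0) / r), L, astar; split.
- exact: velocity_lipschitz.
- by [].
- by move=> x xM; exact: le_trans (HA1 _ xM) (ltW AL).
- by rewrite as0 /= (@le_lt_trans _ _ (1 / 2))//; [rewrite ge_min lexx|rewrite ltr_pdivrMr// mul1r ltr1n].
move=> um up s a umM upM sV RH Ee Ek Hphi /andP[a0 aas].
have a1 : a <= c1 / Cp by rewrite (le_trans (ltW aas))// /astar !ge_min lexx !orbT.
have a2 : a <= mu / 2 * cz2 / C1 by rewrite (le_trans (ltW aas))// /astar !ge_min lexx !orbT.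
have a3 : a <= cE / Cp by rewrite (le_trans (ltW aas))// /astar !ge_min lexx !orbT.
have sV0 : s <= V0 by case/andP: sV => _ h; rewrite (le_trans h)// ge_max !Vle.
have sL : `|s| <= L.
  rewrite ler_norml (le_trans sV0)//andbT; case/andP: sV => h _.
  by rewrite (le_trans _ h)// le_min !Vge.
have Dp w : - M <= w <= M -> a * (relq w uR - s * rele w uR) <= a * Cp.
  by move=> wM; rewrite ler_pM2l// HCp.
have aC1 : a * Cp <= c1 by rewrite -ler_pdivlMr.
have aC3 : a * Cp <= cE by rewrite -ler_pdivlMr.
have sq_ge x y : 0 <= x -> x <= y -> x ^+ 2 <= y ^+ 2 :> R.
  by move=> x0 xy; rewrite ler_pXn2r ?nnegrE// (le_trans x0).
have [E0|umup] := eqVneq um up.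
  move: sV upM {RH Ee Ek Hphi}; rewrite -E0 minxx maxxx => /andP[h1 h2] _.
  have sE : s = V um by apply/eqP; rewrite eq_le h1 h2.
  (* No jump. Within r of u the speed is V0 and both parts are nonpositive; farther away the left
     part alone gains c1. *)
  have [umr|umr] := leP `|um - u| r.
    have sV0' : s = V0 by rewrite sE; exact: velocity_near.
    have umrho : `|um - u| <= rho by exact: le_trans umr rrho.
    have g1 := near_u s um umM umrho sV0; have g2 := HDp um umrho; rewrite -sV0' in g2.
    rewrite -[leRHS]addr0; apply: lerD; last by rewrite pmulr_rle0.
    by apply: le_trans g1 _; rewrite oppr_le0.
  have hr : cz2 * r ^+ 2 <= cz2 * (um - u) ^+ 2.
    by rewrite ler_pM2l// -[leRHS]real_normK ?num_real// sq_ge// ltW.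
  have hr0 : 0 <= cz2 * r ^+ 2 by rewrite mulr_ge0 ?sqr_ge0// ltW.
  have hD := Dp um umM.
  suff h : s * rele um u - relq um u <= - c1.
    by rewrite -(addNr c1); exact: lerD h (le_trans hD aC1).
  have [umr2|umr2] := leP `|um - u| rho.
    apply: le_trans (near_u _ _ umM umr2 sV0) _; rewrite lerN2 /c1 ler_pM//.
    - exact: ltW.
    - by rewrite ge_min lexx.
  have -> : s = - L by rewrite sE; apply: velocity_far => //; rewrite ltW// (le_lt_trans r2rho umr2).
  apply: le_trans (far_u _ umM) _; rewrite lerN2 /c1 (le_trans _ hr)//.
  by rewrite ler_piMl// ge_min lexx orbT.
have sS : s = S um up by rewrite /slope RH mulfK// subr_eq0.
have S_f1 : exists c : R, Num.min um up < c < Num.max um up /\ s = f1 c.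
  rewrite sS; case: (ltgtP um up) umup => // h _.
    exact: (slope_f1 Df).
  by rewrite slopeC; exact: (slope_f1 Df).
have [c [cI sc]] := S_f1.
have sA : `|s| <= A.
  by rewrite sc HA1//; exact: between_itv umM upM (ltW_between cI).
(* Two traces near u would make the shock speed a value of f1 near u, at least f1 u - mu / 2, hence
   larger than V0. *)
have notboth : ~ (`|um - u| <= rho /\ `|up - u| <= rho).
  move=> [h1 h2]; have : f1 u - mu / 2 <= s.
    by rewrite sc; apply: Hf1; exact: between_ball h1 h2 (ltW_between cI).
  by move=> h; have := le_lt_trans (le_trans h sV0) V0mu; rewrite ltxx.
(* f1 increases to the right of 0. If the mean value point c were to the right of a state near u,
   the shock would again be faster than V0; so the other trace lies to the left. *)
have fast v : `|v - u| <= rho -> v < c -> False.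
  move=> vrho vc; have := Hf1 v vrho.
  have : f1 v < f1 c.
    apply: (f1_incr Df1 f2_sign) => //.
    by have [] := near_pos v vrho.
  rewrite -sc => h1 h2; have := le_lt_trans h2 (lt_le_trans h1 (le_trans sV0 (ltW V0mu))).
  by rewrite ltxx.
have [um2|um2] := ltP `|um - u| (2 * r).
  have umrho : `|um - u| <= rho by rewrite ltW// (lt_le_trans um2).
  have uprho : rho < `|up - u|.
    by rewrite ltNge; apply/negP => h; apply: notboth.
  have upu : up <= u - rho.
    have [//|h] := away up uprho; case: (fast um umrho).
    move: cI; have : um < up by have [_ _ h1] := near_pos um umrho; exact: le_lt_trans h1 h.
    by move=> h2; rewrite min_l ?ltW// => /andP[].
  have h1 := near_u s um umM umrho sV0.
  have h2 : relq up uR - s * rele up uR <= C1 * (um - u) ^+ 2.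
    rewrite sS; apply: HB1; first by rewrite ltW// (lt_le_trans um2).
      by case/andP: upM => ->.
    move=> upk; rewrite -sS; apply: kruzkov_slope RH Ek => //.
    by have [] := near_pos um umrho.
  have h3 : a * (relq up uR - s * rele up uR) <= a * (C1 * (um - u) ^+ 2) by rewrite ler_pM2l.
  have h4 : a * C1 * (um - u) ^+ 2 <= mu / 2 * cz2 * (um - u) ^+ 2.
    by rewrite ler_wpM2r ?sqr_ge0// -ler_pdivlMr.
  apply: le_trans (lerD h1 h3) _; rewrite addrC subr_le0 mulrA (le_trans h4)//.
  by rewrite -(mulrA (mu / 2)).
(* With both traces at distance at least 2 r from u, the speed would be - L, slower than any
   chord. *)
have [up2|up2] := ltP `|up - u| (2 * r); last first.
  have VumE : V um = - L by exact: velocity_far.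
  have VupE : V up = - L by exact: velocity_far.
  move: sV; rewrite VumE VupE minxx maxxx => /andP[_ h].
  by move: sA; rewrite ler_norml => /andP[h' _]; have := le_trans h' h; rewrite lerN2 leNgt AL.
have uprho : `|up - u| <= rho by rewrite ltW// (lt_le_trans up2).
have umrho : rho < `|um - u| by rewrite ltNge; apply/negP => h; apply: notboth.
have umu : um <= u - rho.
  have [//|h] := away um umrho; case: (fast up uprho).
  move: cI; have : up < um by have [_ _ h1] := near_pos up uprho; exact: le_lt_trans h1 h.
  by move=> h2; rewrite min_r ?ltW// => /andP[].
have uball : `|u - up| < eps by rewrite distrC (lt_trans up2).
have umphi : eps <= `|um - phi_flat0 f eta q u|.
  by rewrite leNgt; apply/negP => h; apply: Hphi; rewrite distrC.
have EE : E um up = q up - q um - s * (eta up - eta um) by rewrite /shock_entropy -sS.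
have := HE um up; rewrite umu umphi EE; case/andP: umM => -> _ /(_ isT isT) h.
have {}h := h (ltW (lt_le_trans up2 r_E)) Ee.
have h1 := near_u s up upM uprho sV0.
(* The left part at u_- equals the left part at u_+, which is nonpositive since u_+ is near u, plus
   the entropy dissipation, at most - cE. *)
have h2 := rel_jump eta e1 q u RH.
have h3 := Dp up upM.
rewrite -opprB -[X in - X + _](addrK (q up - q um - s * (eta up - eta um))) -h2 opprB opprB.
rewrite -[leRHS](addNr cE); apply: lerD (le_trans h3 aC3).
rewrite -[leRHS]addr0; apply: lerD h _; apply: le_trans h1 _.
by rewrite oppr_le0.
Qed.

End admissible_velocity.

(** * Smooth cutoffs *)

Section smooth_functions.
Context {R : realType}.
Implicit Types (f g : R -> R) (x : R) (n m : nat).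

Fixpoint Cn n f : Prop :=
  if n is m.+1 then (forall x, derivable f x 1) /\ Cn m (derive1 f)
  else continuous f.

Definition smooth f : Prop := forall n, Cn n f.

Lemma der_at_derivable x f d : der_at x f d -> derivable f x 1.
Proof. by case. Qed.

Lemma der_at_derive1 x f d : der_at x f d -> derive1 f x = d.
Proof. by case/der_atP. Qed.

Lemma derivable_der_at x f : derivable f x 1 -> der_at x f (derive1 f x).
Proof. by move=> h; apply/der_atP. Qed.

Lemma Cn_der n f g : (forall x, der_at x f (g x)) -> Cn n g -> Cn n.+1 f.
Proof.
move=> Df Cg; split=> [x|]; first exact: der_at_derivable (Df x).
by rewrite (_ : derive1 f = g)//; apply/funext => x; exact: der_at_derive1.
Qed.

Lemma Cn_continuous n f : Cn n f -> continuous f.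
Proof.
case: n => [//|n] [df _] x; exact: der_continuous (derivable_der_at (df x)).
Qed.

Lemma CnW n f : Cn n.+1 f -> Cn n f.
Proof.
elim: n f => [|n IH] f h; first exact: (Cn_continuous h).
by case: h => df h; split => //; exact: IH.
Qed.

Lemma Cn_cst n (k : R) : Cn n (fun=> k).
Proof.
elim: n k => [|n IH] k; first exact: cst_continuous.
by apply: Cn_der (IH 0) => x; exact: der_cst.
Qed.

Lemma CnD n f g : Cn n f -> Cn n g -> Cn n (fun x => f x + g x).
Proof.
elim: n f g => [|n IH] f g /=.
  by move=> cf cg x; apply: continuousD; [exact: cf|exact: cg].
move=> [df Cf] [dg Cg]; apply: Cn_der (IH _ _ Cf Cg) => x.
by apply: derD; exact: derivable_der_at.
Qed.

Lemma CnM n f g : Cn n f -> Cn n g -> Cn n (fun x => f x * g x).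
Proof.
elim: n f g => [|n IH] f g.
  by move=> cf cg x; apply: continuousM; [exact: cf|exact: cg].
move=> Cf Cg; have [df Cf'] := Cf; have [dg Cg'] := Cg.
apply: (@Cn_der n _ (fun x => derive1 f x * g x + f x * derive1 g x)).
  by move=> x; apply: derM; exact: derivable_der_at.
by apply: CnD; apply: IH => //; exact: CnW.
Qed.

Lemma Cn_affine n f (a b : R) : Cn n f -> Cn n (fun x => f (a * x + b)).
Proof.
elim: n f => [|n IH] f.
  move=> cf x; apply: (continuous_comp (f := fun x => a * x + b)); last exact: cf.
  by apply: der_continuous; apply: derD; [exact: der_scale (der_id x)|exact: der_cst].
move=> [df Cf]; apply: (@Cn_der n _ (fun x => a * derive1 f (a * x + b))).
  move=> x; apply: der_eq.
    apply: (der_comp (f := f)); first exact: derivable_der_at.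
    by apply: derD; [exact: der_scale (der_id x)|exact: der_cst].
  by rewrite /= addr0 mulr1 mulrC.
by apply: CnM; [exact: Cn_cst|exact: IH].
Qed.

(** The functions x^(-m) exp(- 1 / x), extended by 0. The derivative of each one is a combination of
    two others, so smoothness of the whole family follows by induction. *)
Definition flat m x : R := if 0 < x then x^-1 ^+ m * expR (- x^-1) else 0.

Lemma expr_le_exp m (y : R) : 0 <= y -> y ^+ m <= m%:R ^+ m * expR y.
Proof.
case: m => [|m] y0; first by rewrite !expr0 mul1r -expR0 ler_expR.
have m0 : (0 : R) < m.+1%:R by rewrite ltr0n.
have -> : expR y = expR (y / m.+1%:R) ^+ m.+1.
  by rewrite -expRM_natl mulrC divfK// gt_eqF.
rewrite -exprMn ler_pXn2r ?nnegrE ?mulr_ge0 ?expR_ge0 ?(ltW m0)//.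
rewrite mulrC -ler_pdivrMr//; apply: le_trans (expR_ge1Dx _).
by rewrite lerDr.
Qed.

Lemma derX m x : der_at x (fun y : R => y ^+ m) (m%:R * x ^+ m.-1).
Proof.
elim: m => [|m IH].
  by apply: der_eq; [exact: der_cst|rewrite mul0r].
have -> : (fun y : R => y ^+ m.+1) = (fun y => y * y ^+ m).
  by apply/funext => y; rewrite exprS.
apply: der_eq; first by apply: derM; [exact: der_id|exact: IH].
rewrite /=; case: m {IH} => [|m] /=; first by rewrite expr0; ring.
by rewrite exprS -[in RHS]natr1; ring.
Qed.

(** The quadratic bound gives the derivative 0 at the origin, through [der_at_quadratic]. It comes
    from y^(m + 2) exp(- y) being bounded, for y = 1 / x. *)
Lemma flat_small m : exists C : R, 0 <= C /\ forall x, `|flat m x| <= C * x ^+ 2.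
Proof.
exists (m.+2%:R ^+ m.+2); split; first by rewrite exprn_ge0.
move=> x; rewrite /flat; case: ifPn => x0; last first.
  by rewrite normr0 mulr_ge0 ?sqr_ge0 ?exprn_ge0.
have y0 : 0 < x^-1 by rewrite invr_gt0.
rewrite ger0_norm ?mulr_ge0 ?expR_ge0 ?exprn_ge0 ?(ltW y0)//.
have := expr_le_exp m.+2 (ltW y0); set y := x^-1 in y0 *.
rewrite expRN -(ler_pdivrMr _ _ (expR_gt0 _)) => h.
have -> : x ^+ 2 = y ^- 2 by rewrite /y exprVn invrK.
rewrite ler_pdivlMr ?exprn_gt0//; apply: le_trans h.
by rewrite (_ : y ^+ m.+2 = y ^+ m * y ^+ 2) 1?mulrAC// -exprD addn2.
Qed.

Lemma der_at_local x f g d : (\forall y \near x, f y = g y) -> der_at x g d ->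
  der_at x f d.
Proof.
move=> fg [dg gd]; rewrite -gd; split; last exact: near_eq_derive.
by apply: near_eq_derivable dg; apply: filterS fg => y ->.
Qed.

Lemma der_at_quadratic f (C : R) : f 0 = 0 -> (forall x, `|f x| <= C * x ^+ 2) ->
  der_at 0 f 0.
Proof.
move=> f0 fC.
have C1 : 0 < C + 1.
  by rewrite ltr_wpDl//; have := le_trans (normr_ge0 _) (fC 1); rewrite expr1n mulr1.
have h : (fun h : R => h^-1 *: (f (h *: 1 + 0) - f 0)) @ (0 : R)^' --> (0 : R).
  apply/cvgrPdist_le => e e0; near=> t.
  have t0 : t != 0 by near: t; exact: nbhs_dnbhs_neq.
  rewrite f0 subr0 addr0 sub0r normrN /GRing.scale /= mulr1 normrM normfV.
  rewrite ler_pdivrMl ?normr_gt0//; apply: le_trans (fC t) _.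
  have C0 : 0 <= C by have := le_trans (normr_ge0 _) (fC 1); rewrite expr1n mulr1.
  rewrite -real_normK ?num_real// expr2 mulrCA ler_wpM2l//.
  have : `|t| <= e / (C + 1).
    by near: t; apply: dnbhs0_le; exact: divr_gt0.
  rewrite ler_pdivlMr// mulrDr mulr1 mulrC; apply: le_trans.
  by rewrite lerDl.
by split; [apply/cvg_ex; exists 0|exact: cvg_lim h].
Unshelve. all: by end_near. Qed.

Lemma der_flat m x : der_at x (flat m) (flat m.+2 x - m%:R * flat m.+1 x).
Proof.
case: (ltgtP x 0) => x0.
- apply: (@der_at_local _ _ (fun=> 0)).
    near=> y; rewrite /flat ifF//; apply/negbTE; rewrite -leNgt ltW//.
    by near: y; exact: lt_nbhsl.
  by apply: der_eq; [exact: der_cst|rewrite /flat ltNge (ltW x0) /= mulr0 subrr].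
- apply: (@der_at_local _ _ (fun x => x^-1 ^+ m * expR (- x^-1))).
    near=> y; rewrite /flat ifT//.
    by near: y; exact: lt_nbhsr.
  have dV : der_at x (fun y : R => y^-1) (- 1 / x ^+ 2).
    by apply: (@derV _ x (fun y => y)); [rewrite gt_eqF|exact: der_id].
  have dX : der_at x (fun y : R => y^-1 ^+ m) (m%:R * x^-1 ^+ m.-1 * (- 1 / x ^+ 2)).
    by apply: (der_comp (f := fun y : R => y ^+ m)); [exact: derX|exact: dV].
  apply: der_eq; first apply: derM; first exact: dX.
    apply: (der_comp (f := expR)); first exact: is_derive_expR.
    exact: derN dV.
  rewrite /flat x0 /=; case: m dX => [|m] _ /=.
    by rewrite !mul0r !expr0 mul1r; field; rewrite gt_eqF.
  by rewrite !exprS; field; rewrite gt_eqF.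
- have [C [C0 HC]] := flat_small m.
  rewrite x0; apply: der_eq; first apply: der_at_quadratic HC.
    by rewrite /flat ltxx.
  by rewrite /flat ltxx mulr0 subrr.
Unshelve. all: by end_near. Qed.

Lemma smooth_flat m : smooth (flat m).
Proof.
move=> n; elim: n m => [|n IH] m.
  by move=> x; exact: der_continuous (der_flat m x).
apply: (Cn_der (der_flat m)); apply: CnD => //.
rewrite (_ : (fun x => _) = (fun x => - m%:R * flat m.+1 x)).
  by apply: CnM => //; exact: Cn_cst.
by apply/funext => x; rewrite mulNr.
Qed.

End smooth_functions.

(** * A one-sided bump, its primitive and plateaus *)

Section cutoff.
Context {R : realType}.
Local Notation leb := (@lebesgue_measure R).
Implicit Types (f g : R -> R) (x : R) (n m : nat).

(** The support is [1 / 2, 1], not centred at 0: averages built on it see only points strictly to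
    the right of their base point. This separates right traces from left ones, and lets a time
    cutoff based at s = 0 be supported in positive times. *)
Definition bump0 x : R := flat 0 (2 * x - 1) * flat 0 (2 - 2 * x).

Lemma smooth_bump0 : smooth bump0.
Proof.
move=> n; apply: CnM.
  exact: (@Cn_affine _ n (flat 0) 2 (- 1) (smooth_flat 0 n)).
rewrite (_ : (fun x => _) = (fun x => flat 0 (- 2 * x + 2))).
  exact: Cn_affine (smooth_flat 0 n).
by apply/funext => x; congr flat; ring.
Qed.

Lemma flat_ge0 m x : 0 <= flat m x.
Proof.
by rewrite /flat; case: ifPn => // x0; rewrite mulr_ge0 ?expR_ge0// exprn_ge0// invr_ge0 ltW.
Qed.

Lemma flat_gt0 m x : 0 < x -> 0 < flat m x.
Proof. by move=> x0; rewrite /flat x0 mulr_gt0 ?expR_gt0// exprn_gt0// invr_gt0. Qed.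

Lemma bump0_ge0 x : 0 <= bump0 x.
Proof. by rewrite mulr_ge0// flat_ge0. Qed.

Lemma bump0_out x : ~~ (1 / 2 < x < 1) -> bump0 x = 0.
Proof.
rewrite negb_and -!leNgt /bump0 /flat => /orP[h|h].
  by rewrite ifF ?mul0r//; apply/negbTE; rewrite -leNgt; lra.
by rewrite [X in _ * X]ifF ?mulr0//; apply/negbTE; rewrite -leNgt; lra.
Qed.

Lemma smooth_bm f (a b : R) : continuous f -> (forall x, ~~ (a <= x <= b) -> f x = 0) ->
  bounded_measurable f.
Proof.
move=> cf f0; split; first exact: continuous_measurable_fun.
have [B [B0 fB]] := continuous_seg_bounded a b cf.
exists B => x; have [xab|xab] := boolP (a <= x <= b); first exact: fB.
by rewrite f0// normr0 ltW.
Qed.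

Lemma bm_bump0 : bounded_measurable bump0.
Proof.
apply: (@smooth_bm _ (1 / 2) 1); first exact: (smooth_bump0 0).
move=> x xab; apply: bump0_out; apply: contra xab => /andP[? ?].
by rewrite !ltW.
Qed.

Let mass : R := integ 0 1 bump0.

Lemma mass_gt0 : 0 < mass.
Proof.
have [|B [B0 HB]] := @continuous_seg_pos _ bump0 (2 / 3) (3 / 4) (fun x _ => smooth_bump0 0 x).
  by move=> x /andP[h1 h2]; rewrite mulr_gt0// flat_gt0//; lra.
have bb := bm_bump0.
have -> : mass = integ 0 (2 / 3) bump0 + (integ (2 / 3) (3 / 4) bump0 + integ (3 / 4) 1 bump0).
  by rewrite -!integ_chasles//; lra.
have h1 : 0 <= integ 0 (2 / 3) bump0 by apply: integ_ge0 => x _; exact: bump0_ge0.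
have h2 : 0 <= integ (3 / 4) 1 bump0 by apply: integ_ge0 => x _; exact: bump0_ge0.
have h3 : B * (3 / 4 - 2 / 3) <= integ (2 / 3) (3 / 4) bump0.
  by rewrite -integ_cst; [apply: integ_le => //; exact: bm_cst|lra].
have h4 : 0 < B * (3 / 4 - 2 / 3) by rewrite mulr_gt0//; lra.
lra.
Qed.

Definition bump x : R := bump0 x / mass.

Lemma smooth_bump : smooth bump.
Proof. by move=> n; apply: CnM; [exact: smooth_bump0|exact: Cn_cst]. Qed.

Lemma bump_ge0 x : 0 <= bump x.
Proof. by rewrite divr_ge0 ?bump0_ge0// ltW// mass_gt0. Qed.

Lemma bump_out x : ~~ (1 / 2 < x < 1) -> bump x = 0.
Proof. by move=> h; rewrite /bump bump0_out// mul0r. Qed.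

Lemma bm_bump : bounded_measurable bump.
Proof. by apply: bmM; [exact: bm_bump0|exact: bm_cst]. Qed.

Lemma bump_mass : integ 0 1 bump = 1.
Proof.
rewrite (_ : bump = fun x => mass^-1 * bump0 x).
  by rewrite integZ ?mulVf ?gt_eqF ?mass_gt0//; exact: bm_bump0.
by apply/funext => x; rewrite /bump mulrC.
Qed.

Lemma bump_bounded : exists B : R, 0 < B /\ forall x, bump x <= B.
Proof.
have [_ [B HB]] := bm_bump; exists (B + 1); split.
  by rewrite ltr_wpDl// (le_trans (normr_ge0 _) (HB 0)).
by move=> x; rewrite (le_trans (ler_norm _))// (le_trans (HB x))// lerDl.
Qed.

Definition step x : R := integ (- 1) x bump.

Lemma step_le x : x <= 1 / 2 -> step x = 0.
Proof.
move=> x2; rewrite /step (@eq_integ _ _ _ _ (fun=> 0)); last first.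
  move=> y /andP[_ yx]; apply: bump_out; rewrite negb_and -!leNgt.
  by rewrite (le_trans yx).
have [h|h] := leP (- 1) x; last by rewrite integ_ltNge.
by rewrite integ_cst// mul0r.
Qed.

Lemma der_step x : der_at x step (bump x).
Proof.
have [xm|xm] := ltP x 0.
  apply: (@der_at_local _ _ _ (fun=> 0)).
    near=> y; apply: step_le; apply: ltW; apply: lt_le_trans (_ : 0 <= _); last lra.
    by near: y; exact: lt_nbhsl.
  apply: der_eq; first exact: der_cst.
  by rewrite bump_out// negb_and -!leNgt; apply/orP; left; rewrite (le_trans (ltW xm))//; lra.
apply/der_atP; apply: (@continuous_FTC1_closed _ bump (- 1) x (x + 1)).
- by rewrite ltrDl.
- by apply: bm_integ; exact: bm_bump.
- by rewrite (lt_le_trans _ xm)//; lra.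
- exact: (smooth_bump 0).
Unshelve. all: by end_near. Qed.

Lemma smooth_step : smooth step.
Proof. by move=> n; apply: CnW; apply: (Cn_der der_step); exact: smooth_bump. Qed.

Lemma step_ge x : 1 <= x -> step x = 1.
Proof.
move=> x1; have bb := bm_bump.
have -> : step x = integ (- 1) 0 bump + (integ 0 1 bump + integ 1 x bump).
  by rewrite -!integ_chasles//; lra.
rewrite bump_mass.
rewrite (@eq_integ _ (- 1) 0 _ (fun=> 0)); last first.
  by move=> y /andP[_ y0]; rewrite bump_out// negb_and -!leNgt; apply/orP; left; lra.
rewrite (@eq_integ _ 1 x _ (fun=> 0)); last first.
  by move=> y /andP[y1 _]; rewrite bump_out// negb_and -!leNgt; apply/orP; right.
by rewrite !integ_cst ?mul0r ?add0r ?addr0//; lra.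
Qed.

Lemma step_mono x y : x <= y -> step x <= step y.
Proof.
move=> xy; apply: (nondecr_der xy (fun z _ => der_step z)) => z _; exact: bump_ge0.
Qed.

Lemma step_ge0 x : 0 <= step x.
Proof.
have [h|h] := leP x (1 / 2); first by rewrite step_le.
by rewrite -(@step_le (1 / 2))// step_mono// ltW.
Qed.

Lemma step_le1 x : step x <= 1.
Proof.
have [h|h] := leP 1 x; first by rewrite step_ge.
by rewrite -(@step_ge 1)// step_mono// ltW.
Qed.

(* A smooth plateau: it rises on [a + d / 2, a + d] and falls on
   [b + d / 2, b + d]. *)
Definition plateau d (a b : R) x : R := step ((x - a) / d) - step ((x - b) / d).

Definition bump_at d (a : R) x : R := bump ((x - a) / d) / d.

Lemma smooth_affine_div f d (a : R) : smooth f -> smooth (fun x => f ((x - a) / d)).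
Proof.
move=> sf n; rewrite (_ : (fun x => _) = (fun x => f (d^-1 * x + - (a / d)))).
  exact: Cn_affine (sf n).
by apply/funext => x; congr f; ring.
Qed.

Lemma smooth_plateau d (a b : R) : smooth (plateau d a b).
Proof.
move=> n; rewrite /plateau (_ : (fun x => _) =
  (fun x => step ((x - a) / d) + - 1 * step ((x - b) / d))).
  apply: CnD; first exact: (smooth_affine_div _ _ smooth_step).
  by apply: CnM; [exact: Cn_cst|exact: (smooth_affine_div _ _ smooth_step)].
by apply/funext => x; ring.
Qed.

Lemma der_plateau d (a b : R) x : der_at x (plateau d a b) (bump_at d a x - bump_at d b x).
Proof.
have h c : der_at x (fun x => step ((x - c) / d)) (bump_at d c x).
  apply: der_eq.
    apply: (der_comp (f := step)); first exact: der_step.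
    apply: derM; last exact: der_cst.
    by apply: derB; [exact: der_id|exact: der_cst].
  by rewrite /bump_at /=; ring.
by apply: derB; exact: h.
Qed.

Lemma plateau_ge0 d (a b : R) x : 0 < d -> a <= b -> 0 <= plateau d a b x.
Proof.
move=> d0 ab; rewrite subr_ge0 step_mono// ler_pM2r ?invr_gt0//; lra.
Qed.

Lemma plateau_out d (a b : R) x : 0 < d -> a <= b ->
  ~~ (a + d / 2 <= x <= b + d) -> plateau d a b x = 0.
Proof.
move=> d0 ab; rewrite negb_and -!ltNge => /orP[h|h].
  by rewrite /plateau !step_le ?subrr// ler_pdivrMr//; lra.
by rewrite /plateau !step_ge ?subrr// ler_pdivlMr//; lra.
Qed.

End cutoff.

(** * Almost everywhere derivatives of Lipschitz curves *)

Section lipschitz_differentiation.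
Context {R : realType}.
Local Notation leb := (@lebesgue_measure R).

Lemma lipschitz_within (h : R -> R) (L : R) :
  (forall x y, `|h x - h y| <= L * `|x - y|) -> continuous h.
Proof.
move=> hL x; have L0 : 0 <= L.
  by have := hL 1 0; rewrite subr0 normr1 mulr1 => /(le_trans _)->.
apply/cvgrPdist_le => e e0; near=> y.
apply: le_trans (hL _ _) _.
have : `|x - y| <= e / (L + 1).
  by near: y; apply: cvgr_dist_le; [exact: cvg_id|rewrite divr_gt0// ltr_wpDl].
move=> xy; rewrite (le_trans (ler_wpM2l L0 xy))// mulrCA ger_pMr//.
by rewrite ler_pdivrMr ?mul1r ?lerDl// ltr_wpDl.
Unshelve. all: by end_near. Qed.

Lemma der_lipschitz_le (h : R -> R) (L x d : R) :
  (forall x y, `|h x - h y| <= L * `|x - y|) -> der_at x h d -> `|d| <= L.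
Proof.
move=> hL [dh <-].
have /cvg_norm /= c : (fun t : R => t^-1 *: (h (t *: 1 + x) - h x)) @ 0^' --> 'D_1 h x by [].
rewrite -(cvg_lim _ c)//; apply: limr_le; first by apply/cvg_ex; exists (`|'D_1 h x|).
near=> t.
have t0 : t != 0 by near: t; exact: nbhs_dnbhs_neq.
rewrite /GRing.scale /= mulr1 normrM normrV ?unitfE// ler_pdivrMl ?normr_gt0// mulrC.
by have := hL (t + x) x; rewrite addrK.
Unshelve. all: by end_near. Qed.

Lemma stieltjes_oc (k : cumulative R R) a b : a <= b ->
  lebesgue_stieltjes_measure k `]a, b]%classic = (k b - k a)%:E.
Proof.
move=> ab; rewrite /lebesgue_stieltjes_measure /measure_extension measurable_mu_extE.
  exact: (@wlength_itv_bnd R k a b false false).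
by exists (a, b).
Qed.

Section split.
Variables (h : R -> R).
Hypothesis hL : forall x y, `|h x - h y| <= `|x - y|.

(** For a 1-Lipschitz h, [rising] and [falling] are nondecreasing, their difference is h and their
    sum is the identity. Their Stieltjes measures therefore add up to Lebesgue measure, which
    dominates each of them. *)
Definition rising (x : R) : R := (x + h x) / 2.
Definition falling (x : R) : R := (x - h x) / 2.

Lemma rising_nondecr : nondecreasing rising.
Proof.
move=> x y xy; rewrite ler_pM2r ?invr_gt0//.
have := hL x y; rewrite ler_norml ler0_norm ?subr_le0//; lra.
Qed.

Lemma falling_nondecr : nondecreasing falling.
Proof.
move=> x y xy; rewrite ler_pM2r ?invr_gt0//.
have := hL x y; rewrite ler_norml ler0_norm ?subr_le0//; lra.
Qed.

Lemma continuous_h : continuous h.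
Proof. by apply: (@lipschitz_within _ 1) => x y; rewrite mul1r. Qed.

Lemma rising_right : right_continuous rising.
Proof.
move=> x; apply: (@cvg_within_filter) => //.
apply: cvgMl; apply: cvgD; [exact: cvg_id|exact: continuous_h].
Qed.

Lemma falling_right : right_continuous falling.
Proof.
move=> x; apply: (@cvg_within_filter) => //.
apply: cvgMl; apply: cvgB; [exact: cvg_id|exact: continuous_h].
Qed.

HB.instance Definition _ :=
  isCumulative.Build R _ R rising rising_nondecr rising_right.
HB.instance Definition _ :=
  isCumulative.Build R _ R falling falling_nondecr falling_right.

Lemma stieltjes_split (A : set (measurableTypeR R)) : measurable A ->
  leb A = (lebesgue_stieltjes_measure rising A + lebesgue_stieltjes_measure falling A)%E.
Proof.
move=> mA.
pose mF := lebesgue_stieltjes_measure (rising : cumulative R R).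
pose mG := lebesgue_stieltjes_measure (falling : cumulative R R).
rewrite -[RHS](measure_addE mF mG); apply: lebesgue_measure_unique => // X oX.
rewrite [RHS](measure_addE mF mG X) /lebesgue_measure.
case: oX => -[a b] _ <- /=.
have [ab|ba] := leP a b; last by rewrite set_itv_ge ?bnd_simp -?leNgt ?ltW// !measure0 adde0.
rewrite (stieltjes_oc _ ab); transitivity ((rising b - rising a)%:E + (falling b - falling a)%:E)%E.
  by rewrite -EFinD /rising /falling; congr EFin; rewrite /=; field.
by congr (_ + _)%E; rewrite -stieltjes_oc.
Qed.

(** Radon-Nikodym, on a bounded interval so that the Stieltjes measure is finite. Differentiating
    the primitive of the density will give the derivative of [rising], hence that of h, almost
    everywhere. *)
Lemma rising_density (T : R) : 0 < T ->
  exists g : R -> R, leb.-integrable setT (EFin \o g) /\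
  forall a b : R, - T <= a -> a <= b -> b <= T ->
    rising b - rising a = \int[leb]_(x in `]a, b]) g x.
Proof.
move=> T0; pose mF := lebesgue_stieltjes_measure (rising : cumulative R R).
have mD : measurable (`]- T, T]%classic : set (measurableTypeR R)) by exact: measurable_itv.
have finD : (mF `](- T)%R, T]%classic < +oo)%E.
  by rewrite /mF stieltjes_oc ?ltry// ge0_cp// ltW.
pose nu := mfrestr mD finD.
have dom : nu `<< leb.
  apply/null_content_dominatesP => A mA A0.
  have := stieltjes_split (measurableI _ _ mA mD).
  have -> : leb (A `&` `]- T, T]) = 0%E.
    have /= := le_measure leb (x:=A `&` `](- T)%R, T]%classic) (y:=A).
    rewrite !inE A0 => /(_ (measurableI _ _ mA mD) mA (@subIsetl _ _ _)).
    by move=> le0; apply/eqP; rewrite eq_le le0 measure_ge0.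
  move=> /esym/eqP; rewrite padde_eq0// => /andP[/eqP + _].
  by rewrite /nu /= /mfrestr /mrestr.
have fin := Radon_Nikodym_SigmaFinite.f_fin_num dom.
have int := Radon_Nikodym_SigmaFinite.f_integrable dom.
have E := Radon_Nikodym_SigmaFinite.f_integral dom.
set g := Radon_Nikodym_SigmaFinite.f _ _ in fin int E.
have gE : EFin \o (fine \o g) = g by apply/funext => x /=; rewrite fineK.
exists (fine \o g); split; first by rewrite gE.
move=> a b Ta ab bT; rewrite /Rintegral.
have := E `]a, b]%classic (measurable_itv _).
rewrite /nu /= /mfrestr /mrestr setIidl.
  rewrite [LHS]stieltjes_oc// => /(congr1 fine) /= ->.
  by congr fine; apply: eq_integral => x _; rewrite /= fineK.
move=> x /=; rewrite !in_itv /= => /andP[ax xb].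
  by rewrite (le_lt_trans Ta ax) (le_trans xb bT).
Qed.
End split.

Lemma lipschitz_ae_der (h : R -> R) (L T : R) : 0 < T -> 0 < L ->
  (forall x y, `|h x - h y| <= L * `|x - y|) ->
  exists g : R -> R, [/\ measurable_fun setT g, (forall x, `|g x| <= L) &
    {ae leb, forall x, - T < x < T -> der_at x h (g x)}].
Proof.
move=> T0 L0 hL.
pose k x := L^-1 * h x.
have kL x y : `|k x - k y| <= `|x - y|.
  by rewrite -mulrBr normrM gtr0_norm ?invr_gt0// ler_pdivrMl.
have [g [ig gE]] := rising_density kL T0.
have mg : measurable_fun setT g by apply/measurable_EFinP; case/integrableP: ig.
pose w x : R := L * (2 * g x - 1).
(* The truncation makes the bound hold at every point; where h is differentiable, |w x| <= L already
   and nothing changes. *)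
exists (fun x => Num.max (- L) (Num.min L (w x))); split.
- apply: measurable_maxr => //; apply: measurable_minr => //.
  by apply: measurable_funM => //; apply: measurable_funB => //; apply: measurable_funM.
- move=> x; rewrite ler_norml; apply/andP; split; first by rewrite le_max lexx.
  by rewrite ge_max ge_min lexx andbT ge0_cp// ltW.
have locg : locally_integrable setT g.
  split => //; first exact: openT.
  move=> K _ cK; have mK : measurable (K : set (measurableTypeR R)) by exact: compact_measurable.
  by have /integrableP[] := integrableS measurableT mK (@subsetT _ _) ig.
have ig' y : leb.-integrable `[- T, y] (EFin \o g) by apply: integrableS ig.
have ft := @FTC1 R g (BLeft (- T)) ig' locg.
apply: (ae_imp ft) => x /= gx /andP[Tx xT].
have {gx} [dF Fx] := gx Tx.
have dr : der_at x (rising k) (g x).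
  rewrite -Fx.
  have dF' := derD (der_cst x (rising k (- T))) (derivable_der_at dF).
  apply: der_at_local (der_eq dF' (add0r _)).
  near=> y; rewrite -Rintegral_itv_obnd_cbnd//.
  rewrite (_ : (\int[leb]_(t in `]- T, y]) g t)%R = rising k y - rising k (- T)).
    by rewrite addrC subrK.
  symmetry; apply: gE => //.
  - by near: y; exact: lt_le_nbhsr.
  - by near: y; exact: lt_le_nbhsl.
  by apply: integrableS ig.
have dk : der_at x h (w x).
  have hE : h = (fun y => L * (2 * rising k y - y)).
    by apply/funext => y; rewrite /rising /k; field; rewrite gt_eqF.
  rewrite [X in der_at x X _]hE.
  exact: (der_scale L (derB (der_scale 2 dr) (der_id x))).
have : `|w x| <= L.
  exact: der_lipschitz_le dk.
rewrite ler_norml => /andP[w1 w2].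
by rewrite min_r// max_r.
Unshelve. all: by end_near. Qed.
End lipschitz_differentiation.

(** * Balances between moving boundaries *)

Section iterated_pairing.
Context {R : realType}.
Local Notation leb := (@lebesgue_measure R).

Lemma integ_supported (a b : R) (g : R -> R) : bounded_measurable g ->
  (forall x, ~~ (a <= x <= b) -> g x = 0) ->
  (\int[leb]_x (g x)%:E)%E = (integ a b g)%:E.
Proof.
move=> bg g0; rewrite integE// [RHS]integral_mkcond; apply: eq_integral => x _.
rewrite patchE; case: ifPn => // /negP xab; rewrite g0//; apply/negP => h; apply: xab.
by rewrite inE /= in_itv.
Qed.

(** w is known only almost everywhere in x for each t. The set where it differs from G is measurable
    with null sections, hence null in the product, and Fubini is applied to the bounded G of bounded
    support. *)
Lemma integral_iterated (w G : R * R -> R) (a b X : R) :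
  let D := `]0, +oo[ `*` setT : set (measurableTypeR R * measurableTypeR R) in
  0 < a -> measurable_fun D w -> bounded_measurable G ->
  (forall z, ~~ ((a <= z.1 <= b) && (- X <= z.2 <= X)) -> G z = 0) ->
  (forall t, 0 < t -> {ae leb, forall x, w (t, x) = G (t, x)}) ->
  \int[(leb \x leb)%E]_(z in D) w z = integ a b (fun t => integ (- X) X (fun x => G (t, x))).
Proof.
move=> D a0 mw bG G0 wG.
have mD : measurable D by apply: measurableX => //; exact: measurable_itv.
have mG : measurable_fun setT G by case: bG.
have mGD : measurable_fun D G by exact: measurable_funTS.
have EwG : (\int[(leb \x leb)]_(z in D) (w z)%:E = \int[(leb \x leb)]_(z in D) (G z)%:E)%E.
  apply: ae_eq_integral => //; [exact/measurable_EFinP|exact/measurable_EFinP|].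
  pose N := D `&` [set z | (w z)%:E != (G z)%:E].
  have mN : measurable N.
    by apply: (@measurable_neqe _ _ _ D mD (EFin \o w) (EFin \o G)) => //; exact/measurable_EFinP.
  exists N; split => //; last first.
    by move=> z /= /not_implyP[Dz /eqP nz]; split.
  rewrite /product_measure1; apply: integral0_eq => t _.
  have [t0|t0] := ltP 0 t.
    have [A [mA A0 sA]] := wG t t0.
    apply/eqP; rewrite eq_le measure_ge0 andbT -A0 le_measure ?inE//.
      exact: measurable_xsection.
    move=> x; rewrite /xsection /= inE => -[_ /= ne]; apply: sA => /= e.
    by move: ne; rewrite e eqxx.
  rewrite /= (_ : xsection N t = set0) ?measure0// -subset0 => x.
  by rewrite /xsection /= inE => -[[/= + _] _]; rewrite in_itv /= andbT ltNge t0.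
have iG : (leb \x leb)%E.-integrable setT (EFin \o G).
  pose B := `[a, b]%classic `*` `[- X, X]%classic : set (measurableTypeR R * measurableTypeR R).
  have mB : measurable B by apply: measurableX; exact: measurable_itv.
  rewrite (_ : EFin \o G = (EFin \o G) \_ B); last first.
    apply/funext => z; rewrite patchE; case: ifPn => // /negP zB.
    rewrite /= G0//; apply/negP => /andP[h1 h2]; apply: zB.
    by rewrite inE; split; rewrite /= in_itv.
  rewrite -integrable_mkcond//; apply: (@bm_integrable R _ _ (product_measure1 leb leb)) => //.
  have EB : (leb \x leb)%E B = (leb `[a, b] * leb `[(- X)%R, X])%E.
    by apply: product_measure1E; exact: measurable_itv.
  apply: (@le_lt_trans _ _ (leb `[a, b] * leb `[(- X)%R, X])%E).
    by rewrite -EB le_eqVlt; apply/orP; left; apply/eqP.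
  by rewrite lte_mul_pinfty// ?leb_itv_lty// ge0_fin_numE// leb_itv_lty.
rewrite /Rintegral EwG.
have -> : (\int[(leb \x leb)]_(z in D) (G z)%:E = \int[(leb \x leb)]_z (G z)%:E)%E.
  rewrite integral_mkcond; apply: eq_integral => z _; rewrite patchE.
  case: ifPn => // /negP zD; rewrite G0//; apply/negP => /andP[/andP[h1 _] _].
  by apply: zD; rewrite inE; split => //=; rewrite in_itv /= andbT (lt_le_trans a0).
rewrite -(integral12_prod_meas1 iG).
have E t : (\int[leb]_x (G (t, x))%:E)%E = (integ (- X) X (fun x => G (t, x)))%:E.
  apply: integ_supported => [|x xX]; first exact: bm_section1.
  by apply: G0; rewrite (negPf xX) andbF.
transitivity (fine (\int[leb]_t (integ (- X) X (fun x => G (t, x)))%:E)%E).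
  by congr fine; apply: eq_integral => t _; exact: E.
rewrite (integ_supported (a := a) (b := b))//; first exact: bm_parameter.
move=> t tab; rewrite (_ : (fun x => _) = (fun=> 0)).
  have [XX|XX] := leP (- X) X; first by rewrite integ_cst// mul0r.
  by rewrite integ_ltNge.
by apply/funext => x; apply: G0; rewrite (negPf tab).
Qed.

End iterated_pairing.

(** * Test functions carried by moving curves *)

Section moving_test_functions.
Context {R : realType}.
Implicit Types (f g c chi : R -> R) (z : R * R).

Lemma partial1 (phi : R * R -> R) z d : der_at z.1 (fun t => phi (t, z.2)) d ->
  derivable phi z (1, 0) /\ 'D_(1, 0) phi z = d.
Proof.
have E : (fun h : R => h^-1 *: (phi (h *: (1, 0) + z) - phi z)) =
         (fun h : R => h^-1 *: (phi (h *: 1 + z.1, z.2) - phi (z.1, z.2))).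
  apply/funext => t; rewrite -surjective_pairing; congr (_ *: (phi _ - _)).
  by case: z => x y; congr pair; rewrite /= scaler0 add0r.
by move=> [h1 h2]; split; [rewrite /derivable E|rewrite -h2 /derive E].
Qed.

Lemma partial2 (phi : R * R -> R) z d : der_at z.2 (fun t => phi (z.1, t)) d ->
  derivable phi z (0, 1) /\ 'D_(0, 1) phi z = d.
Proof.
have E : (fun h : R => h^-1 *: (phi (h *: (0, 1) + z) - phi z)) =
         (fun h : R => h^-1 *: (phi (z.1, h *: 1 + z.2) - phi (z.1, z.2))).
  apply/funext => t; rewrite -surjective_pairing; congr (_ *: (phi _ - _)).
  by case: z => x y; congr pair; rewrite /= scaler0 add0r.
by move=> [h1 h2]; split; [rewrite /derivable E|rewrite -h2 /derive E].
Qed.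

Lemma section1 (phi : R * R -> R) z : derivable phi z (1, 0) ->
  der_at z.1 (fun t => phi (t, z.2)) ('D_(1, 0) phi z).
Proof.
have E : (fun h : R => h^-1 *: (phi (h *: (1, 0) + z) - phi z)) =
         (fun h : R => h^-1 *: (phi (h *: 1 + z.1, z.2) - phi (z.1, z.2))).
  apply/funext => t; rewrite -surjective_pairing; congr (_ *: (phi _ - _)).
  by case: z => x y; congr pair; rewrite /= scaler0 add0r.
by move=> h; split; [move: h; rewrite /derivable E|rewrite /derive E].
Qed.

Lemma section2 (phi : R * R -> R) z : derivable phi z (0, 1) ->
  der_at z.2 (fun t => phi (z.1, t)) ('D_(0, 1) phi z).
Proof.
have E : (fun h : R => h^-1 *: (phi (h *: (0, 1) + z) - phi z)) =
         (fun h : R => h^-1 *: (phi (z.1, h *: 1 + z.2) - phi (z.1, z.2))).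
  apply/funext => t; rewrite -surjective_pairing; congr (_ *: (phi _ - _)).
  by case: z => x y; congr pair; rewrite /= scaler0 add0r.
by move=> h; split; [move: h; rewrite /derivable E|rewrite /derive E].
Qed.

Lemma class_C2_partials n (phi phi1 phi2 : R * R -> R) : continuous phi ->
  (forall z, der_at z.1 (fun t => phi (t, z.2)) (phi1 z)) ->
  (forall z, der_at z.2 (fun t => phi (z.1, t)) (phi2 z)) ->
  class_C2 n phi1 -> class_C2 n phi2 -> class_C2 n.+1 phi.
Proof.
move=> cphi d1 d2 C1 C2; split => //; split.
- by move=> z; case: (partial1 (d1 z)).
- by move=> z; case: (partial2 (d2 z)).
- by rewrite (_ : (fun z => _) = phi1)//; apply/funext => z; case: (partial1 (d1 z)).
- by rewrite (_ : (fun z => _) = phi2)//; apply/funext => z; case: (partial2 (d2 z)).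
Qed.

Lemma class_C2D n (phi psi : R * R -> R) : class_C2 n phi -> class_C2 n psi ->
  class_C2 n (fun z => phi z + psi z).
Proof.
elim: n phi psi => [|n IH] phi psi [cf Cf] [cg Cg].
  by split => // z; apply: cvgD; [exact: cf|exact: cg].
have [f1 f2 Cf1 Cf2] := Cf; have [g1 g2 Cg1 Cg2] := Cg.
split; first by move=> z; apply: cvgD; [exact: cf|exact: cg].
split.
- by move=> z; exact: (derivableD (f1 z) (g1 z)).
- by move=> z; exact: (derivableD (f2 z) (g2 z)).
- rewrite (_ : (fun z => _) = (fun z => 'D_(1, 0) phi z + 'D_(1, 0) psi z)).
    exact: IH.
  by apply/funext => z; exact: (deriveD (f1 z) (g1 z)).
- rewrite (_ : (fun z => _) = (fun z => 'D_(0, 1) phi z + 'D_(0, 1) psi z)).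
    exact: IH.
  by apply/funext => z; exact: (deriveD (f2 z) (g2 z)).
Qed.

(** Both partial derivatives of such a product are sums of products of the same form, so an
    induction on the order gives all derivatives. *)
Definition travelling chi g c z : R := chi z.1 * g (z.2 - c z.1).

Lemma der_travelling1 chi g c z : smooth chi -> smooth g -> smooth c ->
  der_at z.1 (fun t => travelling chi g c (t, z.2))
   (travelling (derive1 chi) g c z +
    travelling (fun t => - (chi t * derive1 c t)) (derive1 g) c z).
Proof.
move=> /(_ 1)[dchi _] /(_ 1)[dg _] /(_ 1)[dc _]; rewrite /travelling /=.
apply: der_eq.
  apply: derM; first exact: derivable_der_at.
  apply: (@der_comp _ _ g (fun t => z.2 - c t)); first exact: derivable_der_at.
  by apply: derB; [exact: der_cst|exact: derivable_der_at].
by rewrite /=; ring.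
Qed.

Lemma der_travelling2 chi g c z : smooth g ->
  der_at z.2 (fun x => travelling chi g c (z.1, x)) (travelling chi (derive1 g) c z).
Proof.
move=> /(_ 1)[dg _]; rewrite /travelling /=; apply: der_eq.
  apply: der_scale; apply: (@der_comp _ _ g (fun t => t - c z.1)).
    exact: derivable_der_at.
  by apply: derB; [exact: der_id|exact: der_cst].
by rewrite /=; ring.
Qed.

Lemma continuous_travelling chi g c : continuous chi -> continuous g -> continuous c ->
  continuous (travelling chi g c).
Proof.
move=> cchi cg cc z; apply: continuousM.
  by apply: (continuous_comp (f := fst)); [exact: cvg_fst|exact: cchi].
apply: (continuous_comp (f := fun z : R * R => z.2 - c z.1)); last exact: cg.
apply: continuousB; first exact: cvg_snd.
by apply: (continuous_comp (f := fst)); [exact: cvg_fst|exact: cc].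
Qed.

Lemma smooth_derive1 f : smooth f -> smooth (derive1 f).
Proof. by move=> sf n; case: (sf n.+1). Qed.

Lemma smoothM f g : smooth f -> smooth g -> smooth (fun x => f x * g x).
Proof. by move=> sf sg n; exact: CnM. Qed.

Lemma smoothN f : smooth f -> smooth (fun x => - f x).
Proof.
move=> sf; rewrite (_ : (fun x => _) = (fun x => (-1) * f x)).
  by apply: smoothM => // n; exact: Cn_cst.
by apply/funext => x; rewrite mulN1r.
Qed.

Lemma class_C2_travelling n chi g c : smooth chi -> smooth g -> smooth c ->
  class_C2 n (travelling chi g c).
Proof.
move=> + + sc; elim: n chi g => [|n IH] chi g schi sg.
  by split => //; apply: continuous_travelling; [exact: (schi 0%N)|exact: (sg 0%N)|exact: (sc 0%N)].
apply: class_C2_partials.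
- by apply: continuous_travelling; [exact: (schi 0%N)|exact: (sg 0%N)|exact: (sc 0%N)].
- by move=> z; exact: der_travelling1.
- by move=> z; exact: der_travelling2.
- apply: class_C2D; apply: IH => //; do ?exact: smooth_derive1.
  by apply: smoothN; apply: smoothM => //; exact: smooth_derive1.
- by apply: IH => //; exact: smooth_derive1.
Qed.

Definition moving_plateau del chi c d z : R := chi z.1 * plateau del (c z.1) (d z.1) z.2.

Lemma moving_plateauE del chi c d : moving_plateau del chi c d =
  (fun z => travelling chi (fun x => step ((x - 0) / del)) c z
     + travelling (fun t => - chi t) (fun x => step ((x - 0) / del)) d z).
Proof.
by apply/funext => z; rewrite /moving_plateau /travelling /plateau !subr0; ring.
Qed.

Lemma derive1_step del x : derive1 (fun x => step ((x - 0) / del)) x = bump_at del 0 x :> R.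
Proof.
apply: (der_at_derive1 (d := bump_at del 0 x)); rewrite /bump_at; apply: der_eq.
  apply: (@der_comp _ _ step (fun x => (x - 0) / del)); first exact: der_step.
  apply: (@derM _ _ (fun x => x - 0) (fun=> del^-1)); last exact: der_cst.
  by apply: derB; [exact: der_id|exact: der_cst].
by rewrite /=; ring.
Qed.

Lemma bump_at_shift del (a x : R) : bump_at del 0 (x - a) = bump_at del a x.
Proof. by rewrite /bump_at subr0. Qed.

Lemma test_function_moving del chi c d (a b X : R) :
  smooth chi -> smooth c -> smooth d -> 0 < del -> 0 < a ->
  (forall t, ~~ (a <= t <= b) -> chi t = 0) ->
  (forall t, a <= t <= b -> [/\ - X <= c t, c t <= d t & d t + del <= X]) ->
  [/\ test_function (moving_plateau del chi c d),
   (forall z, ~~ ((a <= z.1 <= b) && (- X <= z.2 <= X)) -> moving_plateau del chi c d z = 0),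
   (forall z, 'D_(1, 0) (moving_plateau del chi c d) z =
      derive1 chi z.1 * plateau del (c z.1) (d z.1) z.2 +
      chi z.1 * (derive1 d z.1 * bump_at del (d z.1) z.2 -
                 derive1 c z.1 * bump_at del (c z.1) z.2)) &
   (forall z, 'D_(0, 1) (moving_plateau del chi c d) z =
      chi z.1 * (bump_at del (c z.1) z.2 - bump_at del (d z.1) z.2))].
Proof.
move=> schi sc sd del0 a0 chi0 cd.
have sstep : smooth (fun x : R => step ((x - 0) / del)).
  by apply: smooth_affine_div; exact: smooth_step.
have snchi := smoothN schi.
have out z : ~~ ((a <= z.1 <= b) && (- X <= z.2 <= X)) -> moving_plateau del chi c d z = 0.
  rewrite /moving_plateau; have [h1|/chi0->] := boolP (a <= z.1 <= b); last by rewrite mul0r.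
  rewrite /= => zX; have [h2 h3 h4] := cd _ h1; rewrite plateau_out ?mulr0//.
  apply: contra zX => /andP[h5 h6]; apply/andP; split; last exact: le_trans h4.
  by apply: le_trans h5; rewrite (le_trans h2)// lerDl divr_ge0// ltW.
have dN t : derive1 (fun t => - chi t) t = - derive1 chi t.
  by apply: der_at_derive1; apply: derN; apply: derivable_der_at; case: (schi 1%N).
split => //.
- split => [n|].
    by rewrite moving_plateauE; apply: class_C2D; exact: class_C2_travelling.
  exists (`[a, b]%classic `*` `[- X, X]%classic); split.
  + by apply: compact_setX; exact: segment_compact.
  + by move=> z [] /=; rewrite in_itv /= => /andP[az _] _; exact: lt_le_trans az.
  + move=> z zK; apply: out; apply/negP => /andP[h1 h2].
    by apply: zK; split; rewrite /= in_itv.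
- move=> z; rewrite moving_plateauE.
  set phi := fun z0 => _; have [_ ->] := @partial1 phi z _ (derD (der_travelling1 z schi sstep sc)
                             (der_travelling1 z snchi sstep sd)).
  by rewrite /travelling !derive1_step !dN !bump_at_shift /plateau !subr0; ring.
- move=> z; rewrite moving_plateauE.
  set phi := fun z0 => _; have [_ ->] := @partial2 phi z _ (derD (der_travelling2 chi c z sstep)
                             (der_travelling2 (fun t => - chi t) d z sstep)).
  by rewrite /travelling !derive1_step !bump_at_shift; ring.
Qed.

End moving_test_functions.

(** * Entropy inequalities on regions with smooth moving sides *)

Section balances.
Context {R : realType}.
Local Notation leb := (@lebesgue_measure R).
Implicit Types (chi c d : R -> R) (E Q : R * R -> R).

Lemma integ_der (F f : R -> R) (a b : R) : a <= b -> (forall x, der_at x F (f x)) ->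
  continuous f -> integ a b f = F b - F a.
Proof.
rewrite le_eqVlt => /predU1P[->|ab] dF cf; first by rewrite integaa subrr.
rewrite /integ /Rintegral (@continuous_FTC2 _ _ F)//.
- by apply: continuous_subspaceT.
- split.
  + by move=> x _; case: (dF x).
  + exact: cvg_at_right_filter (der_continuous (dF a)).
  + exact: cvg_at_left_filter (der_continuous (dF b)).
- by move=> x _; exact: der_at_derive1.
Qed.

Lemma bmZ (m : measure_display) (T : measurableType m) (k : R) (f : T -> R) : bounded_measurable f ->
  bounded_measurable (fun x => k * f x).
Proof. by move=> bf; apply: bmM => //; exact: bm_cst. Qed.

Lemma bm_bump_at del a : 0 < del -> bounded_measurable (bump_at del a : R -> R).
Proof.
move=> d0; apply: bmM; last exact: bm_cst.
apply: (bm_comp (F := bump)); last exact: bm_bump.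
by apply: measurable_funM => //; apply: measurable_funB.
Qed.

Lemma bump_at_ge0 del a (x : R) : 0 < del -> 0 <= bump_at del a x.
Proof. by move=> d0; rewrite divr_ge0 ?bump_ge0// ltW. Qed.

Lemma bump_at_out del a (x : R) : 0 < del -> ~~ (a + del / 2 < x < a + del) ->
  bump_at del a x = 0.
Proof.
move=> d0 h; rewrite /bump_at bump_out ?mul0r//.
by apply: contra h => /andP[]; rewrite ltr_pdivlMr// ltr_pdivrMr// => h1 h2; apply/andP; split; lra.
Qed.

Lemma smooth_bump_at del a : smooth (bump_at del a : R -> R).
Proof.
move=> n; apply: CnM; last exact: Cn_cst.
exact: (smooth_affine_div _ _ smooth_bump).
Qed.

Lemma integ_bump_at del a (x y : R) : 0 < del -> x <= a + del / 2 -> a + del <= y ->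
  integ x y (bump_at del a) = 1.
Proof.
move=> d0 xa ay.
rewrite (@integ_der (fun x => step ((x - a) / del))).
- rewrite step_ge ?step_le ?subr0// ?ler_pdivrMr// ?ler_pdivlMr//; lra.
- lra.
- move=> z; apply: der_eq.
    apply: (der_comp (f := step)); first exact: der_step.
    apply: derM; last exact: der_cst.
    by apply: derB; [exact: der_id|exact: der_cst].
  by rewrite /bump_at /=; ring.
- exact: (smooth_bump_at _ _ 0%N).
Qed.

Lemma plateau_le1 del a b (x : R) : `|plateau del a b x| <= 1.
Proof.
rewrite /plateau ler_norml.
have := (step_ge0 ((x - a) / del), step_le1 ((x - a) / del)).
have := (step_ge0 ((x - b) / del), step_le1 ((x - b) / del)).
by move=> [? ?] [? ?]; apply/andP; split; lra.
Qed.

Lemma bm_plateau del a b : bounded_measurable (plateau del a b : R -> R).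
Proof.
split; first by apply: continuous_measurable_fun; exact: (smooth_plateau _ _ _ 0%N).
by exists 1 => x; exact: plateau_le1.
Qed.

Variables (del X : R).
Hypothesis del_gt0 : 0 < del.

Definition average E (t y : R) : R := integ (- X) X (fun x => bump_at del y x * E (t, x)).
Definition box E (t y z : R) : R := integ (- X) X (fun x => plateau del y z x * E (t, x)).
Definition through E Q (t y s : R) : R := average Q t y - s * average E t y.

(** At time t, the x-integral of the weak formulation tested on [moving_plateau]. The derivatives
    [chi1], [c1], [d1] are separate arguments, so that the formula keeps a meaning for Lipschitz
    sides, with velocities given almost everywhere. *)
Definition balance E Q chi chi1 c c1 d d1 (t : R) : R :=
  chi1 t * box E t (c t) (d t) +
  chi t * (through E Q t (c t) (c1 t) - through E Q t (d t) (d1 t)).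

Lemma bm_moving_bump c : measurable_fun setT c ->
  bounded_measurable (fun z : R * R => bump_at del (c z.1) z.2).
Proof.
move=> mc.
rewrite (_ : (fun z => _) = (fun z : R * R => bump_at del 0 (z.2 - c z.1))); last first.
  by apply/funext => z; rewrite bump_at_shift.
apply: (bm_comp (F := bump_at del 0)); last exact: bm_bump_at.
by apply: measurable_funB => //; apply: measurableT_comp.
Qed.

Lemma bm_moving_plateau c d : measurable_fun setT c -> measurable_fun setT d ->
  bounded_measurable (fun z : R * R => plateau del (c z.1) (d z.1) z.2).
Proof.
have step_bm (k : R -> R) : measurable_fun setT k ->
    bounded_measurable (fun z : R * R => step ((z.2 - k z.1) / del)).
  move=> mk; apply: (bm_comp (F := step)).
    by apply: measurable_funM => //; apply: measurable_funB => //; exact: measurableT_comp.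
  split; first by apply: continuous_measurable_fun; exact: (smooth_step 0%N).
  by exists 1 => x; rewrite ger0_norm ?step_ge0 ?step_le1.
by move=> mc md; apply: bmB; exact: step_bm.
Qed.

Lemma bm_average E c : bounded_measurable E -> measurable_fun setT c ->
  bounded_measurable (fun t => average E t (c t)).
Proof.
move=> bE mc; apply: (bm_parameter (F := fun z => bump_at del (c z.1) z.2 * E (z.1, z.2))).
apply: bmM; first exact: bm_moving_bump.
by rewrite (_ : (fun z => _) = E)//; apply/funext => -[].
Qed.

Lemma bm_box E c d : bounded_measurable E -> measurable_fun setT c ->
  measurable_fun setT d -> bounded_measurable (fun t => box E t (c t) (d t)).
Proof.
move=> bE mc md.
apply: (bm_parameter (F := fun z => plateau del (c z.1) (d z.1) z.2 * E (z.1, z.2))).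
apply: bmM; first exact: bm_moving_plateau.
by rewrite (_ : (fun z => _) = E)//; apply/funext => -[].
Qed.

Lemma bm_through E Q c c1 : bounded_measurable E -> bounded_measurable Q ->
  measurable_fun setT c -> bounded_measurable c1 ->
  bounded_measurable (fun t => through E Q t (c t) (c1 t)).
Proof.
by move=> bE bQ mc bc1; apply: bmB; [|apply: bmM => //]; exact: bm_average.
Qed.

Lemma bm_balance E Q chi chi1 c c1 d d1 : bounded_measurable E -> bounded_measurable Q ->
  bounded_measurable chi -> bounded_measurable chi1 -> measurable_fun setT c ->
  bounded_measurable c1 -> measurable_fun setT d -> bounded_measurable d1 ->
  bounded_measurable (balance E Q chi chi1 c c1 d d1).
Proof.
move=> bE bQ bchi bchi1 mc bc1 md bd1; apply: bmD; apply: bmM => //; first exact: bm_box.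
by apply: bmB; exact: bm_through.
Qed.

Lemma balance_iterated E Q chi chi1 c c1 d d1 t :
  bounded_measurable E -> bounded_measurable Q ->
  balance E Q chi chi1 c c1 d d1 t =
  integ (- X) X (fun x =>
    E (t, x) * (chi1 t * plateau del (c t) (d t) x +
      chi t * (d1 t * bump_at del (d t) x - c1 t * bump_at del (c t) x)) +
    Q (t, x) * (chi t * (bump_at del (c t) x - bump_at del (d t) x))).
Proof.
move=> bE bQ; have bEt := bm_section1 t bE; have bQt := bm_section1 t bQ.
have b1 := bm_plateau del (c t) (d t).
have b2 := bm_bump_at (c t) del_gt0; have b3 := bm_bump_at (d t) del_gt0.
have h1 := bmM b1 bEt; have h2 := bmM b2 bEt; have h3 := bmM b3 bEt.
have h4 := bmM b2 bQt; have h5 := bmM b3 bQt.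
have k (h : R -> R) (k : R) : bounded_measurable h -> bounded_measurable (fun x => k * h x).
  by move=> bh; apply: bmM => //; exact: bm_cst.
have h6 := k _ (chi1 t) h1; have h7 := k _ (chi t * d1 t) h3.
have h8 := k _ (- (chi t * c1 t)) h2; have h9 := k _ (chi t) h4; have h10 := k _ (- chi t) h5.
rewrite (_ : (fun x => _) = (fun x => chi1 t * (plateau del (c t) (d t) x * E (t, x)) +
  (chi t * d1 t * (bump_at del (d t) x * E (t, x)) +
  (- (chi t * c1 t) * (bump_at del (c t) x * E (t, x)) +
  (chi t * (bump_at del (c t) x * Q (t, x)) +
   - chi t * (bump_at del (d t) x * Q (t, x))))))); last first.
  by apply/funext => x; ring.
have g1 := bmD h9 h10; have g2 := bmD h8 g1; have g3 := bmD h7 g2.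
rewrite (integD _ _ h6 g3) (integD _ _ h7 g2) (integD _ _ h8 g1) (integD _ _ h9 h10) !integZ//.
change (balance E Q chi chi1 c c1 d d1 t = chi1 t * box E t (c t) (d t) +
  (chi t * d1 t * average E t (d t) + (- (chi t * c1 t) * average E t (c t) +
  (chi t * average Q t (c t) + - chi t * average Q t (d t))))).
rewrite /balance /through.
move: (box _ _ _ _) (average E t (d t)) (average E t (c t)) (average Q t (c t)) (average Q t (d t)).
by clear; move=> *; ring.
Qed.

Lemma window_sub (c d x : R) : - X <= c -> d + del <= X ->
  c + del / 2 <= x -> x <= d + del -> - X <= x <= X.
Proof. by move: del_gt0 => ? ? ? ? ?; apply/andP; split; lra. Qed.

Definition admissible_cutoff (a b : R) chi : Prop :=
  [/\ 0 < a, a <= b, smooth chi, (forall t, 0 <= chi t) &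
      forall t, ~~ (a < t < b) -> chi t = 0].

Definition window (a b : R) c d : Prop :=
  forall t, a <= t <= b -> [/\ - X <= c t, c t <= d t & d t + del <= X].

Lemma cutoff_bm a b chi : admissible_cutoff a b chi ->
  [/\ bounded_measurable chi, bounded_measurable (derive1 chi) &
    forall t, ~~ (a < t < b) -> derive1 chi t = 0].
Proof.
move=> [_ _ schi chi_ge0 chi0].
suff chi1 t : ~~ (a < t < b) -> derive1 chi t = 0.
  split=> //.
    apply: (@smooth_bm _ _ a b); first exact: (schi 0%N).
    move=> x xab; apply: chi0; apply: contra xab => /andP[*]; apply/andP; split; exact: ltW.
  apply: (@smooth_bm _ _ a b); first exact: (smooth_derive1 schi 0%N).
  move=> x xab; apply: chi1; apply: contra xab => /andP[*]; apply/andP; split; exact: ltW.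
move=> tab; apply: der_at_derive1.
apply: (@derive1_at_min _ chi (t - 1) (t + 1)); first lra.
- by move=> x _; exact: (schi 1%N).1.
- by rewrite in_itv /=; apply/andP; split; lra.
- by move=> x _; rewrite [leLHS]chi0.
Qed.

Definition smooth_balanced E Q : Prop :=
  forall (a b L : R) chi c d, admissible_cutoff a b chi ->
    smooth c -> smooth d -> (forall t, `|derive1 c t| <= L) ->
    (forall t, `|derive1 d t| <= L) -> window a b c d ->
    0 <= integ a b (balance E Q chi (derive1 chi) c (derive1 c) d (derive1 d)).

Lemma smooth_measurable (f : R -> R) : smooth f -> measurable_fun setT f.
Proof. by move=> sf; apply: continuous_measurable_fun; exact: (sf 0%N). Qed.

Lemma bounded_derive (L : R) c : smooth c -> (forall t, `|derive1 c t| <= L) ->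
  bounded_measurable (derive1 c).
Proof.
by move=> sc cL; split; [apply: smooth_measurable; exact: smooth_derive1|exists L].
Qed.

Lemma bm_moving_derivative a b L chi c d : admissible_cutoff a b chi ->
    smooth c -> smooth d -> (forall t, `|derive1 c t| <= L) ->
    (forall t, `|derive1 d t| <= L) ->
  bounded_measurable (fun z : R * R =>
   derive1 chi z.1 * plateau del (c z.1) (d z.1) z.2 +
      chi z.1 * (derive1 d z.1 * bump_at del (d z.1) z.2 -
                 derive1 c z.1 * bump_at del (c z.1) z.2)) /\
  bounded_measurable (fun z : R * R =>
     chi z.1 * (bump_at del (c z.1) z.2 - bump_at del (d z.1) z.2)).
Proof.
move=> /cutoff_bm[b1 b2 _] sc sd cL dL.
have mc := smooth_measurable sc; have md := smooth_measurable sd.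
have fst_bm (f : R -> R) : bounded_measurable f -> bounded_measurable (fun z : R * R => f z.1).
  exact: bm_comp.
have h1 := bm_moving_bump mc; have h2 := bm_moving_bump md.
have h3 := bm_moving_plateau mc md.
have h4 := fst_bm _ b1; have h5 := fst_bm _ b2.
have h6 := fst_bm _ (bounded_derive sc cL); have h7 := fst_bm _ (bounded_derive sd dL).
split; last by apply: bmM => //; exact: bmB.
by apply: bmD; apply: bmM => //; apply: bmB; exact: bmM.
Qed.

Lemma integ_section1 (phi : R * R -> R) (a b x : R) : class_C2 1 phi -> a <= b ->
  integ a b (fun t => 'D_(1, 0) phi (t, x)) = phi (b, x) - phi (a, x).
Proof.
move=> [_ [d1 _ [c1 _] _]] ab.
apply: (@integ_der (fun t => phi (t, x)) (fun t => 'D_(1, 0) phi (t, x)) a b ab).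
  by move=> t; exact: (section1 (d1 (t, x))).
move=> t; apply: (@continuous_comp _ _ _ (fun t : R => (t, x)) ('D_(1, 0) phi)); last exact: c1.
exact: (cvg_pair (f := id) (g := fun=> x) cvg_id (cvg_cst x)).
Qed.

Lemma integ_section2 (phi : R * R -> R) (a b t : R) : class_C2 1 phi -> a <= b ->
  integ a b (fun x => 'D_(0, 1) phi (t, x)) = phi (t, b) - phi (t, a).
Proof.
move=> [_ [_ d2 _ [c2 _]]] ab.
apply: (@integ_der (fun x => phi (t, x)) (fun x => 'D_(0, 1) phi (t, x)) a b ab).
  by move=> x; exact: (section2 (d2 (t, x))).
move=> x; apply: (@continuous_comp _ _ _ (fun x : R => (t, x)) ('D_(0, 1) phi)); last exact: c2.
exact: (cvg_pair (f := fun=> t) (g := id) (cvg_cst t) cvg_id).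
Qed.

Lemma iterated_zero (F1 F2 : R * R -> R) (a b k k' : R) :
  bounded_measurable F1 -> bounded_measurable F2 ->
  (forall x, integ a b (fun t => F1 (t, x)) = 0) ->
  (forall t, a <= t <= b -> integ (- X) X (fun x => F2 (t, x)) = 0) ->
  integ a b (fun t => integ (- X) X (fun x => k * F1 (t, x) + k' * F2 (t, x))) = 0.
Proof.
move=> b1 b2 z1 z2.
rewrite (@eq_integ _ _ _ _ (fun t => k * integ (- X) X (fun x => F1 (t, x)))).
  rewrite integZ; last exact: bm_parameter.
  rewrite integ_Fubini// (@eq_integ _ _ _ _ (fun=> 0)); last by move=> x _; exact: z1.
  by rewrite -[X in integ _ _ X]/(fun x : R => 0 : R) /integ /Rintegral integral0 mulr0.
move=> t tab; have h1 := bm_section1 t b1; have h2 := bm_section1 t b2.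
by rewrite (integD _ _ (bmZ k h1) (bmZ k' h2)) !integZ// z2// mulr0 addr0.
Qed.

(** The integrand is a derivative of the compactly supported test function, in t for k and in x for
    k', and integrates to 0 in that variable. Relative entropies contain such constants. *)
Lemma constant_balanced (k k' : R) : smooth_balanced (fun=> k) (fun=> k').
Proof.
move=> a b L chi c d chiP sc sd cL dL W.
have [a0 ab schi chi_ge0 chi0] := chiP.
have [D1 D2] := bm_moving_derivative chiP sc sd cL dL.
have chi0' t : ~~ (a <= t <= b) -> chi t = 0.
  move=> h; apply: chi0; apply: contra h => /andP[*]; apply/andP; split; exact: ltW.
have [[C2 _] out P1 P2] := test_function_moving schi sc sd del_gt0 a0 chi0' W.
have XX : - X <= X.
  have /W[h1 h2 h3] : a <= a <= b by rewrite lexx.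
  by rewrite (le_trans h1)// (le_trans h2)// (le_trans _ h3)// lerDl ltW.
have E1 (x : R) : integ a b (fun t => 'D_(1, 0) (moving_plateau del chi c d) (t, x)) = 0.
  rewrite (integ_section1 x (C2 1%N) ab).
  by rewrite /moving_plateau /= !chi0 ?ltxx ?andbF// !mul0r subrr.
have E2 t : a <= t <= b -> integ (- X) X (fun x => 'D_(0, 1) (moving_plateau del chi c d) (t, x)) = 0.
  move=> tab; have [h1 h2 h3] := W t tab.
  rewrite (integ_section2 t (C2 1%N) XX) /moving_plateau /=.
  rewrite [in X in _ - X]plateau_out//; last first.
    apply/negP => /andP[h4 _]; have d2 : 0 < del / 2 by rewrite divr_gt0.
    by have := lt_le_trans (ltr_pwDr d2 h1) h4; rewrite ltxx.
  have step1 y : y + del <= X -> step ((X - y) / del) = 1.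
    by move=> yX; rewrite step_ge// ler_pdivlMr// mul1r lerBrDl.
  by rewrite mulr0 subr0 /plateau !step1 ?subrr ?mulr0// (le_trans _ h3)// lerD2r.
have [F1 eF1] : exists F : R * R -> R, F = 'D_(1, 0) (moving_plateau del chi c d).
  exists ('D_(1, 0) (moving_plateau del chi c d)); reflexivity.
have [F2 eF2] : exists F : R * R -> R, F = 'D_(0, 1) (moving_plateau del chi c d).
  exists ('D_(0, 1) (moving_plateau del chi c d)); reflexivity.
have bF1 : bounded_measurable F1 by rewrite eF1; move: D1; rewrite -(funext P1).
have bF2 : bounded_measurable F2 by rewrite eF2; move: D2; rewrite -(funext P2).
rewrite (@eq_integ _ _ _ _ (fun t => integ (- X) X (fun x => k * F1 (t, x) + k' * F2 (t, x)))).
  rewrite iterated_zero// => [x|t tab]; rewrite ?eF1 ?eF2; [exact: E1|exact: E2].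
move=> t _; rewrite balance_iterated; do ?exact: bm_cst.
by apply: eq_integ => x _; rewrite eF1 eF2 P1 P2.
Qed.

(** With [smooth_balancedZ], balanced pairs form a convex cone. It contains the affine functions of
    the solution, and so the relative entropies. *)
Lemma smooth_balancedD E Q E' Q' : bounded_measurable E -> bounded_measurable Q ->
  bounded_measurable E' -> bounded_measurable Q' ->
  smooth_balanced E Q -> smooth_balanced E' Q' ->
  smooth_balanced (fun z => E z + E' z) (fun z => Q z + Q' z).
Proof.
move=> bE bQ bE' bQ' S S' a b L chi c d chiP sc sd cL dL W.
have [b1 b2 _] := cutoff_bm chiP.
have [b3 b4] := (bounded_derive sc cL, bounded_derive sd dL).
have mc := smooth_measurable sc; have md := smooth_measurable sd.
have := addr_ge0 (S _ _ _ _ _ _ chiP sc sd cL dL W) (S' _ _ _ _ _ _ chiP sc sd cL dL W).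
rewrite -integD; [|exact: bm_balance..].
congr (0 <= _); apply: eq_integ => t _; rewrite !balance_iterated//; try exact: bmD.
have [D1 D2] := bm_moving_derivative chiP sc sd cL dL.
have h1 := bm_section1 t D1; have h2 := bm_section1 t D2.
have g1 := bm_section1 t bE; have g2 := bm_section1 t bQ.
have g3 := bm_section1 t bE'; have g4 := bm_section1 t bQ'.
rewrite -integD; last 2 first.
- by apply: bmD; [exact: (bmM g1 h1)|exact: (bmM g2 h2)].
- by apply: bmD; [exact: (bmM g3 h1)|exact: (bmM g4 h2)].
by apply: eq_integ => x _; ring.
Qed.

Lemma smooth_balancedZ E Q (k : R) : 0 <= k -> bounded_measurable E -> bounded_measurable Q ->
  smooth_balanced E Q -> smooth_balanced (fun z => k * E z) (fun z => k * Q z).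
Proof.
move=> k0 bE bQ S a b L chi c d chiP sc sd cL dL W.
have [b1 b2 _] := cutoff_bm chiP.
have [b3 b4] := (bounded_derive sc cL, bounded_derive sd dL).
have mc := smooth_measurable sc; have md := smooth_measurable sd.
have := mulr_ge0 k0 (S _ _ _ _ _ _ chiP sc sd cL dL W).
rewrite -integZ; last exact: bm_balance.
congr (0 <= _); apply: eq_integ => t _.
rewrite !balance_iterated//; [|by apply: bmM => //; exact: bm_cst..].
have [D1 D2] := bm_moving_derivative chiP sc sd cL dL.
have h1 := bm_section1 t D1; have h2 := bm_section1 t D2.
have g1 := bm_section1 t bE; have g2 := bm_section1 t bQ.
rewrite -integZ; last by apply: bmD; [exact: (bmM g1 h1)|exact: (bmM g2 h2)].
by apply: eq_integ => x _; ring.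
Qed.

Section solutions.
Variables (e q : R -> R) (u : R -> R -> R) (U : R * R -> R).
Hypotheses
  (me : measurable_fun (`]0, +oo[ `*` setT : set (measurableTypeR R * measurableTypeR R))
    (fun z => e (u z.1 z.2)))
  (mq : measurable_fun (`]0, +oo[ `*` setT : set (measurableTypeR R * measurableTypeR R))
    (fun z => q (u z.1 z.2)))
  (uU : forall t : R, 0 < t -> {ae leb, forall x : R, u t x = U (t, x)})
  (bE : bounded_measurable (fun z => e (U z))) (bQ : bounded_measurable (fun z => q (U z))).

Lemma balance_pairing (a b L : R) chi c d : admissible_cutoff a b chi ->
    smooth c -> smooth d -> (forall t, `|derive1 c t| <= L) ->
    (forall t, `|derive1 d t| <= L) -> window a b c d ->
  [/\ test_function (moving_plateau del chi c d), (forall z, 0 <= moving_plateau del chi c d z) &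
   weak_pairing e q u (moving_plateau del chi c d) =
   integ a b (balance (fun z => e (U z)) (fun z => q (U z)) chi (derive1 chi) c (derive1 c) d (derive1 d))].
Proof.
move=> chiP sc sd cL dL W.
have [a0 ab schi chi_ge0 chi0] := chiP.
have [D1 D2] := bm_moving_derivative chiP sc sd cL dL.
have chi0' t : ~~ (a <= t <= b) -> chi t = 0.
  move=> h; apply: chi0; apply: contra h => /andP[*]; apply/andP; split; exact: ltW.
have [tst out P1 P2] := test_function_moving schi sc sd del_gt0 a0 chi0' W.
have phi_ge0 z : 0 <= moving_plateau del chi c d z.
  have [zab|zab] := boolP (a <= z.1 <= b).
    by rewrite mulr_ge0// plateau_ge0//; have [] := W _ zab.
  by rewrite /moving_plateau chi0'// mul0r.
split => //.
rewrite /weak_pairing (@integral_iterated _ _ (fun z => e (U z) * 'D_(1, 0) (moving_plateau del chi c d) z +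
  q (U z) * 'D_(0, 1) (moving_plateau del chi c d) z) a b X)//.
- apply: eq_integ => t _; rewrite balance_iterated//; apply: eq_integ => x _.
  by rewrite P1 P2.
- apply: measurable_funD; apply: measurable_funM => //.
    by apply: measurable_funTS; case: D1; rewrite -(funext P1).
  by apply: measurable_funTS; case: D2; rewrite -(funext P2).
- apply: bmD; apply: bmM => //.
    by move: D1; rewrite -(funext P1).
  by move: D2; rewrite -(funext P2).
- move=> z zX; rewrite P1 P2.
  have [zab|nab] := boolP (a < z.1 < b); last first.
    have [_ _ ->//] := cutoff_bm chiP; by rewrite (chi0 _ nab) !mul0r addr0 !mulr0 addr0.
  have zab' : a <= z.1 <= b by case/andP: zab => *; apply/andP; split; exact: ltW.
  have [h1 h2 h3] := W _ zab'.
  have zX' : ~~ (- X <= z.2 <= X) by move: zX; rewrite zab'.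
  have inX (x : R) : c z.1 + del / 2 <= x -> x <= d z.1 + del -> - X <= x <= X.
    exact: (window_sub h1 h3).
  have d2 : 0 < del / 2 by rewrite divr_gt0.
  rewrite plateau_out//; last by apply: contra zX' => /andP[]; exact: inX.
  rewrite !bump_at_out//; last 2 first.
  - apply: contra zX' => /andP[/ltW h4 /ltW h5]; apply: inX => //.
    by rewrite (le_trans h5)// lerD2r.
  - apply: contra zX' => /andP[/ltW h4 /ltW h5]; apply: inX => //.
    by rewrite (le_trans _ h4)// lerD2r.
  by rewrite !(mulr0, subr0, addr0).
- by move=> t t0; apply: (ae_imp (uU t0)) => x /= ->.
Qed.

Lemma entropic_balanced : entropic e q u ->
  smooth_balanced (fun z => e (U z)) (fun z => q (U z)).
Proof.
move=> ent a b L chi c d chiP sc sd cL dL W.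
have [tst ge0 <-] := balance_pairing chiP sc sd cL dL W.
exact: ent.
Qed.

(** The conservation law is an equality, so the reversed inequality holds too; this is what allows
    negative multiples of the identity. *)
Lemma conserved_balanced : (forall phi, test_function phi -> weak_pairing e q u phi = 0) ->
  smooth_balanced (fun z => - e (U z)) (fun z => - q (U z)).
Proof.
move=> cons a b L chi c d chiP sc sd cL dL W.
have [tst _] := balance_pairing chiP sc sd cL dL W.
rewrite cons// => /(congr1 -%R); rewrite oppr0.
have [b1 b2 _] := cutoff_bm chiP.
have [b3 b4] := (bounded_derive sc cL, bounded_derive sd dL).
have mc := smooth_measurable sc; have md := smooth_measurable sd.
rewrite -integN; last exact: bm_balance.
move=> e0; rewrite [leRHS](_ : _ = 0)// e0; apply: eq_integ => t _.
have [bE' bQ'] := (bmN bE, bmN bQ).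
rewrite !balance_iterated//.
have [D1 D2] := bm_moving_derivative chiP sc sd cL dL.
have h1 := bm_section1 t D1; have h2 := bm_section1 t D2.
have g1 := bm_section1 t bE; have g2 := bm_section1 t bQ.
rewrite -integN; last by apply: bmD; [exact: (bmM g1 h1)|exact: (bmM g2 h2)].
by apply: eq_integ => x _; ring.
Qed.

End solutions.

End balances.

(** * One-sided mollification of curves *)

Section mollification.
Context {R : realType}.
Local Notation leb := (@lebesgue_measure R).
Implicit Types (psi k h : R -> R).

Definition supported (a b : R) psi : Prop := forall x, ~~ (a <= x <= b) -> psi x = 0.

Lemma supported_derive1 a b psi : supported a b psi -> supported a b (derive1 psi).
Proof.
move=> s x; rewrite negb_and -!ltNge => xab; apply: der_at_derive1.
apply: (@der_at_local _ _ _ (fun=> 0)); last exact: der_cst.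
case/orP: xab => xab; near=> y; apply: s; rewrite negb_and -!ltNge; apply/orP; [left|right].
  by near: y; exact: lt_nbhsl.
by near: y; exact: lt_nbhsr.
Unshelve. all: by end_near. Qed.

Lemma lipschitz_of_derive psi (B : R) : smooth psi -> (forall x, `|derive1 psi x| <= B) ->
  forall x y, `|psi x - psi y| <= B * `|x - y|.
Proof.
move=> spsi dB.
have dpsi z : der_at z psi (derive1 psi z) by apply: derivable_der_at; exact: (spsi 1%N).1.
suff lt x y : x < y -> `|psi x - psi y| <= B * `|x - y|.
  move=> x y; have [/lt//|/lt|->] := ltgtP x y; last by rewrite !subrr normr0 mulr0.
  by rewrite distrC [`|y - x|]distrC.
move=> xy; have [c [_ e]] := mean_value xy (fun z _ => dpsi z).
rewrite distrC e normrM [`|x - y|]distrC; apply: ler_wpM2r => //; exact: dB.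
Qed.

Lemma taylor1 psi a b : smooth psi -> supported a b psi ->
  exists B : R, 0 <= B /\ forall x t, `|psi (x + t) - psi x - t * derive1 psi x| <= B * t ^+ 2.
Proof.
move=> spsi sab; have s1 := smooth_derive1 spsi; have s2 := smooth_derive1 s1.
have [_ [B BP]] := smooth_bm (s2 0%N) (supported_derive1 (supported_derive1 sab)).
have dpsi z : der_at z psi (derive1 psi z) by apply: derivable_der_at; exact: (spsi 1%N).1.
exists B; split; first by apply: le_trans (BP 0).
have lip := lipschitz_of_derive s1 BP.
have bnd x y z : `|y - x| <= `|z| -> `|derive1 psi y - derive1 psi x| * `|z| <= B * z ^+ 2.
  move=> yx; rewrite -real_normK ?num_real// expr2 mulrA ler_wpM2r//.
  apply: le_trans (lip _ _) _; apply: ler_wpM2l => //; exact: le_trans (BP 0).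
move=> x t; have [t0|t0|->] := ltgtP t 0.
- have xt : x + t < x by lra.
  have [c [/andP[c1 c2] e]] := mean_value xt (fun z _ => dpsi z).
  have -> : psi (x + t) - psi x - t * derive1 psi x = (derive1 psi c - derive1 psi x) * t.
    have e' : psi (x + t) = psi x - derive1 psi c * (x - (x + t)) by rewrite -e; ring.
    rewrite e'; ring.
  rewrite normrM; apply: bnd; rewrite !ltr0_norm ?subr_lt0//; lra.
- have xt : x < x + t by lra.
  have [c [/andP[c1 c2] e]] := mean_value xt (fun z _ => dpsi z).
  have -> : psi (x + t) - psi x - t * derive1 psi x = (derive1 psi c - derive1 psi x) * t.
    rewrite e; ring.
  rewrite normrM; apply: bnd; rewrite !gtr0_norm ?subr_gt0//; lra.
- by rewrite addr0 subrr mul0r subr0 normr0 expr0n /= mulr0.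
Qed.

Definition convolve (u v : R) psi k (r : R) : R := integ u v (fun s => psi (s - r) * k s).

Lemma bm_translate psi a b (r : R) : smooth psi -> supported a b psi ->
  bounded_measurable (fun s : R => psi (s - r)).
Proof.
move=> spsi sab; apply: (bm_comp (F := psi)); last exact: smooth_bm (spsi 0%N) sab.
exact: measurable_funB.
Qed.

(** Differentiation under the integral sign: the second-order Taylor remainder of psi is uniform, so
    the increment of the convolution is its linear part up to O(t^2). *)
Lemma der_convolve u v psi k a b r : smooth psi -> supported a b psi -> bounded_measurable k ->
  der_at r (convolve u v psi k) (- convolve u v (derive1 psi) k r).
Proof.
move=> spsi sab bk; have [B [B0 T]] := taylor1 spsi sab; have [_ [K kK]] := bk.
have [uv|vu] := leP u v; last first.
  rewrite (_ : convolve u v psi k = fun=> 0).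
    by apply: der_eq (der_cst _ _) _; rewrite /convolve integ_ltNge// oppr0.
  by apply/funext => x; rewrite /convolve integ_ltNge.
pose F := convolve u v psi k; pose d := - convolve u v (derive1 psi) k r.
pose f (t : R) := F (r + t) - F r - t * d.
have fq t : `|f t| <= B * K * (v - u) * t ^+ 2.
  have b1 x := bmM (bm_translate x spsi sab) bk.
  have b2 := bmM (bm_translate r (smooth_derive1 spsi) (supported_derive1 sab)) bk.
  have -> : f t = integ u v (fun s => (psi ((s - r) + - t) - psi (s - r) - - t * derive1 psi (s - r)) * k s).
    rewrite /f /F /d /convolve mulrN opprK -integB// -integZ// -integD//; last 2 first.
    - exact: bmB.
    - exact: bmZ.
    by apply: eq_integ => s _; rewrite opprD addrA; ring.
  have -> : B * K * (v - u) * t ^+ 2 = (B * t ^+ 2 * K) * (v - u) by ring.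
  apply: integ_norm_le => //.
    apply: bmM => //; apply: bmB; first apply: bmB.
    - apply: (bm_comp (F := psi)); last exact: smooth_bm (spsi 0%N) sab.
      by apply: measurable_funD => //; exact: measurable_funB.
    - exact: bm_translate spsi sab.
    - apply: bmZ; exact: bm_translate (smooth_derive1 spsi) (supported_derive1 sab).
  move=> s _; rewrite normrM ler_pM//; have := T (s - r) (- t); by rewrite sqrrN.
have f0 : f 0 = 0 by rewrite /f addr0 mul0r subr0 subrr.
have df := der_at_quadratic f0 fq.
have FE : F = fun y => F r + (f (y - r) + d * (y - r)).
  by apply/funext => y; rewrite /f (_ : r + (y - r) = y); ring.
rewrite [X in der_at r X _]FE; apply: der_eq.
  apply: derD; first exact: der_cst.
  apply: derD.
    apply: (@der_comp _ _ f (fun y => y - r)); first by rewrite subrr; exact: df.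
    by apply: derB; [exact: der_id|exact: der_cst].
  by apply: der_scale; apply: derB; [exact: der_id|exact: der_cst].
by rewrite /= subr0 mul0r !add0r mulr1.
Qed.

Lemma smooth_convolve u v psi k a b : smooth psi -> supported a b psi ->
  bounded_measurable k -> smooth (convolve u v psi k).
Proof.
move=> + + bk n; elim: n psi => [|n IH] psi spsi sab.
  by move=> x; exact: der_continuous (der_convolve u v x spsi sab bk).
apply: Cn_der => [x|]; first exact: (der_convolve u v x spsi sab bk).
have := IH _ (smooth_derive1 spsi) (supported_derive1 sab).
move=> /(CnM (Cn_cst n (-1))); rewrite (_ : (fun x => _) = fun x => - convolve u v (derive1 psi) k x)//.
by apply/funext => x; rewrite mulN1r.
Qed.

Lemma supported_bump_at e : 0 < e -> supported 0 e (bump_at e 0).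
Proof.
move=> e0 x h; apply: bump_at_out => //; apply: contra h => /andP[h1 h2].
have e2 : 0 < e / 2 by rewrite divr_gt0.
by rewrite -[e]add0r (ltW h2) andbT (le_trans _ (ltW h1))// add0r ltW.
Qed.

(** An average of k over ]r + e / 2, r + e[, on the right of r only. Smoothing a curve on [a, b]
    thus uses none of its values before a. *)
Definition mollify (u v e : R) k : R -> R := convolve u v (bump_at e 0) k.

Lemma smooth_mollify u v e k : 0 < e -> bounded_measurable k -> smooth (mollify u v e k).
Proof.
by move=> e0 bk; exact: (smooth_convolve _ _ (smooth_bump_at e 0) (supported_bump_at e0) bk).
Qed.

Lemma derive_mollify u v e k r : 0 < e -> bounded_measurable k ->
  derive1 (mollify u v e k) r = - convolve u v (derive1 (bump_at e 0)) k r.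
Proof.
move=> e0 bk; apply: der_at_derive1.
exact: (der_convolve _ _ r (smooth_bump_at e 0) (supported_bump_at e0) bk).
Qed.

Section bounds.
Variables (u v e r : R).
Hypotheses (e_gt0 : 0 < e) (ur : u <= r) (rv : r + 2 * e <= v).

Lemma mollify_le k k' : bounded_measurable k -> bounded_measurable k' ->
  (forall s, r <= s <= r + e -> k s <= k' s) -> mollify u v e k r <= mollify u v e k' r.
Proof.
move=> bk bk' kk'.
have bb := bm_translate r (smooth_bump_at e 0) (supported_bump_at e_gt0).
apply: integ_le => [||s _]; [exact: bmM|exact: bmM|].
have [sr|sr] := boolP (r <= s <= r + e); first by rewrite ler_wpM2l ?bump_at_ge0// kk'.
rewrite (supported_bump_at e_gt0) ?mul0r//; apply: contra sr => /andP[h1 h2].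
by apply/andP; split; lra.
Qed.

Lemma mollify_cst (K : R) : mollify u v e (fun=> K) r = K.
Proof.
transitivity (integ u v (fun s => K * bump_at e r s)).
  by apply: eq_integ => s _; rewrite bump_at_shift mulrC.
rewrite integZ; last exact: bm_bump_at.
rewrite integ_bump_at ?mulr1//; move: e_gt0 ur rv => *; lra.
Qed.

Lemma bump_shift_out s : s <= r \/ r + e <= s -> bump_at e 0 (s - r) = 0.
Proof.
have e2 : 0 < e / 2 by rewrite divr_gt0.
move=> h; apply: bump_at_out => //; rewrite negb_and -!leNgt !add0r; apply/orP.
by case: h => h; [left|right]; lra.
Qed.

Lemma derive_bump_out s : s <= r \/ r + 2 * e <= s -> derive1 (bump_at e 0) (s - r) = 0.
Proof.
have e2 : 0 < e / 2 by rewrite divr_gt0.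
have sup : supported (e / 2) e (bump_at e 0).
  move=> x h; apply: bump_at_out => //; rewrite !add0r.
  by apply: contra h => /andP[h1 h2]; apply/andP; split; exact: ltW.
move=> h; apply: (supported_derive1 sup); rewrite negb_and -!ltNge; apply/orP.
by case: h => h; [left|right]; lra.
Qed.

Let bdb := bm_translate r (smooth_derive1 (smooth_bump_at e 0)) (supported_derive1 (supported_bump_at e_gt0)).
Let uv : u <= v. Proof. by move: e_gt0 ur rv => *; lra. Qed.
Let re : r + e <= v. Proof. by move: e_gt0 ur rv => *; lra. Qed.

Lemma der_bump_shift s : der_at s (fun s => bump_at e 0 (s - r)) (derive1 (bump_at e 0) (s - r)).
Proof.
apply: der_eq.
  apply: (@der_comp _ _ (bump_at e 0) (fun s => s - r)).
    by apply: derivable_der_at; exact: (smooth_bump_at e 0 1%N).1.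
  by apply: derB; [exact: der_id|exact: der_cst].
by rewrite /= subr0 mulr1.
Qed.

Let cdb : continuous (fun s : R => derive1 (bump_at e 0) (s - r)).
Proof.
move=> s; apply: (@continuous_comp _ _ _ (fun s => s - r) (derive1 (bump_at e 0))).
  by apply: cvgB; [exact: cvg_id|exact: cvg_cst].
exact: (smooth_derive1 (smooth_bump_at e 0) 0%N).
Qed.

Let ends : bump_at e 0 (v - r) = 0 /\ bump_at e 0 (u - r) = 0.
Proof. by split; apply: bump_shift_out; [right|left]. Qed.

Lemma derive_bump_mass : integ u v (fun s => derive1 (bump_at e 0) (s - r)) = 0.
Proof. by rewrite (integ_der uv der_bump_shift cdb) !ends.1 ends.2 subrr. Qed.

Let bmove : bounded_measurable (fun s : R => derive1 (bump_at e 0) (s - r) * (s - r)).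
Proof.
pose w (x : R) := derive1 (bump_at e 0) x * x.
apply: (bm_comp (F := w)); first exact: measurable_funB.
apply: (@smooth_bm _ _ 0 e).
  by move=> x; apply: cvgM; [exact: (smooth_derive1 (smooth_bump_at e 0) 0%N)|exact: cvg_id].
by move=> x h; rewrite /w (supported_derive1 (supported_bump_at e_gt0)) ?mul0r.
Qed.

Lemma derive_bump_moment : integ u v (fun s => derive1 (bump_at e 0) (s - r) * (s - r)) = - 1.
Proof.
have dm s : der_at s (fun s => bump_at e 0 (s - r) * (s - r))
    (derive1 (bump_at e 0) (s - r) * (s - r) + bump_at e 0 (s - r)).
  apply: der_eq; first apply: derM.
  - exact: der_bump_shift.
  - by apply: derB; [exact: der_id|exact: der_cst].
  - by rewrite /= subr0 mulr1.
have cm : continuous (fun s : R => derive1 (bump_at e 0) (s - r) * (s - r) + bump_at e 0 (s - r)).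
  move=> s; apply: cvgD; last exact: der_continuous (der_bump_shift s).
  by apply: cvgM; [exact: cdb|apply: cvgB; [exact: cvg_id|exact: cvg_cst]].
have bb := bm_translate r (smooth_bump_at e 0) (supported_bump_at e_gt0).
have := integ_der uv dm cm; rewrite ends.1 ends.2 !mul0r subrr (integD _ _ bmove bb).
rewrite (_ : integ u v (fun s => bump_at e 0 (s - r)) = 1).
  by move=> /eqP; rewrite addr_eq0 => /eqP.
rewrite (@eq_integ _ _ _ _ (bump_at e r)); last by move=> s _; rewrite bump_at_shift.
rewrite integ_bump_at//; move: e_gt0 ur rv => *; lra.
Qed.

Lemma derive_bump_at_le B x : (forall x, `|derive1 (bump : R -> R) x| <= B) ->
  `|derive1 (bump_at e 0) x| <= B / e ^+ 2.
Proof.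
move=> bB; rewrite (@der_at_derive1 _ _ _ (derive1 bump ((x - 0) / e) / e ^+ 2)).
  rewrite normrM [X in _ * X]ger0_norm ?invr_ge0 ?sqr_ge0//.
  by apply: ler_wpM2r; rewrite ?invr_ge0 ?sqr_ge0.
apply: der_eq.
  apply: (@derM _ _ (fun x => bump ((x - 0) / e)) (fun=> e^-1)); last exact: der_cst.
  apply: (@der_comp _ _ bump (fun x => (x - 0) / e)).
    by apply: derivable_der_at; exact: (smooth_bump 1%N).1.
  apply: (@derM _ _ (fun x => x - 0) (fun=> e^-1)); last exact: der_cst.
  by apply: derB; [exact: der_id|exact: der_cst].
by rewrite /=; field; rewrite gt_eqF.
Qed.

(** The derivative of the kernel has mass 0 and first moment - 1, so the mollified derivative is
    exact on affine functions. What is left is an error eta e, integrated against a kernel of size B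
    / e^2 over a length 2 e. It serves both for the uniform bound, with g = 0, and for convergence
    at points of differentiability. *)
Lemma derive_mollify_close k (g B eta : R) : bounded_measurable k ->
  (forall x, `|derive1 (bump : R -> R) x| <= B) ->
  (forall s, r <= s <= r + 2 * e -> `|k s - k r - g * (s - r)| <= eta * e) ->
  `|derive1 (mollify u v e k) r - g| <= 2 * B * eta.
Proof.
move=> bk bB kg.
pose w s := derive1 (bump_at e 0) (s - r) * (k s - k r - g * (s - r)).
have wE : w = fun s => derive1 (bump_at e 0) (s - r) * k s -
    (k r * derive1 (bump_at e 0) (s - r) + g * (derive1 (bump_at e 0) (s - r) * (s - r))).
  by apply/funext => s; rewrite /w; ring.
have b1 := bmM bdb bk.
have b2 := bmD (bmZ (k r) bdb) (bmZ g bmove).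
have bw : bounded_measurable w by rewrite wE; exact: bmB.
have -> : derive1 (mollify u v e k) r - g = - integ u v w.
  rewrite derive_mollify// wE (integB _ _ b1 b2) (integD _ _ (bmZ (k r) bdb) (bmZ g bmove)).
  rewrite (integZ _ _ _ bdb) (integZ _ _ _ bmove) derive_bump_mass derive_bump_moment /convolve.
  ring.
have w0 s : s <= r \/ r + 2 * e <= s -> w s = 0 by move=> h; rewrite /w derive_bump_out// mul0r.
have r2 : r <= r + 2 * e by rewrite lerDl mulr_ge0// ltW.
rewrite normrN (integ_chasles bw ur (le_trans r2 rv)) (integ_chasles bw r2 rv).
rewrite (@eq_integ _ u r _ (fun=> 0)); last by move=> s /andP[_ sr]; apply: w0; left.
rewrite (@eq_integ _ (r + 2 * e) v _ (fun=> 0)); last by move=> s /andP[sr _]; apply: w0; right.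
rewrite !integ_cst// !mul0r add0r addr0.
have -> : 2 * B * eta = B / e ^+ 2 * (eta * e) * (r + 2 * e - r) by field; rewrite gt_eqF.
apply: integ_norm_le => // s sr; rewrite normrM ler_pM//; last exact: kg.
exact: derive_bump_at_le.
Qed.

End bounds.

Lemma derive_mollify_bounded (u v e : R) k : 0 < e -> bounded_measurable k ->
  exists B : R, forall r, `|derive1 (mollify u v e k) r| <= B.
Proof.
move=> e0 bk; have [_ [K kK]] := bk.
have s1 := smooth_derive1 (smooth_bump_at e 0).
have s2 := supported_derive1 (supported_bump_at e0).
have [_ [B bB]] := smooth_bm (s1 0%N) s2.
exists (B * K * `|v - u|) => r; rewrite derive_mollify// normrN /convolve.
have [uv|vu] := leP u v.
  rewrite [`|v - u|]ger0_norm ?subr_ge0//; apply: integ_norm_le => //.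
    by apply: bmM => //; exact: bm_translate s1 s2.
  by move=> s _; rewrite normrM ler_pM.
by rewrite integ_ltNge// normr0 !mulr_ge0//; [apply: le_trans (bB 0)|apply: le_trans (kK 0)].
Qed.

Lemma der_at_close x f d (eta : R) : 0 < eta -> der_at x f d ->
  exists rho : R, 0 < rho /\ forall y, `|y - x| <= rho ->
    `|f y - f x - d * (y - x)| <= eta * `|y - x|.
Proof.
move=> eta0 [df <-].
have /cvgrPdist_le /(_ _ eta0) : (fun t : R => t^-1 *: (f (t *: 1 + x) - f x)) @ 0^' --> 'D_1 f x by [].
move=> [rho /= rho0 H]; exists (rho / 2); split; first by rewrite divr_gt0.
move=> y yx; have [->|ne] := eqVneq y x; first by rewrite !subrr mulr0 subr0 normr0 mulr0.
have yx0 : y - x != 0 by rewrite subr_eq0.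
have := H (y - x); rewrite /= sub0r normrN => /(_ _ yx0) {}H.
have {}H : `|'D_1 f x - (y - x)^-1 * (f y - f x)| <= eta.
  have := H _; rewrite /GRing.scale /= mulr1 subrK; apply.
  by rewrite (le_lt_trans yx)// ltr_pdivrMr// ltr_pMr// ltr1n.
have -> : f y - f x - 'D_1 f x * (y - x) = - (('D_1 f x - (y - x)^-1 * (f y - f x)) * (y - x)).
  by field.
by rewrite normrN normrM ler_wpM2r.
Qed.

End mollification.

Section sequences.
Context {R : realType}.

Lemma continuous_seq (g : R -> R) (v_ : nat -> R) (v : R) : continuous g ->
  v_ n @[n --> \oo] --> v -> g (v_ n) @[n --> \oo] --> g v.
Proof. by move=> cg cv; apply: (cvg_comp _ _ cv); exact: cg. Qed.

Lemma cvg_dist_le (v_ w : nat -> R) (v : R) : (forall n, `|v_ n - v| <= w n) ->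
  w n @[n --> \oo] --> (0 : R) -> v_ n @[n --> \oo] --> v.
Proof.
move=> vw w0; apply/cvgrPdist_le => e e0; near=> n.
rewrite distrC (le_trans (vw n))//; near: n.
by apply: (cvgr_le (0 : R)).
Unshelve. all: by end_near. Qed.

End sequences.

(** * Extension of the balances to Lipschitz sides *)

Section lipschitz_balance.
Context {R : realType}.
Local Notation leb := (@lebesgue_measure R).
Implicit Types (chi c d : R -> R) (E Q : R * R -> R).
Variables (del X : R).
Hypothesis del_gt0 : 0 < del.

Definition lipschitz_with (L : R) c : Prop := forall x y, `|c x - c y| <= L * `|x - y|.

(** The window condition extends to b + 1 because smoothing a side at a time t looks ahead, by less
    than 1. *)
Definition balanced E Q : Prop :=
  forall (a b L : R) chi c d c1 d1, admissible_cutoff a b chi ->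
    lipschitz_with L c -> lipschitz_with L d ->
    bounded_measurable c1 -> bounded_measurable d1 ->
    {ae leb, forall t, a <= t <= b -> der_at t c (c1 t)} ->
    {ae leb, forall t, a <= t <= b -> der_at t d (d1 t)} ->
    window del X a (b + 1) c d ->
    0 <= integ a b (balance del X E Q chi (derive1 chi) c c1 d d1).

Definition width (n : nat) : R := n.+2%:R^-1.

Lemma width_gt0 n : 0 < width n. Proof. by rewrite invr_gt0. Qed.

Lemma width_le n : 2 * width n <= 1.
Proof. by rewrite /width ler_pdivrMr// mul1r ler_nat. Qed.

Lemma cvg_width : width n @[n --> \oo] --> (0 : R).
Proof.
by have := @cvg_harmonic R; rewrite -(cvg_shiftS (@harmonic R)).
Qed.

Section curve.
Variables (a b L : R) (c c1 : R -> R).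
Hypotheses (ab : a <= b) (cL : lipschitz_with L c).
Hypothesis (cX : forall t, a <= t <= b + 1 -> - X <= c t <= X).

Definition truncated (s : R) : R := Num.max (- X) (Num.min X (c s)).
Definition smoothed (n : nat) : R -> R := mollify a (b + 1) (width n) truncated.

Lemma truncatedE s : a <= s <= b + 1 -> truncated s = c s.
Proof. by move=> /cX /andP[h1 h2]; rewrite /truncated min_r// max_r. Qed.

Lemma bm_truncated : bounded_measurable truncated.
Proof.
have cc := lipschitz_within cL.
split.
  apply: measurable_maxr => //; apply: measurable_minr => //.
  exact: continuous_measurable_fun.
have X0 : - X <= X.
  by have /andP[h1 h2] : - X <= c a <= X; [apply: cX; rewrite lexx /=; move: ab; lra|exact: le_trans h2].
exists X => s; rewrite ler_norml le_max lexx /= ge_max X0 ge_min lexx //.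
Qed.

Lemma smooth_smoothed n : smooth (smoothed n).
Proof. exact: smooth_mollify (width_gt0 n) bm_truncated. Qed.

Let sub (n : nat) r s : a <= r <= b -> r <= s <= r + 2 * width n -> a <= s <= b + 1.
Proof. by have := width_le n; move=> h /andP[h1 h2] /andP[h3 h4]; apply/andP; split; lra. Qed.

Let r2 (n : nat) r : a <= r <= b -> a <= r /\ r + 2 * width n <= b + 1.
Proof. by have := width_le n; move=> h /andP[h1 h2]; split; lra. Qed.

Let L_ge0 : 0 <= L.
Proof. by have := cL 1 0; rewrite subr0 normr1 mulr1; apply: le_trans. Qed.

Let near_r (n : nat) r s : r <= s <= r + 2 * width n -> `|s - r| <= 2 * width n.
Proof. by move=> /andP[h1 h2]; rewrite ger0_norm; lra. Qed.

Lemma smoothed_close n r : a <= r <= b -> `|smoothed n r - c r| <= 2 * L * width n.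
Proof.
move=> rab; have [h1 h2] := r2 n rab; have w0 := width_gt0 n.
have bt := bm_truncated.
have close s : r <= s <= r + width n -> `|truncated s - c r| <= 2 * L * width n.
  move=> /andP[s1 s2]; have s3 : r <= s <= r + 2 * width n by apply/andP; split; lra.
  rewrite truncatedE; last exact: sub s3.
  apply: le_trans (cL _ _) _; rewrite [2 * L]mulrC -mulrA; apply: ler_wpM2l => //.
  exact: near_r s3.
rewrite ler_norml; apply/andP; split.
  have := @mollify_le _ a (b + 1) _ r w0 _ _ (bm_cst _ (c r - 2 * L * width n)) bt.
  rewrite (mollify_cst w0 h1 h2) => le; rewrite lerBrDl; apply: le => s /close.
  by rewrite ler_norml => /andP[? _]; lra.
have := @mollify_le _ a (b + 1) _ r w0 _ _ bt (bm_cst _ (c r + 2 * L * width n)).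
rewrite (mollify_cst w0 h1 h2) => le; rewrite lerBlDl; apply: le => s /close.
by rewrite ler_norml => /andP[_ ?]; lra.
Qed.

Lemma smoothed_cvg r : a <= r <= b -> smoothed n r @[n --> \oo] --> c r.
Proof.
move=> rab; apply: (cvg_dist_le (w := fun n => 2 * L * width n)).
  by move=> n; exact: smoothed_close.
by rewrite -[X in _ --> X](mulr0 (2 * L)); apply: cvgM; [exact: cvg_cst|exact: cvg_width].
Qed.

Variable (B : R).
Hypothesis bB : forall x, `|derive1 (bump : R -> R) x| <= B.

Lemma derive_smoothed_le n r : a <= r <= b -> `|derive1 (smoothed n) r| <= 2 * B * (2 * L).
Proof.
move=> rab; have [h1 h2] := r2 n rab.
rewrite -[X in `|X|]subr0.
apply: (derive_mollify_close (width_gt0 n) h1 h2 bm_truncated bB) => s sr.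
rewrite mul0r subr0 !truncatedE; [|apply: (sub (n := n) (r := r))..] => //; last first.
  by rewrite lexx lerDl mulr_ge0// ltW ?width_gt0.
apply: le_trans (cL _ _) _; rewrite [2 * L]mulrC -mulrA; apply: ler_wpM2l => //.
exact: near_r sr.
Qed.

Lemma derive_smoothed_cvg r : a <= r <= b -> der_at r c (c1 r) ->
  derive1 (smoothed n) r @[n --> \oo] --> c1 r.
Proof.
move=> rab dc; apply/cvgrPdist_le => e e0.
have B0 : 0 <= B by apply: le_trans (bB 0).
pose eta := e / (2 * B * 2 + 1).
have D0 : 0 < 2 * B * 2 + 1 by rewrite ltr_wpDl// !mulr_ge0.
have eta0 : 0 < eta by rewrite divr_gt0.
have [rho [rho0 H]] := der_at_close eta0 dc.
have w2 : \forall n \near \oo, width n < rho / 2.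
  by apply: (cvgr_lt (0 : R)); [exact: cvg_width|rewrite divr_gt0].
near=> n; have [h1 h2] := r2 n rab.
have wr : 2 * width n <= rho.
  have : width n < rho / 2 by near: n.
  by rewrite ltr_pdivlMr// mulrC => /ltW.
rewrite distrC; apply: le_trans (_ : 2 * B * (eta * 2) <= e).
  apply: (derive_mollify_close (width_gt0 n) h1 h2 bm_truncated bB) => s sr.
  rewrite !truncatedE; [|apply: (sub (n := n) (r := r))..] => //; last first.
    by rewrite lexx lerDl mulr_ge0// ltW ?width_gt0.
  have nr := near_r sr.
  apply: le_trans (H _ (le_trans nr wr)) _; rewrite -[leRHS]mulrA.
  exact: (ler_wpM2l (ltW eta0) nr).
have -> : 2 * B * (eta * 2) = e * ((2 * B * 2) / (2 * B * 2 + 1)) by rewrite /eta; ring.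
by rewrite ger_pMr// ler_pdivrMr// mul1r lerDl.
Unshelve. all: by end_near. Qed.

End curve.

Lemma bump_derive_bounded : exists B : R, forall x, `|derive1 (bump : R -> R) x| <= B.
Proof.
have sup : supported (1 / 2) 1 (bump : R -> R).
  move=> x h; apply: bump_out; apply: contra h => /andP[h1 h2].
  by apply/andP; split; exact: ltW.
by have [_] := smooth_bm (smooth_derive1 smooth_bump 0%N) (supported_derive1 sup).
Qed.

(** A single operator smooths both sides of a region. It is a positive average, so it keeps their
    order and their bounds by constants, hence the window condition. *)
Lemma smoothing a b L : a <= b -> exists Sm : (R -> R) -> nat -> R -> R,
  (forall c, lipschitz_with L c -> (forall t, a <= t <= b + 1 -> - X <= c t <= X) ->
   [/\ (forall n, smooth (Sm c n)),
       (forall n, exists B : R, forall t, `|derive1 (Sm c n) t| <= B),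
       (exists B : R, forall n t, a <= t <= b -> `|derive1 (Sm c n) t| <= B),
       (forall t, a <= t <= b -> Sm c n t @[n --> \oo] --> c t) &
       (forall t g, a <= t <= b -> der_at t c g ->
         derive1 (Sm c n) t @[n --> \oo] --> g)] /\
   (forall n t K, a <= t <= b -> (forall s, a <= s <= b + 1 -> K <= c s) -> K <= Sm c n t) /\
   (forall n t K, a <= t <= b -> (forall s, a <= s <= b + 1 -> c s <= K) -> Sm c n t <= K)) /\
  (forall c d, lipschitz_with L c -> (forall t, a <= t <= b + 1 -> - X <= c t <= X) ->
     lipschitz_with L d -> (forall t, a <= t <= b + 1 -> - X <= d t <= X) ->
     (forall t, a <= t <= b + 1 -> c t <= d t) ->
     forall n t, a <= t <= b -> Sm c n t <= Sm d n t).
Proof.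
move=> ab; exists (smoothed a b).
have tb n t : a <= t <= b -> a <= t /\ t + 2 * width n <= b + 1.
  by move=> /andP[at' tb]; have := width_le n; split; lra.
have inW n t s : a <= t <= b -> t <= s <= t + width n -> a <= s <= b + 1.
  move=> /(tb n)[h1 h2] /andP[h3 h4]; have w0 := width_gt0 n.
  by apply/andP; split; lra.
split; last first.
  move=> c d cL cX dL dX cd n t tab; apply: mollify_le.
  - exact: width_gt0.
  - exact: bm_truncated ab cL cX.
  - exact: bm_truncated ab dL dX.
  - by move=> s /(inW _ _ _ tab) sab; rewrite (truncatedE cX sab) (truncatedE dX sab); exact: cd.
move=> c cL cX; have bt := bm_truncated ab cL cX; split; last split.
- have [B bB] := bump_derive_bounded; split.
  + by move=> n; exact: smooth_smoothed ab cL cX n.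
  + by move=> n; exact: derive_mollify_bounded (width_gt0 n) bt.
  + by exists (2 * B * (2 * L)) => n t; exact: derive_smoothed_le ab cL cX _ bB n t.
  + by move=> t; exact: smoothed_cvg ab cL cX t.
  + by move=> t g tab dg; exact: (derive_smoothed_cvg ab cL cX (c1 := fun=> g) bB tab dg).
- move=> n t K tab Kc; have [h1 h2] := tb n t tab.
  rewrite -(mollify_cst (width_gt0 n) h1 h2 K); apply: mollify_le => //.
  + exact: width_gt0.
  + exact: bm_cst.
  + by move=> s /(inW _ _ _ tab) sab; rewrite (truncatedE cX sab); exact: Kc.
- move=> n t K tab Kc; have [h1 h2] := tb n t tab.
  rewrite -(mollify_cst (width_gt0 n) h1 h2 K); apply: mollify_le => //.
  + exact: width_gt0.
  + exact: bm_cst.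
  + by move=> s /(inW _ _ _ tab) sab; rewrite (truncatedE cX sab); exact: Kc.
Qed.

Lemma average_cvg E t (y_ : nat -> R) y : bounded_measurable E -> y_ n @[n --> \oo] --> y ->
  average del X E t (y_ n) @[n --> \oo] --> average del X E t y.
Proof.
move=> bE cy; have [mE [K EK]] := bm_section1 t bE.
have [_ [B bB]] := bm_bump_at 0 del_gt0.
have bb z := bm_bump_at z del_gt0.
have bEt := bm_section1 t bE.
apply: (integ_dominated (B := B * K)).
- by move=> n; case: (bmM (bb (y_ n)) bEt).
- exact: bmM.
- by move=> n x; rewrite normrM ler_pM// -bump_at_shift.
- apply: aeW => x _; apply: cvgM; last exact: cvg_cst.
  under eq_cvg do rewrite -bump_at_shift; rewrite -bump_at_shift.
  apply: (continuous_seq (g := bump_at del 0)); first exact: (smooth_bump_at del 0 0%N).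
  by apply: cvgB => //; exact: cvg_cst.
Qed.

Lemma box_cvg E t (y_ z_ : nat -> R) y z : bounded_measurable E ->
  y_ n @[n --> \oo] --> y -> z_ n @[n --> \oo] --> z ->
  box del X E t (y_ n) (z_ n) @[n --> \oo] --> box del X E t y z.
Proof.
move=> bE cy cz; have [mE [K EK]] := bm_section1 t bE.
have bp u v := bm_plateau del u v.
have bEt := bm_section1 t bE.
have stepc (u_ : nat -> R) u x : u_ n @[n --> \oo] --> u ->
    step ((x - u_ n) / del) @[n --> \oo] --> step ((x - u) / del).
  move=> cu; apply: (continuous_seq (g := step)); first exact: (smooth_step 0%N).
  by apply: cvgM; [apply: cvgB => //; exact: cvg_cst|exact: cvg_cst].
apply: (integ_dominated (B := 1 * K)).
- by move=> n; case: (bmM (bp (y_ n) (z_ n)) bEt).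
- exact: bmM.
- move=> n x; rewrite normrM ler_pM//; exact: plateau_le1.
- by apply: aeW => x _; apply: cvgM; [apply: cvgB; exact: stepc|exact: cvg_cst].
Qed.

Lemma through_cvg E Q t (y_ s_ : nat -> R) (y s : R) : bounded_measurable E ->
  bounded_measurable Q -> y_ n @[n --> \oo] --> y -> s_ n @[n --> \oo] --> s ->
  through del X E Q t (y_ n) (s_ n) @[n --> \oo] --> through del X E Q t y s.
Proof.
move=> bE bQ cy cs; apply: cvgB; first exact: average_cvg.
by apply: cvgM => //; exact: average_cvg.
Qed.

Lemma balance_cvg E Q t (k k1 : R) (y_ z_ ys_ zs_ : nat -> R) (y z ys zs : R) :
  bounded_measurable E -> bounded_measurable Q ->
  y_ n @[n --> \oo] --> y -> z_ n @[n --> \oo] --> z ->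
  ys_ n @[n --> \oo] --> ys -> zs_ n @[n --> \oo] --> zs ->
  k1 * box del X E t (y_ n) (z_ n) + k * (through del X E Q t (y_ n) (ys_ n)
    - through del X E Q t (z_ n) (zs_ n)) @[n --> \oo] -->
  k1 * box del X E t y z + k * (through del X E Q t y ys - through del X E Q t z zs).
Proof.
move=> bE bQ cy cz cys czs.
have h1 := through_cvg (t := t) bE bQ cy cys; have h2 := through_cvg (t := t) bE bQ cz czs.
exact: (cvgD (cvgM (cvg_cst k1) (box_cvg (t := t) bE cy cz)) (cvgM (cvg_cst k) (cvgB h1 h2))).
Qed.

(** Dominated convergence in t along the smoothed sides: their velocities are uniformly bounded, and
    converge wherever the original sides are differentiable. *)
Lemma smooth_balanced_lipschitz E Q : bounded_measurable E -> bounded_measurable Q ->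
  smooth_balanced del X E Q -> balanced E Q.
Proof.
move=> bE bQ S a b L chi c d c1 d1 chiP cL dL bc1 bd1 dc dd W.
have [a0 ab schi chi_ge0 chi0] := chiP.
have [bchi bchi1 chi10] := cutoff_bm chiP.
have cX t : a <= t <= b + 1 -> - X <= c t <= X.
  by move=> /W[h1 h2 h3]; rewrite h1 (le_trans h2)// (le_trans _ h3)// lerDl ltW.
have dX t : a <= t <= b + 1 -> - X <= d t <= X.
  by move=> /W[h1 h2 h3]; rewrite (le_trans h1 h2) (le_trans _ h3)// lerDl ltW.
have [Sm [SmP Sm_le]] := smoothing L ab.
have [[sc0 bc0 [Bc uc] cc gc] [cge cle]] := SmP c cL cX.
have [[sd0 bd0 [Bd ud] cd gd] [dge dle]] := SmP d dL dX.
have {Sm_le} cd_le := Sm_le c d cL cX dL dX (fun t tab => let: And3 _ h _ := W t tab in h).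
move: (Sm c) (Sm d) sc0 bc0 uc cc gc cge cle sd0 bd0 ud cd gd dge dle cd_le.
move=> c_ d_ sc bc0 uc cc gc cge cle sd bd0 ud cd gd dge dle cd_le {SmP Sm}.
have mc := continuous_measurable_fun (lipschitz_within cL).
have md := continuous_measurable_fun (lipschitz_within dL).
pose f_ n := balance del X E Q chi (derive1 chi) (c_ n) (derive1 (c_ n)) (d_ n) (derive1 (d_ n)).
have [f f_E] : exists f, f = f_ by exists f_.
have bf n : bounded_measurable (f n).
  have [B1 h1] := bc0 n; have [B2 h2] := bd0 n; rewrite f_E.
  have k1 := bounded_derive (sc n) h1; have k2 := bounded_derive (sd n) h2.
  have k3 := smooth_measurable (sc n); have k4 := smooth_measurable (sd n).
  exact: bm_balance.
have f_ge0 n : 0 <= integ a b (f n).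
  have [B1 h1] := bc0 n; have [B2 h2] := bd0 n; rewrite f_E.
  apply: (S a b (Num.max B1 B2) chi (c_ n) (d_ n) chiP (sc n) (sd n)).
  - by move=> t; rewrite le_max h1.
  - by move=> t; rewrite le_max h2 orbT.
  - move=> t tab; split; [apply: cge|exact: cd_le|rewrite -lerBrDr; apply: dle] => // s.
      by move=> /W[].
    by move=> /W[_ _]; rewrite lerBrDr.
suff cv : integ a b (f n) @[n --> \oo] --> integ a b (balance del X E Q chi (derive1 chi) c c1 d d1).
  apply: (ler_cvg_to (cvg_cst (0 : R)) cv); exact: nearW.
have [_ [KE EK]] := bE; have [_ [KQ QK]] := bQ.
have [_ [B1 chiB1]] := bchi; have [_ [B2 chiB2]] := bchi1.
have XX : - X <= X.
  have /W[h1 h2 h3] : a <= a <= b + 1 by rewrite lexx /= (le_trans ab)// lerDl.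
  by rewrite (le_trans h1)// (le_trans h2)// (le_trans _ h3)// lerDl ltW.
have [_ [Bb bb]] := bm_bump_at 0 del_gt0.
have average_le F K t y : bounded_measurable F -> (forall z, `|F z| <= K) ->
    `|average del X F t y| <= Bb * K * (X - - X).
  move=> bF FK; apply: integ_norm_le => //.
    by apply: bmM; [exact: bm_bump_at|exact: bm_section1].
  by move=> x _; rewrite normrM ler_pM// -bump_at_shift.
pose AE : R := Bb * KE * (X - - X); pose AQ : R := Bb * KQ * (X - - X).
have box_le t y z : `|box del X E t y z| <= 1 * KE * (X - - X).
  apply: integ_norm_le => //.
    by apply: bmM; [exact: bm_plateau|exact: bm_section1].
  by move=> x _; rewrite normrM ler_pM// plateau_le1.
have through_le t y s K : `|s| <= K -> `|through del X E Q t y s| <= AQ + K * AE.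
  move=> sK; rewrite /through; apply: le_trans (ler_normB _ _) _.
  apply: lerD; first exact: average_le.
  by rewrite normrM; apply: ler_pM => //; exact: average_le.
have nonneg (x y : R) : `|x| <= y -> 0 <= y by apply: le_trans.
have B10 := nonneg _ _ (chiB1 a); have B20 := nonneg _ _ (chiB2 a).
have C0 := nonneg _ _ (box_le a a a).
have Bc0 : 0 <= Bc by apply: (nonneg _ _ (uc 0%N a _)); rewrite lexx.
have Bd0 : 0 <= Bd by apply: (nonneg _ _ (ud 0%N a _)); rewrite lexx.
have T1 := nonneg _ _ (through_le a a Bc Bc _); have T2 := nonneg _ _ (through_le a a Bd Bd _).
have {}T1 : 0 <= AQ + Bc * AE by apply: T1; rewrite ger0_norm.
have {}T2 : 0 <= AQ + Bd * AE by apply: T2; rewrite ger0_norm.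
apply: (integ_dominated (B := B2 * (1 * KE * (X - - X)) + B1 * ((AQ + Bc * AE) + (AQ + Bd * AE)))).
- by move=> n; case: (bf n).
- exact: bm_balance.
- move=> n t; rewrite f_E /f_ /balance.
  have [tab|nab] := boolP (a < t < b); last first.
    rewrite chi0// chi10// !mul0r addr0 normr0.
    exact: (addr_ge0 (mulr_ge0 B20 C0) (mulr_ge0 B10 (addr_ge0 T1 T2))).
  have tab' : a <= t <= b by case/andP: tab => *; apply/andP; split; exact: ltW.
  apply: le_trans (ler_normD _ _) _; rewrite !normrM.
  apply: lerD; apply: ler_pM => //.
  apply: le_trans (ler_normB _ _) _; apply: lerD; apply: through_le; [exact: uc|exact: ud].
- apply: (ae_imp2 dc dd) => t dct ddt tab.
  have k1 := cc t tab; have k2 := cd t tab.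
  have k3 := gc t _ tab (dct tab); have k4 := gd t _ tab (ddt tab).
  rewrite f_E; rewrite /f_ /balance.
  by apply: balance_cvg.
Qed.

End lipschitz_balance.

(** * Traces and jump relations *)

Section essential_traces.
Context {R : realType}.
Local Notation leb := (@lebesgue_measure R).

(** The essential supremum exceeds c exactly when the section of {f > c} has positive measure, and
    the measure of a section is a measurable function of t. *)
Lemma ess_sup_measurable (f : R * R -> R) : measurable_fun setT f ->
  measurable_fun setT (fun t : R => ess_sup leb (fun y => (f (t, y))%:E)).
Proof.
move=> mf; apply: (measurability _ (ErealGenOInfty.measurableE R)) => // _ [_ [c ->] <-].
rewrite setTI.
pose S := [set z : measurableTypeR R * measurableTypeR R | c < f z].
have mS : measurable S.
  rewrite -[S]setTI; have := mf measurableT `]c, +oo[%classic (measurable_itv _).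
  by rewrite (_ : setT `&` f @^-1` _ = setT `&` S)//; apply/seteqP; split => z [] /= _;
    rewrite /= in_itv /= andbT.
have mX := measurable_fun_xsection leb mS.
rewrite (_ : _ @^-1` _ = setT `&` [set t | (0 < (leb \o xsection S) t)%E]); last first.
  rewrite setTI; apply/seteqP; split => t /=; rewrite !in_itv /= ?andbT.
    rewrite !ltNge; apply: contra => le0; apply/ess_supP.
    exists (xsection S t); split; first exact: measurable_xsection.
      by apply/eqP; rewrite eq_le le0 measure_ge0.
    by move=> y /= /negP; rewrite lee_fin -ltNge /xsection /= inE.
  rewrite !ltNge; apply: contra => /ess_supP[A [mA A0 sA]].
  rewrite -A0 le_measure ?inE//; first exact: measurable_xsection.
  by move=> y; rewrite /xsection /= inE => cy; apply: sA => /=; apply/negP; rewrite lee_fin -ltNge.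
exact: emeasurable_fun_o_infty.
Qed.

(** By Markov's inequality, the set of t where F n t >= 1 / (k + 1) for all n has measure at most k
    + 1 times every integral, hence 0. Only some n depending on t is claimed, so no subsequence has
    to be extracted. *)
Lemma vanishing_integrals (F : nat -> R -> \bar R) (T : R) :
  (forall n, measurable_fun setT (F n)) -> (forall n t, 0 <= F n t)%E ->
  (\int[leb]_(t in `]0%R, T[) F n t)%E @[n --> \oo] --> 0%E ->
  {ae leb, forall t, 0 < t < T -> forall e : R, 0 < e -> exists n, (F n t <= e%:E)%E}.
Proof.
move=> mF F0 cF; pose D := `]0%R, T[%classic : set (measurableTypeR R).
have mD : measurable D by exact: measurable_itv.
pose G k n := D `&` [set t | ((k.+1%:R^-1)%:E <= `|F n t|)%E].
have mG k n : measurable (G k n).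
  apply: emeasurable_fun_c_infty => //; apply: measurableT_comp => //.
  by apply: measurable_funTS; exact: mF.
pose B k := \bigcap_n G k n.
have mB k : measurable (B k) by apply: bigcapT_measurable => n; exact: mG.
have B0 k : leb (B k) = 0%E.
  apply/eqP; rewrite eq_le measure_ge0 andbT.
  have k0 : (0 < k.+1%:R^-1 :> R)%R by rewrite invr_gt0.
  rewrite -(@pmule_rle0 _ (k.+1%:R^-1)%:E) ?lte_fin//.
  apply: (cvge_to_ge cF); apply: nearW => n.
  have mFn : measurable_fun D (F n) by apply: measurable_funTS; exact: mF.
  apply: (@le_trans _ _ (\int[leb]_(t in D) `|F n t|)%E); last first.
    by under eq_integral do rewrite gee0_abs//.
  apply: le_trans (le_integral_abse leb mD mFn k0).
  apply: lee_wpmul2l; first by rewrite lee_fin ltW.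
  by apply: le_measure; [rewrite inE; exact: (mB k)|rewrite inE; exact: (mG k n)|move=> t; exact].
exists (\bigcup_k B k); split.
- exact: bigcup_measurable.
- apply/eqP; rewrite eq_le measure_ge0 andbT.
  apply: le_trans (measure_sigma_subadditive _ _ _ (@subset_refl _ _)) _ => //.
    exact: bigcup_measurable.
  by rewrite eseries0// => k _ _; exact: (B0 k).
- move=> t /= /not_implyP[tT /existsNP[e /not_implyP[e0 /forallNP H]]].
  have Dt : D t by rewrite /D /= in_itv.
  exists (Num.bound e^-1) => // n _; split; first exact: Dt.
  rewrite /= gee0_abs//; have /negP := H n; rewrite -ltNge => /ltW; apply: le_trans.
  rewrite lee_fin invf_ple ?posrE//; apply: ltW.
  have ei : 0 <= e^-1 by rewrite invr_ge0 ltW.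
  by apply: (lt_le_trans (archi_boundP ei)); rewrite ler_nat.
Qed.

End essential_traces.

(** * A bounded representative and its traces along curves *)

Section solution_values.
Context {R : realType}.
Local Notation leb := (@lebesgue_measure R).
Variables (M : R) (u : R -> R -> R).
Hypothesis M_gt0 : 0 < M.
Hypothesis mu : measurable_fun
        (`[0, +oo[ `*` setT : set (measurableTypeR R * measurableTypeR R))
        (fun z => u z.1 z.2).
Hypothesis uM : forall t, 0 <= t -> {ae leb, forall x, - M <= u t x <= M}.

(** A representative that is measurable and bounded by M everywhere. It is 0 at negative times,
    where nothing is known about u. *)
Definition value : R * R -> R :=
  (fun z => Num.max (- M) (Num.min M (u z.1 z.2))) \_ (`[0, +oo[ `*` setT).

Lemma value_le z : `|value z| <= M.
Proof.
rewrite /value patchE; case: ifP => _; last by rewrite normr0 ltW.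
by rewrite ler_norml le_max lexx /= ge_max ge_min lexx andbT ge0_cp// ltW.
Qed.

Lemma value_ae t : 0 <= t -> {ae leb, forall x, u t x = value (t, x)}.
Proof.
move=> t0; apply: (ae_imp (uM t0)) => x /andP[h1 h2].
rewrite /value patchE mem_set /=; last by split => //=; rewrite in_itv /= t0.
by rewrite min_r// max_r.
Qed.

Lemma measurable_value : measurable_fun setT value.
Proof.
have mD : measurable (`[0, +oo[ `*` setT : set (measurableTypeR R * measurableTypeR R)).
  by apply: measurableX => //; exact: measurable_itv.
apply/(measurable_restrictT _ mD).
by apply: measurable_maxr => //; apply: measurable_minr.
Qed.

Definition ess_limit_right (w : R -> R) (x l : R) : Prop := forall e : R, 0 < e ->
  exists rho : R, 0 < rho /\ {ae leb, forall y, x < y < x + rho -> `|w y - l| <= e}.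

Definition ess_limit_left (w : R -> R) (x l : R) : Prop := forall e : R, 0 < e ->
  exists rho : R, 0 < rho /\ {ae leb, forall y, x - rho < y < x -> `|w y - l| <= e}.

Lemma lipschitz_extension (h : R -> R) : lipschitz_curve h ->
  exists L : R, 0 < L /\ lipschitz_with L (fun t => h (Num.max 0 t)).
Proof.
move=> [K [Kr HK]]; pose L : R := Num.max 1 (K + 1); exists L.
have L0 : 0 < L by rewrite lt_max ltr01.
split=> // x y; have KL : K < L by rewrite lt_max ltrDl ltr01 orbT.
have := HK L KL (Num.max 0 x, Num.max 0 y); rewrite /= => H.
apply: le_trans (H _) _; first by split; rewrite /= in_itv /= le_max lexx.
rewrite ler_pM2l//.
have [x0|x0] := leP 0 x; have [y0|y0] := leP 0 y; rewrite ?(max_r x0) ?(max_r y0) ?(max_l (ltW x0)) ?(max_l (ltW y0))//.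
- rewrite subr0 ger0_norm// ler_normr; apply/orP; left; lra.
- rewrite sub0r normrN ger0_norm// ler_normr; apply/orP; right; lra.
- by rewrite subrr normr0.
Qed.

(** Measurability in t of [sup_dist] is obtained for a version F that agrees with it at positive
    times: u is replaced by [value], h is extended to negative times by a constant, and w is
    extended by 0. *)
Lemma sup_dist_ae (h w : R -> R) (A : nat -> set R) (T : R) : lipschitz_curve h ->
  bounded_trace w -> (forall n, measurable (A n : set (measurableTypeR R))) ->
  (\int[leb]_(t in `]0%R, T[) sup_dist u h (A n) (w t) t)%E @[n --> \oo] --> 0%E ->
  {ae leb, forall t, 0 < t < T -> forall e : R, 0 < e -> exists n,
     {ae leb, forall y, A n y -> `|value (t, h t + y) - w t| <= e}}.
Proof.
move=> lh [mw _] mA c0.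
pose F n t := ess_sup leb (fun y => ((`|value (t, h (Num.max 0 t) + y) -
   (w \_ `]0, +oo[) t|) * \1_(A n) y)%:E).
have FE n t : 0 < t -> F n t = sup_dist u h (A n) (w t) t.
  move=> t0; apply: eq_ess_sup; apply: (ae_imp (ae_shift (h t) (value_ae (ltW t0)))) => y e.
  rewrite /patch [h (Num.max 0 t)](_ : _ = h t); last by rewrite max_r// ltW.
  have tpos : (`]0, +oo[%classic : set R) t by rewrite /= in_itv /= t0.
  rewrite (mem_set tpos).
  rewrite indicE; case: ifP => _; last by rewrite mulr0.
  by rewrite mulr1 [h t + y]addrC e.
have [L [L0 hL]] := lipschitz_extension lh.
have mF n : measurable_fun setT (F n).
  apply: (@ess_sup_measurable _ (fun z => `|value (z.1, h (Num.max 0 z.1) + z.2) -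
   (w \_ `]0, +oo[) z.1| * \1_(A n) z.2)).
  have mI : measurable_fun setT (\1_(A n) : R -> R) by apply: measurable_indic; exact: (mA n).
  apply: measurable_funM; last by apply: (measurableT_comp mI).
  apply: measurableT_comp => //; apply: measurable_funB; last first.
    apply: measurableT_comp => //; apply/(measurable_restrictT _ (measurable_itv _)).
    exact: mw.
  apply: (measurableT_comp measurable_value); apply/measurable_fun_pairP; split; first exact: measurable_fst.
  apply: (measurable_funD (f := fun z : R * R => h (Num.max 0 z.1)) (g := snd)) => //.
  exact: (measurableT_comp (continuous_measurable_fun (lipschitz_within hL)) measurable_fst).
have F0 n t : (0 <= F n t)%E.
  have leb0 : (0 < leb [set: R])%E by rewrite -set_itvNyy lebesgue_measure_itv /= ltry.
  apply: ess_sup_gee; first exact: leb0.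
  by apply: aeW => y; rewrite lee_fin mulr_ge0.
have cF : (\int[leb]_(t in `]0%R, T[) F n t)%E @[n --> \oo] --> 0%E.
  rewrite (_ : (fun n => _) = (fun n => \int[leb]_(t in `]0%R, T[) sup_dist u h (A n) (w t) t)%E)//.
  apply/funext => n; apply: eq_integral => t; rewrite inE /= in_itv /= => /andP[t0 _].
  exact: FE.
apply: (ae_imp (vanishing_integrals mF F0 cF)) => t H t0T e e0.
have [n Fn] := H t0T e e0; exists n.
have /andP[t0 _] := t0T.
have := ess_sup_ge leb (fun y => ((`|value (t, h (Num.max 0 t) + y) -
   (w \_ `]0, +oo[) t|) * \1_(A n) y)%:E).
move=> Hs; apply: (ae_imp Hs) => y + Ay; rewrite -/(F n t).
move=> /le_trans/(_ Fn); rewrite lee_fin indicE mem_set// mulr1.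
by rewrite (max_r (ltW t0)) patchE mem_set//= in_itv /= t0.
Qed.

Lemma traces_ae h um up T : lipschitz_curve h -> traces u h um up -> 0 < T ->
  {ae leb, forall t, 0 < t < T ->
    ess_limit_left (fun x => value (t, x)) (h t) (um t) /\
    ess_limit_right (fun x => value (t, x)) (h t) (up t)}.
Proof.
move=> lh [bum bup tr] T0; have [cr cl] := tr T T0.
have mR n : measurable (@right_side R n : set (measurableTypeR R)) by exact: measurable_itv.
have mL n : measurable (@left_side R n : set (measurableTypeR R)) by exact: measurable_itv.
apply: (ae_imp2 (sup_dist_ae lh bum mL cl) (sup_dist_ae lh bup mR cr)) => t Hl Hr t0T.
split=> e e0.
- have [n Hn] := Hl t0T e e0; exists n.+1%:R^-1; split; first by rewrite invr_gt0.
  apply: (ae_imp (ae_shift (- h t) Hn)) => y + /andP[y1 y2].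
  rewrite [h t + _]addrC subrK; apply; by rewrite /left_side /= in_itv /= ltrBrDl y1 subr_lt0 y2.
- have [n Hn] := Hr t0T e e0; exists n.+1%:R^-1; split; first by rewrite invr_gt0.
  apply: (ae_imp (ae_shift (- h t) Hn)) => y + /andP[y1 y2].
  rewrite [h t + _]addrC subrK; apply; by rewrite /right_side /= in_itv /= subr_gt0 y1 ltrBlDl y2.
Qed.

End solution_values.

(** * Differentiation of integrals and removal of cutoffs *)

Section differentiation_of_integrals.
Context {R : realType}.
Local Notation leb := (@lebesgue_measure R).
Implicit Types (w : R -> R).

Lemma ae_witness (P : R -> Prop) (a b : R) : a < b -> {ae leb, forall y, P y} ->
  exists y, a < y < b /\ P y.
Proof.
move=> ab [A [mA A0 sA]]; apply: contrapT => /forallNP H.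
have sub : `]a, b[%classic `<=` A.
  move=> y; rewrite /= in_itv /= => yab; apply: sA => /= Py; exact: (H y).
have := le_measure leb (x := `]a, b[%classic) (y := A).
rewrite !inE => /(_ (measurable_itv _) mA sub) le.
have {le} : (leb `]a, b[ <= 0)%E.
  by apply: (le_trans le); rewrite le_eqVlt; apply/orP; left; apply/eqP; exact: A0.
by rewrite lebesgue_measure_itv /= lte_fin ab -EFinB lee_fin subr_le0 leNgt ab.
Qed.

Lemma ae_der_integ w : bounded_measurable w ->
  {ae leb, forall t, 0 < t -> der_at t (fun y => integ 0 y w) (w t)}.
Proof.
move=> bw; have [mw [B wB]] := bw.
have loc : locally_integrable setT w.
  split => //; first exact: openT.
  move=> K _ cK; have mK : measurable (K : set (measurableTypeR R)) by exact: compact_measurable.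
  have Kfin : (leb K < +oo)%E by exact: compact_finite_measure.
  by have /integrableP[] := bm_integrable mK Kfin bw.
have int y : leb.-integrable `[0, y] (EFin \o w) by exact: bm_integ.
have ft := @FTC1 R w (BLeft 0) int loc.
apply: (ae_imp ft) => t /= H t0; have [dF Fx] := H t0.
by apply/der_atP.
Qed.

Lemma ae_ge0_of_integ w (T : R) : bounded_measurable w ->
  (forall s t, 0 < s -> s < t -> t < T -> 0 <= integ s t w) ->
  {ae leb, forall t, 0 < t < T -> 0 <= w t}.
Proof.
move=> bw wge; apply: (ae_imp (ae_der_integ bw)) => t dw /andP[t0 tT].
rewrite leNgt; apply/negP => wt.
have e0 : 0 < - w t / 2 by rewrite divr_gt0// oppr_gt0.
have [rho [rho0 H]] := der_at_close e0 (dw t0).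
pose y : R := t + Num.min rho ((T - t) / 2).
have m0 : 0 < Num.min rho ((T - t) / 2) by rewrite lt_min rho0 divr_gt0// subr_gt0.
have ty : t < y by rewrite ltrDl.
have yT : y < T.
  have : Num.min rho ((T - t) / 2) <= (T - t) / 2 by rewrite ge_min lexx orbT.
  rewrite /y; lra.
have yt : y - t = Num.min rho ((T - t) / 2) by rewrite /y addrC addKr.
have := H y; rewrite yt (gtr0_norm m0) ge_min lexx => /(_ isT).
rewrite (integ_chasles bw (ltW t0) (ltW ty)) [integ 0 t w + _]addrC addrK.
rewrite ler_norml => /andP[_]; have := wge t y t0 ty yT.
have : w t * Num.min rho ((T - t) / 2) < 0 by rewrite pmulr_llt0.
move: (Num.min _ _) => m; nra.
Qed.

(** The plateau differs from the indicator of [y, z] only in two transition layers of length at most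
    [del], one to the right of y and one to the right of z. *)
Lemma plateau_integ_close (del a b y z B : R) w : 0 < del -> bounded_measurable w ->
  (forall x, `|w x| <= B) -> a <= y -> y <= z -> z + del <= b ->
  `|integ a b (fun x => plateau del y z x * w x) - integ y z w| <= 2 * B * del.
Proof.
move=> d0 bw wB ay yz zb.
have B0 : 0 <= B by apply: le_trans (wB 0).
have bp := bmM (bm_plateau del y z) bw.
have zd : z <= z + del by rewrite lerDl ltW.
have lo c x : x <= c -> step ((x - c) / del) = 0.
  by move=> xc; rewrite step_le// (@le_trans _ _ 0)// pmulr_lle0 ?invr_gt0// subr_le0.
have hi c x : c + del <= x -> step ((x - c) / del) = 1.
  by move=> xc; rewrite step_ge// ler_pdivlMr// mul1r lerBrDl.
rewrite (integ_chasles bp ay (le_trans yz (le_trans zd zb))).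
rewrite (integ_chasles bp yz (le_trans zd zb)) (integ_chasles bp zd zb).
rewrite (@eq_integ _ a y _ (fun=> 0)); last first.
  by move=> x /andP[_ xy]; rewrite /plateau !lo// ?subrr ?mul0r// (le_trans xy).
rewrite (@eq_integ _ (z + del) b _ (fun=> 0)); last first.
  by move=> x /andP[xz _]; rewrite /plateau !hi// ?subrr ?mul0r// (le_trans _ xz)// lerD2r.
rewrite !integ_cst// !mul0r add0r addr0 addrAC.
have -> : 2 * B * del = B * del + B * del by ring.
apply: le_trans (ler_normD _ _) _; apply: lerD; last first.
  rewrite -[X in _ <= _ * X](addrK z) [del + z]addrC; apply: integ_norm_le => // x _.
  by rewrite normrM -[B]mul1r ler_pM// plateau_le1.
rewrite -integB//.
pose m : R := Num.min (y + del) z.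
have ym : y <= m by rewrite le_min lerDl ltW.
have mz : m <= z by rewrite ge_min lexx orbT.
rewrite (integ_chasles (bmB bp bw) ym mz).
have -> : integ m z (fun x => plateau del y z x * w x - w x) = 0.
  have [ydz|ydz] := leP (y + del) z; last first.
    have -> : m = z by rewrite /m min_r// ltW.
    exact: integaa.
  have my : m = y + del by rewrite /m min_l.
  rewrite (@eq_integ _ m z _ (fun=> 0)) ?integ_cst ?mul0r// => x /andP[mx xz].
  by rewrite /plateau (lo z)// hi ?subr0 ?mul1r ?subrr// -my.
rewrite addr0; apply: (@le_trans _ _ (B * (m - y))).
  apply: integ_norm_le => //; first exact: bmB.
  move=> x /andP[yx xm].
  have -> : plateau del y z x * w x - w x = - ((1 - step ((x - y) / del)) * w x).
    by rewrite /plateau (lo z) ?(le_trans xm)//; ring.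
  rewrite normrN normrM -[B]mul1r ler_pM// ger0_norm ?subr_ge0 ?step_le1//.
  by rewrite gerBl step_ge0.
apply: ler_wpM2l => //; rewrite lerBlDl; by rewrite ge_min lexx.
Qed.

Lemma dominated_ge0 (a b B : R) (chi chi1 A p : R -> R) (A_ p_ : nat -> R -> R) :
  bounded_measurable chi -> bounded_measurable chi1 ->
  (forall t, ~~ (a < t < b) -> chi t = 0) -> (forall t, ~~ (a < t < b) -> chi1 t = 0) ->
  (forall n, bounded_measurable (A_ n)) -> (forall n, bounded_measurable (p_ n)) ->
  bounded_measurable A -> bounded_measurable p ->
  (forall n t, a < t < b -> `|A_ n t| <= B) -> (forall n t, a < t < b -> `|p_ n t| <= B) ->
  {ae leb, forall t, a < t < b -> A_ n t @[n --> \oo] --> A t} ->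
  {ae leb, forall t, a < t < b -> p_ n t @[n --> \oo] --> p t} ->
  (forall n, 0 <= integ a b (fun t => chi1 t * A_ n t + chi t * p_ n t)) ->
  0 <= integ a b (fun t => chi1 t * A t + chi t * p t).
Proof.
move=> bchi bchi1 chi0 chi10 bA_ bp_ bA bp AB pB cA cp ge0.
have [_ [C chiC]] := bchi; have [_ [C1 chiC1]] := bchi1.
have C0 : 0 <= C by apply: le_trans (chiC 0).
have C10 : 0 <= C1 by apply: le_trans (chiC1 0).
have bf n : bounded_measurable (fun t => chi1 t * A_ n t + chi t * p_ n t).
  by apply: bmD; exact: bmM.
suff cv : integ a b (fun t => chi1 t * A_ n t + chi t * p_ n t) @[n --> \oo] -->
    integ a b (fun t => chi1 t * A t + chi t * p t).
  by apply: (ler_cvg_to (cvg_cst (0 : R)) cv); exact: nearW.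
apply: (integ_dominated (B := C1 * `|B| + C * `|B|)).
- by move=> n; case: (bf n).
- by apply: bmD; exact: bmM.
- move=> n t; have [tab|nab] := boolP (a < t < b); last first.
    by rewrite chi0// chi10// !mul0r addr0 normr0 addr_ge0// mulr_ge0.
  apply: le_trans (ler_normD _ _) _; rewrite !normrM; apply: lerD; apply: ler_pM => //.
  + exact: le_trans (AB n t tab) (ler_norm _).
  + exact: le_trans (pB n t tab) (ler_norm _).
- apply: (ae_imp2 cA cp) => t cAt cpt _; have [tab|nab] := boolP (a < t < b).
    by apply: cvgD; apply: cvgM; [exact: cvg_cst|exact: cAt|exact: cvg_cst|exact: cpt].
  rewrite chi0// chi10// !mul0r; under eq_cvg do rewrite !mul0r.
  exact: cvg_cst.
Qed.

Lemma integ_plateau_ge0 (s t : R) w (N : nat) : s <= t -> bounded_measurable w ->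
  (forall n, (N <= n)%N ->
    0 <= integ s (t + 2 * width n) (fun x => plateau (width n) s t x * w x)) ->
  0 <= integ s t w.
Proof.
move=> st bw H; have [_ [B wB]] := bw.
have B0 : 0 <= B by apply: le_trans (wB 0).
apply/ler_addgt0Pr => r r0.
have r1 : 0 < r / (2 * B + 1) by rewrite divr_gt0// ltr_wpDl// mulr_ge0.
have cw := @cvg_width R.
near \oo => n.
have wr : width n <= r / (2 * B + 1) by near: n; apply: (cvgr_le (0 : R)).
have Nn : (N <= n)%N by near: n; exact: nbhs_infty_ge.
have w0 := @width_gt0 R n.
have := @plateau_integ_close (width n) s (t + 2 * width n) s t B w w0 bw wB (lexx s) st _.
rewrite lerD2l ler_pMl// ler1n => /(_ isT).
rewrite ler_norml => /andP[_ h]; have := H n Nn => h2.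
have h3 : 2 * B * width n <= r.
  apply: (@le_trans _ _ (2 * B * (r / (2 * B + 1)))).
    by apply: ler_wpM2l => //; rewrite mulr_ge0.
  by rewrite mulrCA ger_pMr// ler_pdivrMr ?mul1r ?lerDl// ltr_wpDl// mulr_ge0.
lra.
Unshelve. all: by end_near. Qed.

End differentiation_of_integrals.

Section boundary_layers.
Context {R : realType}.
Local Notation leb := (@lebesgue_measure R).
Variables (M : R) (U : R * R -> R).
Hypotheses (mU : measurable_fun setT U) (UM : forall z, `|U z| <= M).

Lemma ess_limit_bound (x l : R) (w : R -> R) : (forall y, `|w y| <= M) ->
  ess_limit_right w x l \/ ess_limit_left w x l -> `|l| <= M.
Proof.
move=> wM H; apply/ler_addgt0Pr => e e0.
have [a [b [ab Hab]]] : exists a b, a < b /\ {ae leb, forall y, a < y < b -> `|w y - l| <= e}.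
  case: H => /(_ e e0)[rho [rho0 Hr]].
    by exists x, (x + rho); rewrite ltrDl.
  by exists (x - rho), x; rewrite gtrBl.
have [y [yab /(_ yab) h]] := ae_witness ab Hab.
have -> : l = w y - (w y - l) by ring.
by apply: le_trans (ler_normB _ _) _; exact: lerD.
Qed.

Section pair.
Variables (e : R -> R) (K : R).
Hypotheses (ce : continuous e) (K_ge0 : 0 <= K)
  (eK : forall x y, `|x| <= M -> `|y| <= M -> `|e x - e y| <= K * `|x - y|).

Lemma bm_pair : bounded_measurable (fun z => e (U z)).
Proof. exact: bm_continuous_comp ce mU UM. Qed.

Variables (del X : R).
Hypothesis del_gt0 : 0 < del.

Lemma average_close t y l r : - X <= y -> y + del <= X -> `|l| <= M ->
  {ae leb, forall x, y + del / 2 < x < y + del -> `|U (t, x) - l| <= r} ->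
  `|average del X (fun z => e (U z)) t y - e l| <= K * r.
Proof.
move=> Xy yX lM near.
have b1 := bm_bump_at y del_gt0; have b2 := bm_section1 t bm_pair.
have d2 : 0 < del / 2 by rewrite divr_gt0.
have mass : integ (- X) X (bump_at del y) = 1.
  by rewrite integ_bump_at// (le_trans Xy)// lerDl ltW.
have -> : average del X (fun z => e (U z)) t y - e l =
    integ (- X) X (fun x => bump_at del y x * (e (U (t, x)) - e l)).
  rewrite -[e l in LHS]mulr1 -mass -integZ// -integB//; [|exact: bmM|exact: bmZ].
  by apply: eq_integ => x _; ring.
have b3 : bounded_measurable (fun x => bump_at del y x * (e (U (t, x)) - e l)).
  by apply: bmM => //; apply: bmB => //; exact: bm_cst.
apply: le_trans (integ_norm _ _ b3) _.
rewrite -[K * r]mulr1 -mass -integZ//.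
apply: ae_integ_le; [exact: bm_norm|exact: bmZ|].
apply: (ae_imp near) => x H _; rewrite normrM ger0_norm ?bump_at_ge0// mulrC.
have [xs|xs] := boolP (y + del / 2 < x < y + del); last first.
  by rewrite bump_at_out// !mulr0.
apply: ler_wpM2r; first exact: bump_at_ge0.
have xM := UM (t, x); apply: le_trans (eK xM lM) _.
by apply: ler_wpM2l; [exact: K_ge0|exact: H].
Qed.

Lemma box_close t y z B : - X <= y -> y <= z -> z + del <= X -> (forall z, `|e (U z)| <= B) ->
  `|box del X (fun z => e (U z)) t y z - integ y z (fun x => e (U (t, x)))| <= 2 * B * del.
Proof.
move=> Xy yz zX eB; apply: plateau_integ_close => //; exact: bm_section1 t bm_pair.
Qed.

End pair.
End boundary_layers.

(** * Jump inequalities along a Lipschitz curve *)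

Section jump_relations.
Context {R : realType}.
Local Notation leb := (@lebesgue_measure R).
Variables (M T : R) (U : R * R -> R) (h g um up : R -> R) (L : R).
Hypotheses (M_gt0 : 0 < M) (T_gt0 : 0 < T).
Hypotheses (mU : measurable_fun setT U) (UM : forall z, `|U z| <= M).
Hypotheses (hL : lipschitz_with L h) (bg : bounded_measurable g)
  (dh : {ae leb, forall t, 0 < t < T -> der_at t h (g t)}).
Hypotheses (bum : bounded_trace um) (bup : bounded_trace up).
Hypothesis tr : {ae leb, forall t, 0 < t < T ->
    ess_limit_left (fun x => U (t, x)) (h t) (um t) /\
    ess_limit_right (fun x => U (t, x)) (h t) (up t)}.

Lemma traces_bounded : {ae leb, forall t, 0 < t < T -> `|um t| <= M /\ `|up t| <= M}.
Proof.
apply: (ae_imp tr) => t H /H[Hl Hr]; split.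
  by apply: (ess_limit_bound (x := h t) (w := fun x => U (t, x)) _ (or_intror Hl)) => y; exact: UM.
by apply: (ess_limit_bound (x := h t) (w := fun x => U (t, x)) _ (or_introl Hr)) => y; exact: UM.
Qed.

Variables (e Q : R -> R) (K : R).
Hypotheses (ce : continuous e) (cQ : continuous Q) (K_ge0 : 0 <= K)
  (eK : forall x y, `|x| <= M -> `|y| <= M -> `|e x - e y| <= K * `|x - y|)
  (QK : forall x y, `|x| <= M -> `|y| <= M -> `|Q x - Q y| <= K * `|x - y|).

(* Averages taken just to the right of y see the right trace when y is the
   curve, and the left trace when y is the curve shifted by the width. *)
Lemma average_trace (k : R -> R) (y_ : nat -> R) (X t l : R) : continuous k ->
    (forall x y, `|x| <= M -> `|y| <= M -> `|k x - k y| <= K * `|x - y|) -> `|l| <= M ->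
    (forall n, - X <= y_ n /\ y_ n + width n <= X) ->
    (forall r, 0 < r -> \forall n \near \oo,
      {ae leb, forall x, y_ n + width n / 2 < x < y_ n + width n -> `|U (t, x) - l| <= r}) ->
  average (width n) X (fun z => k (U z)) t (y_ n) @[n --> \oo] --> k l.
Proof.
move=> ck kK lM yX H; apply/cvgrPdist_le => r r0.
have r1 : 0 < r / (K + 1) by rewrite divr_gt0// ltr_wpDl.
near=> n; rewrite distrC.
have [y1 y2] := yX n.
apply: le_trans (average_close mU UM ck K_ge0 kK (width_gt0 n) y1 y2 lM _) _.
  by near: n; exact: (H _ r1).
by rewrite mulrCA ger_pMr// ler_pdivrMr ?ltr_wpDl// mul1r lerDl.
Unshelve. all: by end_near. Qed.

Lemma average_bounded (del X t y B : R) (E : R * R -> R) : 0 < del -> - X <= y -> y + del <= X ->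
  bounded_measurable E -> (forall z, `|E z| <= B) -> `|average del X E t y| <= B.
Proof.
move=> d0 Xy yX bE EB; have b1 := bm_bump_at y d0; have b2 := bm_section1 t bE.
have d2 : 0 < del / 2 by rewrite divr_gt0.
apply: le_trans (integ_norm _ _ (bmM b1 b2)) _.
have mass : integ (- X) X (bump_at del y) = 1.
  by rewrite integ_bump_at// (le_trans Xy)// lerDl ltW.
rewrite -[B]mulr1 -mass -integZ//; apply: integ_le => [||x _]; [exact/bm_norm/bmM|exact: bmZ|].
by rewrite normrM ger0_norm ?bump_at_ge0// mulrC ler_wpM2r// bump_at_ge0.
Qed.

Let E (z : R * R) := e (U z).
Let F (z : R * R) := Q (U z).

Lemma bmEF : bounded_measurable E /\ bounded_measurable F.
Proof. by split; exact: bm_continuous_comp mU UM. Qed.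

Lemma through_right_cvg (X t : R) : - X <= h t -> h t + 1 <= X -> 0 < t < T ->
    ess_limit_right (fun x => U (t, x)) (h t) (up t) ->
  through (width n) X E F t (h t) (g t) @[n --> \oo] --> Q (up t) - g t * e (up t).
Proof.
move=> Xh hX t0T Hr.
have upM : `|up t| <= M by apply: (ess_limit_bound _ (or_introl Hr)) => y; exact: UM.
have win n : - X <= h t /\ h t + width n <= X.
  by split=> //; have := @width_le R n; have := @width_gt0 R n; lra.
have near_t r : 0 < r -> \forall n \near \oo,
    {ae leb, forall x, h t + width n / 2 < x < h t + width n -> `|U (t, x) - up t| <= r}.
  move=> r0; have [rho [rho0 H]] := Hr r r0; have cw := @cvg_width R.
  near=> n; apply: (ae_imp H) => x Hx /andP[h1 h2]; apply: Hx.
  have w2 : 0 < width n / 2 :> R by rewrite divr_gt0// width_gt0.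
  have wr : width n < rho by near: n; apply: (cvgr_lt (0 : R)).
  by apply/andP; split; lra.
apply: cvgB; first exact: average_trace cQ QK upM win near_t.
by apply: cvgM; [exact: cvg_cst|exact: average_trace ce eK upM win near_t].
Unshelve. all: by end_near. Qed.

Lemma through_left_cvg (X t : R) : - X + 1 <= h t -> h t <= X -> 0 < t < T ->
    ess_limit_left (fun x => U (t, x)) (h t) (um t) ->
  through (width n) X E F t (h t - width n) (g t) @[n --> \oo] --> Q (um t) - g t * e (um t).
Proof.
move=> Xh hX t0T Hr.
have umM : `|um t| <= M by apply: (ess_limit_bound _ (or_intror Hr)) => y; exact: UM.
have win n : - X <= h t - width n /\ h t - width n + width n <= X.
  by rewrite subrK; split=> //; have := @width_le R n; have := @width_gt0 R n; lra.
have near_t r : 0 < r -> \forall n \near \oo, {ae leb, forall x,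
    h t - width n + width n / 2 < x < h t - width n + width n -> `|U (t, x) - um t| <= r}.
  move=> r0; have [rho [rho0 H]] := Hr r r0; have cw := @cvg_width R.
  near=> n; apply: (ae_imp H) => x Hx /andP[h1 h2]; apply: Hx.
  have w2 : 0 < width n / 2 :> R by rewrite divr_gt0// width_gt0.
  have wr : width n < rho by near: n; apply: (cvgr_lt (0 : R)).
  by apply/andP; split; lra.
apply: cvgB; first exact: average_trace cQ QK umM win near_t.
by apply: cvgM; [exact: cvg_cst|exact: average_trace ce eK umM win near_t].
Unshelve. all: by end_near. Qed.

(** Traces are bounded by M only for almost every t; [clamp] makes them measurable and bounded on
    the whole line, without changing them where they matter. *)
Definition clamp (w : R -> R) : R -> R :=
  fun t => Num.max (- M) (Num.min M ((w \_ `]0, +oo[) t)).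

Lemma clamp_le w t : `|clamp w t| <= M.
Proof.
by rewrite /clamp ler_norml le_max lexx /= ge_max ge_min lexx andbT ge0_cp// ltW.
Qed.

Lemma measurable_clamp w : bounded_trace w -> measurable_fun setT (clamp w).
Proof.
move=> [mw _]; apply: measurable_maxr => //; apply: measurable_minr => //.
by apply/(measurable_restrictT _ (measurable_itv _)); exact: mw.
Qed.

Lemma clampE w t : 0 < t -> `|w t| <= M -> clamp w t = w t.
Proof.
move=> t0; rewrite ler_norml => /andP[h1 h2].
rewrite /clamp patchE mem_set /=; last by rewrite in_itv /= t0.
by rewrite min_r// max_r.
Qed.

Lemma bm_clamp (k w : R -> R) : continuous k -> bounded_trace w -> bounded_measurable (fun t => k (clamp w t)).
Proof. by move=> ck bw; exact: bm_continuous_comp ck (measurable_clamp bw) (clamp_le w). Qed.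

Hypothesis bal : forall n X, balanced (width n) X E F.

Lemma h_bounded (b : R) : exists X : R, 0 < X /\ forall t, 0 <= t <= b -> `|h t| + 1 <= X.
Proof.
exists (`|h 0| + `|L| * `|b| + 1); split; first by rewrite ltr_wpDl// addr_ge0// mulr_ge0.
move=> t /andP[t0 tb]; rewrite lerD2r.
have -> : h t = h 0 + (h t - h 0) by ring.
apply: le_trans (ler_normD _ _) _; rewrite lerD2l.
apply: le_trans (hL _ _) _; rewrite subr0 (ger0_norm t0).
apply: le_trans (ler_wpM2r t0 (ler_norm L)) _; apply: ler_wpM2l => //.
exact: le_trans tb (ler_norm b).
Qed.

Let jump (t : R) : R := (Q (clamp um t) - g t * e (clamp um t)) -
  (Q (clamp up t) - g t * e (clamp up t)).

Let bm_jump : bounded_measurable jump.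
Proof. by apply: bmB; apply: bmB; [|apply: bmM => //| |apply: bmM => //]; exact: bm_clamp. Qed.

(** The balance is written on the thin strip between h - [width n] and h. Its content is
    O([width n]) and disappears; the averages attached to its two sides tend to the left and to the
    right trace. *)
Lemma jump_weak (s t : R) (m : nat) : 0 < s -> s < t -> t + 2 * width m < T ->
  0 <= integ s (t + 2 * width m) (fun x => plateau (width m) s t x * jump x).
Proof.
move=> s0 st tT; set b := t + 2 * width m.
pose chi := plateau (width m) s t.
have w0 := @width_gt0 R m.
have sb : s <= b by rewrite /b; lra.
have cut : admissible_cutoff s b chi.
  split=> //; first exact: smooth_plateau.
    by move=> x; apply: plateau_ge0 => //; exact: ltW.
  move=> x nx; apply: plateau_out => //; first exact: ltW.
  by apply: contra nx => /andP[h1 h2]; apply/andP; split; rewrite /b; lra.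
have [bchi bchi1 chi10] := cutoff_bm cut.
have chi0 : forall x, ~~ (s < x < b) -> chi x = 0 by case: cut.
have [X [X0 hX]] := h_bounded (b + 1).
have mh := continuous_measurable_fun (lipschitz_within hL).
have [bE bF] := bmEF.
have hXt x : s <= x <= b + 1 -> - X + 1 <= h x /\ h x + 1 <= X.
  move=> /andP[h1 h2]; have := hX x; rewrite h2 andbT (le_trans (ltW s0) h1) => /(_ isT).
  move=> h3; have : `|h x| <= X - 1 by lra.
  by rewrite ler_norml => /andP[? ?]; split; lra.
have in01 x : s < x < b -> 0 < x < T.
  by move=> /andP[h1 h2]; apply/andP; split; [exact: lt_trans h1|exact: lt_trans tT].
pose A_ n x := box (width n) X E x (h x - width n) (h x).
pose p_ n x := through (width n) X E F x (h x - width n) (g x) -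
  through (width n) X E F x (h x) (g x).
have mhw n : measurable_fun setT (fun x => h x - width n) by exact: measurable_funB.
have [BE EB] := bE.2; have [BF FB] := bF.2; have [Bg gB] := bg.2.
have BE0 : 0 <= BE by apply: le_trans (EB (0, 0)).
have BF0 : 0 <= BF by apply: le_trans (FB (0, 0)).
have Bg0 : 0 <= Bg by apply: le_trans (gB 0).
pose C : R := 3 * BE + 2 * (BF + Bg * BE).
have AC n x : s < x < b -> `|A_ n x| <= 3 * BE * width n.
  move=> xsb; have w1 := @width_gt0 R n; have w2 := @width_le R n.
  have [h1 h2] : - X + 1 <= h x /\ h x + 1 <= X.
    by apply: hXt; move: xsb => /andP[h1 h2]; apply/andP; split; lra.
  have h3 : - X <= h x - width n by lra.
  have h4 : h x - width n <= h x by rewrite gerBl ltW.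
  have h5 : h x + width n <= X by lra.
  have := box_close mU UM ce (width_gt0 n) x h3 h4 h5 EB.
  have b1 : bounded_measurable (fun y => E (x, y)) by exact: bm_section1.
  have := integ_norm_le (f := fun y => e (U (x, y))) b1 h4 (fun y _ => EB (x, y)).
  have -> : BE * (h x - (h x - width n)) = BE * width n by ring.
  rewrite -/(A_ n x); move: (A_ n x) (integ _ _ _) => p r.
  rewrite !ler_norml => /andP[? ?] /andP[? ?]; apply/andP; split; lra.
have thr n x y : - X <= y -> y + width n <= X -> `|through (width n) X E F x y (g x)| <= BF + Bg * BE.
  move=> h1 h2; apply: le_trans (ler_normB _ _) _; apply: lerD.
    exact: average_bounded (width_gt0 n) h1 h2 bF FB.
  rewrite normrM; apply: ler_pM => //.
  exact: average_bounded (width_gt0 n) h1 h2 bE EB.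
have pC n x : s < x < b -> `|p_ n x| <= C.
  move=> xsb; have w1 := @width_gt0 R n; have w2 := @width_le R n.
  have [h1 h2] : - X + 1 <= h x /\ h x + 1 <= X.
    by apply: hXt; move: xsb => /andP[h1 h2]; apply/andP; split; lra.
  have C1 : 2 * (BF + Bg * BE) <= C by rewrite /C lerDr mulr_ge0.
  apply: le_trans C1; apply: le_trans (ler_normB _ _) _.
  have -> : 2 * (BF + Bg * BE) = (BF + Bg * BE) + (BF + Bg * BE) by ring.
  by apply: lerD; apply: thr; lra.
have A_C n x : s < x < b -> `|A_ n x| <= C.
  move=> /(AC n) h1; apply: le_trans h1 _.
  have w1 := @width_gt0 R n; have w2 := @width_le R n.
  apply: (@le_trans _ _ (3 * BE)).
    by rewrite ler_piMr ?mulr_ge0//; lra.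
  by rewrite /C lerDl mulr_ge0// addr_ge0// mulr_ge0.
have bA_ n : bounded_measurable (A_ n) by exact: bm_box.
have bp_ n : bounded_measurable (p_ n).
  by apply: bmB; exact: (bm_through X (width_gt0 n) bE bF).
have cA : {ae leb, forall x, s < x < b -> A_ n x @[n --> \oo] --> (0 : R)}.
  apply: aeW => x xsb; apply: (cvg_dist_le (w := fun n => 3 * BE * width n)).
    by move=> n; rewrite subr0; exact: AC.
  rewrite -[X in _ --> X](mulr0 (3 * BE)).
  by apply: cvgM; [exact: cvg_cst|exact: cvg_width].
have cp : {ae leb, forall x, s < x < b -> p_ n x @[n --> \oo] --> jump x}.
  apply: (ae_imp2 tr traces_bounded) => x + + xsb.
  move=> /(_ (in01 x xsb))[Hl Hr] /(_ (in01 x xsb))[h1 h2].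
  have /andP[x0 _] := in01 x xsb.
  have [h3 h4] : - X + 1 <= h x /\ h x + 1 <= X.
    by apply: hXt; move: xsb => /andP[h5 h6]; apply/andP; split; lra.
  rewrite /jump !clampE//; apply: cvgB.
    by apply: through_left_cvg => //; [lra|exact: in01].
  by apply: through_right_cvg => //; [lra|exact: in01].
have ge0 n : 0 <= integ s b (fun x => derive1 chi x * A_ n x + chi x * p_ n x).
  have w1 := @width_gt0 R n; have w2 := @width_le R n.
  apply: (bal (n := n) (X := X) (L := L) cut (c := fun x => h x - width n) (d := h)) => //.
  - by move=> x y; rewrite opprB addrA subrK; exact: hL.
  - apply: (ae_imp dh) => x dx /andP[h1 h2].
    apply: der_eq; first (apply: derB; [apply: dx|exact: der_cst]).
      by rewrite (lt_le_trans s0 h1) (le_lt_trans h2 tT).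
    by rewrite subr0.
  - apply: (ae_imp dh) => x dx /andP[h1 h2]; apply: dx.
    by rewrite (lt_le_trans s0 h1) (le_lt_trans h2 tT).
  - by move=> x /hXt[h1 h2]; split; lra.
have := dominated_ge0 bchi bchi1 chi0 chi10 bA_ bp_ (bm_cst _ 0) bm_jump A_C pC cA cp ge0.
congr (0 <= _); apply: eq_integ => x _.
by rewrite mulr0 add0r.
Qed.

(** Applied to (id, f) and (- id, - f) this gives the Rankine-Hugoniot relation; applied to eta and
    to eta_k, the two entropy inequalities of the jump. *)
Lemma jump_inequality : {ae leb, forall t, 0 < t < T ->
  0 <= (Q (um t) - g t * e (um t)) - (Q (up t) - g t * e (up t))}.
Proof.
suff H : {ae leb, forall t, 0 < t < T -> 0 <= jump t}.
  apply: (ae_imp2 H traces_bounded) => t + + t0T => /(_ t0T) + /(_ t0T)[h1 h2].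
  have /andP[t0 _] := t0T.
  by rewrite /jump !clampE.
apply: (ae_ge0_of_integ bm_jump) => s t s0 st tT.
have [N HN] : exists N, forall n, (N <= n)%N -> 2 * width n < T - t :> R.
  have Tt : 0 < (T - t) / 2 by rewrite divr_gt0// subr_gt0.
  have : \forall n \near \oo, (width n : R) < (T - t) / 2.
    by apply: (cvgr_lt (0 : R)) => //; exact: cvg_width.
  move=> [N _ HN]; exists N => n /HN /=; lra.
apply: (integ_plateau_ge0 (N := N)) => //; first exact: ltW.
by move=> n /HN h1; apply: jump_weak => //; lra.
Qed.

End jump_relations.

(** * Generalized characteristics *)

Section delayed_curves.
Context {R : realType}.
Local Notation leb := (@lebesgue_measure R).
Variables (U : R * R -> R) (V : R -> R) (M L : R).
Hypotheses (mU : measurable_fun setT U) (UM : forall z, `|U z| <= M).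
Hypotheses (cV : continuous V) (L_gt0 : 0 < L) (VL : forall x, `|V x| <= L).

Definition window_mean (P : R -> R) (w : R) (z : R * R) : R :=
  w^-1 * integ 0 w (fun y => P (U (z.1, z.2 + y))).

Lemma ae_neq (c : R) : {ae leb, forall y, y <> c}.
Proof.
exists [set c]; split; [exact: measurable_set1|exact: lebesgue_measure_set1|].
by move=> y /= /contrapT.
Qed.

Lemma bm_window (P : R -> R) : continuous P ->
  bounded_measurable (fun z : (R * R) * R => P (U (z.1.1, z.1.2 + z.2))).
Proof.
move=> cP; apply: bm_continuous_comp cP _ (fun z => UM _).
apply: (measurableT_comp mU); apply/measurable_fun_pairP; split.
  exact: (measurableT_comp measurable_fst measurable_fst).
apply: (measurable_funD (f := fun z : (R * R) * R => z.1.2) (g := snd)) => //.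
exact: (measurableT_comp measurable_snd measurable_fst).
Qed.

Lemma bm_window_mean (P : R -> R) (w : R) : continuous P -> bounded_measurable (window_mean P w).
Proof.
move=> cP; apply: bmZ; exact: (bm_parameter 0 w (bm_window cP)).
Qed.

Lemma window_mean_le (P : R -> R) (w B : R) z : continuous P -> 0 < w ->
  {ae leb, forall y, 0 < y < w -> P (U (z.1, z.2 + y)) <= B} -> window_mean P w z <= B.
Proof.
move=> cP w0 H; have b1 := bm_section1 z (bm_window cP).
rewrite /window_mean ler_pdivrMl// [w * B]mulrC -[w in B * w]subr0 -(integ_cst B (ltW w0)).
apply: ae_integ_le => //; first exact: bm_cst.
apply: (ae_imp2 H (ae_imp2 (ae_neq 0) (ae_neq w) (fun y h1 h2 => conj h1 h2))) => y + [y0 yw] /andP[h1 h2].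
by apply; rewrite !lt_neqAle h1 h2 !andbT eq_sym; apply/andP; split; apply/eqP.
Qed.

Variable w : R.
Hypothesis w_gt0 : 0 < w.

(* Evaluating the curve with a delay makes [k' = mean of V (U (t, k (t - w)))]
   explicitly solvable, one step of length [w] at a time. *)
Fixpoint delayed (j : nat) (t : R) : R :=
  if j is i.+1 then integ 0 t (fun r => window_mean V w (r, delayed i (r - w))) else 0.

Lemma delayedS j t : delayed j.+1 t =
  integ 0 t (fun r => window_mean V w (r, delayed j (r - w))).
Proof. by []. Qed.

Lemma bm_delay (k : R -> R) : measurable_fun setT k ->
  bounded_measurable (fun r : R => window_mean V w (r, k (r - w))).
Proof.
move=> mk; apply: bm_comp (bm_window_mean w cV).
apply/measurable_fun_pairP; split; first exact: measurable_id.
by apply: (measurableT_comp mk); exact: measurable_funB.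
Qed.

Lemma window_mean_norm z : `|window_mean V w z| <= L.
Proof.
have b1 := bm_section1 z (bm_window cV).
rewrite /window_mean normrM gtr0_norm ?invr_gt0// ler_pdivrMl// mulrC.
rewrite -[X in _ <= _ * X]subr0; apply: integ_norm_le => //; exact: ltW.
Qed.

Lemma lipschitz_primitive (f : R -> R) : bounded_measurable f -> (forall x, `|f x| <= L) ->
  lipschitz_with L (fun t => integ 0 t f).
Proof.
move=> bf fL.
suff H s t : s <= t -> `|integ 0 s f - integ 0 t f| <= L * `|s - t|.
  move=> x y; have [/H//|/ltW/H] := leP x y.
  by rewrite distrC [`|y - x|]distrC.
move=> st; have st' : `|s - t| = t - s by rewrite distrC ger0_norm ?subr_ge0.
have [s0|s0] := leP 0 s.
  rewrite (integ_chasles bf s0 st) opprD addrA subrr add0r normrN st'.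
  exact: integ_norm_le.
rewrite (integ_ltNge _ s0) sub0r normrN; have [t0|t0] := leP 0 t; last first.
  by rewrite integ_ltNge// normr0 mulr_ge0// ltW.
apply: (@le_trans _ _ (L * (t - 0))); first exact: integ_norm_le.
by rewrite st' ler_pM2l//; lra.
Qed.

Lemma delayed_lipschitz j : lipschitz_with L (delayed j).
Proof.
elim: j => [|j IH].
  by move=> x y; rewrite /= subrr normr0 mulr_ge0// ltW.
apply: lipschitz_primitive => [|x]; last exact: window_mean_norm.
by apply: bm_delay; apply: continuous_measurable_fun; exact: lipschitz_within IH.
Qed.

Lemma delayed_le0 j t : t <= 0 -> delayed j t = 0.
Proof.
case: j => //= j; rewrite le_eqVlt => /predU1P[->|t0]; first exact: integaa.
exact: integ_ltNge.
Qed.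

(** At time r an iterate only consults its predecessor at time r - w, so each iteration fixes the
    curve on one more step of length w. *)
Lemma delayed_stable j t : t <= j%:R * w -> delayed j.+1 t = delayed j t.
Proof.
elim: j t => [|j IH] t tj.
  by rewrite mul0r in tj; rewrite !delayed_le0.
rewrite delayedS [RHS]delayedS; apply: eq_integ => r /andP[_ rt]; rewrite IH//.
by rewrite lerBlDr (le_trans rt)// (le_trans tj)// -natr1 mulrDl mul1r.
Qed.

Lemma delayed_curve (T : R) : exists k : R -> R,
  [/\ lipschitz_with L k, k 0 = 0 &
      forall s t, 0 <= s -> s <= t -> t <= T ->
        k t - k s = integ s t (fun r => window_mean V w (r, k (r - w)))].
Proof.
pose N := Num.bound (T / w); exists (delayed N.+1).
have TN : T <= N%:R * w.
  have [T0|T0] := leP 0 T.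
    have /archi_boundP : 0 <= T / w by rewrite divr_ge0// ltW.
    by rewrite ltr_pdivrMr// => /ltW.
  by rewrite (le_trans (ltW T0))// mulr_ge0// ltW.
split; [exact: delayed_lipschitz|exact: delayed_le0|].
move=> s t s0 st tT.
have mk : measurable_fun setT (delayed N).
  by apply: continuous_measurable_fun; exact: lipschitz_within (delayed_lipschitz N).
have b1 := bm_delay mk.
rewrite !delayedS (integ_chasles b1 s0 st) addrC addKr.
apply: eq_integ => r /andP[_ rt]; rewrite delayed_stable//.
by rewrite (le_trans _ TN)// lerBlDr (le_trans rt)// (le_trans tT)// lerDl ltW.
Qed.

End delayed_curves.

Lemma ae_nat {R : realType} (P : nat -> R -> Prop) :
  (forall n, {ae @lebesgue_measure R, forall x, P n x}) ->
  {ae @lebesgue_measure R, forall x, forall n, P n x}.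
Proof.
move=> H; suff : (@lebesgue_measure R).-negligible (\bigcup_n (~` [set x | P n x])).
  by apply: negligibleS => x /= /existsNP[n nP]; exists n.
by apply: negligible_bigcup => n; exact: H.
Qed.

Lemma ultra_fmap (S T : Type) (f : S -> T) (F : set_system S) :
  UltraFilter F -> UltraFilter (f @ F).
Proof.
move=> uF; have pF := @ultra_proper _ _ uF; split; first exact: fmap_proper_filter.
move=> H pH FH; apply/seteqP; split => // A HA.
have [//|FA] := in_ultra_setVsetC (f @^-1` A) uF.
have HI : H (A `&` ~` A) by apply: filterI => //; exact: FH.
by have [x []] := filter_ex HI.
Qed.

(** * Limits of delayed curves and their velocity *)

Section generalized_characteristics.
Context {R : realType}.
Local Notation leb := (@lebesgue_measure R).
Variables (U : R * R -> R) (V : R -> R) (M L KV : R).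
Hypotheses (mU : measurable_fun setT U) (UM : forall z, `|U z| <= M).
Hypotheses (VK : forall x y, `|V x - V y| <= KV * `|x - y|).
Hypotheses (L_gt0 : 0 < L) (VL : forall x, `|V x| <= L).

Lemma cV : continuous V. Proof. exact: lipschitz_within VK. Qed.

(** The filter G is obtained as an ultrafilter finer than \oo: the bounded sequences [k n t]
    converge along it for all t simultaneously, in place of a diagonal extraction. The velocity
    estimates use only that G is proper and contains the tails. *)
Definition limit_curve (h : R -> R) : Prop :=
  exists (G : set_system nat) (k : nat -> R -> R),
  [/\ ProperFilter G, \oo `<=` G,
   (forall n, lipschitz_with L (k n)),
   (forall n s t, 0 <= s -> s <= t -> t <= n%:R ->
      k n t - k n s = integ s t (fun r => window_mean U V (width n) (r, k n (r - width n)))) &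
   (forall t, k n t @[n --> G] --> h t)].

Lemma limit_curve_exists : exists h : R -> R, [/\ lipschitz_with L h, h 0 = 0 & limit_curve h].
Proof.
have /choice[k kP] : forall n, exists k : R -> R, [/\ lipschitz_with L k, k 0 = 0 &
      forall s t, 0 <= s -> s <= t -> t <= n%:R ->
      k t - k s = integ s t (fun r => window_mean U V (width n) (r, k (r - width n)))].
  by move=> n; exact: (delayed_curve mU UM cV L_gt0 VL (width_gt0 n)).
have [G [uG sG]] := ultraFilterLemma (@eventually_filter : ProperFilter \oo).
have cvgk t : exists l : R, k n t @[n --> G] --> l.
  pose B := `[- (L * `|t|), L * `|t|]%classic : set R.
  have cB : compact B by exact: segment_compact.
  have kB : \forall n \near G, B (k n t).
    apply: filterS (filterT : G setT) => n _; have [kL k0 _] := kP n.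
    by rewrite /B /= in_itv /= -ler_norml -[k n t]subr0 -k0 -[X in _ * `|X|]subr0; exact: kL.
  move: cB; rewrite compact_ultra => /(_ (k n t @[n --> G])) cB.
  have [l [_ kl]] := cB (ultra_fmap (k ^~ t) uG) kB.
  by exists l.
have [h hP] := choice cvgk.
exists h; split; last first.
- exists G, k; split.
  + exact: ultra_proper.
  + exact: sG.
  + by move=> n; have [] := kP n.
  + by move=> n; have [] := kP n.
  + exact: hP.
- have := hP 0; under eq_cvg do rewrite (let: And3 _ e _ := kP _ in e).
  by move=> h0; apply: (cvg_unique _ h0 (cvg_cst 0)).
- move=> x y.
  have h1 : `|k n x - k n y| @[n --> G] --> `|h x - h y| by apply: cvg_norm; exact: cvgB.
  apply: (cvgr_to_le h1); apply: nearW => n; have [kL _ _] := kP n; exact: kL.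
Qed.

(* The value - B outside the window is neutral, since |P| <= B. *)
Definition upper_value (P : R -> R) (h : R -> R) (B r t : R) : R :=
  fine (ess_sup leb (fun z => ((if `|z| < r then P (U (t, h t + z)) else - B))%:E)).

Section upper.
Variables (P h : R -> R) (B : R).
Hypotheses (cP : continuous P) (PB : forall x, `|P x| <= B) (ch : continuous h).

Let F r t := ess_sup leb (fun z => (if `|z| < r then P (U (t, h t + z)) else - B)%:E).

Let F_fin r t : F r t \is a fin_num /\ (- B%:E <= F r t <= B%:E)%E.
Proof.
have B0 : 0 <= B by apply: le_trans (PB 0).
have leb0 : (0 < leb [set: R])%E by rewrite -set_itvNyy lebesgue_measure_itv /= ltry.
have bd z : - B <= (if `|z| < r then P (U (t, h t + z)) else - B) <= B.
  case: ifP => _; first by rewrite -ler_norml PB.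
  by rewrite lexx ge0_cp.
have l1 : (- B%:E <= F r t)%E.
  apply: ess_sup_gee; first exact: leb0.
  by apply: aeW => z; rewrite -EFinN lee_fin; have /andP[] := bd z.
have l2 : (F r t <= B%:E)%E.
  by apply/ess_supP; apply: aeW => z; rewrite lee_fin; have /andP[] := bd z.
split; last by rewrite l1 l2.
by rewrite fin_numElt (lt_le_trans _ l1) ?(le_lt_trans l2) ?ltry// -EFinN ltNyr.
Qed.

Lemma bm_upper r : bounded_measurable (upper_value P h B r).
Proof.
split; last first.
  exists B => t; have [f1 /andP[f2 f3]] := F_fin r t.
  by rewrite ler_norml -!lee_fin fineK// EFinN f2 f3.
apply: (measurableT_comp (f := fine)) => //.
apply: (@ess_sup_measurable _ (fun z : R * R => if `|z.2| < r then P (U (z.1, h z.1 + z.2)) else - B)).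
apply: measurable_fun_ifT => //.
  apply: measurable_fun_ltr => //.
  by apply: measurableT_comp => //; exact: measurable_snd.
apply: (measurableT_comp (continuous_measurable_fun cP)).
apply: (measurableT_comp mU); apply/measurable_fun_pairP; split; first exact: measurable_fst.
apply: (measurable_funD (f := fun z : R * R => h z.1) (g := snd)) => //.
exact: (measurableT_comp (continuous_measurable_fun ch) measurable_fst).
Qed.

Lemma upper_ge r t : {ae leb, forall x, `|x - h t| < r -> P (U (t, x)) <= upper_value P h B r t}.
Proof.
have := ess_sup_ge leb (fun z => (if `|z| < r then P (U (t, h t + z)) else - B)%:E).
move=> H; apply: (ae_imp (ae_shift (- h t) H)) => x + xr; rewrite xr [h t + _]addrC subrK.
by have [f1 _] := F_fin r t; rewrite -/(F r t) -lee_fin /upper_value fineK.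
Qed.

Lemma upper_le r t m : {ae leb, forall x, `|x - h t| < r -> P (U (t, x)) <= m} -> - B <= m ->
  upper_value P h B r t <= m.
Proof.
move=> H Bm; have [f1 _] := F_fin r t; rewrite -lee_fin /upper_value fineK//.
apply/ess_supP; apply: (ae_imp (ae_shift (h t) H)) => z; rewrite addrK [z + _]addrC lee_fin.
by case: ifP => // _; exact.
Qed.

End upper.

(** During a short time after s, the delayed curves stay so close to h that every window they
    average over lies within r of h. Their velocity times c is then at most the essential supremum
    over that neighbourhood, a bound which does not involve n and passes to the limit. *)
Lemma curve_upper (h : R -> R) (c : R) (B : R) (r s : R) :
  limit_curve h -> lipschitz_with L h -> 0 <= s -> 0 < r ->
  (forall x, `|c * V x| <= B) ->
  exists tau : R, 0 < tau /\ forall t, s <= t <= s + tau ->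
    c * (h t - h s) <= integ s t (upper_value (fun v => c * V v) h B r).
Proof.
move=> [G [k [pG sG kL kE kh]]] hL s0 r0 cB.
have cP : continuous (fun v => c * V v) by move=> x; apply: cvgM; [exact: cvg_cst|exact: cV].
have ch := lipschitz_within hL.
(* The distance to h is at most r / 8 for each of the two motions during tau, r / 4 at time s, and r
   / 8 for the delay and the window together: less than r in all. *)
pose tau := r / (8 * L).
have tau0 : 0 < tau by rewrite divr_gt0// mulr_gt0.
exists tau; split=> // t /andP[st ts].
have cv : c * (k n t - k n s) @[n --> G] --> c * (h t - h s).
  by apply: cvgM; [exact: cvg_cst|exact: cvgB].
apply: (cvgr_to_le cv).
have e1 : \forall n \near G, t <= n%:R.
  by apply: sG; exact: nbhs_infty_ger.
have e2 : \forall n \near G, width n < r / (8 * (L + 1)).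
  have r1 : 0 < r / (8 * (L + 1)) by rewrite divr_gt0// mulr_gt0// addr_gt0.
  have cw := @cvg_width R.
  have : \forall n \near \oo, width n < r / (8 * (L + 1)) by apply: (cvgr_lt (0 : R)).
  exact: sG.
have e3 : \forall n \near G, `|h s - k n s| < r / 4.
  by have /cvgrPdist_lt := kh s; apply; rewrite divr_gt0.
near=> n.
have tn : t <= n%:R by near: n.
have wn : width n < r / (8 * (L + 1)) by near: n.
have hk : `|h s - k n s| < r / 4 by near: n.
have w0 := @width_gt0 R n.
rewrite (kE n s t s0 st tn).
have mk : measurable_fun setT (k n) := continuous_measurable_fun (lipschitz_within (kL n)).
have b1 := bm_delay mU UM cV (width n) mk.
rewrite -integZ//; apply: integ_le; [exact: bmZ|exact: bm_upper|].
move=> x /andP[sx xt].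
have -> : c * window_mean U V (width n) (x, k n (x - width n)) =
    window_mean U (fun v => c * V v) (width n) (x, k n (x - width n)).
  rewrite /window_mean mulrCA -integZ//.
  exact: (bm_section1 (x, k n (x - width n)) (bm_window mU UM cV)).
apply: window_mean_le => //=.
have up := upper_ge h cB r x.
apply: (ae_imp (ae_shift (k n (x - width n)) up)) => y; rewrite [y + _]addrC => H /andP[y0 yw].
apply: H.
have l1 := kL n (x - width n) s; have l2 := hL s x.
have l3 : `|x - width n - s| <= tau + width n.
  by rewrite ler_norml; apply/andP; split; lra.
have l4 : `|s - x| <= tau by rewrite distrC ler_norml; apply/andP; split; lra.
have l5 := le_trans l1 (ler_wpM2l (ltW L_gt0) l3).
have l6 := le_trans l2 (ler_wpM2l (ltW L_gt0) l4).
have l7 : L * tau = r / 8 by rewrite /tau; field; rewrite gt_eqF.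
have l8 : (L + 1) * width n < r / 8.
  have L1 : 0 < L + 1 by rewrite addr_gt0.
  have -> : r / 8 = (L + 1) * (r / (8 * (L + 1))) by field; rewrite gt_eqF.
  by rewrite ltr_pM2l.
have -> : k n (x - width n) + y - h x =
  (k n (x - width n) - k n s) - (h s - k n s) + (h s - h x) + y by ring.
move: hk l5 l6; rewrite mulrDr l7 !ler_norml ltr_norml => /andP[? ?] /andP[? ?] /andP[? ?].
move: l8; rewrite mulrDl mul1r => l8.
by rewrite ltr_norml; apply/andP; split; lra.
Unshelve. all: by end_near. Qed.

(** At a common point of differentiability, [curve_upper] bounds c h'(t) by the upper value in every
    radius [width m]. As the radius shrinks, the one-sided essential limits reduce this value to the
    larger of c V(u_-) and c V(u_+). *)
Lemma velocity_upper (h g um up : R -> R) (c B T : R) : limit_curve h -> lipschitz_with L h ->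
  (forall x, `|c * V x| <= B) ->
  {ae leb, forall t, 0 < t < T -> der_at t h (g t)} ->
  {ae leb, forall t, 0 < t < T ->
    ess_limit_left (fun x => U (t, x)) (h t) (um t) /\
    ess_limit_right (fun x => U (t, x)) (h t) (up t)} ->
  {ae leb, forall t, 0 < t < T -> c * g t <= Num.max (c * V (um t)) (c * V (up t))}.
Proof.
move=> lc hL cB dh tr.
have cP : continuous (fun v => c * V v) by move=> x; apply: cvgM; [exact: cvg_cst|exact: cV].
have ch := lipschitz_within hL.
pose S m := upper_value (fun v => c * V v) h B (width m).
have bS m : bounded_measurable (S m) by exact: bm_upper.
have dS : {ae leb, forall t, forall m, 0 < t -> der_at t (fun y => integ 0 y (S m)) (S m t)}.
  have /ae_nat H : forall m, {ae leb, forall t, 0 < t -> der_at t (fun y => integ 0 y (S m)) (S m t)}.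
    by move=> m; exact: ae_der_integ.
  by apply: (ae_imp H) => t Ht m; exact: Ht.
have key : {ae leb, forall t, 0 < t < T -> forall m, c * g t <= S m t}.
  apply: (ae_imp2 dh dS) => t dht dSt tT m; have /andP[t0 _] := tT.
  have {}dht := dht tT; have {}dSt := dSt m t0.
  have [tau [tau0 Ht]] := curve_upper lc hL (ltW t0) (width_gt0 m) cB.
  apply/ler_addgt0Pr => e e0.
  have e2 : 0 < e / 2 by rewrite divr_gt0.
  have [r1 [r10 H1]] := der_at_close e2 (der_scale c dht).
  have [r2 [r20 H2]] := der_at_close e2 dSt.
  pose y := Num.min tau (Num.min r1 r2).
  have y0 : 0 < y by rewrite !lt_min tau0 r10.
  have ytau : y <= tau by rewrite ge_min lexx.
  have yr1 : y <= r1 by rewrite !ge_min lexx orbT.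
  have yr2 : y <= r2 by rewrite !ge_min lexx !orbT.
  have ty : t <= t + y by rewrite lerDl ltW.
  have := Ht (t + y); rewrite ty lerD2l ytau => /(_ isT) h3.
  have e3 : t + y - t = y by ring.
  have := H1 (t + y); have := H2 (t + y); rewrite e3 (gtr0_norm y0).
  move=> /(_ yr2) + /(_ yr1); rewrite (integ_chasles (bS m) (ltW t0) ty).
  move: h3; rewrite -/(S m); move: (integ 0 t _) (integ t _ _) => p q h3.
  rewrite !ler_norml => /andP[h4 h5] /andP[h6 h7].
  rewrite -(ler_pM2r y0); move: h3 h4 h5 h6 h7; rewrite mulrDl.
  have -> : e / 2 * y = e * y / 2 by field.
  move=> *; lra.
apply: (ae_imp2 key tr) => t + + tT => /(_ tT) K1 /(_ tT)[Hl Hr].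
apply/ler_addgt0Pr => e e0.
have K0 : 0 <= KV by have := VK 1 0; rewrite subr0 normr1 mulr1; apply: le_trans.
have D0 : 0 < `|c| * KV + 1 by rewrite ltr_wpDl// mulr_ge0.
pose e1 := e / (`|c| * KV + 1).
have e10 : 0 < e1 by rewrite divr_gt0.
have cVe v l : `|v - l| <= e1 -> c * V v <= c * V l + e.
  move=> vl; have -> : c * V v = c * V l + c * (V v - V l) by ring.
  rewrite lerD2l; apply: le_trans (ler_norm _) _; rewrite normrM.
  apply: (@le_trans _ _ (`|c| * (KV * e1))).
    by rewrite ler_wpM2l//; apply: le_trans (VK _ _) _; rewrite ler_wpM2l.
  by rewrite /e1 mulrA mulrCA ger_pMr// ler_pdivrMr// mul1r lerDl.
have [r1 [r10 H1]] := Hl e1 e10; have [r2 [r20 H2]] := Hr e1 e10.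
have [m [m1 m2]] : exists m, width m < r1 /\ width m < r2.
  have cw := @cvg_width R.
  have n1 : \forall n \near \oo, width n < r1 by apply: (cvgr_lt (0 : R)).
  have n2 : \forall n \near \oo, width n < r2 by apply: (cvgr_lt (0 : R)).
  have [N _ HN] := filterI n1 n2.
  by exists N; have [] := HN N (leqnn N).
apply: le_trans (K1 m) _; rewrite /S; apply: (upper_le cB).
- apply: (ae_imp2 (ae_imp2 H1 H2 (fun x a b => conj a b)) (ae_neq (h t))) => x [a1 a2] xh.
  rewrite ltr_norml => /andP[x1 x2].
  have [xl|xl|//] := ltgtP x (h t).
    apply: (@le_trans _ _ (c * V (um t) + e)); last by rewrite lerD2r le_max lexx.
    by apply: cVe; apply: a1; rewrite xl andbT; lra.
  apply: (@le_trans _ _ (c * V (up t) + e)); last by rewrite lerD2r le_max lexx orbT.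
  by apply: cVe; apply: a2; rewrite xl /=; lra.
- have : - B <= c * V (um t) by have := cB (um t); rewrite ler_norml => /andP[].
  have : c * V (um t) <= Num.max (c * V (um t)) (c * V (up t)) by rewrite le_max lexx.
  move: (Num.max _ _) => *; lra.
Qed.

(** The upper bound for c = 1 and the lower bound for c = - 1. *)
Lemma filippov (h g um up : R -> R) (T : R) : limit_curve h -> lipschitz_with L h ->
  {ae leb, forall t, 0 < t < T -> der_at t h (g t)} ->
  {ae leb, forall t, 0 < t < T ->
    ess_limit_left (fun x => U (t, x)) (h t) (um t) /\
    ess_limit_right (fun x => U (t, x)) (h t) (up t)} ->
  {ae leb, forall t, 0 < t < T ->
    Num.min (V (um t)) (V (up t)) <= g t <= Num.max (V (um t)) (V (up t))}.
Proof.
move=> lc hL dh tr.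
have B1 x : `|1 * V x| <= L by rewrite mul1r.
have B2 x : `|-1 * V x| <= L by rewrite mulN1r normrN.
apply: (ae_imp2 (velocity_upper lc hL B1 dh tr) (velocity_upper lc hL B2 dh tr)).
move=> t + + tT => /(_ tT) + /(_ tT); rewrite !mul1r !mulN1r => h1.
by rewrite -oppr_min lerN2 => h2; apply/andP.
Qed.

End generalized_characteristics.

(** * Decay of the two-sided relative entropy *)

Section slabs.
Context {R : realType}.
Local Notation leb := (@lebesgue_measure R).
Implicit Types (c d w : R -> R) (E Q : R * R -> R).

Lemma integ_ends w (B a b a' b' : R) : bounded_measurable w -> (forall x, `|w x| <= B) ->
  a <= b -> a' <= b' -> `|integ a b w - integ a' b' w| <= B * (`|a - a'| + `|b - b'|).
Proof.
move=> bw wB ab ab'.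
have B0 : 0 <= B by apply: le_trans (wB 0).
pose m := Num.min a a'.
pose P x := integ m x w.
have PL x y : m <= x -> m <= y -> `|P x - P y| <= B * `|x - y|.
  wlog xy : x y / x <= y.
    move=> H; have [xy|yx] := leP x y; first exact: H.
    by move=> h1 h2; rewrite distrC [`|x - y|]distrC; apply: H => //; exact: ltW.
  move=> mx my; rewrite /P (integ_chasles bw mx xy) opprD addrA subrr add0r normrN.
  rewrite distrC [`|y - x|]ger0_norm ?subr_ge0//.
  by apply: integ_norm_le => // *; exact: wB.
have ma : m <= a by rewrite ge_min lexx.
have ma' : m <= a' by rewrite ge_min lexx orbT.
have mb := le_trans ma ab; have mb' := le_trans ma' ab'.
have e1 : integ a b w = P b - P a by rewrite /P (integ_chasles bw ma ab); ring.
have e2 : integ a' b' w = P b' - P a' by rewrite /P (integ_chasles bw ma' ab'); ring.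
rewrite e1 e2 (_ : P b - P a - (P b' - P a') = (P b - P b') - (P a - P a')); last by ring.
apply: le_trans (ler_normB _ _) _; rewrite mulrDr addrC.
by apply: lerD; exact: PL.
Qed.

(** The indicator inside a fixed interval, instead of moving limits of integration, makes
    measurability in t a case of [bm_parameter]. *)
Definition slab (X : R) E c d (t : R) : R :=
  integ (- X) X (fun x => if c t <= x <= d t then E (t, x) else 0).

Lemma bm_slab_integrand E c d : bounded_measurable E -> measurable_fun setT c ->
  measurable_fun setT d ->
  bounded_measurable (fun z : R * R => if c z.1 <= z.2 <= d z.1 then E z else 0).
Proof.
move=> [mE [B EB]] mc md; split.
  apply: measurable_fun_ifT => //; apply: measurable_and; apply: measurable_fun_ler => //.
    exact: (measurableT_comp mc).
  exact: (measurableT_comp md).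
exists B => z; case: ifP => _; first exact: EB.
by rewrite normr0; apply: le_trans (EB z).
Qed.

Lemma bm_slab X E c d : bounded_measurable E -> measurable_fun setT c ->
  measurable_fun setT d -> bounded_measurable (slab X E c d).
Proof. by move=> bE mc md; apply: (bm_parameter _ _ (bm_slab_integrand bE mc md)). Qed.

Lemma slabE X E c d t : bounded_measurable E -> measurable_fun setT c ->
  measurable_fun setT d -> - X <= c t -> c t <= d t -> d t <= X ->
  slab X E c d t = integ (c t) (d t) (fun x => E (t, x)).
Proof.
move=> bE mc md h1 h2 h3.
have b1 : bounded_measurable (fun x : R => if c t <= x <= d t then E (t, x) else 0).
  exact: (bm_section1 t (bm_slab_integrand bE mc md)).
rewrite /slab (integ_chasles b1 h1 (le_trans h2 h3)) (integ_chasles b1 h2 h3).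
have z0 (a b : R) : b <= c t \/ d t <= a ->
    integ a b (fun x : R => if c t <= x <= d t then E (t, x) else 0) = 0.
  move=> H; have [ab|ba] := leP a b; last by rewrite integ_ltNge.
  rewrite -[RHS](mul0r (b - a)) -(integ_cst _ ab); apply: ae_eq_integ => //; first exact: bm_cst.
  apply: (ae_imp2 (ae_neq (c t)) (ae_neq (d t))) => x /eqP xc /eqP xd /andP[ax xb].
  case: ifP => // /andP[cx xd']; exfalso; move: H xc xd; rewrite !neq_lt.
  by move=> [?|?] /orP[?|?] /orP[?|?]; lra.
rewrite (z0 (- X) (c t)); last by left.
rewrite (z0 (d t) X); last by right.
rewrite addr0 add0r.
by apply: eq_integ => x ->.
Qed.

Lemma side_balance E Q (X a b Lc k Bp : R) chi c d c1 d1 (p : R -> R) (p_ : nat -> R -> R) :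
  bounded_measurable E -> bounded_measurable Q ->
  (forall n, balanced (width n) X E Q) -> admissible_cutoff a b chi ->
  lipschitz_with Lc c -> lipschitz_with Lc d ->
  bounded_measurable c1 -> bounded_measurable d1 ->
  {ae leb, forall t, a <= t <= b -> der_at t c (c1 t)} ->
  {ae leb, forall t, a <= t <= b -> der_at t d (d1 t)} ->
  0 <= k <= 1 ->
  (forall t, a <= t <= b + 1 -> [/\ - X <= c t, c t <= d t - 1 & d t + 1 <= X]) ->
  (forall n, bounded_measurable (p_ n)) -> bounded_measurable p ->
  (forall n t, a < t < b -> `|p_ n t| <= Bp) ->
  {ae leb, forall t, a < t < b -> p_ n t @[n --> \oo] --> p t} ->
  (forall n t, a < t < b -> through (width n) X E Q t (c t) (c1 t) -
     through (width n) X E Q t (d t - k * width n) (d1 t) <= p_ n t) ->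
  0 <= integ a b (fun t => derive1 chi t * slab X E c d t + chi t * p t).
Proof.
move=> bE bQ bal cut cL dL bc1 bd1 dc dd /andP[k0 k1] W bp_ bp pB cp thr.
have [bchi bchi1 chi10] := cutoff_bm cut.
have [a0 ab schi chi_ge0 chi0] := cut.
have mc := continuous_measurable_fun (lipschitz_within cL).
have md := continuous_measurable_fun (lipschitz_within dL).
have [BE EB] := bE.2.
have BE0 : 0 <= BE by apply: le_trans (EB (0, 0)).
have wk n : 0 <= k * width n <= width n.
  by rewrite mulr_ge0 ?(ltW (width_gt0 _))//= ler_piMl// ltW// width_gt0.
pose A_ n x := box (width n) X E x (c x) (d x - k * width n).
have mdw n : measurable_fun setT (fun x => d x - k * width n) by exact: measurable_funB.
have bA_ n : bounded_measurable (A_ n) by exact: bm_box.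
have bS := bm_slab X bE mc md.
have AS n t : a < t < b -> `|A_ n t - slab X E c d t| <= 3 * BE * width n.
  move=> /andP[at_ tb]; have [|h1 h2 h3] := W t.
    by rewrite (ltW at_) (le_trans (ltW tb))// lerDl.
  have /andP[w0 w1] := wk n; have w2 := @width_gt0 R n; have w3 := @width_le R n.
  have h4 : d t <= X by lra.
  have h5 : c t <= d t by lra.
  rewrite slabE//.
  have b1 : bounded_measurable (fun x => E (t, x)) by exact: bm_section1.
  have h6 : c t <= d t - k * width n by lra.
  have h7 : d t - k * width n + width n <= X by lra.
  have := plateau_integ_close (width_gt0 n) b1 (fun x => EB (t, x)) h1 h6 h7.
  have := integ_ends b1 (fun x => EB (t, x)) h6 h5.
  rewrite subrr normr0 add0r (_ : d t - k * width n - d t = - (k * width n)); last by ring.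
  rewrite normrN (ger0_norm w0) -/(A_ n t) => H1 H2.
  have H3 : BE * (k * width n) <= BE * width n by rewrite ler_wpM2l.
  apply: le_trans (ler_distD (integ (c t) (d t - k * width n) (fun x => E (t, x))) _ _) _.
  apply: le_trans (lerD H2 (le_trans H1 H3)) _.
  by rewrite (_ : 3 * BE * width n = 2 * BE * width n + BE * width n)//; ring.
have [BS SB] := bS.2.
have AB n t : a < t < b -> `|A_ n t| <= BS + 3 * BE + `|Bp|.
  move=> tab; have := AS n t tab; have := SB t.
  have w2 := @width_gt0 R n; have w3 := @width_le R n.
  have H : 3 * BE * width n <= 3 * BE by rewrite ler_piMr ?mulr_ge0//; lra.
  have := normr_ge0 Bp; move: (slab _ _ _ _ _) (A_ n t) => S A.
  rewrite !ler_norml => ? /andP[? ?] /andP[? ?]; apply/andP; split; lra.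
have pB' n t : a < t < b -> `|p_ n t| <= BS + 3 * BE + `|Bp|.
  move=> tab; apply: le_trans (pB n t tab) _; apply: le_trans (ler_norm _) _.
  by rewrite lerDr addr_ge0 ?mulr_ge0//; apply: le_trans (SB 0).
have cA : {ae leb, forall t, a < t < b -> A_ n t @[n --> \oo] --> slab X E c d t}.
  apply: aeW => t tab; apply: (cvg_dist_le (w := fun n => 3 * BE * width n)).
    by move=> n; exact: AS.
  rewrite -[X in _ --> X](mulr0 (3 * BE)).
  by apply: cvgM; [exact: cvg_cst|exact: cvg_width].
apply: (dominated_ge0 bchi bchi1 chi0 chi10 bA_ bp_ bS bp AB pB' cA cp) => n.
have w2 := @width_gt0 R n; have w3 := @width_le R n; have /andP[w0 w1] := wk n.
have bmb : bounded_measurable (balance (width n) X E Q chi (derive1 chi) c c1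
    (fun t => d t - k * width n) d1) by exact: bm_balance.
apply: (le_trans (y := integ a b (balance (width n) X E Q chi (derive1 chi) c c1
    (fun t => d t - k * width n) d1))).
  apply: (bal n a b Lc) => //.
  - by move=> x y; rewrite opprB addrA subrK; exact: dL.
  - apply: (ae_imp dd) => x dx h.
    apply: der_eq; first (apply: derB; [apply: dx|exact: der_cst]) => //.
    by rewrite subr0.
  - by move=> t /W[h1 h2 h3]; split; lra.
apply: integ_le => //; first by apply: bmD; exact: bmM.
move=> t tab; rewrite /balance lerD2l.
have [tab'|nab] := boolP (a < t < b); last by rewrite chi0// !mul0r.
by rewrite ler_wpM2l//; exact: thr.
Qed.

End slabs.

(** * Balances between the curve and an inward moving end *)

Section cones.
Context {R : realType}.
Local Notation leb := (@lebesgue_measure R).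
Variables (M T : R) (U : R * R -> R) (h g um up : R -> R) (L : R).
Hypotheses (M_gt0 : 0 < M).
Hypotheses (mU : measurable_fun setT U) (UM : forall z, `|U z| <= M).
Hypotheses (L_gt0 : 0 < L) (hL : lipschitz_with L h) (h0 : h 0 = 0)
  (bg : bounded_measurable g)
  (dh : {ae leb, forall t, 0 < t < T -> der_at t h (g t)}).
Hypotheses (bum : bounded_trace um) (bup : bounded_trace up).
Hypothesis tr : {ae leb, forall t, 0 < t < T ->
    ess_limit_left (fun x => U (t, x)) (h t) (um t) /\
    ess_limit_right (fun x => U (t, x)) (h t) (up t)}.
Variables (e Q : R -> R) (K : R).
Hypotheses (ce : continuous e) (cQ : continuous Q) (K_ge0 : 0 <= K)
  (eK : forall x y, `|x| <= M -> `|y| <= M -> `|e x - e y| <= K * `|x - y|)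
  (QK : forall x y, `|x| <= M -> `|y| <= M -> `|Q x - Q y| <= K * `|x - y|).
Let E (z : R * R) := e (U z).
Let F (z : R * R) := Q (U z).
Hypothesis bal : forall n X, balanced (width n) X E F.
Variable Y : R.
Hypothesis Y_large : 2 * L * (T + 2) + 1 <= Y.

Lemma cone_width t : 0 <= t <= T + 1 ->
  [/\ - (Y + 1) <= - Y + L * t, - Y + L * t <= h t - 1, h t + 1 <= Y - L * t,
      Y - L * t + 1 <= Y + 1 & - Y <= h t - 1 /\ h t + 1 <= Y].
Proof.
move=> /andP[t0 tT]; have := hL t 0; rewrite h0 !subr0 (ger0_norm t0) ler_norml => /andP[h1 h2].
have Lt0 : 0 <= L * t by rewrite mulr_ge0// ltW.
have LT : L * t <= L * (T + 1) by rewrite ler_pM2l.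
move: Y_large L_gt0; rewrite (_ : 2 * L * (T + 2) = 2 * (L * (T + 1)) + 2 * L); last by ring.
by move: (L * t) (L * (T + 1)) Lt0 LT h1 h2 => *; split; [lra..|split; lra].
Qed.

Lemma average_le (del X t y k : R) (E1 F1 : R * R -> R) : 0 < del ->
  bounded_measurable E1 -> bounded_measurable F1 ->
  (forall z, F1 z <= k * E1 z) -> average del X F1 t y <= k * average del X E1 t y.
Proof.
move=> d0 bE bF FE; have bb := bm_bump_at y d0.
have b1 := bm_section1 t bE; have b2 := bm_section1 t bF.
rewrite /average -integZ; last exact: bmM.
apply: integ_le; [exact: bmM|by apply: bmM; [exact: bm_cst|exact: bmM]|move=> x _].
by rewrite mulrCA ler_wpM2l// bump_at_ge0.
Qed.

Let bEF := bmEF mU UM ce cQ.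
Let mh := continuous_measurable_fun (lipschitz_within hL).

Lemma bm_edge (w : R -> R) : bounded_trace w ->
  bounded_measurable (fun t => Q (clamp M w t) - g t * e (clamp M w t)).
Proof.
by move=> bw; apply: bmB; [|apply: bmM => //]; exact: bm_clamp.
Qed.

Lemma through_bounded : exists B : R, forall n X t y, - X <= y -> y + width n <= X ->
  `|through (width n) X E F t y (g t)| <= B.
Proof.
have [bE bF] := bEF.
have [BE EB] := bE.2; have [BF FB] := bF.2; have [Bg gB] := bg.2.
exists (BF + Bg * BE) => n X t y h1 h2; apply: le_trans (ler_normB _ _) _; apply: lerD.
  exact: average_bounded (width_gt0 n) h1 h2 bF FB.
rewrite normrM; apply: ler_pM => //.
exact: average_bounded (width_gt0 n) h1 h2 bE EB.
Qed.

Lemma der_cone (k k' t : R) : der_at t (fun s : R => k + k' * s) k'.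
Proof.
apply: der_eq; first (apply: derD; [exact: der_cst|apply: der_scale; exact: der_id]).
by rewrite mulr1 add0r.
Qed.

Lemma lipschitz_cone (k k' : R) : `|k'| <= L -> lipschitz_with L (fun s : R => k + k' * s).
Proof.
move=> kL x y; rewrite (_ : k + k' * x - (k + k' * y) = k' * (x - y)); last by ring.
by rewrite normrM ler_wpM2r.
Qed.

Section cutoff.
Variables (a b : R) (chi : R -> R).
Hypotheses (cut : admissible_cutoff a b chi) (bT : b < T).

Let inT t : a < t < b -> 0 < t < T.
Proof.
case: cut => a0 _ _ _ _ /andP[at_ tb]; apply/andP; split; first exact: lt_trans at_.
exact: lt_trans bT.
Qed.

Let inT' t : a <= t <= b -> 0 < t < T.
Proof.
case: cut => a0 _ _ _ _ /andP[at_ tb]; apply/andP; split; first exact: lt_le_trans at_.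
exact: le_lt_trans bT.
Qed.

Let inT1 t : a <= t <= b + 1 -> 0 <= t <= T + 1.
Proof.
case: cut => a0 _ _ _ _ /andP[at_ tb]; apply/andP; split; first exact: le_trans (ltW a0) at_.
by apply: le_trans tb _; rewrite lerD2r ltW.
Qed.

Let inT2 t : a < t < b -> 0 <= t <= T + 1.
Proof. by move=> /andP[h1 h2]; apply: inT1; rewrite (ltW h1) (le_trans (ltW h2))// lerDl. Qed.

(** At the outer end, which has speed L, the flux through the side is an average of Q - L e,
    nonpositive and discarded. At h the averages are taken on the left and tend to the left
    trace. *)
Lemma cone_left : (forall v, `|v| <= M -> Q v <= L * e v) ->
  0 <= integ a b (fun t => derive1 chi t * slab (Y + 1) E (fun t => - Y + L * t) h t +
    chi t * - (Q (clamp M um t) - g t * e (clamp M um t))).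
Proof.
move=> QL; have [bE bF] := bEF; have [B HB] := through_bounded.
apply: (side_balance (Q := F) (Lc := L) (k := 1) (c1 := fun=> L) (d1 := g) (Bp := B)
  (p_ := fun n t => - through (width n) (Y + 1) E F t (h t - width n) (g t))) => //.
- by apply: lipschitz_cone; rewrite ger0_norm// ltW.
- exact: bm_cst.
- by apply: aeW => t _; exact: der_cone.
- by apply: (ae_imp dh) => t dt /inT'; exact: dt.
- by rewrite ler01 lexx.
- by move=> t /inT1 /cone_width[h1 h2 h3 h4 [h5 h6]]; split => //; lra.
- by move=> n; apply: bmN; apply: (bm_through _ (width_gt0 n) bE bF) => //; exact: measurable_funB.
- by apply: bmN; exact: bm_edge.
- move=> n t /inT2 /cone_width[h1 h2 h3 h4 [h5 h6]]; rewrite normrN.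
  by have w2 := @width_gt0 R n; have w3 := @width_le R n; apply: HB; lra.
- apply: (ae_imp2 tr (traces_bounded UM tr)) => t + + tab.
  move=> /(_ (inT tab))[Hl _] /(_ (inT tab))[h7 _].
  have /cone_width[h1 h2 h3 h4 [h5 h6]] := inT2 tab.
  rewrite clampE//; last by have /andP[] := inT tab.
  apply: cvgN; apply: (through_left_cvg mU UM ce cQ K_ge0 eK QK _ _ (inT tab)) => //; lra.
- move=> n t tab; rewrite mul1r gerDr /through.
  rewrite subr_le0; apply: average_le => //; first exact: width_gt0.
  by move=> z; exact: QL.
Qed.

Lemma cone_right : (forall v, `|v| <= M -> - Q v <= L * e v) ->
  0 <= integ a b (fun t => derive1 chi t * slab (Y + 1) E h (fun t => Y - L * t) t +
    chi t * (Q (clamp M up t) - g t * e (clamp M up t))).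
Proof.
move=> QL; have [bE bF] := bEF; have [B HB] := through_bounded.
have dE : (fun t => Y - L * t) = (fun t => Y + - L * t) by apply/funext => t; rewrite mulNr.
apply: (side_balance (Q := F) (Lc := L) (k := 0) (c1 := g) (d1 := fun=> - L) (Bp := B)
  (p_ := fun n t => through (width n) (Y + 1) E F t (h t) (g t))) => //.
- by rewrite dE; apply: lipschitz_cone; rewrite normrN ger0_norm// ltW.
- exact: bm_cst.
- by apply: (ae_imp dh) => t dt /inT'; exact: dt.
- by apply: aeW => t _; rewrite dE; exact: der_cone.
- by rewrite ler01 lexx.
- by move=> t /inT1 /cone_width[h1 h2 h3 h4 [h5 h6]]; split => //; lra.
- by move=> n; apply: (bm_through _ (width_gt0 n) bE bF).
- exact: bm_edge.
- move=> n t /inT2 /cone_width[h1 h2 h3 h4 [h5 h6]].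
  by have w2 := @width_gt0 R n; have w3 := @width_le R n; apply: HB; lra.
- apply: (ae_imp2 tr (traces_bounded UM tr)) => t + + tab.
  move=> /(_ (inT tab))[_ Hr] /(_ (inT tab))[_ h7].
  have /cone_width[h1 h2 h3 h4 [h5 h6]] := inT2 tab.
  rewrite clampE//; last by have /andP[] := inT tab.
  apply: (through_right_cvg mU UM ce cQ K_ge0 eK QK _ _ (inT tab)) => //; lra.
- move=> n t tab; rewrite mul0r subr0 gerBl /through mulNr opprK.
  have := @average_le (width n) (Y + 1) t (Y - L * t) L E (fun z => - F z) (width_gt0 n) bE (bmN bF)
    (fun z => QL _ (UM z)).
  rewrite [average _ _ (fun z => - F z) _ _](_ : _ = - average (width n) (Y + 1) F t (Y - L * t)).
    by rewrite -lerBlDl sub0r.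
  rewrite /average -integN; last first.
    by apply: bmM; [apply: bm_bump_at; exact: width_gt0|exact: bm_section1].
  by apply: eq_integ => x _; rewrite mulrN.
Qed.

End cutoff.

End cones.

(** * Right Lebesgue points and one-sided means in time *)

Section steady_times.
Context {R : realType}.
Local Notation leb := (@lebesgue_measure R).
Implicit Types (w : R -> R).

(** s is a right Lebesgue point of w, tested along the lengths [width m] only. *)
Definition steady w (s : R) : Prop := forall eta : R, 0 < eta ->
  \forall m \near \oo, integ s (s + width m) (fun r => `|w r - w s|) <= eta * width m.

Definition mean (m : nat) w (s : R) : R :=
  integ s (s + width m) (fun r => bump_at (width m) s r * w r).

Lemma integ_open_le (a b k : R) w : bounded_measurable w ->
  (\int[leb]_(x in `]a, b[) (w x)%:E <= k%:E)%E -> integ a b w <= k.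
Proof.
move=> bw H; rewrite -lee_fin (integE _ _ bw); apply: le_trans H.
rewrite (@integral_itv_bndoo R a b (fun x => (w x)%:E) true false)//.
by apply: measurable_funTS; apply/measurable_EFinP; case: bw.
Qed.

Lemma ae_steady w : bounded_measurable w -> {ae leb, forall s, steady w s}.
Proof.
move=> bw; have [mw [B wB]] := bw.
have loc : locally_integrable setT w.
  split => //; first exact: openT.
  move=> K _ cK; have mK : measurable (K : set (measurableTypeR R)) by exact: compact_measurable.
  have Kfin : (leb K < +oo)%E by exact: compact_finite_measure.
  by have /integrableP[] := bm_integrable mK Kfin bw.
apply: (ae_imp (lebesgue_differentiation loc)) => s /= ls eta eta0.
have e4 : (0 < (eta / 4)%:E :> \bar R)%E by rewrite lte_fin divr_gt0.
have H : \forall r \near (0 : R)^'+, (davg w s r < (eta / 4)%:E)%E.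
  have nb : nbhs (0%E : \bar R) [set x | (x < (eta / 4)%:E)%E].
    by apply: open_nbhs_nbhs; split; [exact: open_ereal_lt_ereal|exact: e4].
  exact: (ls _ nb).
have [rho /= rho0 Hrho] : exists2 rho : R, 0 < rho & forall r, 0 < r -> r < rho -> (davg w s r < (eta / 4)%:E)%E.
  have [rho /= rho0 Hrho] := H; exists rho => // r r0 rr; apply: Hrho => //=.
  by rewrite sub0r normrN gtr0_norm.
have cw := @cvg_width R.
near=> m.
have wr : 2 * width m < rho.
  suff : width m < rho / 2 by lra.
  by near: m; apply: (cvgr_lt (0 : R)) => //; rewrite divr_gt0.
have w0 := @width_gt0 R m.
have w20 : 0 < 2 * width m :> R by rewrite mulr_gt0.
have := Hrho _ w20 wr; rewrite /davg /iavg lebesgue_measure_ball; last exact: ltW.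
have w4 : (2 * width m) *+ 2 != 0 :> R by rewrite gt_eqF// pmulrn_lgt0.
rewrite inver (negPf w4) => /ltW; rewrite lee_pdivrMl; last by rewrite pmulrn_lgt0.
rewrite (_ : ((2 * width m *+ 2)%:E * (eta / 4)%:E = (eta * width m)%:E)%E); last first.
  by rewrite -EFinM; congr EFin; rewrite -mulr_natr; field.
move=> H1; have bd : bounded_measurable (fun r => `|w r - w s|).
  by apply: bm_norm; apply: bmB => //; exact: bm_cst.
apply: integ_open_le => //; apply: le_trans H1.
apply: ge0_subset_integral => //.
- exact: measurable_ball.
- apply: measurable_funTS; apply/measurable_EFinP.
  by case: bd.
- move=> x /=; rewrite in_itv /= => /andP[h1 h2]; rewrite /ball /= ltr_norml.
  by apply/andP; split; lra.
Unshelve. all: by end_near. Qed.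

Lemma bump_at_le (B del a x : R) : 0 < del -> (forall x, bump x <= B) ->
  bump_at del a x <= B / del.
Proof. by move=> d0 H; rewrite /bump_at ler_pM2r ?invr_gt0. Qed.

Lemma mean_diff m w (s k : R) : bounded_measurable w ->
  mean m w s - k = integ s (s + width m) (fun r => bump_at (width m) s r * (w r - k)).
Proof.
move=> bw; have w0 := @width_gt0 R m; have bb := bm_bump_at s w0.
under [in RHS]eq_fun do rewrite mulrBr.
rewrite (integB _ _ (bmM bb bw) (bmM bb (bm_cst _ k))); congr (_ - _).
under eq_fun do rewrite mulrC.
by rewrite (integZ _ _ k bb) (integ_bump_at w0)// ?mulr1// lerDl divr_ge0// ltW.
Qed.

Lemma mean_ge m w (s k : R) : bounded_measurable w ->
  (forall r, s <= r <= s + width m -> k <= w r) -> k <= mean m w s.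
Proof.
move=> bw H; rewrite -subr_ge0 (mean_diff _ _ _ bw); apply: integ_ge0 => r rs.
by rewrite mulr_ge0 ?bump_at_ge0 ?width_gt0// subr_ge0 H.
Qed.

Lemma mean_steady w (s : R) : bounded_measurable w -> steady w s ->
  forall eta : R, 0 < eta -> \forall m \near \oo, mean m w s <= w s + eta.
Proof.
move=> bw ss eta eta0; have [B [B0 HB]] := @bump_bounded R.
have e1 : 0 < eta / B by rewrite divr_gt0.
near=> m; have H : integ s (s + width m) (fun r => `|w r - w s|) <= eta / B * width m.
  by near: m; exact: ss.
have w0 := @width_gt0 R m; have bb := bm_bump_at s w0.
rewrite -lerBlDl (mean_diff _ _ _ bw).
have bd : bounded_measurable (fun r => w r - w s) by apply: bmB => //; exact: bm_cst.
apply: (@le_trans _ _ (B / width m * integ s (s + width m) (fun r => `|w r - w s|))).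
  have bn := bm_norm bd.
  rewrite -(integZ _ _ _ bn); apply: integ_le; [exact: bmM|exact: bmM (bm_cst _ _) _|].
  move=> r _; apply: le_trans (ler_norm _) _; rewrite normrM ler_wpM2r//.
  by rewrite ger0_norm ?bump_at_ge0//; exact: bump_at_le.
apply: (@le_trans _ _ (B / width m * (eta / B * width m))).
  by rewrite ler_wpM2l// divr_ge0 ?ltW.
rewrite le_eqVlt; apply/orP; left; apply/eqP; field.
by rewrite !gt_eqF.
Unshelve. all: by end_near. Qed.

Definition lower_right w (t : R) : Prop := forall eta : R, 0 < eta ->
  exists rho : R, 0 < rho /\ forall r, t <= r <= t + rho -> w t - eta <= w r.

Lemma steady_le w (s t : R) : bounded_measurable w -> steady w s -> lower_right w t ->
  (\forall m \near \oo, mean m w t <= mean m w s) -> w t <= w s.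
Proof.
move=> bw ss lt H; apply/ler_addgt0Pr => eta eta0.
have e2 : 0 < eta / 2 by rewrite divr_gt0.
have [rho [rho0 Hr]] := lt _ e2.
suff H0 : w t - eta / 2 <= w s + eta / 2 by move: H0; clear; lra.
have cw := @cvg_width R.
near \oo => m.
have h1 : mean m w t <= mean m w s by near: m.
have h2 : mean m w s <= w s + eta / 2 by near: m; exact: mean_steady.
have wr : width m < rho by near: m; apply: (cvgr_lt (0 : R)).
have h3 : w t - eta / 2 <= mean m w t.
  apply: mean_ge => // r /andP[h3 h4]; apply: Hr; rewrite h3/=.
  by apply: le_trans h4 _; rewrite lerD2l ltW.
exact: le_trans h3 (le_trans h1 h2).
Unshelve. all: by end_near. Qed.

Lemma integ_vanish (a b u v : R) w : bounded_measurable w ->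
  (forall x, ~~ (u < x < v) -> w x = 0) -> a <= u -> u <= v -> v <= b ->
  integ a b w = integ u v w.
Proof.
move=> bw w0 au uv vb.
have z (x y : R) : y <= u \/ v <= x -> integ x y w = 0.
  move=> H; rewrite (eq_integ (g := fun=> 0)).
    have [xy|yx] := leP x y; first by rewrite integ_cst// mul0r.
    by rewrite integ_ltNge.
  move=> r /andP[h1 h2]; apply: w0; apply/negP => /andP[h3 h4].
  by case: H => H; lra.
rewrite (integ_chasles bw au (le_trans uv vb)) (integ_chasles bw uv vb).
by rewrite (z a u) ?(z v b) ?addr0 ?add0r//; [right|left].
Qed.

(** The derivative of the plateau is a bump at s minus a bump at t. The lower limit s + [width m] /
    4 is still to the left of the first bump, and is positive even for s = 0: so the inequality,
    which holds only for positive times, reaches the initial time. *)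
Lemma mean_of_cutoff (m : nat) w (s t : R) : bounded_measurable w -> s <= t ->
  integ (s + width m / 4) (t + 2 * width m) (fun r => derive1 (plateau (width m) s t) r * w r) =
  mean m w s - mean m w t.
Proof.
move=> bw st; have w0 := @width_gt0 R m.
have bs := bm_bump_at s w0; have bt := bm_bump_at t w0.
have E r : derive1 (plateau (width m) s t) r * w r =
    bump_at (width m) s r * w r - bump_at (width m) t r * w r.
  by rewrite (der_at_derive1 (der_plateau _ _ _ _)) mulrBl.
under eq_fun do rewrite E.
rewrite (integB _ _ (bmM bs bw) (bmM bt bw)).
have V (c : R) : s <= c -> c <= t ->
    integ (s + width m / 4) (t + 2 * width m) (fun r => bump_at (width m) c r * w r) = mean m w c.
  move=> sc ct; have bc := bmM (bm_bump_at c w0) bw.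
  have out x : ~~ (c + width m / 2 < x < c + width m) -> bump_at (width m) c x * w x = 0.
    by move=> nx; rewrite bump_at_out// mul0r.
  rewrite /mean (integ_vanish bc out)//; try lra.
  by rewrite (integ_vanish bc out)//; lra.
by rewrite !V.
Qed.

End steady_times.

(** * Regularity in time of integrals over slabs *)

Section slab_times.
Context {R : realType}.
Local Notation leb := (@lebesgue_measure R).
Variables (M X L : R) (U : R * R -> R) (e : R -> R) (c d : R -> R).
Hypotheses (mU : measurable_fun setT U) (UM : forall z, `|U z| <= M).
Hypotheses (ce : continuous e) (L_gt0 : 0 < L).
Hypotheses (cL : lipschitz_with L c) (dL : lipschitz_with L d).
Let E (z : R * R) := e (U z).
Let bE : bounded_measurable E. Proof. exact: (bm_pair mU UM ce). Qed.
Let mc := continuous_measurable_fun (lipschitz_within cL).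
Let md := continuous_measurable_fun (lipschitz_within dL).
Let X_ok (t : R) := [/\ - X <= c t, c t <= d t & d t <= X].

Let slab_move (B r t : R) : (forall z, `|E z| <= B) -> X_ok r -> X_ok t ->
  `|slab X E c d r - integ (c t) (d t) (fun x => E (r, x))| <= B * (2 * L * `|r - t|).
Proof.
move=> EB [h1 h2 h3] [h4 h5 h6]; rewrite (slabE bE mc md)//.
have B0 : 0 <= B by apply: le_trans (EB (0, 0)).
have := integ_ends (bm_section1 r bE) (fun x => EB (r, x)) h2 h5.
move=> H; apply: le_trans H _; rewrite ler_wpM2l//.
by have := cL r t; have := dL r t; lra.
Qed.

(* Convexity of [e] reduces lower semicontinuity to weak continuity in time. *)
Lemma slab_lower (k : R -> R) (T t : R) : continuous k ->
  (forall v w, `|v| <= M -> `|w| <= M -> e w + k w * (v - w) <= e v) ->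
  (forall g : R -> R, leb.-integrable setT (EFin \o g) ->
     {within `[0, +oo[, continuous (fun t => \int[leb]_x (g x * U (t, x)))}) ->
  0 <= t -> t < T -> (forall r, 0 <= r <= T -> X_ok r) ->
  lower_right (slab X E c d) t.
Proof.
move=> ck kc wk t0 tT ok eta eta0.
have [B EB] := bE.2; have B0 : 0 <= B by apply: le_trans (EB (0, 0)).
have okt : X_ok t by apply: ok; rewrite t0 ltW.
have [h1 h2 h3] := okt.
pose G x := k (U (t, x)).
have bG : bounded_measurable G by exact: (bm_section1 t (bm_pair mU UM ck)).
have bUs r := bm_section1 r (conj mU (ex_intro _ M UM) : bounded_measurable U).
(* The supporting slopes of e at time t, on the slab frozen at time t: an integrable weight
   independent of r, to which weak continuity applies. *)
pose g x := G x * \1_(`[c t, d t]%classic : set R) x.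
have mI : measurable_fun setT (\1_(`[c t, d t]%classic : set R) : R -> R).
  by apply: measurable_indic; exact: measurable_itv.
have bg : bounded_measurable g.
  apply: bmM => //; split => //; exists 1 => x.
  by rewrite indicE; case: (_ \in _); rewrite ?normr1// normr0.
have gout x : ~~ (c t <= x <= d t) -> g x = 0.
  by move=> nx; rewrite /g indicE memNset ?mulr0// /= in_itv /=; apply/negP.
have ig : leb.-integrable setT (EFin \o g).
  apply/integrableP; split; first by apply/measurable_EFinP; case: bg.
  have -> : (\int[leb]_x `|(EFin \o g) x| = \int[leb]_x (`|g x|)%:E)%E by apply: eq_integral.
  rewrite (integ_supported (a := c t) (b := d t)) ?ltry//; first exact: bm_norm.
  by move=> x /gout ->; rewrite normr0.
have IE r : \int[leb]_x (g x * U (r, x)) = integ (c t) (d t) (fun x => G x * U (r, x)).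
  rewrite /Rintegral (integ_supported (a := c t) (b := d t)).
  - apply: eq_integ => x xcd; rewrite /g indicE mem_set ?mulr1//.
  - exact: bmM.
  - by move=> x /gout ->; rewrite mul0r.
have /subspace_continuousP cont := wk g ig.
have t_in : (`[0, +oo[%classic : set R) t by rewrite /= in_itv /= t0.
have e3 : 0 < eta / 2 by rewrite divr_gt0.
have [rho [rho0 Hr]] : exists rho : R, 0 < rho /\ forall r, t <= r <= t + rho ->
    `|integ (c t) (d t) (fun x => G x * U (r, x)) - integ (c t) (d t) (fun x => G x * U (t, x))| <= eta / 2.
  have /cvgrPdist_le /(_ _ e3) := cont t t_in.
  move=> [rho /= rho0 H]; exists (rho / 2); split; first by rewrite divr_gt0.
  move=> r /andP[tr rr]; rewrite -!IE distrC; apply: H.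
    by rewrite /ball /= distrC ger0_norm ?subr_ge0//; lra.
  by rewrite in_itv /= (le_trans t0).
(* The last bound limits the effect of the motion of the two ends to eta / 2; weak continuity
   accounts for the other half. *)
pose rho' := Num.min rho (Num.min (T - t) (eta / (4 * L * B + 1))).
have D0 : 0 < 4 * L * B + 1 by rewrite ltr_wpDl// !mulr_ge0// ltW.
have rho'0 : 0 < rho' by rewrite !lt_min rho0 subr_gt0 tT divr_gt0.
exists rho'; split => // r /andP[tr rr].
have [r1 r2 r3] : [/\ r <= t + rho, r <= T & r - t <= eta / (4 * L * B + 1)].
  have : r - t <= rho' by rewrite lerBlDl.
  rewrite !le_min => /andP[? /andP[? ?]]; split => //; lra.
have okr : X_ok r by apply: ok; rewrite (le_trans t0 tr).
have := slab_move EB okr okt; rewrite (ger0_norm (x := r - t)) ?subr_ge0//.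
have H4 : B * (2 * L * (r - t)) <= eta / 2.
  move: r3; rewrite ler_pdivlMr// => r3.
  have : 0 <= r - t by rewrite subr_ge0.
  by move: r3; rewrite mulrDr mulr1; move: (r - t) => p r3 p0; lra.
have H5 := Hr r; rewrite tr r1 in H5; have {}H5 := H5 isT.
have b1 := bm_section1 r bE; have b2 := bm_section1 t bE.
have b3 := bmM bG (bUs r); have b4 := bmM bG (bUs t).
have H6 : integ (c t) (d t) (fun x => E (t, x)) + (integ (c t) (d t) (fun x => G x * U (r, x)) -
    integ (c t) (d t) (fun x => G x * U (t, x))) <= integ (c t) (d t) (fun x => E (r, x)).
  rewrite -(integB _ _ b3 b4) -(integD _ _ b2 (bmB b3 b4)).
  apply: integ_le => //; first by apply: bmD => //; exact: bmB.
  by move=> x _; rewrite -mulrBr; exact: kc.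
have H7 : slab X E c d t = integ (c t) (d t) (fun x => E (t, x)) by rewrite (slabE bE mc md).
rewrite H7; move: H4 H5 H6.
move: (slab X E c d r) (integ _ _ _) (integ _ _ _) (integ _ _ _) (integ _ _ _) (B * _).
move=> p1 p2 p3 p4 p5 p6; rewrite !ler_norml => i1 /andP[i2 i3] i4 /andP[i5 i6]; lra.
Qed.

(** Since e is Lipschitz on [- M, M], slab integrals at times r and s differ by at most K times the
    L^1 distance of U(r, .) and U(s, .) on [- X, X], plus O(r - s) for the ends. A right Lebesgue
    time controls the time average of that distance. *)
Lemma slab_steady (u : R -> R -> R) (K T s : R) : 0 <= K -> 0 < X ->
  (forall x y, `|x| <= M -> `|y| <= M -> `|e x - e y| <= K * `|x - y|) ->
  (forall t : R, 0 <= t -> measurable_fun setT (u t)) ->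
  (forall t : R, 0 <= t -> {ae leb, forall x : R, u t x = U (t, x)}) ->
  right_lebesgue_time u s -> 0 <= s -> s < T -> (forall r, 0 <= r <= T -> X_ok r) ->
  steady (slab X E c d) s.
Proof.
move=> K0 X0 eK meas uU rl s0 sT ok eta eta0.
have [B EB] := bE.2; have B0 : 0 <= B by apply: le_trans (EB (0, 0)).
have oks : X_ok s by apply: ok; rewrite s0 ltW.
have [h1 h2 h3] := oks.
pose F (z : R * R) := `|U z - U (s, z.2)|.
have bU : bounded_measurable U by split => //; exists M.
have bUs r := bm_section1 r bU.
have bF : bounded_measurable F.
  apply: bm_norm; apply: bmB => //.
  exact: (bm_comp (@measurable_snd _ _ R R) (bUs s)).
pose dist r := integ (- X) X (fun x => F (r, x)).
have bdist : bounded_measurable dist by exact: bm_parameter.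
have H r : s <= r <= T -> `|slab X E c d r - slab X E c d s| <= K * dist r + B * (2 * L * (r - s)).
  move=> /andP[sr rT]; have okr : X_ok r by apply: ok; rewrite (le_trans s0 sr).
  have := slab_move EB okr oks; rewrite (ger0_norm (x := r - s)) ?subr_ge0// => Hm.
  have b1 := bm_section1 r bE; have b2 := bm_section1 s bE; have b3 := bm_section1 r bF.
  apply: le_trans (ler_distD (integ (c s) (d s) (fun x => E (r, x))) _ _) _.
  rewrite addrC; apply: lerD => //; rewrite (slabE bE mc md)// -(integB _ _ b1 b2).
  apply: le_trans (integ_norm _ _ (bmB b1 b2)) _; apply: (le_trans (y := integ (c s) (d s) (fun x => K * F (r, x)))).
    apply: integ_le; [exact: bm_norm (bmB b1 b2)|by apply: bmM => //; exact: bm_cst|].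
    by move=> x _; exact: eK.
  rewrite (integZ _ _ _ b3) ler_wpM2l// /dist.
  rewrite (integ_chasles b3 h1 (le_trans h2 h3)) (integ_chasles b3 h2 h3).
  have p1 : 0 <= integ (- X) (c s) (fun x => F (r, x)) by apply: integ_ge0 => x _; exact: normr_ge0.
  have p2 : 0 <= integ (d s) X (fun x => F (r, x)) by apply: integ_ge0 => x _; exact: normr_ge0.
  by rewrite addrCA lerDl addr_ge0.
pose k := eta / (2 * (K + 1)).
have K1 : 0 < K + 1 by rewrite ltr_wpDl.
have k0 : 0 < k by rewrite divr_gt0// mulr_gt0.
have [rho rho0 Hrho] : exists2 rho : R, 0 < rho & forall t, 0 < t -> t < rho ->
    integ s (s + t) dist <= k * t.
  have cvP := rl X X0.
  have nb : nbhs (0%E : \bar R) [set x | (x < k%:E)%E].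
    by apply: open_nbhs_nbhs; split; [exact: open_ereal_lt_ereal|rewrite /= lte_fin].
  have [rho /= rho0 Hr] := cvP _ nb; exists rho => // t t0 tr.
  have := Hr t; rewrite /= sub0r normrN gtr0_norm// => /(_ tr t0) /ltW; rewrite lee_pdivrMl// => H1; rewrite mulrC; apply: integ_open_le => //.
  apply: le_trans H1; rewrite le_eqVlt; apply/orP; left; apply/eqP; apply: eq_integral => r.
  rewrite inE /= in_itv /= => /andP[sr _]; have r0 := le_trans s0 (ltW sr).
  rewrite integE; last exact: (bm_section1 r bF).
  have mF : measurable_fun `](- X), X[ (fun x => (F (r, x))%:E).
    by apply: measurable_funTS; apply/measurable_EFinP; case: (bm_section1 r bF).
  rewrite (@integral_itv_bndoo R (- X) X (fun x => (F (r, x))%:E) true false)//.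
  apply: ae_eq_integral => //.
    apply: measurable_funTS; apply/measurable_EFinP; apply: measurableT_comp => //.
    by apply: measurable_funB; exact: meas.
  apply: (ae_imp2 (uU r r0) (uU s s0)) => x -> -> _; by [].
have cw := @cvg_width R.
have bS := bm_slab X bE mc md.
have bSs : bounded_measurable (fun r => `|slab X E c d r - slab X E c d s|).
  by apply: bm_norm; apply: bmB => //; exact: bm_cst.
have Ts0 : 0 < T - s by rewrite subr_gt0.
have D0 : 0 < eta / (4 * L * B + 1) by rewrite divr_gt0// ltr_wpDl// !mulr_ge0// ltW.
near=> m.
have w0 : 0 < width m :> R by exact: width_gt0.
have w1 : width m < rho by near: m; apply: (cvgr_lt (0 : R)).
have w2 : width m < T - s by near: m; apply: (cvgr_lt (0 : R)).
have w3 : width m < eta / (4 * L * B + 1) by near: m; apply: (cvgr_lt (0 : R)).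
move: (width m) w0 w1 w2 w3 => w w0 w1 w2 w3.
have H1 := Hrho _ w0 w1.
have sw : s <= s + w by rewrite lerDl ltW.
apply: (le_trans (y := integ s (s + w) (fun r => K * dist r + B * (2 * L * w)))).
  have b2 : bounded_measurable (fun r => K * dist r) by apply: bmM => //; exact: bm_cst.
  apply: integ_le => //; first by apply: bmD => //; exact: bm_cst.
  move=> r /andP[sr rw]; apply: le_trans (H r _) _.
    by rewrite sr/= (le_trans rw)// -lerBrDl ltW.
  rewrite lerD2l; apply: ler_wpM2l => //; apply: ler_wpM2l; first by rewrite mulr_ge0// ltW.
  by rewrite lerBlDl.
rewrite (integD _ _ (bmM (bm_cst _ K) bdist) (bm_cst _ _)) (integZ _ _ _ bdist) integ_cst//.
rewrite (_ : s + w - s = w); last by ring.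
rewrite (_ : eta * w = eta / 2 * w + eta / 2 * w); last by field.
apply: lerD.
  apply: le_trans (ler_wpM2l K0 H1) _; rewrite mulrA.
  suff Hk : K * k <= eta / 2 by exact: ler_wpM2r (ltW w0) _ _ Hk.
  rewrite /k (_ : K * (eta / (2 * (K + 1))) = eta / 2 * (K / (K + 1))); last by field; rewrite gt_eqF.
  have e2 : 0 <= eta / 2 by rewrite divr_ge0// ltW.
  by rewrite ler_piMr// ler_pdivrMr// mul1r lerDl.
apply: ler_wpM2r; first exact: ltW.
have D1 : 0 < 4 * L * B + 1 by rewrite ltr_wpDl// !mulr_ge0// ltW.
move: w3; rewrite ltr_pdivlMr// mulrDr mulr1 => w3.
rewrite (_ : B * (2 * L * w) = w * (4 * L * B) / 2); last by field.
by move: (w * _) w3 => p w3; lra.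
Unshelve. all: by end_near. Qed.

End slab_times.

Section regular_times.
Context {R : realType}.
Local Notation leb := (@lebesgue_measure R).
Implicit Types (w v : R -> R).

Lemma steadyDZ w v (a s : R) : bounded_measurable w -> bounded_measurable v -> 0 <= a ->
  steady w s -> steady v s -> steady (fun r => w r + a * v r) s.
Proof.
move=> bw bv a0 sw sv eta eta0.
have e2 : 0 < eta / 2 by rewrite divr_gt0.
have a1 : 0 < a + 1 by rewrite ltr_wpDl.
have e3 : 0 < eta / (2 * (a + 1)) by rewrite divr_gt0// mulr_gt0.
near=> m.
have h1 : integ s (s + width m) (fun r => `|w r - w s|) <= eta / 2 * width m.
  by near: m; exact: sw.
have h2 : integ s (s + width m) (fun r => `|v r - v s|) <= eta / (2 * (a + 1)) * width m.
  by near: m; exact: sv.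
have w0 : 0 <= width m :> R by rewrite ltW// width_gt0.
have b1 : bounded_measurable (fun r => `|w r - w s|).
  by apply: bm_norm; apply: bmB => //; exact: bm_cst.
have b2 : bounded_measurable (fun r => `|v r - v s|).
  by apply: bm_norm; apply: bmB => //; exact: bm_cst.
have b3 := bmM (bm_cst _ a) b2.
apply: (le_trans (y := integ s (s + width m) (fun r => `|w r - w s| + a * `|v r - v s|))).
  apply: integ_le.
  - apply: bm_norm; apply: bmB; last exact: bm_cst.
    by apply: bmD => //; apply: bmM => //; exact: bm_cst.
  - exact: bmD.
  move=> r _; rewrite (_ : _ - _ = (w r - w s) + a * (v r - v s)); last by ring.
  by apply: le_trans (ler_normD _ _) _; rewrite normrM (ger0_norm a0).
rewrite (integD _ _ b1 b3) (integZ _ _ _ b2).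
rewrite (_ : eta * width m = eta / 2 * width m + eta / 2 * width m); last by field.
apply: lerD => //; apply: le_trans (ler_wpM2l a0 h2) _; rewrite mulrA.
suff Hk : a * (eta / (2 * (a + 1))) <= eta / 2 by exact: ler_wpM2r w0 _ _ Hk.
rewrite (_ : a * (eta / (2 * (a + 1))) = eta / 2 * (a / (a + 1))); last by field; rewrite gt_eqF.
by rewrite ler_piMr ?(ltW e2)// ler_pdivrMr// mul1r lerDl.
Unshelve. all: by end_near. Qed.

Lemma lower_rightDZ w v (a t : R) : 0 <= a -> lower_right w t -> lower_right v t ->
  lower_right (fun r => w r + a * v r) t.
Proof.
move=> a0 lw lv eta eta0.
have a1 : 0 < a + 1 by rewrite ltr_wpDl.
have e2 : 0 < eta / 2 by rewrite divr_gt0.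
have [r1 [r10 H1]] := lw _ e2.
have e3 : 0 < eta / (2 * (a + 1)) by rewrite divr_gt0// mulr_gt0.
have [r2 [r20 H2]] := lv _ e3.
exists (Num.min r1 r2); split; first by rewrite lt_min r10.
move=> r /andP[tr]; rewrite -lerBlDl le_min => /andP[h1 h2].
have := H1 r; rewrite tr -lerBlDl h1 => /(_ isT) k1.
have := H2 r; rewrite tr -lerBlDl h2 => /(_ isT) k2.
have k3 : a * (v t - eta / (2 * (a + 1))) <= a * v r by rewrite ler_wpM2l.
have k4 : a * (eta / (2 * (a + 1))) <= eta / 2.
  rewrite (_ : a * (eta / (2 * (a + 1))) = eta / 2 * (a / (a + 1))); last by field; rewrite gt_eqF.
  by rewrite ler_piMr// ?divr_ge0 ?(ltW eta0)// ler_pdivrMr// mul1r lerDl.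
rewrite mulrBr in k3; lra.
Qed.

End regular_times.

(** * Exhaustion of half-lines by segments *)

Section half_lines.
Context {R : realType}.
Local Notation leb := (@lebesgue_measure R).
Variables (F : R -> R) (z c : R).
Hypotheses (bF : bounded_measurable F) (F0 : forall x, 0 <= F x).

Let mF (D : set (measurableTypeR R)) : measurable_fun D (fun x => (F x)%:E).
Proof. by apply: measurable_funTS; apply/measurable_EFinP; case: bF. Qed.

Lemma archi_above (x : R) : exists n : nat, x <= n%:R.
Proof.
have := archi_boundP (normr_ge0 x); move: (Num.bound _) => n h.
by exists n; apply: le_trans (ler_norm x) (ltW h).
Qed.

Lemma half_line_left : (integ (- n%:R + c) z F)%:E @[n --> \oo] -->
  (\int[leb]_(x in `]-oo, 0%R[) (F (x + z))%:E)%E.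
Proof.
pose J (n : nat) : set R := `[- n%:R + c, z]%classic.
have -> : (\int[leb]_(x in `]-oo, 0%R[) (F (x + z))%:E =
    \int[leb]_(x in \bigcup_n J n) (F x)%:E)%E.
  have -> : \bigcup_n J n = `]-oo, z]%classic.
    apply/seteqP; split => [x [n _]|x]; rewrite /= ?in_itv /=; first by move=> /andP[].
    move=> xz; have [n hn] := archi_above (c - x); exists n => //=.
    by rewrite /J /= in_itv /= xz andbT; lra.
  have mI : measurable_fun `]-oo, z[ (fun x => (F x)%:E) by exact: mF.
  rewrite -(@integral_itv_bndo_bndc R _ z (fun x => (F x)%:E) mI).
  rewrite -(integral_shift z (measurable_itv _) mI) //.
  congr (integral _ _ _); apply/seteqP; split => x; rewrite /= !in_itv /=; lra.
under eq_cvg do rewrite (integE _ _ bF).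
apply: ge0_nondecreasing_set_cvg_integral => //.
- move=> m n mn; apply/subsetPset => x; rewrite /J /= !in_itv /= => /andP[h1 ->].
  by rewrite andbT; apply: le_trans h1; rewrite lerD2r lerN2 ler_nat.
- by move=> n; exact: measurable_itv.
- by move=> n x _; rewrite lee_fin.
Qed.

Lemma half_line_right : (integ z (n%:R - c) F)%:E @[n --> \oo] -->
  (\int[leb]_(x in `]0%R, +oo[) (F (x + z))%:E)%E.
Proof.
pose J (n : nat) : set R := `[z, n%:R - c]%classic.
have -> : (\int[leb]_(x in `]0%R, +oo[) (F (x + z))%:E =
    \int[leb]_(x in \bigcup_n J n) (F x)%:E)%E.
  have -> : \bigcup_n J n = `[z, +oo[%classic.
    apply/seteqP; split => [x [n _]|x]; rewrite /= ?in_itv /= ?andbT; first by move=> /andP[].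
    move=> xz; have [n hn] := archi_above (c + x); exists n => //=.
    by rewrite /J /= in_itv /= xz /=; lra.
  have mI : measurable_fun `]z, +oo[ (fun x => (F x)%:E) by exact: mF.
  rewrite -(@integral_itv_obnd_cbnd R z _ (fun x => (F x)%:E) mI).
  rewrite -(integral_shift z (measurable_itv _) mI) //.
  congr (integral _ _ _); apply/seteqP; split => x; rewrite /= !in_itv /= !andbT; lra.
under eq_cvg do rewrite (integE _ _ bF).
apply: ge0_nondecreasing_set_cvg_integral => //.
- move=> m n mn; apply/subsetPset => x; rewrite /J /= !in_itv /= => /andP[-> h1] /=.
  by apply: le_trans h1 _; rewrite lerD2r ler_nat.
- by move=> n; exact: measurable_itv.
- by move=> n x _; rewrite lee_fin.
Qed.

End half_lines.

(** * Monotonicity of the weighted two-sided entropy *)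

Section contraction.
Context {R : realType}.
Local Notation leb := (@lebesgue_measure R).
Variables (M L a K : R) (u : R -> R -> R) (U : R * R -> R) (h um up : R -> R)
  (el Ql kl er Qr kr : R -> R).
Hypotheses (M_gt0 : 0 < M) (L_gt0 : 0 < L) (a_ge0 : 0 <= a) (K_ge0 : 0 <= K).
Hypotheses (mU : measurable_fun setT U) (UM : forall z, `|U z| <= M)
  (meas : forall t : R, 0 <= t -> measurable_fun setT (u t))
  (uU : forall t : R, 0 <= t -> {ae leb, forall x : R, u t x = U (t, x)})
  (weak : forall g : R -> R, leb.-integrable setT (EFin \o g) ->
     {within `[0, +oo[, continuous (fun t => \int[leb]_x (g x * U (t, x)))}).
Hypotheses (hL : lipschitz_with L h) (h0 : h 0 = 0)
  (bum : bounded_trace um) (bup : bounded_trace up).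
Hypotheses (cel : continuous el) (cQl : continuous Ql) (ckl : continuous kl)
  (cer : continuous er) (cQr : continuous Qr) (ckr : continuous kr)
  (elK : forall x y, `|x| <= M -> `|y| <= M -> `|el x - el y| <= K * `|x - y|)
  (QlK : forall x y, `|x| <= M -> `|y| <= M -> `|Ql x - Ql y| <= K * `|x - y|)
  (erK : forall x y, `|x| <= M -> `|y| <= M -> `|er x - er y| <= K * `|x - y|)
  (QrK : forall x y, `|x| <= M -> `|y| <= M -> `|Qr x - Qr y| <= K * `|x - y|)
  (kel : forall v w, `|v| <= M -> `|w| <= M -> el w + kl w * (v - w) <= el v)
  (ker : forall v w, `|v| <= M -> `|w| <= M -> er w + kr w * (v - w) <= er v)
  (QlL : forall v, `|v| <= M -> Ql v <= L * el v)
  (QrL : forall v, `|v| <= M -> - Qr v <= L * er v)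
  (ball_ : forall n X, balanced (width n) X (fun z => el (U z)) (fun z => Ql (U z)))
  (balr : forall n X, balanced (width n) X (fun z => er (U z)) (fun z => Qr (U z))).
Hypothesis jump : forall T : R, 0 < T -> exists g : R -> R,
  [/\ bounded_measurable g,
    {ae leb, forall t, 0 < t < T -> der_at t h (g t)},
    {ae leb, forall t, 0 < t < T ->
      ess_limit_left (fun x => U (t, x)) (h t) (um t) /\
      ess_limit_right (fun x => U (t, x)) (h t) (up t)} &
    {ae leb, forall t, 0 < t < T ->
      g t * el (um t) - Ql (um t) + a * (Qr (up t) - g t * er (up t)) <= 0}].

(* The outer ends of the two slabs move inwards at speed [L], which bounds all
   characteristic speeds, so that nothing enters through them. *)
Definition mass (n : nat) (t : R) : R :=
  slab (n%:R + 1) (fun z => el (U z)) (fun t => - n%:R + L * t) h t +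
  a * slab (n%:R + 1) (fun z => er (U z)) h (fun t => n%:R - L * t) t.

Let mh := continuous_measurable_fun (lipschitz_within hL).
Let dE (Y : R) : (fun t => Y - L * t) = (fun t => Y + - L * t).
Proof. by apply/funext => t; rewrite mulNr. Qed.
Let cLl (Y : R) : lipschitz_with L (fun t => Y + L * t).
Proof. by apply: lipschitz_cone; rewrite ger0_norm// ltW. Qed.
Let cLr (Y : R) : lipschitz_with L (fun t => Y - L * t).
Proof. by rewrite dE; apply: lipschitz_cone; rewrite normrN ger0_norm// ltW. Qed.
Let bl : bounded_measurable (fun z => el (U z)). Proof. exact: (bm_pair mU UM cel). Qed.
Let br : bounded_measurable (fun z => er (U z)). Proof. exact: (bm_pair mU UM cer). Qed.
Let bml (n : nat) : bounded_measurable
  (slab (n%:R + 1) (fun z => el (U z)) (fun t => - n%:R + L * t) h).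
Proof. exact: (bm_slab _ bl (continuous_measurable_fun (lipschitz_within (cLl _))) mh). Qed.
Let bmr (n : nat) : bounded_measurable
  (slab (n%:R + 1) (fun z => er (U z)) h (fun t => n%:R - L * t)).
Proof. exact: (bm_slab _ br mh (continuous_measurable_fun (lipschitz_within (cLr _)))). Qed.

Lemma bm_mass n : bounded_measurable (mass n).
Proof. exact: (bmD (bml n) (bmM (bm_cst _ a) (bmr n))). Qed.

(** The left balance plus a times the right one: the terms at h add up to the dissipation D <= 0,
    weighted by chi >= 0. What remains is the integral of chi' times the mass, which is the
    difference of the two means. *)
Lemma mean_mass_decay (n m : nat) (s t T : R) : 0 <= s -> s <= t -> t + 2 * width m < T ->
  2 * L * (T + 2) + 1 <= n%:R -> mean m (mass n) t <= mean m (mass n) s.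
Proof.
move=> s0 st tT nT; have w0 : 0 < width m :> R by exact: width_gt0.
have T0 : 0 < T by lra.
have [g [bg dg tr jmp]] := jump T0.
pose chi := plateau (width m) s t.
pose p := s + width m / 4; pose b := t + 2 * width m.
have cut : admissible_cutoff p b chi.
  split; [by rewrite /p; lra|by rewrite /p /b; lra|exact: smooth_plateau|..].
    by move=> x; exact: plateau_ge0.
  move=> x nx; apply: plateau_out => //; apply: contra nx => /andP[? ?].
  by rewrite /p /b; apply/andP; split; lra.
have [bchi bchi1 _] := cutoff_bm cut.
have Hl := cone_left M_gt0 mU UM L_gt0 hL h0 bg dg bum tr cel cQl K_ge0 elK QlK ball_ nT cut tT QlL.
have Hr := cone_right M_gt0 mU UM L_gt0 hL h0 bg dg bup tr cer cQr K_ge0 erK QrK balr nT cut tT QrL.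
have be1 := bm_edge M_gt0 bg cel cQl bum.
have be2 := bm_edge M_gt0 bg cer cQr bup.
have bA := bmD (bmM bchi1 (bml n)) (bmM bchi (bmN be1)).
have bB := bmD (bmM bchi1 (bmr n)) (bmM bchi be2).
have baB := bmM (bm_cst _ a) bB.
rewrite -subr_ge0 -mean_of_cutoff//; last exact: bm_mass.
have Hr' := mulr_ge0 a_ge0 Hr.
apply: le_trans (addr_ge0 Hl Hr') _.
rewrite -(integZ _ _ _ bB) -(integD _ _ bA baB).
apply: ae_integ_le => //; [exact: bmD|exact: bmM bchi1 (bm_mass n)|].
apply: (ae_imp2 jmp (traces_bounded UM tr)) => x J B /andP[px xb].
have xT : 0 < x < T.
  by apply/andP; split; [apply: lt_le_trans px; rewrite /p; lra|exact: le_lt_trans tT].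
have /andP[x0 _] := xT.
have [umM upM] := B xT; have {}J := J xT.
rewrite !clampE//; have chi0 : 0 <= chi x by exact: plateau_ge0.
rewrite -subr_ge0 /mass -/chi -/p -/b.
move: (slab _ _ _ _ x) (slab _ _ _ _ x) (derive1 chi x) => A B' c1.
rewrite (_ : _ - _ = chi x * - (g x * el (um x) - Ql (um x) + a * (Qr (up x) - g x * er (up x)))); last by ring.
by rewrite mulr_ge0// oppr_ge0.
Qed.

(** The time horizon t + 3 leaves room for cutoffs ending at t + 2 [width m]; the assumption on n
    keeps the cones around h open up to that horizon. At s either hypothesis gives a Lebesgue point
    of the mass. *)
Lemma mass_decay (n : nat) (s t : R) : 0 <= s -> s < t -> 2 * L * (t + 5) + 1 <= n%:R ->
  right_lebesgue_time u s \/ steady (mass n) s -> mass n t <= mass n s.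
Proof.
move=> s0 st nT H; have t0 : 0 <= t by lra.
have nT' : 2 * L * (t + 3 + 2) + 1 <= n%:R by rewrite (_ : t + 3 + 2 = t + 5)//; ring.
have W r : 0 <= r <= t + 3 -> 0 <= r <= t + 3 + 1 by move=> /andP[? ?]; apply/andP; split; lra.
have okl r : 0 <= r <= t + 3 -> [/\ - (n%:R + 1) <= - n%:R + L * r, - n%:R + L * r <= h r & h r <= n%:R + 1].
  by move=> /W /(cone_width L_gt0 hL h0 nT')[? ? ? ? [? ?]]; split; lra.
have okr r : 0 <= r <= t + 3 -> [/\ - (n%:R + 1) <= h r, h r <= n%:R - L * r & n%:R - L * r <= n%:R + 1].
  by move=> /W /(cone_width L_gt0 hL h0 nT')[? ? ? ? [? ?]]; split; lra.
have X0 : 0 < n%:R + 1 :> R by rewrite ltr_wpDl.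
apply: steady_le; first exact: bm_mass.
- case: H => // rl; apply: (steadyDZ (bml n) (bmr n) a_ge0).
    by apply: (slab_steady mU UM cel L_gt0 (cLl _) hL K_ge0 X0 elK meas uU rl s0 (T := t + 3)) => //; lra.
  by apply: (slab_steady mU UM cer L_gt0 hL (cLr _) K_ge0 X0 erK meas uU rl s0 (T := t + 3)) => //; lra.
- apply: lower_rightDZ => //.
    by apply: (slab_lower mU UM cel L_gt0 (cLl _) hL ckl kel weak t0 (T := t + 3)) => //; lra.
  by apply: (slab_lower mU UM cer L_gt0 hL (cLr _) ckr ker weak t0 (T := t + 3)) => //; lra.
- apply: nearW => m; apply: (mean_mass_decay s0 (ltW st) _ nT').
  by have := @width_le R m; lra.
Qed.

Hypotheses (el_ge0 : forall v, 0 <= el v) (er_ge0 : forall v, 0 <= er v).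

(** This is [pseudo_norm] with a_2 = a_1 a: only the ratio a enters the dissipation, and a_1 is a
    common factor. *)
Definition two_sided (a1 : R) (t : R) : \bar R :=
  (a1%:E * \int[leb]_(x in `]-oo, 0%R[) (el (u t (x + h t)))%:E +
   (a1 * a)%:E * \int[leb]_(x in `]0%R, +oo[) (er (u t (x + h t)))%:E)%E.

Lemma integral_value (e : R -> R) (D : set (measurableTypeR R)) t : continuous e -> measurable D -> 0 <= t ->
  (\int[leb]_(x in D) (e (u t (x + h t)))%:E = \int[leb]_(x in D) (e (U (t, x + h t)))%:E)%E.
Proof.
move=> ce mD t0; have me := continuous_measurable_fun ce.
have ms : measurable_fun setT (fun x : R => x + h t) by exact: measurable_funD.
apply: ae_eq_integral => //.
- apply: measurable_funTS; apply/measurable_EFinP; apply: (measurableT_comp me).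
  exact: (measurableT_comp (meas t0)).
- apply: measurable_funTS; apply/measurable_EFinP; apply: (measurableT_comp me).
  have mt : measurable_fun setT (fun y => U (t, y)) by case: (bm_section1 t (conj mU (ex_intro _ M UM) : bounded_measurable U)).
  exact: (measurableT_comp mt).
- by apply: (ae_imp (ae_shift (h t) (uU t0))) => x /= -> _.
Qed.

Lemma mass_cvg (a1 t : R) : 0 < a1 -> 0 <= t ->
  (a1 * mass n t)%:E @[n --> \oo] --> two_sided a1 t.
Proof.
move=> a10 t0.
have cvl : (integ (- n%:R + L * t) (h t) (fun x => el (U (t, x))))%:E @[n --> \oo] -->
    (\int[leb]_(x in `]-oo, 0%R[) (el (u t (x + h t)))%:E)%E.
  by rewrite integral_value//; apply: half_line_left => //; exact: (bm_section1 t bl).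
have cvr : (integ (h t) (n%:R - L * t) (fun x => er (U (t, x))))%:E @[n --> \oo] -->
    (\int[leb]_(x in `]0%R, +oo[) (er (u t (x + h t)))%:E)%E.
  by rewrite integral_value//; apply: half_line_right => //; exact: (bm_section1 t br).
have cv : (a1%:E * (integ (- n%:R + L * t) (h t) (fun x => el (U (t, x))))%:E +
   (a1 * a)%:E * (integ (h t) (n%:R - L * t) (fun x => er (U (t, x))))%:E)%E @[n --> \oo] -->
   two_sided a1 t.
  apply: cvgeD; [|exact: cvgeZl|exact: cvgeZl].
  apply: ge0_adde_def; rewrite inE mule_ge0 ?lee_fin ?integral_ge0 ?mulr_ge0 ?(ltW a10)//.
    by move=> x _; rewrite lee_fin.
  by move=> x _; rewrite lee_fin.
apply: cvg_trans cv; apply: near_eq_cvg.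
have [N hN] := archi_above (2 * L * (t + 2) + 1).
exists N => // n /= Nn.
have nT : 2 * L * (t + 2) + 1 <= n%:R by rewrite (le_trans hN)// ler_nat.
have tt : 0 <= t <= t + 1 by rewrite t0 lerDl ler01.
have [h1 h2 h3 h4 [h5 h6]] := cone_width L_gt0 hL h0 nT tt.
have p1 : - n%:R + L * t <= h t by lra.
have p2 : h t <= n%:R + 1 by lra.
have p3 : - (n%:R + 1) <= h t by lra.
have p4 : h t <= n%:R - L * t by lra.
have p5 : n%:R - L * t <= n%:R + 1 by lra.
rewrite /mass (slabE bl (continuous_measurable_fun (lipschitz_within (cLl _))) mh h1 p1 p2).
rewrite (slabE br mh (continuous_measurable_fun (lipschitz_within (cLr _))) p3 p4 p5).
by rewrite -!EFinM -EFinD; congr EFin; ring.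
Qed.

Lemma two_sided_decay (a1 s t : R) : 0 < a1 -> 0 <= s -> s <= t ->
  right_lebesgue_time u s \/ (forall n, steady (mass n) s) -> (two_sided a1 t <= two_sided a1 s)%E.
Proof.
move=> a10 s0; rewrite le_eqVlt => /predU1P[->//|st] H.
apply: (lee_cvg_to (mass_cvg a10 (le_trans s0 (ltW st))) (mass_cvg a10 s0)).
have [N hN] := archi_above (2 * L * (t + 5) + 1).
exists N => // n /= Nn; rewrite lee_fin ler_pM2l//; apply: mass_decay => //.
  by rewrite (le_trans hN)// ler_nat.
by case: H; [left|right].
Qed.

(** The exceptional set consists of the times that are neither right Lebesgue times of u nor
    Lebesgue points of all the masses. The second failure makes it negligible, the first one keeps
    it away from right Lebesgue times, and outside it [two_sided_decay] applies. *)
Lemma two_sided_nonincreasing (a1 : R) : 0 < a1 -> nonincreasing_in_time u (two_sided a1).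
Proof.
move=> a10.
have H := ae_nat (fun n => ae_steady (bm_mass n)).
exists [set s | ~ right_lebesgue_time u s /\ ~ forall n, steady (mass n) s]; split.
- by apply: negligibleS H => s /= [_ ns].
- by move=> s [].
- move=> s t s0 /= ns st; apply: two_sided_decay => //.
  by have [|nr] := pselect (right_lebesgue_time u s); [left|right; apply: contrapT => k; apply: ns].
Qed.

End contraction.

(** * Balances satisfied by a weak solution *)

Section bounded_solutions.
Context {R : realType}.
Local Notation leb := (@lebesgue_measure R).
Variables (f : R -> R) (M : R) (u : R -> R -> R).
Hypotheses (M_gt0 : 0 < M) (cf : continuous f) (sol : weak_solution f M u).
Local Notation U := (value M u).

Lemma solution_measurable : measurable_fun
  (`[0, +oo[ `*` setT : set (measurableTypeR R * measurableTypeR R)) (fun z => u z.1 z.2).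
Proof. by case: sol. Qed.

Lemma solution_range (t : R) : 0 <= t -> {ae leb, forall x, - M <= u t x <= M}.
Proof. by case: sol => _ H _ _ _; exact: H. Qed.

Lemma measurable_U : measurable_fun setT U.
Proof. exact: measurable_value solution_measurable. Qed.

Lemma U_le z : `|U z| <= M. Proof. exact: value_le. Qed.

Lemma solution_value (t : R) : 0 <= t -> {ae leb, forall x : R, u t x = U (t, x)}.
Proof. exact: (value_ae solution_range). Qed.

Lemma measurable_solution (t : R) : 0 <= t -> measurable_fun setT (u t).
Proof.
move=> t0.
have mt : measurable_fun [set: R] (fun x : R => (t, x)) by exact: measurable_pair1.
apply: (measurable_comp _ _ solution_measurable mt).
  by apply: measurableX => //; exact: measurable_itv.
by move=> _ [x _ <-]; split => //=; rewrite in_itv /= t0.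
Qed.

Lemma value_weakly_continuous (g : R -> R) : leb.-integrable setT (EFin \o g) ->
  {within `[0, +oo[, continuous (fun t => \int[leb]_x (g x * U (t, x)))}.
Proof.
move=> ig; case: sol => _ _ H _ _; have := H g ig.
apply: subspace_eq_continuous => t; rewrite inE /= in_itv /= andbT => t0.
have mg : measurable_fun setT g by have /integrableP[/measurable_EFinP] := ig.
congr fine; apply: ae_eq_integral => //.
- by apply/measurable_EFinP; apply: measurable_funM => //; exact: measurable_solution.
- apply/measurable_EFinP; apply: measurable_funM => //.
  by case: (bm_section1 t (conj measurable_U (ex_intro _ M U_le) : bounded_measurable U)).
- by apply: (ae_imp (solution_value t0)) => x /= ->.
Qed.

Lemma measurable_of_solution (e : R -> R) : continuous e -> measurable_fun
  (`]0, +oo[ `*` setT : set (measurableTypeR R * measurableTypeR R)) (fun z => e (u z.1 z.2)).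
Proof.
move=> ce; apply: (measurableT_comp (continuous_measurable_fun ce)).
apply: measurable_funS solution_measurable; first by apply: measurableX => //; exact: measurable_itv.
by move=> z [/= z0 _]; split => //=; move: z0; rewrite !in_itv /= !andbT => /ltW.
Qed.

Let bU (e : R -> R) : continuous e -> bounded_measurable (fun z => e (U z)).
Proof. exact: (bm_pair measurable_U U_le). Qed.

Let posval (t : R) : 0 < t -> {ae leb, forall x : R, u t x = U (t, x)}.
Proof. by move=> t0; exact: (solution_value (ltW t0)). Qed.

Lemma pair_smooth_balanced (e Q : R -> R) (del X : R) : 0 < del -> continuous e -> continuous Q ->
  entropic e Q u -> smooth_balanced del X (fun z => e (U z)) (fun z => Q (U z)).
Proof.
move=> d0 ce cQ ent; exact: (entropic_balanced d0 (measurable_of_solution ce)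
  (measurable_of_solution cQ) posval (bU ce) (bU cQ) ent).
Qed.

Lemma linear_smooth_balanced (k del X : R) : 0 < del ->
  smooth_balanced del X (fun z => k * U z) (fun z => k * f (U z)).
Proof.
move=> d0; have cid : continuous (@id R) by move=> x; exact: cvg_id.
have cons : forall phi, test_function phi -> weak_pairing id f u phi = 0 by case: sol.
have b1 := bU cid; have b2 := bU cf.
have [k0|k0] := leP 0 k.
  have ent : entropic id f u by move=> phi tst _; rewrite cons.
  exact: (smooth_balancedZ d0 k0 b1 b2 (pair_smooth_balanced d0 cid cf ent)).
have k1 : 0 <= - k by rewrite oppr_ge0 ltW.
have H := conserved_balanced (X := X) d0 (measurable_of_solution cid) (measurable_of_solution cf)
  posval b1 b2 cons.
have HZ := smooth_balancedZ d0 k1 (bmN b1) (bmN b2) H.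
have -> : (fun z => k * U z) = (fun z => - k * - U z) by apply/funext => z; rewrite mulrNN.
have -> : (fun z => k * f (U z)) = (fun z => - k * - f (U z)) by apply/funext => z; rewrite mulrNN.
exact: HZ.
Qed.

Lemma linear_balanced (k X : R) n : balanced (width n) X (fun z => k * U z) (fun z => k * f (U z)).
Proof.
have cid : continuous (@id R) by move=> x; exact: cvg_id.
exact: (smooth_balanced_lipschitz (width_gt0 n) (bmM (bm_cst _ k) (bU cid)) (bmM (bm_cst _ k) (bU cf))
  (linear_smooth_balanced _ (width_gt0 n))).
Qed.

Lemma pair_balanced (e Q : R -> R) (X : R) n : continuous e -> continuous Q ->
  entropic e Q u -> balanced (width n) X (fun z => e (U z)) (fun z => Q (U z)).
Proof.
move=> ce cQ ent; exact: (smooth_balanced_lipschitz (width_gt0 n) (bU ce) (bU cQ)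
  (pair_smooth_balanced (width_gt0 n) ce cQ ent)).
Qed.

(** eta(. | b) is eta plus a multiple of the identity plus a constant, and its flux has the same
    structure with q and f. The three pairs are balanced separately; the multiple may have either
    sign. *)
Lemma rel_balanced (eta e1 q : R -> R) (b X : R) n : continuous eta -> continuous q ->
  entropic eta q u ->
  balanced (width n) X (fun z => rel_eta eta e1 (U z) b) (fun z => rel_flux f e1 q (U z) b).
Proof.
move=> ceta cq ent; have d0 := @width_gt0 R n.
have cid : continuous (@id R) by move=> x; exact: cvg_id.
have b1 := bU ceta; have b2 := bU cq.
have b3 := bmM (bm_cst _ (- e1 b)) (bU cid); have b4 := bmM (bm_cst _ (- e1 b)) (bU cf).
have b5 := @bm_cst R _ (measurableTypeR R * measurableTypeR R)%type (e1 b * b - eta b).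
have b6 := @bm_cst R _ (measurableTypeR R * measurableTypeR R)%type (e1 b * f b - q b).
have H1 := smooth_balancedD d0 b1 b2 b3 b4 (pair_smooth_balanced (X := X) d0 ceta cq ent)
  (linear_smooth_balanced (- e1 b) d0).
have H2 := smooth_balancedD d0 (bmD b1 b3) (bmD b2 b4) b5 b6 H1
  (constant_balanced d0 (e1 b * b - eta b) (e1 b * f b - q b)).
have H3 := smooth_balanced_lipschitz d0 (bmD (bmD b1 b3) b5) (bmD (bmD b2 b4) b6) H2.
have -> : (fun z => rel_eta eta e1 (U z) b) =
    (fun z => eta (U z) + - e1 b * U z + (e1 b * b - eta b)).
  by apply/funext => z; rewrite /rel_eta; move: (U z) => w; ring.
have -> : (fun z => rel_flux f e1 q (U z) b) =
    (fun z => q (U z) + - e1 b * f (U z) + (e1 b * f b - q b)).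
  by apply/funext => z; rewrite /rel_flux; move: (U z) => w; ring.
exact: H3.
Qed.

End bounded_solutions.

Lemma ae_and {R : realType} (P Q : R -> Prop) : {ae @lebesgue_measure R, forall x, P x} ->
  {ae @lebesgue_measure R, forall x, Q x} -> {ae @lebesgue_measure R, forall x, P x /\ Q x}.
Proof. by move=> H1 H2; apply: (ae_imp2 H1 H2). Qed.

(** * The contracting curve of a given solution *)

Section entropic_shocks.
Context {R : realType}.
Local Notation leb := (@lebesgue_measure R).
Variables (f f1 f2 eta e1 e2 q V : R -> R) (M eps uL uR k KV L astar : R) (u : R -> R -> R).
Hypotheses (Df : forall x, der_at x f (f1 x)) (Df1 : forall x, der_at x f1 (f2 x))
  (De : forall x, der_at x eta (e1 x)) (De1 : forall x, der_at x e1 (e2 x))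
  (Dq : forall x, der_at x q (e1 x * f1 x)) (e2_gt0 : forall x, 0 < e2 x)
  (M_gt0 : 0 < M) (uLM : - M <= uL <= M) (uRM : - M <= uR <= M)
  (phik : phi_nat f uL = k) (S : S_weak f eta q M uL eps u)
  (VK : forall x y, `|V x - V y| <= KV * `|x - y|)
  (VL : forall x, `|V x| <= L) (L_gt0 : 0 < L)
  (f1L : forall x, - M <= x <= M -> `|f1 x| <= L).
Local Notation U := (value M u).
Local Notation rele := (rel_eta eta e1).
Local Notation relq := (rel_flux f e1 q).
Hypothesis contracting : forall um up s a : R, - M <= um <= M -> - M <= up <= M ->
    Num.min (V um) (V up) <= s <= Num.max (V um) (V up) ->
    f um - f up = s * (um - up) ->
    q up - q um - s * (eta up - eta um) <= 0 ->
    kruzkov_flux f k up - kruzkov_flux f k um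
      - s * (kruzkov_entropy k up - kruzkov_entropy k um) <= 0 ->
    ~ (`|phi_flat0 f eta q uL - um| < eps /\ `|uL - up| < eps) ->
    0 < a < astar ->
    s * rele um uL - relq um uL + a * (relq up uR - s * rele up uR) <= 0.

Let cf : continuous f := fun x => der_continuous (Df x).
Let cf1 : continuous f1 := fun x => der_continuous (Df1 x).
Let ceta : continuous eta := fun x => der_continuous (De x).
Let ce1 : continuous e1 := fun x => der_continuous (De1 x).
Let cq : continuous q := fun x => der_continuous (Dq x).
Let sol : weak_solution f M u. Proof. by case: S. Qed.
Let mU := measurable_U sol.
Let UM := U_le u M_gt0.
Let meas := measurable_solution sol.
Let uU := solution_value sol.
Let weak := value_weakly_continuous M_gt0 sol.

Lemma normM (x : R) : (`|x| <= M) = (- M <= x <= M). Proof. exact: ler_norml. Qed.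

Lemma lipschitz_on (g g1 : R -> R) : (forall x, der_at x g (g1 x)) -> continuous g1 ->
  exists K : R, 0 <= K /\ forall x y, `|x| <= M -> `|y| <= M -> `|g x - g y| <= K * `|x - y|.
Proof.
move=> Dg cg1; have [B [B0 [_ H]]] := lipschitz_seg (- M) M Dg cg1.
exists B; split; first exact: ltW.
by move=> x y; rewrite !normM; exact: H.
Qed.

(** This form shows that the flux is continuous, and Lipschitz on bounded sets, although it is
    defined with a sign function. *)
Lemma kruzkov_fluxE (c v : R) : kruzkov_flux f c v = f (Num.max v c) - f (Num.min v c).
Proof.
rewrite /kruzkov_flux; have [vc|cv|->] := ltgtP v c.
- by rewrite ltr0_sg ?subr_lt0// mulN1r opprB.
- by rewrite gtr0_sg ?subr_gt0// mul1r.
- by rewrite !subrr mulr0.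
Qed.

Lemma continuous_kruzkov_flux (c : R) : continuous (kruzkov_flux f c).
Proof.
have -> : kruzkov_flux f c = (fun v => f (Num.max v c) - f (Num.min v c)).
  by apply/funext => v; exact: kruzkov_fluxE.
have cid : continuous (fun v : R => v) by move=> x; exact: cvg_id.
have cc : continuous (fun _ : R => c) by move=> x; exact: cvg_cst.
have c1 : continuous (fun v => Num.max v c).
  by move=> x; exact: (continuous_max (cid x) (cc x)).
have c2 : continuous (fun v => Num.min v c).
  by move=> x; exact: (continuous_min (cid x) (cc x)).
move=> x; apply: cvgB.
  by apply: (continuous_comp (c1 x)); exact: cf.
by apply: (continuous_comp (c2 x)); exact: cf.
Qed.

Lemma continuous_kruzkov_entropy (c : R) : continuous (@kruzkov_entropy R c).
Proof.
have H : forall x y : R, `|kruzkov_entropy c x - kruzkov_entropy c y| <= 1 * `|x - y|.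
  move=> x y; rewrite mul1r /kruzkov_entropy; apply: le_trans (ler_dist_dist _ _) _.
  by rewrite opprB addrA subrK.
exact: lipschitz_within H.
Qed.

Lemma kruzkov_flux_lipschitz : exists K : R, 0 <= K /\ forall x y, `|x| <= M -> `|y| <= M ->
  `|kruzkov_flux f k x - kruzkov_flux f k y| <= K * `|x - y|.
Proof.
pose N := M + `|k|.
have [B [B0 [_ H]]] := lipschitz_seg (- N) N Df cf1.
exists (2 * B); split; first by rewrite mulr_ge0// ltW.
have kN : - N <= k <= N.
  by rewrite -ler_norml /N lerDr ltW.
have inN x : `|x| <= M -> - N <= x <= N.
  by rewrite -ler_norml /N => h; apply: le_trans h _; rewrite lerDl.
have mx (x : R) : - N <= x <= N -> - N <= Num.max x k <= N.
  by move: kN; have [_|_] := leP x k.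
have mn (x : R) : - N <= x <= N -> - N <= Num.min x k <= N.
  by move: kN; have [_|_] := leP x k.
have d1 (x y : R) : `|Num.max x k - Num.max y k| <= `|x - y|.
  by rewrite ![Num.max _ k]maxC; exact: dist_max.
have d2 (x y : R) : `|Num.min x k - Num.min y k| <= `|x - y|.
  by rewrite ![Num.min _ k]minC; exact: dist_min.
move=> x y /inN hx /inN hy; rewrite !kruzkov_fluxE.
rewrite (_ : _ - _ = (f (Num.max x k) - f (Num.max y k)) - (f (Num.min x k) - f (Num.min y k))); last by ring.
apply: le_trans (ler_normB _ _) _; rewrite -mulrA mulr_natl mulr2n; apply: lerD.
  by apply: le_trans (H _ _ (mx _ hx) (mx _ hy)) _; rewrite ler_pM2l.
by apply: le_trans (H _ _ (mn _ hx) (mn _ hy)) _; rewrite ler_pM2l.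
Qed.

(** The curve and its traces are quantified before a and T, because the same h must serve the
    prescribed ratio a_2 / a_1, the ratio used for the L^2 bound, and all time horizons. Only the
    measurable velocity g is produced for each T. *)
Lemma contracting_curve : exists h um up : R -> R,
  [/\ lipschitz_with L h, h 0 = 0, bounded_trace um, bounded_trace up &
   forall a T : R, 0 < a < astar -> 0 < T -> exists g : R -> R,
    [/\ bounded_measurable g,
      {ae leb, forall t, 0 < t < T -> der_at t h (g t)},
      {ae leb, forall t, 0 < t < T ->
        ess_limit_left (fun x => U (t, x)) (h t) (um t) /\
        ess_limit_right (fun x => U (t, x)) (h t) (up t)} &
      {ae leb, forall t, 0 < t < T ->
        g t * rele (um t) uL - relq (um t) uL +
          a * (relq (up t) uR - g t * rele (up t) uR) <= 0}]].
Proof.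
have [h [hL h0 hlim]] := limit_curve_exists mU UM VK L_gt0 VL.
have lh : lipschitz_curve h.
  exists L; split; first exact: gtr0_real.
  by move=> K LK [x y] _ /=; apply: le_trans (hL x y) _; rewrite ler_wpM2r// ltW.
case: S => _ ent kru str exc; have [um [up trs]] := str h lh.
have [bum bup _] := trs.
exists h, um, up; split => // a T aa T0.
have [g [mg gL dg]] := lipschitz_ae_der T0 L_gt0 hL.
have bg : bounded_measurable g by split => //; exists L.
have dg' : {ae leb, forall t, 0 < t < T -> der_at t h (g t)}.
  apply: (ae_imp dg) => t H /andP[t0 tT]; apply: H; rewrite tT andbT.
  by apply: lt_trans t0; rewrite oppr_lt0.
have tr := traces_ae (solution_measurable sol) (solution_range sol) lh trs T0.
exists g; split => //.
have fil := filippov mU UM VK L_gt0 VL hlim hL dg' tr.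
have cid : continuous (fun x : R => x) by move=> x; exact: cvg_id.
have [Kf [Kf0 fK]] := lipschitz_on Df cf1.
have c1f : continuous (fun x : R => 1 * x) by move=> x; apply: cvgM; [exact: cvg_cst|exact: cvg_id].
(* The values c = 1 and c = - 1 give opposite inequalities, that is, the Rankine-Hugoniot
   relation. *)
have lin (c : R) : `|c| <= 1 -> {ae leb, forall t, 0 < t < T ->
    0 <= (c * f (um t) - g t * (c * um t)) - (c * f (up t) - g t * (c * up t))}.
  move=> c1.
  apply: (jump_inequality (e := fun x => c * x) (Q := fun x => c * f x) (K := Num.max 1 Kf)
    M_gt0 mU UM hL bg dg' bum bup tr).
  - by move=> x; apply: cvgM; [exact: cvg_cst|exact: cvg_id].
  - by move=> x; apply: cvgM; [exact: cvg_cst|exact: cf].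
  - by rewrite le_max ler01.
  - move=> x y _ _; rewrite -mulrBr normrM ler_wpM2r//.
    by rewrite le_max c1.
  - move=> x y xM yM; rewrite -mulrBr normrM; apply: (@le_trans _ _ (1 * (Kf * `|x - y|))).
      by apply: ler_pM => //; exact: fK.
    by rewrite mul1r ler_wpM2r// le_max lexx orbT.
  - by move=> n X; exact: linear_balanced.
have lin1 := lin 1 _; rewrite normr1 lexx in lin1; have {}lin1 := lin1 isT.
have lin2 := lin (- 1) _; rewrite normrN normr1 lexx in lin2; have {}lin2 := lin2 isT.
have [Ke [Ke0 eK]] := lipschitz_on De ce1.
have cq1 : continuous (fun x => e1 x * f1 x) by move=> x; apply: cvgM; [exact: ce1|exact: cf1].
have [Kq [Kq0 qK]] := lipschitz_on Dq cq1.
have Jeta := jump_inequality (K := Num.max Ke Kq) M_gt0 mU UM hL bg dg' bum bup tr ceta cq.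
have {}Jeta : {ae leb, forall t, 0 < t < T ->
    0 <= (q (um t) - g t * eta (um t)) - (q (up t) - g t * eta (up t))}.
  apply: Jeta.
  - by rewrite le_max Ke0.
  - by move=> x y h1 h2; apply: le_trans (eK _ _ h1 h2) _; rewrite ler_wpM2r// le_max lexx.
  - by move=> x y h1 h2; apply: le_trans (qK _ _ h1 h2) _; rewrite ler_wpM2r// le_max lexx orbT.
  - by move=> n X; exact: (pair_balanced M_gt0 sol).
have [Kk [Kk0 kK]] := kruzkov_flux_lipschitz.
have Jkru := jump_inequality (K := Num.max 1 Kk) M_gt0 mU UM hL bg dg' bum bup tr
  (@continuous_kruzkov_entropy k) (@continuous_kruzkov_flux k).
have {}Jkru : {ae leb, forall t, 0 < t < T ->
    0 <= (kruzkov_flux f k (um t) - g t * kruzkov_entropy k (um t)) -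
     (kruzkov_flux f k (up t) - g t * kruzkov_entropy k (up t))}.
  apply: Jkru.
  - by rewrite le_max ler01.
  - move=> x y h1 h2; apply: (@le_trans _ _ `|x - y|).
      apply: le_trans (ler_dist_dist _ _) _.
      by rewrite opprB addrA subrK.
    by rewrite ler_peMl// le_max lexx.
  - by move=> x y h1 h2; apply: le_trans (kK _ _ h1 h2) _; rewrite ler_wpM2r// le_max lexx orbT.
  - move=> n X; apply: (pair_balanced M_gt0 sol); [exact: continuous_kruzkov_entropy|exact: continuous_kruzkov_flux|].
    by rewrite -phik; exact: kru.
have excl := exc h um up lh trs.
have A1 := ae_and fil (traces_bounded UM tr).
have A2 := ae_and lin1 lin2.
have A3 := ae_and Jeta Jkru.
have A4 := ae_and A1 A2.
have A5 := ae_and A3 excl.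
apply: (ae_imp2 A4 A5) => t [[F1 F2] [F3 F4]] [[F5 F6] F7] tT.
have {}F1 := F1 tT; have {F2}[h1 h2] := F2 tT; have {}F3 := F3 tT; have {}F4 := F4 tT.
have {}F5 := F5 tT; have {}F6 := F6 tT; have {}F7 : ~ (ball (phi_flat0 f eta q uL) eps (um t) /\ ball uL eps (up t)).
  by apply: F7; case/andP: tT.
apply: contracting => //.
- by rewrite -normM.
- by rewrite -normM.
- by move: F3 F4; lra.
- by move: F5; lra.
- by move: F6; lra.
Qed.

Lemma der_rel_eta b x : der_at x (fun v => rele v b) (e1 x - e1 b).
Proof.
apply: der_eq.
  apply: derB; first (apply: derB; [exact: De|exact: der_cst]).
  by apply: der_scale; apply: derB; [exact: der_id|exact: der_cst].
by rewrite !subr0 mulr1.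
Qed.

Lemma der_rel_flux b x : der_at x (fun v => relq v b) ((e1 x - e1 b) * f1 x).
Proof.
apply: der_eq.
  apply: derB; first (apply: derB; [exact: Dq|exact: der_cst]).
  by apply: der_scale; apply: derB; [exact: Df|exact: der_cst].
by rewrite !subr0 mulrBl.
Qed.

Lemma rel_flux_bound v b : `|v| <= M -> - M <= b <= M ->
  relq v b <= L * rele v b /\ - relq v b <= L * rele v b.
Proof.
rewrite normM => vM bM.
have H w : Num.min v b <= w <= Num.max v b -> `|f1 w| <= L.
  by move=> wvb; apply: f1L; exact: between_itv wvb.
split.
  apply: (rel_flux_le Df De De1 Dq e2_gt0) => w /H; rewrite ler_norml => /andP[_].
  exact.
rewrite lerNl -mulNr; apply: (rel_flux_ge Df De De1 Dq e2_gt0) => w /H.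
by rewrite ler_norml => /andP[].
Qed.

Lemma curve_contraction (h um up : R -> R) (a a1 : R) :
  lipschitz_with L h -> h 0 = 0 -> bounded_trace um -> bounded_trace up -> 0 <= a ->
  (forall T : R, 0 < T -> exists g : R -> R,
    [/\ bounded_measurable g,
      {ae leb, forall t, 0 < t < T -> der_at t h (g t)},
      {ae leb, forall t, 0 < t < T ->
        ess_limit_left (fun x => U (t, x)) (h t) (um t) /\
        ess_limit_right (fun x => U (t, x)) (h t) (up t)} &
      {ae leb, forall t, 0 < t < T ->
        g t * rele (um t) uL - relq (um t) uL +
          a * (relq (up t) uR - g t * rele (up t) uR) <= 0}]) ->
  0 < a1 ->
  nonincreasing_in_time u (two_sided a u h (fun v => rele v uL) (fun v => rele v uR) a1).
Proof.
move=> hL h0 bum bup a0 jump a10.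
have ce1b b : continuous (fun x => e1 x - e1 b).
  by move=> x; apply: cvgB; [exact: ce1|exact: cvg_cst].
have cfl b : continuous (fun x => (e1 x - e1 b) * f1 x).
  by move=> x; apply: cvgM; [exact: ce1b|exact: cf1].
have [K1 [K10 H1]] := lipschitz_on (der_rel_eta uL) (ce1b uL).
have [K2 [K20 H2]] := lipschitz_on (der_rel_eta uR) (ce1b uR).
have [K3 [K30 H3]] := lipschitz_on (der_rel_flux uL) (cfl uL).
have [K4 [K40 H4]] := lipschitz_on (der_rel_flux uR) (cfl uR).
pose K := K1 + K2 + K3 + K4.
have K_le (g : R -> R) K' : K' <= K -> (forall x y, `|x| <= M -> `|y| <= M -> `|g x - g y| <= K' * `|x - y|) ->
    forall x y, `|x| <= M -> `|y| <= M -> `|g x - g y| <= K * `|x - y|.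
  by move=> KK H x y h1 h2; apply: le_trans (H _ _ h1 h2) _; rewrite ler_wpM2r.
have convex b v w : `|v| <= M -> `|w| <= M -> rele w b + (e1 w - e1 b) * (v - w) <= rele v b.
  move=> _ _; rewrite -subr_ge0.
  rewrite (_ : _ - _ = rele v w); last by rewrite /rel_eta; ring.
  exact: (rel_eta_ge0 De De1 e2_gt0).
have ent : entropic eta q u by case: S.
have crel b : continuous (fun v => rele v b) := fun x => der_continuous (der_rel_eta b x).
have crfl b : continuous (fun v => relq v b) := fun x => der_continuous (der_rel_flux b x).
have K0 : 0 <= K by rewrite !addr_ge0.
have L1 : K1 <= K by move: K20 K30 K40; rewrite /K; lra.
have L2 : K2 <= K by move: K10 K30 K40; rewrite /K; lra.
have L3 : K3 <= K by move: K10 K20 K40; rewrite /K; lra.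
have L4 : K4 <= K by move: K10 K20 K30; rewrite /K; lra.
apply: (two_sided_nonincreasing M_gt0 L_gt0 a0 K0 mU UM meas uU weak hL h0 bum bup
  (crel uL) (crfl uL) (ce1b uL) (crel uR) (crfl uR) (ce1b uR)
  (K_le _ _ L1 H1) (K_le _ _ L3 H3) (K_le _ _ L2 H2) (K_le _ _ L4 H4) (convex uL) (convex uR)
  _ _ _ _ jump) => //.
- by move=> v vM; have [] := rel_flux_bound vM uLM.
- by move=> v vM; have [] := rel_flux_bound vM uRM.
- by move=> n X; apply: (rel_balanced M_gt0 cf sol).
- by move=> n X; apply: (rel_balanced M_gt0 cf sol).
- by move=> v; exact: (rel_eta_ge0 De De1 e2_gt0).
- by move=> v; exact: (rel_eta_ge0 De De1 e2_gt0).
Qed.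

End entropic_shocks.

(** * From entropy decay to the L^2 estimate *)

Section l2_norms.
Context {R : realType}.
Local Notation leb := (@lebesgue_measure R).

Lemma Lnorm2_le (F G : R -> R) (K : R) : 0 <= K ->
  (\int[leb]_x ((F x) ^+ 2)%:E <= K%:E * \int[leb]_x ((G x) ^+ 2)%:E)%E ->
  (Lnorm leb 2%:E (EFin \o F) <= (Num.sqrt K)%:E * Lnorm leb 2%:E (EFin \o G))%E.
Proof.
move=> K0 H.
have NE (w : R -> R) : Lnorm leb 2%:E (EFin \o w) = ((\int[leb]_x ((w x) ^+ 2)%:E) `^ 2^-1)%E.
  rewrite unlock /=; congr (_ `^ _)%E; apply: eq_integral => x _ /=.
  by rewrite powR_mulrn// real_normK// num_real.
rewrite !NE -powR12_sqrt// -poweR_EFin -poweRM//; last first.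
  by apply: integral_ge0 => x _; rewrite lee_fin sqr_ge0.
have I0 (w : R -> R) : (0 <= \int[leb]_x ((w x) ^+ 2)%:E)%E.
  by apply: integral_ge0 => x _; rewrite lee_fin sqr_ge0.
apply: gt0_ler_poweR => //; rewrite in_itv /= ?leey ?andbT.
  exact: I0.
by rewrite mule_ge0.
Qed.

Lemma shock_split (v : R -> R) (uL uR : R) : measurable_fun setT v ->
  (\int[leb]_x ((v x - shock uL uR x) ^+ 2)%:E =
   \int[leb]_(x in `]-oo, 0%R[) ((v x - uL) ^+ 2)%:E +
   \int[leb]_(x in `]0%R, +oo[) ((v x - uR) ^+ 2)%:E)%E.
Proof.
move=> mv.
have mS : measurable_fun setT (fun x : R => shock uL uR x).
  by apply: measurable_fun_ifT => //; exact: measurable_fun_ltr.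
have mF : measurable_fun setT (fun x => ((v x - shock uL uR x) ^+ 2)%:E).
  by apply/measurable_EFinP; apply: measurable_funX; exact: measurable_funB.
have mI (D : set (measurableTypeR R)) (b : R) : measurable_fun D (fun x => ((v x - b) ^+ 2)%:E).
  by apply: measurable_funTS; apply/measurable_EFinP; apply: measurable_funX; exact: measurable_funB.
have UT : setT = `]-oo, 0%R[%classic `|` `[0%R, +oo[%classic :> set R.
  apply/seteqP; split => x //= _; rewrite !in_itv /= andbT.
  by have [|] := ltP x 0; [left|right].
rewrite [in LHS]UT ge0_integral_setU//=.
- congr (_ + _)%E.
    apply: eq_integral => x; rewrite inE /= in_itv /= => x0.
    by rewrite /shock x0.
  rewrite (integral_itv_obnd_cbnd (mI _ _)); apply: eq_integral => x.
  by rewrite inE /= in_itv /= andbT => x0; rewrite /shock ltNge x0.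
- by rewrite -UT.
- by move=> x _; rewrite lee_fin sqr_ge0.
- apply/disj_set2P; apply/seteqP; split => x //= []; rewrite !in_itv /= andbT.
  by move=> x0; rewrite leNgt x0.
Qed.

End l2_norms.

Section l2_stability.
Context {R : realType}.
Local Notation leb := (@lebesgue_measure R).
Variables (eta e1 e2 : R -> R) (M uL uR c C a : R) (h : R -> R) (u : R -> R -> R) (U : R * R -> R).
Hypotheses (De : forall x, der_at x eta (e1 x)) (De1 : forall x, der_at x e1 (e2 x))
  (e2cC : forall x, - M <= x <= M -> c <= e2 x <= C) (c_gt0 : 0 < c) (C_gt0 : 0 < C)
  (uLM : - M <= uL <= M) (uRM : - M <= uR <= M) (a01 : 0 < a <= 1).
Hypotheses (mU : measurable_fun setT U) (UM : forall z, `|U z| <= M)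
  (meas : forall t : R, 0 <= t -> measurable_fun setT (u t))
  (uU : forall t : R, 0 <= t -> {ae leb, forall x : R, u t x = U (t, x)}).
Local Notation rele := (rel_eta eta e1).

(** Since a <= 1, the weighted entropy is at least (c a / 2) (Sl + Sr) and, initially, at most (C /
    2) (Sl0 + Sr0). All quantities may be infinite, so the inequalities are chained without any
    subtraction. *)
Lemma compare_weighted (Il Ir Il0 Ir0 Sl Sr Sl0 Sr0 : \bar R) :
  (0 <= Sl -> 0 <= Sr -> 0 <= Sl0 -> 0 <= Sr0 ->
   1%:E * Il + (1 * a)%:E * Ir <= 1%:E * Il0 + (1 * a)%:E * Ir0 ->
   (c / 2)%:E * Sl <= Il -> (c / 2)%:E * Sr <= Ir ->
   Il0 <= (C / 2)%:E * Sl0 -> Ir0 <= (C / 2)%:E * Sr0 ->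
   Sl + Sr <= (C / (c * a))%:E * (Sl0 + Sr0))%E.
Proof.
move=> Sl_ge0 Sr_ge0 Sl0_ge0 Sr0_ge0 H L1 L2 U1 U2; have /andP[a0 a1] := a01.
have k0 : 0 < c / 2 * a by rewrite mulr_gt0// divr_gt0.
have c2 : 0 < c / 2 by rewrite divr_gt0.
have C2 : 0 < C / 2 by rewrite divr_gt0.
rewrite (_ : C / (c * a) = (c / 2 * a)^-1 * (C / 2)); last first.
  by field; rewrite !gt_eqF.
rewrite EFinM -muleA lee_pdivlMl//.
have A1 : ((c / 2 * a)%:E * (Sl + Sr) <= 1%:E * Il + (1 * a)%:E * Ir)%E.
  rewrite ge0_muleDr//; apply: leeD.
    rewrite mul1e; apply: le_trans L1; apply: lee_wpmul2r => //.
    by rewrite lee_fin ler_piMr// ltW.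
  rewrite mul1r [c / 2 * a]mulrC EFinM -muleA; apply: lee_wpmul2l => //.
  by rewrite lee_fin ltW.
apply: le_trans A1 (le_trans H _); rewrite ge0_muleDr//; apply: leeD; first by rewrite mul1e.
have Ir0_ge0 : (0 <= (C / 2)%:E * Sr0)%E by rewrite mule_ge0// lee_fin ltW.
rewrite mul1r; apply: (@le_trans _ _ (a%:E * ((C / 2)%:E * Sr0))%E).
  by apply: lee_wpmul2l => //; rewrite lee_fin ltW.
by rewrite -[leRHS]mul1e; apply: lee_wpmul2r => //; rewrite lee_fin.
Qed.

Lemma integral_compare (e e' : R -> R) (k t : R) (D : set (measurableTypeR R)) :
  continuous e -> continuous e' -> measurable D -> 0 <= t -> 0 <= k ->
  (forall v, - M <= v <= M -> 0 <= e v /\ k * e v <= e' v) ->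
  (k%:E * \int[leb]_(x in D) (e (u t (x + h t)))%:E <=
   \int[leb]_(x in D) (e' (u t (x + h t)))%:E)%E.
Proof.
move=> ce ce' mD t0 k0 H; rewrite !(integral_value h mU UM meas uU)//.
have mt : measurable_fun setT (fun x : R => U (t, x + h t)).
  have m1 : measurable_fun setT (fun y => U (t, y)).
    by case: (bm_section1 t (conj mU (ex_intro _ M UM) : bounded_measurable U)).
  by apply: (measurableT_comp m1); exact: measurable_funD.
have mE (w : R -> R) : continuous w -> measurable_fun D (fun x => (w (U (t, x + h t)))%:E).
  move=> cw; apply: measurable_funTS; apply/measurable_EFinP.
  exact: (measurableT_comp (continuous_measurable_fun cw)).
have HU x := H _ (etrans (esym (ler_norml _ _)) (UM (t, x + h t))).
rewrite -ge0_integralZl_EFin//; [|by move=> x _; rewrite lee_fin; have [] := HU x|exact: mE].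
apply: ge0_le_integral => //.
- by move=> x _; rewrite -EFinM lee_fin mulr_ge0//; have [] := HU x.
- by apply: measurable_funeM; exact: mE.
- exact: mE.
- by move=> x _; rewrite -EFinM lee_fin; have [] := HU x.
Qed.

Lemma l2_of_two_sided (t : R) : 0 <= t -> h 0 = 0 ->
  (two_sided a u h (rele^~ uL) (rele^~ uR) 1 t <= two_sided a u h (rele^~ uL) (rele^~ uR) 1 0)%E ->
  (\int[leb]_x ((u t (x + h t) - shock uL uR x) ^+ 2)%:E <=
   (C / (c * a))%:E * \int[leb]_x ((u 0 x - shock uL uR x) ^+ 2)%:E)%E.
Proof.
move=> t0 h0 H; have /andP[a0 a1] := a01.
have ms : measurable_fun setT (fun x : R => u t (x + h t)).
  by apply: (measurableT_comp (meas t0)); exact: measurable_funD.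
rewrite (shock_split _ _ ms).
have -> : (\int[leb]_x ((u 0 x - shock uL uR x) ^+ 2)%:E =
    \int[leb]_x ((u 0 (x + h 0) - shock uL uR x) ^+ 2)%:E)%E.
  by apply: eq_integral => x _; rewrite h0 addr0.
have ms0 : measurable_fun setT (fun x : R => u 0 (x + h 0)).
  by apply: (measurableT_comp (meas (lexx 0))); exact: measurable_funD.
rewrite (shock_split _ _ ms0).
have crel b : continuous (rele^~ b).
  move=> x; apply: (@der_continuous _ _ _ (e1 x - e1 b)).
  apply: der_eq.
    apply: derB; first (apply: derB; [exact: De|exact: der_cst]).
    by apply: der_scale; apply: derB; [exact: der_id|exact: der_cst].
  by rewrite !subr0 mulr1.
have csq b : continuous (fun v : R => (v - b) ^+ 2).
  have -> : (fun v : R => (v - b) ^+ 2) = (fun v => (v - b) * (v - b)).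
    by apply/funext => v; rewrite expr2.
  by move=> x; apply: cvgM; (apply: cvgB; [exact: cvg_id|exact: cvg_cst]).
have c2 : 0 < c / 2 by rewrite divr_gt0.
have C2 : 0 < C / 2 by rewrite divr_gt0.
have low (D : set (measurableTypeR R)) b s : measurable D -> - M <= b <= M -> 0 <= s ->
    ((c / 2)%:E * \int[leb]_(x in D) ((u s (x + h s) - b) ^+ 2)%:E <=
     \int[leb]_(x in D) (rele (u s (x + h s)) b)%:E)%E.
  move=> mD bM s0; apply: (@integral_compare _ _ _ _ _ (csq b) (crel b)) => //; first exact: ltW.
  move=> v vM; split; first exact: sqr_ge0.
  by have /andP[] := rel_eta_bounds De De1 e2cC vM bM.
have upp (D : set (measurableTypeR R)) b s : measurable D -> - M <= b <= M -> 0 <= s ->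
    (\int[leb]_(x in D) (rele (u s (x + h s)) b)%:E <=
     (C / 2)%:E * \int[leb]_(x in D) ((u s (x + h s) - b) ^+ 2)%:E)%E.
  move=> mD bM s0; rewrite -lee_pdivrMl//.
  apply: (@integral_compare _ _ _ _ _ (crel b) (csq b)) => //.
    by rewrite invr_ge0 ltW.
  move=> v vM; have /andP[h1 h2] := rel_eta_bounds De De1 e2cC vM bM; split.
    by apply: le_trans h1; rewrite mulr_ge0 ?sqr_ge0 ?ltW.
  by rewrite ler_pdivrMl.
have m1 : measurable (`]-oo, 0%R[ : set (measurableTypeR R)) by exact: measurable_itv.
have m2 : measurable (`]0%R, +oo[ : set (measurableTypeR R)) by exact: measurable_itv.
have L1 := low _ _ _ m1 uLM t0; have L2 := low _ _ _ m2 uRM t0.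
have U1 := upp _ _ _ m1 uLM (lexx 0); have U2 := upp _ _ _ m2 uRM (lexx 0).
have pos (D : set (measurableTypeR R)) b s : (0 <= \int[leb]_(x in D) ((u s (x + h s) - b) ^+ 2)%:E)%E.
  by apply: integral_ge0 => x _; rewrite lee_fin sqr_ge0.
exact: (compare_weighted (pos _ _ _) (pos _ _ _) (pos _ _ _) (pos _ _ _) H L1 L2 U1 U2).
Qed.

End l2_stability.

(** * Regularity of the data and proof of the stability estimate *)

Lemma class_C_der {R : realType} (f : R -> R) (n k : nat) : class_C n f -> (k < n)%N ->
  forall x, der_at x (derive1n k f) (derive1n k.+1 f x).
Proof.
by move=> [df _] kn x; rewrite derive1nS; apply: derivable_der_at; exact: df.
Qed.

Theorem corollary1p1 (R : realType) (M : R) (f eta q : R -> R)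
    (M_gt0 : 0 < M)
    (f_flux : concave_convex_flux f)
    (eta_convex : strictly_convex_entropy eta)
    (q_flux : entropy_flux f eta q)
    (eps : R) (eps_gt0 : 0 < eps)
    (uL : R) (uL_I0 : - M <= uL <= M) (uL_gt0 : 0 < uL)
    (uR : R) (uR_I0 : - M <= uR <= M) (uLuR : oleinik f uL uR) :
  exists astar C : R,
    [/\ 0 < astar < 1, 0 < C &
      forall a1 a2 : R, 0 < a1 -> 0 < a2 -> a2 / a1 < astar ->
      forall u : R -> R -> R, S_weak f eta q M uL eps u ->
      exists h : R -> R,
        [/\ lipschitz_curve h,
            h 0 = 0,
            nonincreasing_in_time u (pseudo_norm eta a1 a2 uL uR h u)
          & forall t : R, 0 < t ->
              (Lnorm lebesgue_measure 2%:E
                 (fun x => (u t (x + h t)%R - shock uL uR x)%:E)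
               <= C%:E * Lnorm lebesgue_measure 2%:E
                 (fun x => (u 0%R x - shock uL uR x)%:E))%E]].
Proof.
have [fC f2_sign _ _ f1_Ny] := f_flux; have [etaC e2_gt0] := eta_convex.
have Df x : der_at x f (derive1n 1 f x) := class_C_der fC (isT : (0 < 4)%N) x.
have Df1 x : der_at x (derive1n 1 f) (derive1n 2 f x) := class_C_der fC (isT : (1 < 4)%N) x.
have cf2 x : {for x, continuous (derive1n 2 f)} := der_continuous (class_C_der fC (isT : (2 < 4)%N) x).
have De x : der_at x eta (derive1n 1 eta x) := class_C_der etaC (isT : (0 < 3)%N) x.
have De1 x : der_at x (derive1n 1 eta) (derive1n 2 eta x) := class_C_der etaC (isT : (1 < 3)%N) x.
have ce2 x : {for x, continuous (derive1n 2 eta)} := der_continuous (class_C_der etaC (isT : (2 < 3)%N) x).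
have Dq x : der_at x q (derive1n 1 eta x * derive1n 1 f x) by exact: q_flux.
have [k [k_lt0 Nk Nlt Ngt]] := tangent_point Df Df1 f2_sign f1_Ny uL_gt0.
have phik : phi_nat f uL = k by apply: (phi_natE uL_gt0 k_lt0 Nk Nlt Ngt).
have /andP[kuR uRuL] := oleinik_bounds Df uL_gt0 k_lt0 Nlt Ngt uLuR.
have [V [KV [L [astar [VK [VL L_gt0] f1L ast contracting]]]]] := contracting_velocity
  Df Df1 cf2 De De1 ce2 Dq e2_gt0 f2_sign uL_gt0 k_lt0 Nk Nlt Ngt kuR uRuL M_gt0 uL_I0 eps_gt0.
have [c [c_gt0 cle]] := continuous_seg_pos (fun x (_ : - M <= x <= M) => ce2 x) (fun x _ => e2_gt0 x).
have [C [C_gt0 leC]] := continuous_seg_bounded (- M) M ce2.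
have e2cC x : - M <= x <= M -> c <= derive1n 2 eta x <= C.
  by move=> xM; rewrite (cle x xM) (le_trans (ler_norm _) (leC x xM)).
have /andP[ast0 ast1] := ast.
pose b := astar / 2.
have b0 : 0 < b by rewrite divr_gt0.
have bast : 0 < b < astar by rewrite b0 /b ltr_pdivrMr// ltr_pMr// ltr1n.
have b1 : 0 < b <= 1 by rewrite b0; move: bast => /andP[_ /lt_trans/(_ ast1)/ltW].
(* c and C bound eta'' on [- M, M]; the ratio C / (c b) compares squared L^2 norms, whence the
   square root. *)
exists astar, (Num.sqrt (C / (c * b))); split => //.
  by rewrite sqrtr_gt0 divr_gt0// mulr_gt0.
move=> a1 a2 a1_gt0 a2_gt0 a21 u uS.
have [h [um [up [hL h0 bum bup jump]]]] := contracting_curve Df Df1 De De1 Dq M_gt0 phik uS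
  VK VL L_gt0 contracting.
have decay a a' (aast : 0 < a < astar) := curve_contraction Df Df1 De De1 Dq e2_gt0 M_gt0 uL_I0 uR_I0
  uS L_gt0 f1L hL h0 bum bup (ltW (andP aast).1) (fun T => jump a T aast) (a1 := a').
exists h; split => //.
- exists L; split; first exact: gtr0_real.
  by move=> K LK [x y] _ /=; apply: le_trans (hL x y) _; rewrite ler_wpM2r// ltW.
- have := decay (a2 / a1) a1 _ a1_gt0.
  rewrite a21 divr_gt0// => /(_ isT).
  rewrite /two_sided (_ : a1 * (a2 / a1) = a2)//.
  by rewrite mulrC divfK// gt_eqF.
- move=> t t0; have [wsol _ _ _ _] := uS.
  have [N [_ NR D]] := decay b 1 bast ltr01.
  (* The initial time is a right Lebesgue time by the last clause of [weak_solution], so it is not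
     exceptional. *)
  have N0 : ~ N 0 by move=> /NR; apply; case: wsol.
  apply: Lnorm2_le; first by rewrite divr_ge0 ?mulr_ge0// ltW.
  apply: (l2_of_two_sided De De1 e2cC c_gt0 C_gt0 uL_I0 uR_I0 b1 (measurable_U wsol) (U_le u M_gt0)
    (measurable_solution wsol) (solution_value wsol) (ltW t0) h0).
  exact: D (lexx 0) N0 (ltW t0).
Qed.
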